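(* Let $N\ge2$, let $H$ be a Finsler norm on $\mathbb{R}^N$ and let $B$ satisfy the growth assumptions stated in the context with parameters $p\ge2$, $\kappa=0$, $\gamma>0$, $\Gamma>0$. Let $u$ be a weak solution of $$-\operatorname{div}\big(B'(H(\nabla u))\nabla H(\nabla u)\big)=|u|^{q-1}u\quad\text{in }\mathbb{R}^N$$ which is stable outside a compact set. Assume that $$\begin{cases}\Gamma\gamma^{-1}(p-1)<q<\infty & \text{if } N\le p\gamma\Gamma^{-1},\\[2mm] \Gamma\gamma^{-1}(p-1)<q<\dfrac{N\left(p-\frac{\Gamma}{\gamma}\right)+p}{N\frac{\Gamma}{\gamma}-p} & \text{if } N>p\gamma\Gamma^{-1}.\end{cases}$$ Then $u\equiv0$.
   Context: Finsler norm: a function $H:\mathbb{R}^N\to[0,\infty)$ which is a norm on $\mathbb{R}^N$, is of class $C^2(\mathbb{R}^N\setminus\{0\})$, and whose unit ball $\{\xi\in\mathbb{R}^N: H(\xi)<1\}$ is uniformly convex, i.e. all the principal curvatures of its boundary are bounded away from zero (equivalently, there is $\Lambda>0$ with $\langle D^2H(\xi)v,v\rangle\ge\Lambda|v|^2$ for all $\xi$ with $H(\xi)=1$ and all $v\perp\nabla H(\xi)$). Growth assumptions on $B:[0,\infty)\to\mathbb{R}$ (case $\kappa=0$): $B\in C^2((0,+\infty))$; $B(0)=B'(0)=0$ and $B(t),B'(t),B''(t)>0$ for all $t>0$; and, for all $t>0$, $$\gamma t^{p-1}\le B'(t)\le\Gamma t^{p-1},\qquad \gamma(p-1)t^{p-2}\le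 B''(t)\le\Gamma(p-1)t^{p-2}.$$ Weak solution: a function $u\in W^{1,p}_{loc}(\mathbb{R}^N)\cap L^\infty_{loc}(\mathbb{R}^N)$ (real-valued, possibly sign-changing and globally unbounded) with $$\int_{\mathbb{R}^N}B'(H(\nabla u))\langle\nabla H(\nabla u),\nabla\varphi\rangle\,dx=\int_{\mathbb{R}^N}|u|^{q-1}u\,\varphi\,dx\quad\forall\varphi\in C^1_c(\mathbb{R}^N).$$ Such solutions are known to be of class $C^{1,\alpha}_{loc}(\mathbb{R}^N)$ for some $\alpha\in(0,1)$. Stability outside a compact set: there is a compact set $K\subset\mathbb{R}^N$ such that $L_u(\varphi,\varphi)\ge0$ for all $\varphi\in C^1_c(\mathbb{R}^N\setminus K)$, where $$L_u(\varphi,\varphi)=\int_{\mathbb{R}^N} B''(H(\nabla u))\langle\nabla H(\nabla u),\nabla\varphi\rangle^2\,dx+\int_{\mathbb{R}^N} B'(H(\nabla u))\langle D^2H(\nabla u)\nabla\varphi,\nabla\varphi\rangle\,dx-\int_{\mathbb{R}^N} q|u|^{q-1}\varphi^2\,dx,$$ with the integrands of the first two integrals understood as $0$ at points where $\nabla u=0$. *)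

(* Defs.v *)
From HB Require Import structures.
From mathcomp Require Import all_boot all_order all_algebra.
From mathcomp Require Import all_classical all_reals all_analysis.

Set Implicit Arguments.
Unset Strict Implicit.
Unset Printing Implicit Defensive.

Import Order.TTheory GRing.Theory Num.Theory.
Import numFieldNormedType.Exports.

Local Open Scope classical_set_scope.
Local Open Scope ring_scope.

(* The type 'rV[R]_n carries the product sigma-algebra, generated by the coordinates
   (on R^n this is the Borel sigma-algebra), as n.-tuple T does in
   measurable_structure.v. *)
Definition measure_rV_display : measure_display. Proof. exact. Qed.

Section measurable_rV.
Variables (R : realType) (n : nat).

Let coors : 'I_n -> 'rV[R]_n -> R := fun i x => x ord0 i.

Let rV_set0 : g_sigma_preimage coors set0.
Proof. exact: sigma_algebra0. Qed.

Let rV_setC A : g_sigma_preimage coors A -> g_sigma_preimage coors (~` A).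
Proof. exact: sigma_algebraC. Qed.

Let rV_bigcup (F : (set 'rV[R]_n)^nat) :
  (forall i, g_sigma_preimage coors (F i)) ->
  g_sigma_preimage coors (\bigcup_i (F i)).
Proof. exact: sigma_algebra_bigcup. Qed.

HB.instance Definition _ := @isMeasurable.Build measure_rV_display
  'rV[R]_n (g_sigma_preimage coors) rV_set0 rV_setC rV_bigcup.

Lemma measurable_coord (i : 'I_n) :
  measurable_fun [set: 'rV[R]_n] (fun x : 'rV[R]_n => x ord0 i).
Proof.
move=> _ Y mY; rewrite setTI; apply: sub_sigma_algebra => /=.
rewrite -bigcup_seq/=; exists i => /=; first by rewrite mem_index_enum.
by exists Y => //; rewrite setTI.
Qed.

Lemma measurable_fun_rVP d (T : measurableType d) (f : T -> 'rV[R]_n) :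
  (forall i, measurable_fun setT (fun t => f t ord0 i)) ->
  measurable_fun setT f.
Proof.
move=> mf; have sub : g_sigma_preimage (fun i => coors i \o f) `<=` measurable.
  apply: smallest_sub; first exact: sigma_algebra_measurable.
  rewrite -bigcup_seq; apply: bigcup_sub => i _ A [B mB <-].
  exact: (mf i measurableT B mB).
move=> _ A mA; rewrite setTI; apply: sub.
by rewrite g_sigma_preimage_comp; exists A => //; rewrite setTI.
Qed.

End measurable_rV.

Section lebesgue_rV.
Variable R : realType.

Definition rV_cons n (x : R * 'rV[R]_n) : 'rV[R]_n.+1 :=
  row_mx (const_mx x.1 : 'cV[R]_1) x.2.

Definition rV_uncons n (y : 'rV[R]_n.+1) : R * 'rV[R]_n :=
  (y ord0 ord0, \row_j y ord0 (lift ord0 j)).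

Lemma rV_cons0 n (x : R * 'rV[R]_n) : rV_cons x ord0 ord0 = x.1.
Proof.
rewrite /rV_cons mxE; case: splitP => // j _.
by rewrite mxE.
Qed.

Lemma rV_consS n (x : R * 'rV[R]_n) j :
  rV_cons x ord0 (lift ord0 j) = x.2 ord0 j.
Proof.
rewrite /rV_cons mxE; case: splitP => [k|k].
  by rewrite ord1.
by rewrite /= /bump /= add1n => -[] /val_inj ->.
Qed.

Lemma rV_consK n : cancel (@rV_cons n) (@rV_uncons n).
Proof.
case=> a v; rewrite /rV_uncons rV_cons0; congr pair.
by apply/rowP => j; rewrite mxE rV_consS.
Qed.

Lemma rV_unconsK n : cancel (@rV_uncons n) (@rV_cons n).
Proof.
move=> y; apply/rowP => i; case: (unliftP ord0 i) => [j|] ->.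
  by rewrite rV_consS mxE.
by rewrite rV_cons0.
Qed.

Lemma measurable_rV_cons n : measurable_fun setT (@rV_cons n).
Proof.
apply: measurable_fun_rVP => i; case: (unliftP ord0 i) => [j|] ->.
  under eq_fun do rewrite rV_consS.
  exact: (measurableT_comp (measurable_coord j) measurable_snd).
under eq_fun do rewrite rV_cons0.
exact: measurable_fst.
Qed.

Lemma measurable_rV_uncons n : measurable_fun setT (@rV_uncons n).
Proof.
apply/measurable_fun_pairP; split; first exact: measurable_coord.
apply: measurable_fun_rVP => i.
under eq_fun do rewrite /= mxE.
exact: measurable_coord.
Qed.

Definition lebesgue_step n (mu : {sigma_finite_measure set 'rV[R]_n -> \bar R})
    : set 'rV[R]_n.+1 -> \bar R :=
  pushforward (@lebesgue_measure R \x mu)%E (@rV_cons n).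

Section lebesgue_step.
Variables (n : nat) (mu : {sigma_finite_measure set 'rV[R]_n -> \bar R}).

Let preim (A : set 'rV[R]_n.+1) :
  measurable A -> measurable (@rV_cons n @^-1` A).
Proof. by move=> mA; rewrite -[X in measurable X]setTI; exact: measurable_rV_cons. Qed.

Let step0 : lebesgue_step mu set0 = 0%E.
Proof. by rewrite /lebesgue_step /pushforward preimage_set0 measure0. Qed.

Let step_ge0 A : (0 <= lebesgue_step mu A)%E.
Proof. by rewrite /lebesgue_step /pushforward; apply: measure_ge0. Qed.

Let step_sigma_additive : semi_sigma_additive (lebesgue_step mu).
Proof.
move=> F mF tF mUF; rewrite /lebesgue_step /pushforward preimage_bigcup.
apply: measure_semi_sigma_additive.
- by move=> k; exact: preim.
- apply/trivIsetP => i j _ _ ij; rewrite -preimage_setI.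
  by move/trivIsetP : tF => /(_ _ _ Logic.I Logic.I ij) ->; rewrite preimage_set0.
- by rewrite -preimage_bigcup; exact: preim.
Qed.

HB.instance Definition _ := isMeasure.Build _ _ _ (lebesgue_step mu)
  step0 step_ge0 step_sigma_additive.

Let step_sigma_finite : sigma_finite setT (lebesgue_step mu).
Proof.
have /sigma_finiteP[F [FT ndF Foo]] := sigma_finiteT (@lebesgue_measure R).
have /sigma_finiteP[G [GT ndG Goo]] := sigma_finiteT mu.
exists (fun k => @rV_uncons n @^-1` (F k `*` G k)).
  apply/esym; rewrite -subTset => x _.
  have [i _ Fi] : (\bigcup_k F k) (rV_uncons x).1 by rewrite -FT.
  have [j _ Gj] : (\bigcup_k G k) (rV_uncons x).2 by rewrite -GT.
  exists (maxn i j) => //; split.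
    by have /subsetPset := ndF _ _ (leq_maxl i j); exact.
  by have /subsetPset := ndG _ _ (leq_maxr i j); exact.
move=> k; have [mF Fk] := Foo k; have [mG Gk] := Goo k.
have mFG : measurable (F k `*` G k) by exact: measurableX.
split.
  by rewrite -[X in measurable X]setTI; exact: measurable_rV_uncons.
rewrite /lebesgue_step /pushforward -comp_preimage (_ : _ \o _ = id).
  by rewrite preimage_id product_measure1E// lte_mul_pinfty// ge0_fin_numE.
by apply/funext => x /=; rewrite rV_consK.
Qed.

HB.instance Definition _ := Measure_isSigmaFinite.Build _ _ _
  (lebesgue_step mu) step_sigma_finite.

End lebesgue_step.

Fixpoint lebesgue_rV n : {sigma_finite_measure set 'rV[R]_n -> \bar R} :=
  if n is m.+1 then lebesgue_step (lebesgue_rV m) else \d_(0 : 'rV[R]_0).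

Lemma measurable_rV_box n (A : 'I_n -> set R) :
  (forall i, measurable (A i)) ->
  measurable [set x : 'rV[R]_n | forall i, A i (x ord0 i)].
Proof.
move=> mA; rewrite (_ : [set x | _] =
    \bigcap_(i in [set: 'I_n]) ((fun x : 'rV[R]_n => x ord0 i) @^-1` A i)).
  apply: fin_bigcap_measurable => // i _.
  by rewrite -[X in measurable X]setTI; exact: measurable_coord.
by apply/seteqP; split => x /= xA i; [move=> _|]; exact: xA.
Qed.

Lemma lebesgue_rV_box n (A : 'I_n -> set R) :
  (forall i, measurable (A i)) ->
  lebesgue_rV n [set x | forall i, A i (x ord0 i)] =
  (\prod_(i < n) @lebesgue_measure R (A i))%E.
Proof.
elim: n A => [|n IHn] A mA.
  by rewrite big_ord0 /= diracE mem_set//= => -[].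
rewrite big_ord_recl -(IHn (fun i => A (lift ord0 i)))//.
rewrite -product_measure1E//; last first.
- exact: (@measurable_rV_box n (fun i => A (lift ord0 i))).
- exact: mA.
rewrite /= /lebesgue_step /pushforward; congr (product_measure1 _ _ _).
apply/seteqP; split => [x /= xA|x /= [x1 x2] i].
  split; first by rewrite -(rV_cons0 x); exact: xA.
  by move=> i; rewrite -rV_consS; exact: xA.
by case: (unliftP ord0 i) => [j|] ->; rewrite ?rV_cons0 ?rV_consS.
Qed.

End lebesgue_rV.

Section calculus.
Variables (R : realType) (n : nat).
Implicit Types (f : 'rV[R]_n -> R) (U : set 'rV[R]_n).

Definition dot (v w : 'rV[R]_n) : R := \sum_i v ord0 i * w ord0 i.

Definition grad f (x : 'rV[R]_n) : 'rV[R]_n :=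
  \row_i 'D_(delta_mx ord0 i) f x.

Definition hess f (x : 'rV[R]_n) : 'M[R]_n := 'J (grad f) x.

(* The following two are meant for open U. *)
Definition C1_on U f := forall x, U x ->
  differentiable f x /\ {for x, continuous (grad f)}.

Definition C2_on U f := C1_on U f /\ forall x, U x ->
  differentiable (grad f) x /\ {for x, continuous (hess f)}.

Definition C1c U f :=
  let supp := closure [set x | f x != 0] in
  [/\ C1_on setT f, compact supp & supp `<=` U].

End calculus.

Section finsler.
Variables (R : realType) (n : nat).

(* k is a principal curvature at xi of the level hypersurface of H through xi,
   with respect to the normal - grad H xi: the second fundamental form is
   D^2 H xi / |grad H xi| restricted to the tangent space, and k is one of its
   eigenvalues. *)
Definition principal_curvature (H : 'rV[R]_n -> R) (xi : 'rV[R]_n) (k : R) :=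
  exists v : 'rV[R]_n, [/\ v != 0, dot v (grad H xi) = 0 &
    forall w : 'rV[R]_n, dot w (grad H xi) = 0 ->
      dot (v *m hess H xi) w / Num.sqrt (dot (grad H xi) (grad H xi)) =
      k * dot v w].

Record finsler_norm (H : 'rV[R]_n -> R) : Prop := FinslerNorm {
  finsler_ge0 : forall xi, 0 <= H xi;
  finsler_eq0 : forall xi, H xi = 0 -> xi = 0;
  finslerZ : forall t xi, H (t *: xi) = `|t| * H xi;
  finslerD : forall xi eta, H (xi + eta) <= H xi + H eta;
  finsler_C2 : C2_on [set xi | xi != 0] H;
  finsler_uniformly_convex : exists2 c : R, 0 < c &
    forall xi k, H xi = 1 -> principal_curvature H xi k -> c <= k
}.

(* B is a function on [0, +oo[; its values at negative reals are junk, hence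
   the one-sided derivative at 0. *)
Record growth (p gamma Gamma : R) (B : R -> R) : Prop := Growth {
  growth_derivable : forall t : R, 0 < t -> derivable B t 1;
  growth_derivable2 : forall t : R, 0 < t -> derivable (derive1 B) t 1;
  growth_continuous2 : forall t : R, 0 < t -> {for t, continuous (derive1n 2 B)};
  growth0 : B 0 = 0;
  growth_derive0 : (fun t => (B t - B 0) / t) @ 0^'+ --> (0 : R);
  growth_gt0 : forall t : R, 0 < t -> [/\ 0 < B t, 0 < derive1 B t & 0 < derive1n 2 B t];
  growth_derive : forall t : R, 0 < t ->
    gamma * t `^ (p - 1) <= derive1 B t <= Gamma * t `^ (p - 1);
  growth_derive2 : forall t : R, 0 < t ->
    gamma * (p - 1) * t `^ (p - 2) <= derive1n 2 B t
      <= Gamma * (p - 1) * t `^ (p - 2)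
}.

End finsler.

Section solutions.
Variables (R : realType) (n : nat).
Implicit Types (u phi : 'rV[R]_n -> R) (Du : 'rV[R]_n -> 'rV[R]_n).

Local Notation mu := (lebesgue_rV R n).

Definition Lp_loc (p : R) (f : 'rV[R]_n -> R) :=
  measurable_fun setT f /\
  forall K, compact K -> mu.-integrable K (fun x => (`|f x| `^ p)%:E).

Definition Loo_loc (f : 'rV[R]_n -> R) :=
  measurable_fun setT f /\
  forall K, compact K ->
    exists M : R, {ae mu, forall x, K x -> `|f x| <= M}.

(* u is in W^{1,p}_loc with weak gradient Du; testing against C^1_c or
   C^oo_c functions is equivalent by mollification. *)
Definition sobolev_loc (p : R) u Du :=
  [/\ Lp_loc p u,
      forall i, Lp_loc p (fun x => Du x ord0 i) &
      forall i phi, C1c setT phi ->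
        \int[mu]_x (u x * grad phi x ord0 i) =
        - \int[mu]_x (Du x ord0 i * phi x)].

(* The junk value of grad H 0 must not be used: the field vanishes at 0
   because B'(0) = 0. *)
Definition flux (H : 'rV[R]_n -> R) (B : R -> R) (xi : 'rV[R]_n) : 'rV[R]_n :=
  if xi == 0 then 0 else derive1 B (H xi) *: grad H xi.

Definition weak_solution (H : 'rV[R]_n -> R) (B : R -> R) (p q : R) u Du :=
  [/\ sobolev_loc p u Du, Loo_loc u &
      forall phi, C1c setT phi ->
        \int[mu]_x (dot (flux H B (Du x)) (grad phi x)) =
        \int[mu]_x (`|u x| `^ (q - 1) * u x * phi x)].

Definition second_variation (H : 'rV[R]_n -> R) (B : R -> R) (q : R) u Du phi
    : R :=
  \int[mu]_x (if Du x == 0 then 0 else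
      derive1n 2 B (H (Du x)) * dot (grad H (Du x)) (grad phi x) ^+ 2)
  + \int[mu]_x (if Du x == 0 then 0 else
      derive1 B (H (Du x)) *
      dot (grad phi x *m hess H (Du x)) (grad phi x))
  - \int[mu]_x (q * `|u x| `^ (q - 1) * phi x ^+ 2).

Definition stable_outside_compact (H : 'rV[R]_n -> R) (B : R -> R) (q : R)
    u Du :=
  exists2 K : set 'rV[R]_n, compact K &
    forall phi, C1c (~` K) phi -> 0 <= second_variation H B q u Du phi.

End solutions.

(* Main.v *)
From HB Require Import structures.
Require Import Defs.
From mathcomp Require Import all_boot all_order all_algebra.
From mathcomp Require Import all_classical all_reals all_analysis.
From mathcomp Require Import measurable_realfun ring lra.

Set Implicit Arguments.
Unset Strict Implicit.
Unset Printing Implicit Defensive.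

Import Order.TTheory GRing.Theory Num.Theory.
Import numFieldNormedType.Exports.

Local Open Scope classical_set_scope.
Local Open Scope ring_scope.

(* The solution u is compared with its dilations and with cut-offs of itself, using only
   Sobolev regularity: u is approximated in W^{1,p} on cubes by C^1 functions, so that
   the weak equation may be tested with w (u - u(l x)) and the stability inequality with
   phi = u eta.

   Testing the equation with u eta^2 and the stability inequality with u eta, the
   hypothesis q > (Gamma / gamma) (p - 1) lets one absorb the energy and yields a
   Caccioppoli inequality
     int (|Du|^p + |u|^{q+1}) z^{2m} <= C int |grad z|^sigma,
   sigma = p (q + 1) / (q + 1 - p), off a compact set. Subcriticality gives sigma > N,
   so the right-hand side stays bounded for cut-offs at scale r, and the total energy
   |Du|^p + |u|^{q+1} is integrable on R^N.

   Testing with w (u(l x) - u(x)), convexity of xi |-> B (H xi) and of |s|^{q+1}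
   turns the equation into a one-sided inequality, whose first-order part as l -> 1 is the
   Pohozaev inequality
     N / (q + 1) int |u|^{q+1} w <= N int B (H Du) w - int B'(H Du) H(Du) w
                                     + C int_{annulus} (|Du|^p + |u|^{q+1}).
   Together with the energy identity and p B(t) <= (Gamma / gamma) B'(t) t, and since
   1 + N / (q + 1) > N Gamma / (gamma p), the integral of |u|^{q+1} over any cube is
   bounded by quantities that vanish as r -> oo. *)

(** * Power inequalities *)

(** The multiplier [x . Du] of the classical Pohozaev identity calls for second derivatives of [u].
    The difference [u (l x) - u x] is admissible for a Sobolev function, and convexity replaces the
    differentiation; it leaves only an inequality, but in the direction that the decay argument
    needs.

    The threshold [(Gamma / gamma) (p - 1)] is the largest ratio of [B''(H) H^2] to [B'(H) H] that
    the growth bounds allow. Nothing else enters at leading order: [D^2 H (xi)] annihilates [xi], so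
    for [grad (u eta) = eta Du + u grad eta] every part of the Hessian term contains [grad eta].

    The two numerical conditions, [sigma > N] and [1 + N / (q + 1) > N Gamma / (gamma p)], both come
    from [(N Gamma / gamma - p) (q + 1) < N p]: this is the upper bound on [q] rearranged, and it is
    automatic when [N Gamma / gamma <= p]. *)

Section power_inequalities.
Variable R : realType.
Implicit Types a b c d e g h p q r s t u v w x y z : R.

(** Tangent line inequality of a convex power, obtained from Young's inequality for [t] and
    [s ^ (p - 1)] with conjugate exponents [p] and [p / (p - 1)]; no derivative at 0 is involved. *)
Lemma powR_tangent p s t : 1 <= p -> 0 <= s -> 0 <= t ->
  s `^ p + p * s `^ (p - 1) * (t - s) <= t `^ p.
Proof.
rewrite le_eqVlt => /predU1P[<-|p1] s0 t0.
  by rewrite subrr powRr0 !powRr1//; lra.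
have p0 : 0 < p by lra.
have pp0 : p - 1 != 0 by apply/eqP; lra.
have q0 : 0 < p / (p - 1) by rewrite divr_gt0//; lra.
have := @conjugate_powR R t (s `^ (p - 1)) p (p / (p - 1)) t0 (powR_ge0 _ _) p0 q0.
rewrite -powRrM (_ : (p - 1) * (p / (p - 1)) = p); last by field; rewrite pp0.
have -> : s `^ p = s `^ (p - 1) * s.
  have [->|sn0] := eqVneq s 0; first by rewrite mulr0 powR0// gt_eqF.
  by rewrite -[X in _ = _ * X]powRr1// -powRD ?subrK// sn0 implybT.
move=> H; have {H} : t * s `^ (p - 1) <=
    t `^ p / p + s `^ (p - 1) * s / (p / (p - 1)).
  by apply: H; field; rewrite pp0 gt_eqF.
rewrite -(ler_pM2l p0) mulrDr.
rewrite (_ : p * (t `^ p / p) = t `^ p); last by field; rewrite gt_eqF.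
rewrite (_ : p * (s `^ (p - 1) * s / (p / (p - 1))) = (p - 1) * (s `^ (p - 1) * s)).
  nra.
by field; rewrite pp0 gt_eqF.
Qed.

Lemma powR_lipschitz q x y (M : R) : 1 <= q -> 0 <= x <= M -> 0 <= y <= M ->
  `|x `^ q - y `^ q| <= q * M `^ (q - 1) * `|x - y|.
Proof.
move=> q1; wlog xy : x y / x <= y.
  move=> H Hx Hy; case: (leP x y) => xy; first exact: H.
  by rewrite distrC (distrC x); apply: H => //; exact: ltW.
move=> /andP[x0 xM] /andP[y0 yM].
have Hxy : x `^ q <= y `^ q by rewrite ge0_ler_powR//; lra.
rewrite distrC ger0_norm ?subr_ge0// distrC ger0_norm ?subr_ge0//.
have := powR_tangent q1 y0 x0.
have : y `^ (q - 1) <= M `^ (q - 1) by rewrite ge0_ler_powR// ?nnegrE; lra.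
have := powR_ge0 y (q - 1).
move=> h1 h2 h3.
apply: (@le_trans _ _ (q * y `^ (q - 1) * (y - x))); first lra.
by rewrite ler_wpM2r ?subr_ge0// ler_wpM2l//; lra.
Qed.

Lemma powRD_le p x y : 0 <= p -> 0 <= x -> 0 <= y ->
  (x + y) `^ p <= 2 `^ p * (x `^ p + y `^ p).
Proof.
move=> p0; wlog xy : x y / x <= y.
  move=> H x0 y0; case: (leP x y) => xy; first exact: H.
  by rewrite addrC (addrC (x `^ p)); apply: H => //; exact: ltW.
move=> x0 y0.
apply: (@le_trans _ _ ((2 * y) `^ p)).
  by rewrite ge0_ler_powR// ?nnegrE; lra.
rewrite powRM//; apply: ler_wpM2l; first exact: powR_ge0.
by rewrite lerDr powR_ge0.
Qed.

(** Weighted Young inequality. The cases [y <= d x] and [d x < y], with [d ^ t = e], bound the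
    product by [e x] and by [d ^ (t - 1) y] respectively. *)
Lemma powR_interp t (e : R) : 0 < t <= 1 -> 0 < e -> exists2 C : R, 0 <= C &
  forall x y, 0 <= x -> 0 <= y -> x `^ (1 - t) * y `^ t <= e * x + C * y.
Proof.
move=> /andP[t0 t1] e0; pose d := e `^ t^-1.
have d0 : 0 < d by rewrite powR_gt0.
have dt : d `^ t = e by rewrite /d -powRrM mulVf ?gt_eqF// powRr1// ltW.
have tn0 : t != 0 by rewrite gt_eqF.
exists (d `^ (t - 1)) => [|x y x0 y0]; first exact: powR_ge0.
have D z : 0 <= z -> z `^ (1 - t) * z `^ t = z.
  rewrite le_eqVlt => /predU1P[<-|z0]; first by rewrite (powR0 tn0) mulr0.
  by rewrite -powRD ?subrK ?powRr1 ?(ltW z0)// (gt_eqF z0) implybT.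
have [yx|xy] := leP y (d * x).
  apply: (@le_trans _ _ (x `^ (1 - t) * (d * x) `^ t)).
    apply: ler_wpM2l; first exact: powR_ge0.
    by rewrite ge0_ler_powR// ?nnegrE ?mulr_ge0//; exact: ltW.
  rewrite powRM ?(ltW d0)// dt mulrCA D// lerDl mulr_ge0// powR_ge0//.
apply: (@le_trans _ _ ((d^-1 * y) `^ (1 - t) * y `^ t)).
  apply: ler_wpM2r; first exact: powR_ge0.
  rewrite ge0_ler_powR// ?nnegrE ?subr_ge0//.
    by rewrite mulr_ge0// invr_ge0 ltW.
  by rewrite -(ler_pM2l d0) mulrA divff ?mul1r ?ltW// gt_eqF.
have di0 : 0 <= d^-1 by rewrite invr_ge0 ltW.
rewrite (powRM _ di0 y0) -mulrA (D _ y0).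
rewrite -(powR_inv1 (ltW d0)) -powRrM mulN1r opprB lerDr mulr_ge0 ?(ltW e0)//.
Qed.

(* The exponents of [a], [b], [g] and [z] are tuned so that, with
   [X = z ^ M * max (a ^ p) (b ^ r)], the left side is at most
   [X ^ (1 - j / sg) * (g ^ sg) ^ (j / sg)]. *)
Lemma weighted_young p r (j M e : R) (sg := p * r / (r - p)) :
  0 < p -> p < r -> 0 < j -> j <= p -> sg <= M -> 0 < e ->
  exists2 C : R, 0 <= C & forall a b g z,
    0 <= a -> 0 <= b -> 0 <= g -> 0 <= z <= 1 ->
    a `^ (p - j) * b `^ j * g `^ j * z `^ (M - j) <=
    e * (z `^ M * (a `^ p + b `^ r)) + C * g `^ sg.
Proof.
move=> p0 pr j0 jp sM e0.
have r0 : 0 < r by lra.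
have rp : 0 < r - p by lra.
have sg0 : 0 < sg by rewrite /sg divr_gt0 ?mulr_gt0.
have psg : p <= sg.
  by rewrite /sg -mulrA ler_peMr ?(ltW p0) ?ler_pdivlMr//; lra.
have jsg : 0 < j / sg <= 1.
  by rewrite divr_gt0//= ler_pdivrMr//; lra.
have [C C0 H] := powR_interp jsg e0.
exists C => // a b g z a0 b0 g0 /andP[z0 z1].
pose m := Num.max (a `^ p) (b `^ r).
have m0 : 0 <= m by rewrite /m le_max powR_ge0.
have am : a <= m `^ p^-1.
  rewrite -[leLHS]powRr1// -(@divff _ p) ?gt_eqF// powRrM.
  rewrite ge0_ler_powR// ?nnegrE ?powR_ge0 ?invr_ge0 ?(ltW p0)//.
  by rewrite /m le_max lexx.
have bm : b <= m `^ r^-1.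
  rewrite -[leLHS]powRr1// -(@divff _ r) ?gt_eqF// powRrM.
  rewrite ge0_ler_powR// ?nnegrE ?powR_ge0 ?invr_ge0 ?(ltW r0)//.
  by rewrite /m le_max lexx orbT.
have M0 : 0 < M by lra.
have X0 : 0 <= z `^ M * m by rewrite mulr_ge0// powR_ge0.
have := H _ (g `^ sg) X0 (powR_ge0 _ _).
rewrite -powRrM mulrC [X in g `^ X](_ : _ = j); last by field; rewrite gt_eqF.
move=> H1; apply: (@le_trans _ _ (e * (z `^ M * m) + C * g `^ sg)); last first.
  rewrite lerD2r ler_wpM2l ?(ltW e0)// ler_wpM2l ?powR_ge0//.
  by rewrite /m ge_max lerDl lerDr !powR_ge0.
apply: le_trans H1.
have -> : a `^ (p - j) * b `^ j * g `^ j * z `^ (M - j) =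
    g `^ j * (z `^ (M - j) * (a `^ (p - j) * b `^ j)) by ring.
rewrite ler_wpM2l ?powR_ge0// powRM ?powR_ge0//.
apply: ler_pM; rewrite ?mulr_ge0 ?powR_ge0//.
  (* The convention [0 ^ 0 = 1] isolates [z = 0]: if moreover [M = j], then [j <= p <= sg <= M]
     forces [sg = j] and both sides are 1. *)
  rewrite -powRrM; have [z0'|zn0] := eqVneq z 0.
    rewrite z0'; have [MM|jM] := eqVneq M j.
      have sgE : sg = j by lra.
      by rewrite MM subrr powRr0 sgE divff ?gt_eqF// subrr mulr0 powRr0.
    by rewrite powR0 ?powR_ge0// subr_eq0.
  apply: ger_powR; first by rewrite z1 andbT lt_neqAle eq_sym zn0.
  rewrite mulrBr mulr1 lerD2l lerN2 mulrCA ler_peMr ?(ltW j0)//.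
  by rewrite ler_pdivlMr// mul1r.
(* This identity is [1 / sg = 1 / p - 1 / r], the relation that defines [sg]. *)
have -> : 1 - j / sg = (p - j) / p + j / r.
  by rewrite /sg; field; rewrite ?gt_eqF.
have aj : a `^ (p - j) <= m `^ ((p - j) / p).
  rewrite (mulrC (p - j)) powRrM ge0_ler_powR// ?nnegrE ?powR_ge0//; lra.
have bj : b `^ j <= m `^ (j / r).
  by rewrite (mulrC j) powRrM ge0_ler_powR// ?nnegrE ?powR_ge0// ltW.
apply: (@le_trans _ _ (m `^ ((p - j) / p) * m `^ (j / r))).
  by apply: ler_pM; rewrite ?powR_ge0.
rewrite powRD//; apply/implyP => /eqP H0.
suff : 0 < (p - j) / p + j / r by rewrite H0 ltxx.
have h1 : 0 < j / r by rewrite divr_gt0.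
have h2 : 0 <= (p - j) / p by rewrite divr_ge0; lra.
lra.
Qed.

Lemma powR_young p (j e : R) : 0 < j -> j <= p -> 0 < e ->
  exists2 C : R, 0 <= C & forall a h, 0 <= a -> 0 <= h ->
    a `^ (p - j) * h `^ j <= e * a `^ p + C * h `^ p.
Proof.
move=> j0 jp e0; have p0 : 0 < p by lra.
have jp1 : 0 < j / p <= 1 by rewrite divr_gt0//= ler_pdivrMr//; lra.
have [C C0 H] := powR_interp jp1 e0.
exists C => // a h a0 h0; have := H (a `^ p) (h `^ p) (powR_ge0 _ _) (powR_ge0 _ _).
rewrite -!powRrM [p * (1 - _)](_ : _ = p - j); last by field; rewrite gt_eqF.
by rewrite [p * (j / p)](_ : _ = j)//; field; rewrite gt_eqF.
Qed.

Lemma mul_powRB1 q x : 0 <= x -> 0 < q -> x `^ (q - 1) * x = x `^ q.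
Proof. by move=> x0 q0; rewrite mulrC mulr_powRB1. Qed.

Lemma powRDr1 q x : 0 <= x -> 0 < q -> x `^ (q + 1) = x `^ q * x.
Proof. by move=> x0 q0; rewrite -(mul_powRB1 x0) ?addrK// ltr_wpDr. Qed.

Definition sgnpow q u := `|u| `^ (q - 1) * u.

Lemma normr_sgnpow q u : 1 < q -> `|sgnpow q u| = `|u| `^ q.
Proof.
move=> q1; rewrite /sgnpow normrM (ger0_norm (powR_ge0 _ _)) mulrC mulr_powRB1//.
lra.
Qed.

Lemma sgnpowM q u : 1 < q -> sgnpow q u * u = `|u| `^ (q + 1).
Proof.
move=> q1; rewrite /sgnpow -mulrA -expr2 -real_normK ?num_real//.
by rewrite expr2 mulrA mul_powRB1 ?powRDr1//; lra.
Qed.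

(** Equal signs reduce to [powR_lipschitz]. For opposite signs the two powers add up, but so do
    [|u|] and [|v|] in [|u - v|]. *)
Lemma sgnpow_lipschitz q u v (M : R) : 1 < q -> `|u| <= M -> `|v| <= M ->
  `|sgnpow q u - sgnpow q v| <= q * M `^ (q - 1) * `|u - v|.
Proof.
move=> q1 uM vM; have M0 : 0 <= M by rewrite (le_trans _ uM).
have sgE w : sgnpow q w = if 0 <= w then `|w| `^ q else - `|w| `^ q.
  rewrite /sgnpow; case: ifPn => w0.
    by rewrite -{2}(ger0_norm w0) mul_powRB1//; lra.
  have wE : w = - `|w| by rewrite ltr0_norm ?ltNge// opprK.
  by rewrite {2}wE mulrN mul_powRB1//; lra.
have B (w : R) : `|w| <= M -> `|w| `^ q <= q * M `^ (q - 1) * `|w|.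
  move=> wM; rewrite -(@mul_powRB1 _ `|w|)//; last lra.
  rewrite ler_wpM2r//; apply: (@le_trans _ _ (M `^ (q - 1))).
    by rewrite ge0_ler_powR// ?nnegrE//; lra.
  by rewrite ler_peMl ?powR_ge0// ltW.
have BU := B _ uM; have BV := B _ vM.
have L x y := @powR_lipschitz q x y M (ltW q1).
have D : q * M `^ (q - 1) * `| `|u| - `|v| | <= q * M `^ (q - 1) * `|u - v|.
  rewrite ler_wpM2l ?ler_dist_dist// mulr_ge0 ?powR_ge0//; lra.
rewrite !sgE; case: ifPn => u0; case: ifPn => v0.
- by rewrite (le_trans _ D)// L ?normr_ge0.
- rewrite opprK ger0_norm ?addr_ge0 ?powR_ge0//.
  rewrite (le_trans (lerD BU BV))// -mulrDr ler_wpM2l ?mulr_ge0 ?powR_ge0//; first lra.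
  by rewrite ger0_norm// ltr0_norm ?ltNge// ler_norm.
- rewrite -opprD normrN ger0_norm ?addr_ge0 ?powR_ge0//.
  rewrite (le_trans (lerD BU BV))// -mulrDr ler_wpM2l ?mulr_ge0 ?powR_ge0//; first lra.
  by rewrite (ger0_norm v0) ltr0_norm ?ltNge// distrC (le_trans _ (ler_norm _))// addrC.
- by rewrite -opprD normrN (le_trans _ D)// L ?normr_ge0.
Qed.

(** Tangent line inequality at [v] for the convex function [|s| ^ (q + 1) / (q + 1)], whose
    derivative is [sgnpow q]. *)
Lemma sgnpow_convex q u v : 1 < q ->
  (`|v| `^ (q + 1) - `|u| `^ (q + 1)) / (q + 1) <= sgnpow q v * (v - u).
Proof.
move=> q1; have := @powR_tangent (q + 1) `|v| `|u| _ (normr_ge0 _) (normr_ge0 _).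
rewrite addrK => /(_ _)/wrap[]; first lra.
have := sgnpowM v q1.
have : sgnpow q v * u <= `|v| `^ q * `|u|.
  by rewrite -normr_sgnpow// -normrM ler_norm.
have : `|v| `^ (q + 1) = `|v| `^ q * `|v|.
  by rewrite powRDr1//; lra.
move=> h1 h2 h3 h4.
by rewrite ler_pdivrMr; last lra; nra.
Qed.

Definition clamp (M a : R) : R := Num.max (- M) (Num.min M a).

Lemma clamp_le M a : 0 <= M -> `|clamp M a| <= M.
Proof.
move=> M0; rewrite /clamp ler_norml le_max lexx/= ge_max; apply/andP; split; first lra.
by rewrite ge_min lexx.
Qed.

Lemma clamp_id M a : `|a| <= M -> clamp M a = a.
Proof. by rewrite ler_norml => /andP[h1 h2]; rewrite /clamp min_r// max_r. Qed.

Lemma max_nonexpansive c a b : `|Num.max c a - Num.max c b| <= `|a - b|.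
Proof.
have h1 := ler_norm (a - b); have := ler_norm (b - a); rewrite distrC => h2.
have h0 := normr_ge0 (a - b); rewrite ler_norml.
by case: (leP c a) => ?; case: (leP c b) => ?; apply/andP; split; lra.
Qed.

Lemma min_nonexpansive c a b : `|Num.min c a - Num.min c b| <= `|a - b|.
Proof.
have h1 := ler_norm (a - b); have := ler_norm (b - a); rewrite distrC => h2.
have h0 := normr_ge0 (a - b); rewrite ler_norml.
by case: (leP c a) => ?; case: (leP c b) => ?; apply/andP; split; lra.
Qed.

Lemma clamp_nonexpansive M a b : `|clamp M a - clamp M b| <= `|a - b|.
Proof. by rewrite (le_trans (max_nonexpansive _ _ _))// min_nonexpansive. Qed.

Lemma clamp_norm_le M a : 0 <= M -> `|clamp M a| <= `|a|.
Proof.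
move=> M0; have := clamp_nonexpansive M a 0.
by rewrite (@clamp_id _ 0) ?normr0// !subr0.
Qed.

End power_inequalities.

(** * Row vectors: norm, inner product, measurability *)

Section rV_norm.
Variables (R : realType) (n : nat).
Implicit Types (x y v w : 'rV[R]_n).

Lemma ler_coord_norm x i : `|x ord0 i| <= `|x|.
Proof.
rewrite [leRHS]mx_normrE.
exact: (le_bigmax _ (fun ij => `|x ij.1 ij.2|) (ord0, i)).
Qed.

Lemma rV_norm_le x (r : R) : 0 <= r -> (forall i, `|x ord0 i| <= r) -> `|x| <= r.
Proof.
move=> r0 H; rewrite [leLHS]mx_normrE; apply/bigmax_leP; split => // -[i j] _ /=.
by rewrite ord1.
Qed.

Lemma rV_norm_lt x (r : R) : 0 < r -> (forall i, `|x ord0 i| < r) -> `|x| < r.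
Proof.
move=> r0 H; rewrite [ltLHS]mx_normrE; apply/bigmax_ltP; split => // -[i j] _ /=.
by rewrite ord1.
Qed.

(** The norm of row vectors is the sup norm while [dot] is Euclidean; the factor [n] pays for the
    comparison here and in later constants. *)
Lemma normr_dot_le v w : `|dot v w| <= n%:R * (`|v| * `|w|).
Proof.
rewrite /dot (le_trans (ler_norm_sum _ _ _))//.
rewrite (@le_trans _ _ (\sum_(i < n) `|v| * `|w|))//.
  by apply: ler_sum => i _; rewrite normrM ler_pM ?ler_coord_norm.
rewrite sumr_const card_ord.
by rewrite -[leLHS](@mulr_natl R).
Qed.

Lemma dotC v w : dot v w = dot w v.
Proof. by apply: eq_bigr => i _; rewrite mulrC. Qed.

Lemma dotDr v w y : dot v (w + y) = dot v w + dot v y.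
Proof. by rewrite -big_split; apply: eq_bigr => i _; rewrite mxE mulrDr. Qed.

Lemma dotDl v w y : dot (w + y) v = dot w v + dot y v.
Proof. by rewrite !(dotC _ v) dotDr. Qed.

Lemma dotZr v w (c : R) : dot v (c *: w) = c * dot v w.
Proof. by rewrite mulr_sumr; apply: eq_bigr => i _; rewrite mxE mulrCA. Qed.

Lemma dotZl v w (c : R) : dot (c *: v) w = c * dot v w.
Proof. by rewrite dotC dotZr dotC. Qed.

Lemma dot0l v : dot 0 v = 0.
Proof. by rewrite /dot big1// => i _; rewrite mxE mul0r. Qed.

Lemma dotNr v w : dot v (- w) = - dot v w.
Proof. by rewrite -scaleN1r dotZr mulN1r. Qed.

Lemma dotBr v w y : dot v (w - y) = dot v w - dot v y.
Proof. by rewrite dotDr dotNr. Qed.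

Lemma dot_ge0 v : 0 <= dot v v.
Proof. by apply: sumr_ge0 => i _; rewrite -expr2 sqr_ge0. Qed.

Lemma sqr_norm_le_dot v : `|v| ^+ 2 <= dot v v.
Proof.
have H i : `|v ord0 i| <= Num.sqrt (dot v v).
  rewrite -sqrtr_sqr ler_wsqrtr// /dot (bigD1 i)//= -expr2 lerDl.
  by apply: sumr_ge0 => j _; rewrite -expr2 sqr_ge0.
rewrite -[leRHS]sqr_sqrtr ?dot_ge0// lerXn2r// ?nnegrE ?sqrtr_ge0//.
exact: rV_norm_le.
Qed.

Lemma dot_le_sqr_norm v : dot v v <= n%:R * `|v| ^+ 2.
Proof. by rewrite (le_trans (ler_norm _))// normr_dot_le. Qed.

Lemma rV_coord_continuous i : continuous (fun x : 'rV[R]_n => x ord0 i).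
Proof. exact: coord_continuous. Qed.

Lemma rV_continuousP (T : topologicalType) (f : T -> 'rV[R]_n) (t : T) :
  (forall i, {for t, continuous (fun s => f s ord0 i)}) -> {for t, continuous f}.
Proof.
move=> cf; apply/cvgrPdist_lt => e e0.
have : \forall s \near t, forall i, `|f t ord0 i - f s ord0 i| < e.
  apply: filter_forall => i; have /cvgrPdist_lt := cf i; exact.
apply: filterS => s H; apply: rV_norm_lt => // i; rewrite !mxE; exact: H.
Qed.

Lemma dot_continuous (T : topologicalType) (f g : T -> 'rV[R]_n) (t : T) :
  {for t, continuous f} -> {for t, continuous g} ->
  {for t, continuous (fun s => dot (f s) (g s))}.
Proof.
move=> cf cg; rewrite /dot; apply: cvg_big => // [|i _]; first exact: add_continuous.
apply: cvgM.
  exact: (continuous_comp cf (@rV_coord_continuous i (f t))).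
exact: (continuous_comp cg (@rV_coord_continuous i (g t))).
Qed.

End rV_norm.

Section rV_measurable.
Variable R : realType.

(** An open set is a union of boxes with rational centre and half-side [1 / (k + 1)]. The union runs
    over all such pairs, a countable type, and a box not contained in [A] is replaced by the empty
    set. *)
Lemma open_rV_measurable n (A : set 'rV[R]_n) : open A -> measurable A.
Proof.
move=> oA.
pose box (c : 'rV[rat]_n * nat) : set 'rV[R]_n :=
  [set y | forall i, `](ratr (c.1 ord0 i) - c.2.+1%:R^-1), (ratr (c.1 ord0 i) + c.2.+1%:R^-1)[%classic (y ord0 i)].
rewrite (_ : A = \bigcup_c (if `[< box c `<=` A >] then box c else set0)).
  apply: countable_bigcupT_measurable; first exact: countableP.
  move=> c; case: ifPn => // _.
  apply: (@measurable_rV_box R n (fun i => `](ratr (c.1 ord0 i) - c.2.+1%:R^-1),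
    (ratr (c.1 ord0 i) + c.2.+1%:R^-1)[%classic)) => i.
  exact: measurable_itv.
apply/seteqP; split => [x Ax|x [c _]]; last by case: ifPn => // /asboolP; apply.
have /nbhs_ballP[e /= e0 eA] : nbhs x A by exact: open_nbhs_nbhs.
have e20 : 0 < e / 2 by rewrite divr_gt0.
have [k _ /(_ k (leqnn k)) ke] := near_infty_natSinv_lt (PosNum e20).
have k0 : 0 < k.+1%:R^-1 :> R by rewrite invr_gt0.
have H i : exists c : rat, x ord0 i - k.+1%:R^-1 < ratr c < x ord0 i + k.+1%:R^-1.
  have [c] : exists c, ratr c \in `](x ord0 i - k.+1%:R^-1), (x ord0 i + k.+1%:R^-1)[.
    by apply: rat_in_itvoo; move: (k.+1%:R^-1 : R) k0 => h h0; lra.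
  by rewrite in_itv/= => ?; exists c.
have [c Hc] := choice H.
exists (\row_i c i, k) => //.
have -> : `[< box (\row_i c i, k) `<=` A >].
  apply/asboolP => y yb; apply: eA; rewrite mx_norm_ball /ball_/=.
  apply: rV_norm_lt => // i; rewrite !mxE.
  have := yb i; rewrite /= in_itv/= mxE; have := Hc i; move: ke => /=.
  rewrite ltr_norml; move: (k.+1%:R^-1 : R) => h; lra.
move=> i; rewrite /= in_itv/= mxE; have := Hc i.
by move: (k.+1%:R^-1 : R) k0 => h h0; lra.
Qed.

Lemma closed_rV_measurable n (A : set 'rV[R]_n) : closed A -> measurable A.
Proof. by move/closed_openC/open_rV_measurable/measurableC; rewrite setCK. Qed.

Lemma compact_rV_measurable n (A : set 'rV[R]_n) : compact A -> measurable A.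
Proof.
move/compact_closed => cA; apply: closed_rV_measurable; apply: cA.
exact: norm_hausdorff.
Qed.

Lemma open_continuous_measurable_rV n (D : set 'rV[R]_n) (f : 'rV[R]_n -> R) :
  open D -> (forall x, D x -> {for x, continuous f}) -> measurable_fun D f.
Proof.
move=> oD cf; apply: (measurability _ (RGenOpens.measurableE R)).
move=> _ [_ [a [b ->] <-]]; apply: open_rV_measurable.
rewrite openE => x [Dx /= fx]; rewrite /interior.
apply: filterI; first exact: open_nbhs_nbhs.
by apply: (cf x Dx); apply: open_nbhs_nbhs; split => //; exact: interval_open.
Qed.

Lemma continuous_measurable_rV n (f : 'rV[R]_n -> R) :
  continuous f -> measurable_fun setT f.
Proof.
move=> cf; have oT : open [set: 'rV[R]_n] by exact: openT.
by apply: (open_continuous_measurable_rV oT) => x _; exact: cf.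
Qed.

End rV_measurable.

(** * Affine change of variables *)

Section affine_change.
Variable R : realType.
Local Open Scope ereal_scope.

(** By uniqueness of Lebesgue measure: [|c|] times its image under [x |-> c x + b] gives half-open
    intervals their length. For [c < 0] the endpoints swap and the preimage is closed on the left
    instead. *)
Lemma ge0_integral_affine (c b : R) (f : R -> \bar R) : (c != 0)%R ->
  measurable_fun [set: R] f -> (forall x, 0 <= f x) ->
  \int[@lebesgue_measure R]_x f (c * x + b)%R =
  `|c|^-1%:E * \int[@lebesgue_measure R]_x f x.
Proof.
move=> c0 mf f0.
have mg : measurable_fun setT (fun x : R => (c * x + b)%R).
  by apply: measurable_funD => //; exact: measurable_funM.
have nc0 : (0 <= `|c|)%R by [].
have E A : measurable A -> @lebesgue_measure R A =
    mscale (NngNum nc0) (pushforward (@lebesgue_measure R)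
      ((fun x : R => (c * x + b)%R) : _ -> measurableTypeR R)) A.
  apply: lebesgue_measure_unique => //= _ [[x y] _ <-].
  have [cp|cn] := ltP 0%R c.
    rewrite /mscale/= /pushforward (_ : _ @^-1` _ = `]((x - b) / c)%R, ((y - b) / c)%R]%classic); last first.
      apply/seteqP; split => t /=; rewrite !in_itv/= ltr_pdivrMr// ler_pdivlMr//.
        by rewrite (mulrC t) ltrBlDr lerBrDr.
      by rewrite (mulrC t) ltrBlDr lerBrDr.
    rewrite !lebesgue_measure_itv/= !lte_fin ltr_pM2r ?invr_gt0// ltrD2r.
    case: ifP => _; last by rewrite mule0.
    by rewrite -!EFinB -EFinM gtr0_norm//; congr EFin; field; rewrite gt_eqF.
  have {}cn : (c < 0)%R by rewrite lt_neqAle c0.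
  rewrite /mscale/= /pushforward (_ : _ @^-1` _ = `[((y - b) / c)%R, ((x - b) / c)%R[%classic); last first.
    apply/seteqP; split => t /=; rewrite !in_itv/= ltr_ndivlMr// ler_ndivrMr//.
      by rewrite (mulrC t) ltrBlDr lerBrDr andbC.
    by rewrite (mulrC t) ltrBlDr lerBrDr andbC.
  rewrite !lebesgue_measure_itv/= !lte_fin ltr_nM2r ?invr_lt0// ltrD2r.
  case: ifP => _; last by rewrite mule0.
  by rewrite -!EFinB -EFinM ltr0_norm//; congr EFin; field; rewrite lt_eqF.
rewrite [in RHS](eq_measure_integral (mscale (NngNum nc0) (pushforward (@lebesgue_measure R)
      ((fun x : R => (c * x + b)%R) : _ -> measurableTypeR R))))//; last by move=> A mA _; exact: E.
rewrite ge0_integral_mscale// ge0_integral_pushforward//=.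
rewrite muleA -EFinM mulVf ?normr_eq0// mul1e.
by rewrite preimage_setT.
Qed.

(** Induction on the dimension, following the recursive construction of [lebesgue_rV]: Tonelli
    separates the first coordinate, and the affine map acts on it and on the remaining ones
    independently. *)
Lemma ge0_integral_rV_affine n (c : R) (b : 'rV[R]_n) (f : 'rV[R]_n -> \bar R) :
  (c != 0)%R -> measurable_fun setT f -> (forall x, 0 <= f x) ->
  \int[lebesgue_rV R n]_x f (c *: x + b)%R =
  (`|c|^-1 ^+ n)%:E * \int[lebesgue_rV R n]_x f x.
Proof.
move=> c0; elim: n b f => [|n IH] b f mf f0.
  rewrite expr0 mul1e; apply: eq_integral => x _; congr f.
  by apply/rowP => -[].
have maff : measurable_fun setT (fun x : 'rV[R]_n.+1 => (c *: x + b)%R).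
  apply: measurable_fun_rVP => i.
  under eq_fun do rewrite !mxE.
  apply: measurable_funD => //; apply: measurable_funM => //.
  exact: measurable_coord.
rewrite /= /lebesgue_step ge0_integral_pushforward//=; [|exact: measurable_rV_cons|exact: measurableT_comp].
rewrite ge0_integral_pushforward//=; last exact: measurable_rV_cons.
rewrite preimage_setT.
have mfc : measurable_fun setT (f \o @rV_cons R n).
  by apply: measurableT_comp => //; exact: measurable_rV_cons.
rewrite fubini_tonelli1//; last first.
  exact: (measurableT_comp mf (measurableT_comp maff (@measurable_rV_cons R n))).
rewrite fubini_tonelli1//.
have E (a : R) (v : 'rV[R]_n) : (c *: rV_cons (a, v) + b)%R =
    rV_cons ((c * a + (rV_uncons b).1)%R, (c *: v + (rV_uncons b).2)%R).
  apply/rowP => i.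
  transitivity (c * rV_cons (a, v) ord0 i + b ord0 i)%R; first by rewrite !mxE.
  case: (unliftP ord0 i) => [j|] ->.
    by rewrite !rV_consS/= !mxE.
  by rewrite !rV_cons0.
rewrite /fubini_F/=.
under eq_integral => a _.
  under eq_integral => v _ do rewrite E.
  rewrite (IH _ (fun v => f (rV_cons ((c * a + (rV_uncons b).1)%R, v))))//; last first.
    exact: (measurableT_comp mfc (measurable_pair1 _)).
  over.
have f0' z : 0 <= (f \o @rV_cons R n) z by exact: f0.
pose F := fubini_F (lebesgue_rV R n) (f \o @rV_cons R n).
have mF : measurable_fun [set: R] F.
  exact: (measurable_fun_fubini_tonelli_F (m2 := lebesgue_rV R n) _ mfc f0').
have F0 a : 0 <= F a by exact: integral_ge0.
have mFc : measurable_fun [set: R] (fun a : R => F (c * a + (rV_uncons b).1)%R).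
  apply: measurableT_comp => //.
  by apply: measurable_funD => //; exact: measurable_funM.
rewrite (_ : (fun a => _) = fun a : R => (`|c|^-1 ^+ n)%:E * F (c * a + (rV_uncons b).1)%R)//.
have Fc0 (a : R) : setT a -> 0 <= F (c * a + (rV_uncons b).1)%R by move=> _; exact: F0.
have cn0 : 0 <= ((`|c|^-1 ^+ n)%:E : \bar R) by rewrite lee_fin exprn_ge0// invr_ge0.
rewrite ge0_integralZl; [|exact: measurableT|exact: mFc|exact: Fc0|exact: cn0].
rewrite (ge0_integral_affine _ c0 mF F0).
by rewrite muleA -EFinM -exprSr.
Qed.

End affine_change.

(** * Cubes and density of continuous functions *)

Lemma cvge0_exists_le (R : realType) (u : nat -> \bar R) (e : R) : 0 < e ->
  u k @[k --> \oo] --> 0%E -> exists k, (u k <= e%:E)%E.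
Proof.
move=> e0 /fine_cvgP[fu /cvgrPdist_lt/(_ _ e0) H].
have [k _ /(_ k (leqnn k))[/= fk]] := filterI fu H.
rewrite sub0r normrN => Hk; exists k.
by rewrite -(fineK fk) lee_fin (le_trans (ler_norm _))// ltW.
Qed.

Section cube.
Variables (R : realType) (n : nat).
Local Notation mu := (lebesgue_rV R n).
Implicit Types r s : R.

(** The closed sup-norm ball, encoded as a product of intervals so that measurability, volume and
    compactness come from the factors. *)
Definition cube (r : R) : set 'rV[R]_n := [set x | forall i, `[- r, r]%classic (x ord0 i)].

Lemma cubeP r x : 0 <= r -> cube r x <-> `|x| <= r.
Proof.
move=> r0; split => [H|H i]; last first.
  by rewrite /= in_itv/= -ler_norml (le_trans (ler_coord_norm _ _)).
by apply: rV_norm_le => // i; have := H i; rewrite /= in_itv/= -ler_norml.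
Qed.

Lemma cube_norm_le r x : 0 <= r -> cube r x -> `|x| <= r.
Proof. by move=> r0 /(cubeP _ r0). Qed.

Lemma measurable_cube r : measurable (cube r).
Proof. by apply: (@measurable_rV_box R n (fun=> `[- r, r]%classic)) => i; exact: measurable_itv. Qed.

Lemma lebesgue_cube r : 0 <= r -> mu (cube r) = ((2 * r) ^+ n)%:E.
Proof.
move=> r0; rewrite /cube (@lebesgue_rV_box R n (fun=> `[- r, r]%classic))//.
rewrite lebesgue_measure_itv/= lte_fin; case: ltP => rr.
  have E : r + - - r = 2 * r by ring.
  by rewrite -EFinD E prodEFin prodr_const card_ord.
have -> : r = 0 by move: (rr : r <= - r); lra.
rewrite mulr0; case: n => [|m]; first by rewrite big_ord0 expr0.
by rewrite big_ord_recl mul0e expr0n.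
Qed.

Lemma lebesgue_cube_lty r : (mu (cube r) < +oo)%E.
Proof.
case: (leP 0 r) => r0; first by rewrite lebesgue_cube// ltry.
apply: le_lt_trans (_ : mu (cube 0) < +oo)%E; last by rewrite lebesgue_cube// ltry.
apply: le_measure; rewrite ?inE; [exact: measurable_cube|exact: measurable_cube|].
by move=> x H i; have := H i; rewrite /= !in_itv/=; lra.
Qed.

Lemma compact_cube r : compact (cube r).
Proof. by apply: (@rV_compact _ n (fun=> `[- r, r]%classic)) => i; exact: segment_compact. Qed.

Lemma sub_cube r s : r <= s -> cube r `<=` cube s.
Proof. by move=> rs x H i; have := H i; rewrite /= !in_itv/=; lra. Qed.

Lemma compact_sub_cube (K : set 'rV[R]_n) : compact K -> exists2 r, 0 < r & K `<=` cube r.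
Proof.
move=> cK; have [M [Mr HM]] := compact_bounded cK.
exists (Num.max (M + 1) 1) => [|x Kx]; first by rewrite lt_max ltr01 orbT.
apply/cubeP; first by rewrite le_max ler01 orbT.
by rewrite le_max (HM (M + 1)) ?ltrDl.
Qed.

Lemma integrable_cube_cst r (c : R) : mu.-integrable (cube r) (EFin \o cst c).
Proof.
apply/integrableP; split; first exact/measurable_EFinP.
rewrite [X in (X < _)%E](_ : _ = (`|c|%:E * mu (cube r))%E).
  by rewrite lte_mul_pinfty ?lebesgue_cube_lty.
by rewrite -(integral_cst mu (measurable_cube r)).
Qed.

Lemma continuous_cube_bounded r (f : 'rV[R]_n -> R) : continuous f ->
  exists M : R, forall x, cube r x -> `|f x| <= M.
Proof.
move=> cf; have : compact (f @` cube r).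
  by apply: continuous_compact; [exact/continuous_subspaceT|exact: compact_cube].
move=> cfr; have [M [Mr H]] := compact_bounded cfr; exists (M + 1) => x xr.
by apply: (H (M + 1)); [rewrite ltrDl|exists x].
Qed.

End cube.
Arguments cube {R} n r.

Section density.
Import HBSimple.
Variables (R : realType) (n : nat).
Local Notation mu := (lebesgue_rV R n).
Implicit Types (f g h : 'rV[R]_n -> R).

(** Density is first established for this [L^1] notion because it is stable under Lipschitz
    operations and bounded pointwise limits, which is what a sigma-algebra argument requires. *)
Definition L1_approximable f := measurable_fun setT f /\
  forall r e : R, 0 < e -> exists2 g, continuous g &
    (\int[mu]_(x in cube n r) (`|f x - g x|)%:E <= e%:E)%E.

Lemma measurable_dist f g : measurable_fun setT f -> measurable_fun setT g ->
  forall D, measurable_fun D (fun x => (`|f x - g x|)%:E).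
Proof.
move=> mf mg D; apply: measurable_funTS; apply/measurable_EFinP.
apply: measurableT_comp => //; exact: measurable_funB.
Qed.

Lemma L1_approximable_le f :
  measurable_fun setT f ->
  (forall r e : R, 0 < e -> exists g, L1_approximable g /\
    (\int[mu]_(x in cube n r) (`|f x - g x|)%:E <= e%:E)%E) ->
  L1_approximable f.
Proof.
move=> mf H; split => // r e e0.
have e20 : 0 < e / 2 by rewrite divr_gt0.
have [g [[mg Hg] fg]] := H r (e / 2) e20.
have [h ch gh] := Hg r (e / 2) e20.
have mh := continuous_measurable_rV ch.
exists h => //.
apply: (@le_trans _ _ (\int[mu]_(x in cube n r) ((`|f x - g x|)%:E + (`|g x - h x|)%:E))%E).
  apply: ge0_le_integral => //; first exact: measurable_cube.
  - exact: measurable_dist.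
  - by apply: emeasurable_funD; exact: measurable_dist.
  - by move=> x _; rewrite -EFinD lee_fin (le_trans _ (ler_normD _ _))// addrA subrK.
rewrite ge0_integralD//; [|exact: measurable_cube|exact: measurable_dist|exact: measurable_dist].
by rewrite [e in leRHS]splitr EFinD leeD.
Qed.

Lemma L1_approximable_lim (f : 'rV[R]_n -> R) (f_ : nat -> 'rV[R]_n -> R) (M : R) :
  (forall k, L1_approximable (f_ k)) ->
  (forall x k, `|f_ k x| <= M) -> (forall x, f_ k x @[k --> \oo] --> f x) ->
  L1_approximable f.
Proof.
move=> Hf fM cf.
have mf : measurable_fun setT f.
  by apply: (measurable_fun_cvg (fun k => (Hf k).1)) => x _; exact: cf.
apply: L1_approximable_le => // r e e0.
have := @dominated_convergence _ _ _ mu (cube n r) (measurable_cube r)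
  (fun k x => (f_ k x)%:E) (EFin \o f) (EFin \o cst M).
case.
- by move=> k; apply/measurable_EFinP; apply: measurable_funTS; exact: (Hf k).1.
- by apply/measurable_EFinP; exact: measurable_funTS.
- by apply: aeW => x _; apply: cvg_EFin; [exact: nearW|exact: cf].
- exact: integrable_cube_cst.
- by apply: aeW => x k _; rewrite abse_EFin lee_fin.
move=> _ /(cvge0_exists_le e0)[k Hk] _; exists (f_ k); split => //.
rewrite (le_trans _ Hk)// (eq_integral (fun x => `|f x - f_ k x|%:E))// => x _.
exact: (congr1 EFin (distrC _ _)).
Qed.

Lemma L1_approximable_continuous f : continuous f -> L1_approximable f.
Proof.
move=> cf; split; first exact: continuous_measurable_rV.
move=> r e e0; exists f => //; under eq_integral do rewrite subrr normr0.
by rewrite integral0 lee_fin ltW.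
Qed.

Lemma L1_approximable_op2 (op : R -> R -> R) (c : R) f g : 0 < c ->
  (forall h k : 'rV[R]_n -> R, continuous h -> continuous k ->
    continuous (fun x => op (h x) (k x))) ->
  (forall h k, measurable_fun setT h -> measurable_fun setT k ->
    measurable_fun [set: 'rV[R]_n] (fun x => op (h x) (k x))) ->
  (forall a b a' b', `|op a b - op a' b'| <= c * (`|a - a'| + `|b - b'|)) ->
  L1_approximable f -> L1_approximable g ->
  L1_approximable (fun x => op (f x) (g x)).
Proof.
move=> c0 cop mop lop [mf Hf] [mg Hg]; split; first exact: mop.
move=> r e e0; have e1 : 0 < e / c / 2 by rewrite !divr_gt0.
have [h ch fh] := Hf r _ e1; have [k ck gk] := Hg r _ e1.
have mh := continuous_measurable_rV ch; have mk := continuous_measurable_rV ck.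
exists (fun x => op (h x) (k x)); first exact: cop.
apply: (@le_trans _ _ (\int[mu]_(x in cube n r) (c%:E * ((`|f x - h x|)%:E + (`|g x - k x|)%:E)))%E).
  apply: ge0_le_integral => //; first exact: measurable_cube.
  - by apply: measurable_dist; exact: mop.
  - by apply: measurable_funeM; apply: emeasurable_funD; exact: measurable_dist.
  - by move=> x _; rewrite -EFinD -EFinM lee_fin.
rewrite ge0_integralZl//; last 4 first.
- exact: measurable_cube.
- by apply: emeasurable_funD; exact: measurable_dist.
- by move=> x _; rewrite -EFinD lee_fin.
- by rewrite lee_fin ltW.
rewrite ge0_integralD//; [|exact: measurable_cube|exact: measurable_dist|exact: measurable_dist].
apply: (@le_trans _ _ (c%:E * ((e / c / 2)%:E + (e / c / 2)%:E))%E).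
  by rewrite lee_pmul2l ?lte_fin// leeD.
by rewrite -EFinD -splitr -EFinM lee_fin mulrCA divff ?mulr1// gt_eqF.
Qed.

Lemma L1_approximable_max f g : L1_approximable f -> L1_approximable g ->
  L1_approximable (fun x => Num.max (f x) (g x)).
Proof.
apply: (@L1_approximable_op2 _ 1) => //.
- by move=> h k ch ck x; exact: (continuous_max (ch x) (ck x)).
- by move=> h k mh mk; exact: (measurable_maxr mh mk).
- move=> a b a' b'; rewrite mul1r ler_norml.
  have := ler_norm (a - a'); have := ler_norm (b - b').
  have := ler_norm (a' - a); have := ler_norm (b' - b).
  rewrite (distrC b' b) (distrC a' a) => h1 h2 h3 h4.
  have n1 := normr_ge0 (a - a'); have n2 := normr_ge0 (b - b').
  by case: (leP a b) => ?; case: (leP a' b') => ?; apply/andP; split; lra.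
Qed.

Lemma L1_approximable_lin f g (s t : R) : L1_approximable f -> L1_approximable g ->
  L1_approximable (fun x => s * f x + t * g x).
Proof.
apply: (@L1_approximable_op2 (fun a b => s * a + t * b) (`|s| + `|t| + 1)).
- by rewrite ltr_wpDl// addr_ge0.
- move=> h k ch ck x; exact: (cvgD (cvgM (cvg_cst s) (ch x)) (cvgM (cvg_cst t) (ck x))).
- move=> h k mh mk.
  exact: (measurable_funD (measurable_funM (measurable_cst s) mh) (measurable_funM (measurable_cst t) mk)).
- move=> a b a' b'.
  have -> : s * a + t * b - (s * a' + t * b') = s * (a - a') + t * (b - b') by ring.
  rewrite (le_trans (ler_normD _ _))// !normrM.
  have := normr_ge0 s; have := normr_ge0 t.
  have := normr_ge0 (a - a'); have := normr_ge0 (b - b'); nra.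
Qed.

(** The sets with approximable indicator form a sigma-algebra: a countable union is the limit of
    finite ones, whose indicators are maxima. It contains the half-spaces, hence every measurable
    set. *)
Lemma L1_approximable_indic (A : set 'rV[R]_n) : measurable A ->
  L1_approximable (\1_A : 'rV[R]_n -> R).
Proof.
pose S := [set A : set 'rV[R]_n | L1_approximable (\1_A : 'rV[R]_n -> R)].
have c0 : L1_approximable (cst 0 : 'rV[R]_n -> R).
  by apply: L1_approximable_continuous; exact: cst_continuous.
have c1 : L1_approximable (cst 1 : 'rV[R]_n -> R).
  by apply: L1_approximable_continuous; exact: cst_continuous.
have S0 : S set0 by rewrite /S/= indic0.
have SC B : S B -> S (~` B).
  move=> SB; rewrite /S/= (_ : \1_(~` B) = fun x => 1 * (cst 1 x) + (-1) * \1_B x).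
    exact: L1_approximable_lin.
  by apply/funext => x; rewrite !indicE in_setC mul1r mulN1r; case: (_ \in _) => /=; rewrite ?subrr ?subr0.
have SU (F : nat -> set 'rV[R]_n) : (forall k, S (F k)) -> S (\bigcup_k F k).
  move=> SF; pose g_ K : 'rV[R]_n -> R := \1_(\big[setU/set0]_(k < K) F k).
  apply: (@L1_approximable_lim _ g_ 1).
  - elim => [|K IH]; first by rewrite /g_ big_ord0 indic0.
    rewrite /g_ big_ord_recr/= (_ : \1_(_ `|` _) = fun x => Num.max (g_ K x) (\1_(F K) x)).
      exact: (L1_approximable_max IH (SF K)).
    apply/funext => x; rewrite /g_ !indicE in_setU.
    by do 2 case: (_ \in _) => /=; rewrite ?maxxx ?(max_l ler01) ?(max_r ler01).
  - by move=> x k; rewrite /g_ indicE; case: (_ \in _); rewrite ?normr1 ?normr0.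
  - move=> x; rewrite indicE; case: (pselect ((\bigcup_k F k) x)) => Fx.
      rewrite mem_set//; apply: cvg_near_cst; case: Fx => k _ Fkx.
      exists k.+1 => // K /= kK; rewrite /g_ indicE mem_set//.
      by rewrite -bigcup_mkord; exists k.
    rewrite memNset//; apply: cvg_near_cst; apply: nearW => K.
    rewrite /g_ indicE memNset// -bigcup_mkord => -[k _ Fkx]; apply: Fx; by exists k.
have SR i (a : R) : S ((fun x : 'rV[R]_n => x ord0 i) @^-1` `]a, +oo[%classic).
  have -> : (fun x : 'rV[R]_n => x ord0 i) @^-1` `]a, +oo[%classic = [set x | a < x ord0 i].
    by apply/seteqP; split => x /=; rewrite in_itv/= andbT.
  (* The indicator of an open half-space is the limit of these continuous ramps of slope [k]. *)
  pose g_ (k : nat) (x : 'rV[R]_n) : R := Num.min 1 (Num.max 0 (k%:R * (x ord0 i - a))).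
  apply: (@L1_approximable_lim _ g_ 1).
  - move=> k; apply: L1_approximable_continuous => x.
    have c3 : {for x, continuous (fun x : 'rV[R]_n => k%:R * (x ord0 i - a))}.
      exact: (cvgM (cvg_cst _) (cvgB (@rV_coord_continuous R n i x) (cvg_cst a))).
    exact: (continuous_min (@cst_continuous _ _ (1 : R) x)
      (continuous_max (@cst_continuous _ _ (0 : R) x) c3)).
  - move=> x k; rewrite /g_ ger0_norm; first by rewrite ge_min lexx.
    by rewrite le_min ler01 le_max lexx.
  - move=> x; rewrite indicE /g_; case: (ltP a (x ord0 i)) => ax.
      rewrite mem_set//; apply: cvg_near_cst.
      have d0 : 0 < x ord0 i - a by rewrite subr_gt0.
      have [k Hk] : exists k : nat, (x ord0 i - a)^-1 < k%:R.
        by exists (Num.trunc (x ord0 i - a)^-1).+1; rewrite truncnS_gt.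
      exists k => // K /= kK; apply/min_idPl; rewrite le_max; apply/orP; right.
      rewrite -ler_pdivrMr// mul1r (le_trans (ltW Hk))// ler_nat//.
    rewrite memNset/=; last by apply/negP; rewrite -leNgt.
    apply: cvg_near_cst; apply: nearW => k.
    rewrite (max_l _) ?min_r//; by rewrite mulr_ge0_le0// subr_le0.
move: A; apply: smallest_sub.
  split => //; first by move=> B SB; rewrite setTD; exact: SC.
rewrite -bigcup_seq; apply: bigcup_sub => i _ B [C mC <-]; rewrite setTI.
pose T := [set C : set R | S ((fun x : 'rV[R]_n => x ord0 i) @^-1` C)].
have sub : (@RGenOInfty.G R).-sigma.-measurable `<=` T.
  apply: smallest_sub.
    split; first by rewrite /T/= preimage_set0.
      by move=> D TD; rewrite /T/= setTD preimage_setC; exact: SC.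
    by move=> F TF; rewrite /T/= preimage_bigcup; exact: SU.
  by move=> _ [a ->]; exact: SR.
by apply: sub; rewrite -RGenOInfty.measurableE.
Qed.

Lemma L1_approximable_sfun (s : {sfun 'rV[R]_n >-> R}) : L1_approximable s.
Proof.
rewrite (_ : (s : 'rV[R]_n -> R) = fun x =>
    \sum_(y <- finmap.enum_fset (fset_set (range s))) y * \1_(s @^-1` [set y]) x); last first.
  by apply/funext => x; rewrite fimfunE fsbig_finite.
elim: (finmap.enum_fset _) => [|y r IH].
  under eq_fun do rewrite big_nil.
  by apply: L1_approximable_continuous; exact: cst_continuous.
under eq_fun do rewrite big_cons -[X in _ + X]mul1r.
apply: L1_approximable_lin => //; apply: L1_approximable_indic.
exact: measurable_sfunP.
Qed.

(** Truncation at a level [M] reduces [L^p] to [L^1]: between functions bounded by [M], the [p]-th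
    power of the distance is at most [(2 M) ^ (p - 1)] times the distance. *)
Lemma continuous_dense_Lp (p r e : R) f : 1 <= p -> 0 < e ->
  measurable_fun setT f ->
  mu.-integrable (cube n r) (fun x => (`|f x| `^ p)%:E) ->
  exists2 g, continuous g & (\int[mu]_(x in cube n r) (`|f x - g x| `^ p)%:E <= e%:E)%E.
Proof.
move=> p1 e0 mf intf.
have mC := measurable_cube (n := n) r.
have cclamp M (h : 'rV[R]_n -> R) : continuous h -> continuous (fun x => clamp M (h x)).
  move=> ch x; exact: (continuous_max (@cst_continuous _ _ (- M) x)
    (continuous_min (@cst_continuous _ _ M x) (ch x))).
have mclamp M h : measurable_fun setT h -> measurable_fun [set: 'rV[R]_n] (fun x => clamp M (h x)).
  move=> mh; exact: (measurable_maxr (measurable_cst (- M)) (measurable_minr (measurable_cst M) mh)).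
have mpow h : measurable_fun setT h -> measurable_fun (cube n r) (fun x => (`|h x| `^ p)%:E).
  move=> mh; apply: measurable_funTS; apply/measurable_EFinP.
  exact: (measurableT_comp (measurable_powR p) (measurableT_comp (@normr_measurable R setT) mh)).
have p0 : 0 < p by lra.
(* Truncation and [L^1] approximation contribute [e1] each, and the convexity factor [2 ^ p] then
   gives exactly [e]. *)
pose e1 := e / 2 `^ p / 2.
have e10 : 0 < e1 by rewrite !divr_gt0// powR_gt0.
have [M M0 HM] : exists2 M : R, 0 < M &
    (\int[mu]_(x in cube n r) (`|f x - clamp M (f x)| `^ p)%:E <= e1%:E)%E.
  have := @dominated_convergence _ _ _ mu (cube n r) mC
    (fun k x => (`|f x - clamp k.+1%:R (f x)| `^ p)%:E) (cst 0%E)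
    (fun x => ((2 * `|f x|) `^ p)%:E).
  case.
  - by move=> k; apply: mpow; apply: measurable_funB => //; exact: mclamp.
  - exact: measurable_cst.
  - apply: aeW => x _; apply: cvg_near_cst.
    exists (Num.trunc `|f x|).+1 => // k /= kf.
    rewrite clamp_id ?subrr ?normr0 ?powR0 ?gt_eqF//.
    rewrite ltW// (lt_le_trans (truncnS_gt _))// ler_nat ltnW//.
  - rewrite (_ : (fun x => _) = fun x => ((2 `^ p)%:E * (`|f x| `^ p)%:E)%E).
      by apply: integrableZl.
    by apply/funext => x; rewrite powRM.
  - apply: aeW => x k _; rewrite abse_EFin lee_fin ger0_norm ?powR_ge0//.
    rewrite ge0_ler_powR ?nnegrE ?mulr_ge0//; first exact: ltW.
    rewrite (le_trans (ler_normB _ _))// mulr_natl mulr2n lerD2l.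
    exact: clamp_norm_le.
  move=> _ _; rewrite integral_cst// mul0e => /(cvge0_exists_le e10)[k Hk].
  by exists k.+1%:R.
have e20 : 0 < e1 / (2 * M) `^ (p - 1) by rewrite divr_gt0 ?powR_gt0 ?mulr_gt0.
have mfM := mclamp M f mf.
have intfM : mu.-integrable (cube n r) (EFin \o (fun x => clamp M (f x))).
  apply: (le_integrable mC _ _ (integrable_cube_cst n r M)).
    by apply: measurable_funTS; apply/measurable_EFinP.
  by move=> x _; rewrite /= lee_fin (ger0_norm (ltW M0)) clamp_le// ltW.
have e220 : 0 < e1 / (2 * M) `^ (p - 1) / 2 by rewrite divr_gt0.
have [g cg Hg] : exists2 g, continuous g &
    (\int[mu]_(x in cube n r) (`|clamp M (f x) - g x|)%:E <= (e1 / (2 * M) `^ (p - 1))%:E)%E.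
  have [s_ [_ _ /(cvge0_exists_le e220)[k Hk]]] := approximation_sfun_integrable mC intfM.
  have [ms /(_ r _ e220)[g cg Hg]] := L1_approximable_sfun (s_ k).
  have mg := continuous_measurable_rV cg.
  exists g => //.
  apply: (@le_trans _ _ (\int[mu]_(x in cube n r) ((`|clamp M (f x) - s_ k x|)%:E + (`|s_ k x - g x|)%:E))%E).
    apply: ge0_le_integral => //.
    - exact: measurable_dist.
    - by apply: emeasurable_funD; exact: measurable_dist.
    - by move=> x _; rewrite -EFinD lee_fin (le_trans _ (ler_normD _ _))// addrA subrK.
  rewrite ge0_integralD//; [|exact: measurable_dist|exact: measurable_dist].
  by rewrite [X in (_ <= X%:E)%E]splitr EFinD leeD.
(* The continuous approximation is truncated as well: [clamp] is nonexpansive and fixes the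
   truncated [f], so nothing is lost and both functions are bounded by [M]. *)
exists (fun x => clamp M (g x)); first exact: cclamp.
have mg := continuous_measurable_rV cg.
apply: (@le_trans _ _ (\int[mu]_(x in cube n r) ((2 `^ p)%:E *
   ((`|f x - clamp M (f x)| `^ p)%:E + ((2 * M) `^ (p - 1))%:E * (`|clamp M (f x) - g x|)%:E)))%E).
  apply: ge0_le_integral => //.
  - by apply: mpow; apply: measurable_funB => //; exact: mclamp.
  - apply: measurable_funeM; apply: emeasurable_funD.
      by apply: mpow; exact: measurable_funB.
    by apply: measurable_funeM; exact: measurable_dist.
  - move=> x _; suff H : `|f x - clamp M (g x)| `^ p <= 2 `^ p *
      (`|f x - clamp M (f x)| `^ p + (2 * M) `^ (p - 1) * `|clamp M (f x) - g x|) by [].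
    set a := f x; set b := g x; set c := clamp M a.
    apply: (@le_trans _ _ (2 `^ p * (`|a - c| `^ p + `|c - clamp M b| `^ p))).
      rewrite (le_trans _ (powRD_le _ _ _))//; last lra.
      rewrite ge0_ler_powR ?nnegrE ?addr_ge0//; first lra.
      by rewrite (le_trans _ (ler_normD _ _))// addrA subrK.
    rewrite ler_wpM2l ?powR_ge0// lerD2l -mul_powRB1//.
    apply: ler_pM; rewrite ?powR_ge0//.
      rewrite ge0_ler_powR ?nnegrE ?mulr_ge0//; [lra|lra|].
      by rewrite (le_trans (ler_normB _ _))// mulr_natl mulr2n lerD ?clamp_le// ltW.
    rewrite -{1}[c](clamp_id (clamp_le a (ltW M0))); exact: clamp_nonexpansive.
have mA := mpow _ (measurable_funB mf mfM).
have mB : measurable_fun (cube n r) (fun x => ((2 * M) `^ (p - 1))%:E * (`|clamp M (f x) - g x|)%:E)%E.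
  by apply: measurable_funeM; exact: measurable_dist.
have B0 x : cube n r x -> (0 <= ((2 * M) `^ (p - 1))%:E * (`|clamp M (f x) - g x|)%:E)%E.
  by move=> _; rewrite mule_ge0 ?lee_fin ?powR_ge0.
rewrite ge0_integralZl//; [|exact: emeasurable_funD|by move=> x xr; rewrite adde_ge0// B0].
rewrite ge0_integralD//.
rewrite ge0_integralZl//; [|exact: measurable_dist|by rewrite lee_fin powR_ge0].
apply: (@le_trans _ _ ((2 `^ p)%:E * (e1%:E + ((2 * M) `^ (p - 1))%:E * (e1 / (2 * M) `^ (p - 1))%:E))%E).
  rewrite lee_pmul2l ?lte_fin ?powR_gt0// leeD// lee_pmul2l// lte_fin powR_gt0// mulr_gt0//.
suff -> : e = 2 `^ p * (e1 + (2 * M) `^ (p - 1) * (e1 / (2 * M) `^ (p - 1))) by [].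
have M1 : (2 * M) `^ (p - 1) != 0 by rewrite gt_eqF ?powR_gt0 ?mulr_gt0.
have M2 : 2 `^ p != 0 :> R by rewrite gt_eqF ?powR_gt0.
by rewrite /e1; field; rewrite M1 M2.
Qed.
End density.

(** * Functions of class C^1 *)

Section differentials.
Variables (R : realType).
Implicit Types s t c : R.

Lemma is_diff_littleo (V : normedModType R) (f : V -> R) (x : V) (L : {linear V -> R}) :
  continuous L ->
  (forall e : R, 0 < e -> \forall h \near (0 : V), `|f (x + h) - f x - L h| <= e * `|h|) ->
  is_diff x f L.
Proof.
move=> cL H.
have E : f \o shift x = cst (f x) + L +o_ (0 : V) id.
  apply/eqaddoP => e e0; apply: filterS (H e e0) => h.
  by rewrite /= !fctE /= opprD addrA (addrC h).
have dE := diff_unique cL E.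
apply: DiffDef => //; apply/diff_locallyP; split; first by rewrite dE.
by rewrite dE.
Qed.

(** The form in which the basic differentials below are obtained. A quadratic remainder, uniform in
    the base point, can be integrated against an [L^1] function, which differentiates
    convolutions. *)
Lemma is_diff_quadratic (V : normedModType R) (f : V -> R) (x : V) (L : {linear V -> R}) (C : R) :
  continuous L ->
  (forall h : V, `|h| <= 1 -> `|f (x + h) - f x - L h| <= C * `|h| ^+ 2) ->
  is_diff x f L.
Proof.
move=> cL H; apply: is_diff_littleo => // e e0.
have C1 : 0 < `|C| + 1 by rewrite ltr_wpDl.
have d0 : 0 < Num.min 1 (e / (`|C| + 1)) by rewrite lt_min ltr01 divr_gt0.
near=> h.
have hd : `|h| <= Num.min 1 (e / (`|C| + 1)).
  by near: h; apply/nbhs_normP; exists (Num.min 1 (e / (`|C| + 1))) => //= h; rewrite /= sub0r normrN => /ltW.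
move: hd; rewrite le_min => /andP[h1 h2].
rewrite (le_trans (H h h1))// expr2 mulrA ler_wpM2r//.
rewrite (@le_trans _ _ ((`|C| + 1) * `|h|))// ?ler_wpM2r//.
  by rewrite (le_trans (ler_norm _))// lerDl.
by rewrite mulrC -ler_pdivlMr.
Unshelve. all: by end_near.
Qed.

Lemma lipschitz_continuous_at (V : normedModType R) (f : V -> R) (x : V) (L : R) :
  (forall h : V, `|h| <= 1 -> `|f (x + h) - f x| <= L * `|h|) ->
  {for x, continuous f}.
Proof.
move=> H; apply/cvgrPdist_le => e e0.
have L1 : 0 < `|L| + 1 by rewrite ltr_wpDl.
have d0 : 0 < Num.min 1 (e / (`|L| + 1)) by rewrite lt_min ltr01 divr_gt0.
apply/nbhs_normP; exists (Num.min 1 (e / (`|L| + 1))) => //= t.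
rewrite /= lt_min => /andP[t1 t2].
have := H (t - x); rewrite distrC (ltW t1) subrKC => /(_ isT) {}H.
rewrite distrC (le_trans H)// (@le_trans _ _ ((`|L| + 1) * `|x - t|))//.
  by rewrite ler_wpM2r// (le_trans (ler_norm _))// lerDl.
by rewrite mulrC -ler_pdivlMr// ltW.
Qed.

Lemma is_diff_congr (V W : normedModType R) (f g df dg : V -> W) (x : V) :
  is_diff x f df -> f =1 g -> df =1 dg -> is_diff x g dg.
Proof. by move=> h /funext <- /funext <-. Qed.

(** The [C^1] brick of the mollifying kernel and of the cut-offs; by [sqpos_taylor] its Taylor
    remainder lies between 0 and [t ^+ 2] everywhere. *)
Definition sqpos (s : R) : R := (Num.max s 0) ^+ 2.

Lemma sqpos_ge0 s : 0 <= sqpos s.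
Proof. exact: sqr_ge0. Qed.

Lemma sqpos_eq0 s : s <= 0 -> sqpos s = 0.
Proof. by move=> s0; rewrite /sqpos max_r// expr0n. Qed.

Lemma sqpos_le1 s : s <= 1 -> sqpos s <= 1.
Proof. by move=> s1; rewrite exprn_ile1// ?le_max ?lexx ?orbT// ge_max s1 ler01. Qed.

Lemma sqpos_taylor s t : 0 <= sqpos (s + t) - sqpos s - 2 * Num.max s 0 * t <= t ^+ 2.
Proof.
by rewrite /sqpos; case: (leP s 0) => ?; case: (leP (s + t) 0) => ?; apply/andP; split; nra.
Qed.

Lemma is_diff_sqpos s : is_diff s sqpos ( *:%R (2 * Num.max s 0)).
Proof.
apply: (@is_diff_quadratic _ _ _ _ 1); first exact: scaler_continuous.
move=> h _; rewrite mul1r real_normK ?num_real// ger0_norm.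
  by have /andP[] := sqpos_taylor s h.
by have /andP[] := sqpos_taylor s h.
Qed.

Variable n : nat.
Implicit Types (f g : 'rV[R]_n -> R) (F G : 'rV[R]_n -> 'rV[R]_n).

Fact dot_is_linear (v : 'rV[R]_n) : linear (dot v).
Proof. by move=> a w z; rewrite dotDr dotZr. Qed.

HB.instance Definition _ (v : 'rV[R]_n) :=
  GRing.isLinear.Build R 'rV[R]_n R _ (dot v) (dot_is_linear v).

Lemma dot_linear_continuous (v : 'rV[R]_n) : continuous (dot v).
Proof. by move=> x; apply: dot_continuous; [exact: cst_continuous|exact: cvg_id]. Qed.

Lemma dot_delta (v : 'rV[R]_n) i : dot v (delta_mx ord0 i) = v ord0 i.
Proof.
rewrite /dot (bigD1 i)//= mxE !eqxx mulr1 big1 ?addr0// => j ji.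
by rewrite mxE (negbTE ji) andbF mulr0.
Qed.

Lemma rV_continuousD F G x : {for x, continuous F} -> {for x, continuous G} ->
  {for x, continuous (fun y => F y + G y)}.
Proof. by move=> cF cG; exact: (cvgD cF cG). Qed.

Lemma rV_continuousZ f F x : {for x, continuous f} -> {for x, continuous F} ->
  {for x, continuous (fun y => f y *: F y)}.
Proof.
move=> cf cF; apply: rV_continuousP => i.
have -> : (fun y : 'rV[R]_n => (f y *: F y) ord0 i) = (fun y : 'rV[R]_n => f y * (F y) ord0 i).
  by apply/funext => y; rewrite mxE.
exact: (cvgM cf (continuous_comp cF (@rV_coord_continuous R n i (F x)))).
Qed.

(** The gradient is carried explicitly as [G], so that gradients of compound functions are computed
    by structural rules; [C1_grad] recovers [grad]. *)
Definition C1 f G := continuous G /\ forall x, is_diff x f (dot (G x)).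

Lemma C1_grad f G : C1 f G -> grad f = G.
Proof.
move=> [_ fG]; apply/funext => x; apply/rowP => i; rewrite mxE.
by rewrite deriveE ?(@diff_val _ _ _ _ _ _ _ (fG x)) ?dot_delta//; exact: ex_diff.
Qed.

Lemma C1_C1_on f G : C1 f G -> C1_on setT f.
Proof.
move=> fG x _; split; first by case: (fG.2 x).
by rewrite (C1_grad fG); exact: fG.1.
Qed.

Lemma C1_continuous f G : C1 f G -> continuous f.
Proof. by move=> [_ fG] x; apply: differentiable_continuous; case: (fG x). Qed.

Lemma C1_ext f G G' : C1 f G -> G =1 G' -> C1 f G'.
Proof. by move=> fG /funext <-. Qed.

Lemma C1_cst c : C1 (cst c) (cst 0).
Proof.
split; first exact: cst_continuous.
move=> x; apply: (is_diff_congr (is_diff_cst c x)) => // h.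
by rewrite dot0l.
Qed.

Lemma C1D f g F G : C1 f F -> C1 g G -> C1 (fun x => f x + g x) (fun x => F x + G x).
Proof.
move=> [cF fF] [cG gG]; split=> x; first exact: (cvgD (cF x) (cG x)).
by apply: (is_diff_congr (is_diffD (fF x) (gG x))) => // h; rewrite dotDl.
Qed.

Lemma C1M f g F G : C1 f F -> C1 g G ->
  C1 (fun x => f x * g x) (fun x => f x *: G x + g x *: F x).
Proof.
move=> fF' gG'; have [cF fF] := fF'; have [cG gG] := gG'; split=> x.
  have h1 : {for x, continuous (fun y => f y *: G y)}.
    by apply: rV_continuousZ; [exact: (C1_continuous fF')|exact: cG].
  have h2 : {for x, continuous (fun y => g y *: F y)}.
    by apply: rV_continuousZ; [exact: (C1_continuous gG')|exact: cF].
  exact: (cvgD h1 h2).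
by apply: (is_diff_congr (is_diffM (fF x) (gG x))) => // h; rewrite dotDl !dotZl.
Qed.

Lemma C1_comp (b b' : R -> R) f F : (forall s, is_diff s b ( *:%R (b' s))) ->
  continuous b' -> C1 f F -> C1 (fun x => b (f x)) (fun x => b' (f x) *: F x).
Proof.
move=> bb' cb' fF'; have [cF fF] := fF'; split=> x.
  apply: rV_continuousZ; last exact: cF.
  by apply: continuous_comp; [exact: (C1_continuous fF')|exact: cb'].
by apply: (is_diff_congr (is_diff_comp (fF x) (bb' (f x)))) => // h; rewrite dotZl.
Qed.

Lemma C1Z c f F : C1 f F -> C1 (fun x => c * f x) (fun x => c *: F x).
Proof.
move=> fF; apply: C1_ext (C1M (C1_cst c) fF) _ => x.
by rewrite scaler0 addr0.
Qed.

Lemma C1B f g F G : C1 f F -> C1 g G -> C1 (fun x => f x - g x) (fun x => F x - G x).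
Proof.
move=> fF gG; have := C1D fF (C1Z (-1) gG).
under eq_fun do rewrite mulN1r.
by under [X in C1 _ X]eq_fun do rewrite scaleN1r.
Qed.

Lemma C1X f F m : C1 f F -> C1 (fun x => f x ^+ m) (fun x => (m%:R * f x ^+ m.-1) *: F x).
Proof.
move=> fF; elim: m => [|m IH].
  by apply: C1_ext (C1_cst 1) _ => x; rewrite mul0r scale0r.
under eq_fun do rewrite exprS.
apply: C1_ext (C1M fF IH) _ => x; rewrite scalerA -scalerDl; congr (_ *: _).
case: m {IH} => [|m] /=; first by rewrite !expr0 !mul0r mulr0 add0r mul1r.
by rewrite exprS -(natr1 m.+1) mulrDl mul1r mulrCA.
Qed.

Lemma C1_affine f F c (b : 'rV[R]_n) : C1 f F ->
  C1 (fun x => f (c *: x + b)) (fun x => c *: F (c *: x + b)).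
Proof.
move=> [cF fF].
have ca : continuous (fun x : 'rV[R]_n => c *: x + b).
  by move=> x; exact: (rV_continuousD (rV_continuousZ (@cst_continuous _ _ c x) cvg_id) (@cst_continuous _ _ b x)).
split=> x.
  exact: (rV_continuousZ (@cst_continuous _ _ c x) (continuous_comp (ca x) (cF (c *: x + b)))).
have da : is_diff x (fun y : 'rV[R]_n => c *: y + b) ( *:%R c).
  apply: (is_diff_congr (is_diffD (is_diff_scaler c x) (is_diff_cst b x))) => // h.
  by rewrite /= !fctE addr0.
apply: (is_diff_congr (is_diff_comp da (fF (c *: x + b)))) => // h.
by rewrite /= dotZr dotZl.
Qed.

Lemma C1_sqnorm : C1 (fun x : 'rV[R]_n => dot x x) (fun x => 2 *: x).
Proof.
split=> x; first exact: (rV_continuousZ (@cst_continuous _ _ (2 : R) x) cvg_id).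
apply: (@is_diff_quadratic _ _ _ (dot (2 *: x)) n%:R); first exact: dot_linear_continuous.
move=> h _; rewrite /= dotDl !dotDr dotZl (dotC h x).
rewrite [X in `|X|](_ : _ = dot h h); last by ring.
by rewrite ger0_norm ?dot_ge0// dot_le_sqr_norm.
Qed.

Lemma C1_sqpos f F : C1 f F ->
  C1 (fun x => sqpos (f x)) (fun x => (2 * Num.max (f x) 0) *: F x).
Proof.
have cm : continuous (fun s : R => 2 * Num.max s 0).
  move=> s; have cs : {for s, continuous (fun t : R => Num.max t 0)}.
    exact: (continuous_max (@cvg_id _ (nbhs s)) (@cst_continuous _ _ (0 : R) s)).
  exact: (cvgM (@cst_continuous _ _ (2 : R) s) cs).
move=> fF; exact: (C1_comp is_diff_sqpos cm fF).
Qed.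

End differentials.

(** * Real-valued integrals and convolution *)

Section real_integral.
Context d (T : measurableType d) (R : realType) (mu : {measure set T -> \bar R}).
Implicit Types (f g h : T -> R) (c : R).

(** Integrals are real-valued and over the whole space; restriction to a set is expressed by
    multiplication with its indicator. *)
Definition intg f := mu.-integrable setT (EFin \o f).

Lemma intg_measurable f : intg f -> measurable_fun setT f.
Proof. by move=> /integrableP[/measurable_EFinP]. Qed.

Lemma intg_le f g : measurable_fun setT f -> (forall x, `|f x| <= g x) -> intg g -> intg f.
Proof.
move=> mf fg; apply: le_integrable => //; first exact/measurable_EFinP.
by move=> x _; rewrite /= lee_fin (le_trans (fg x))// ler_norm.
Qed.

Lemma eq_intg f g : f =1 g -> intg f -> intg g.
Proof. by move=> /funext <-. Qed.

Lemma intgD f g : intg f -> intg g -> intg (fun x => f x + g x).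
Proof. by move=> If Ig; exact: (integrableD measurableT If Ig). Qed.

Lemma intgZ c f : intg f -> intg (fun x => c * f x).
Proof. by move=> If; exact: (integrableZl measurableT c If). Qed.

Lemma intgN f : intg f -> intg (fun x => - f x).
Proof. by move=> /(intgZ (-1)); apply: eq_intg => x; rewrite mulN1r. Qed.

Lemma intgB f g : intg f -> intg g -> intg (fun x => f x - g x).
Proof. by move=> If Ig; exact: (intgD If (intgN Ig)). Qed.

Lemma intg_norm f : intg f -> intg (fun x => `|f x|).
Proof.
move=> If; apply: intg_le (_ : intg (fun x => `|f x|)) => [|x|].
- exact: (measurableT_comp (@normr_measurable R setT) (intg_measurable If)).
- by rewrite normr_id.
- exact: (integrable_abse If).
Qed.

Lemma intg_le_norm f g : measurable_fun setT f -> (forall x, `|f x| <= `|g x|) ->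
  intg g -> intg f.
Proof. by move=> mf fg Ig; apply: (intg_le mf fg); exact: intg_norm. Qed.

Lemma intg0 : intg (cst 0).
Proof. exact: integrable0. Qed.

Lemma intg_sum (I : Type) (s : seq I) (f_ : I -> T -> R) :
  (forall i, intg (f_ i)) -> intg (fun x => \sum_(i <- s) f_ i x).
Proof.
move=> If; elim: s => [|i s IH].
  by apply: eq_intg intg0 => x; rewrite big_nil.
by apply: eq_intg (intgD (If i) IH) => x; rewrite big_cons.
Qed.

Lemma RintD f g : intg f -> intg g ->
  \int[mu]_x (f x + g x) = \int[mu]_x f x + \int[mu]_x g x.
Proof. by move=> If Ig; exact: RintegralD. Qed.

Lemma RintZ c f : intg f -> \int[mu]_x (c * f x) = c * \int[mu]_x f x.
Proof. by move=> If; exact: RintegralZl. Qed.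

Lemma RintB f g : intg f -> intg g ->
  \int[mu]_x (f x - g x) = \int[mu]_x f x - \int[mu]_x g x.
Proof. by move=> If Ig; exact: RintegralB. Qed.

Lemma RintN f : intg f -> \int[mu]_x (- f x) = - \int[mu]_x f x.
Proof.
move=> If; rewrite -mulN1r -RintZ//; apply: eq_Rintegral => x _.
by rewrite mulN1r.
Qed.

Lemma Rint0 : \int[mu]_x (0 : R) = 0.
Proof. by rewrite /Rintegral integral0. Qed.

Lemma Rint_sum (I : Type) (s : seq I) (f_ : I -> T -> R) :
  (forall i, intg (f_ i)) ->
  \int[mu]_x (\sum_(i <- s) f_ i x) = \sum_(i <- s) \int[mu]_x f_ i x.
Proof.
move=> If; elim: s => [|i s IH].
  transitivity (\int[mu]_x (0 : R)); last by rewrite Rint0 big_nil.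
  by apply: eq_Rintegral => x _; rewrite big_nil.
rewrite big_cons -IH -RintD//; last exact: intg_sum.
by apply: eq_Rintegral => x _; rewrite big_cons.
Qed.

Lemma le_Rint f g : intg f -> intg g -> (forall x, f x <= g x) ->
  \int[mu]_x f x <= \int[mu]_x g x.
Proof. by move=> If Ig fg; exact: le_Rintegral. Qed.

Lemma Rint_ge0 f : (forall x, 0 <= f x) -> 0 <= \int[mu]_x f x.
Proof. by move=> f0; exact: Rintegral_ge0. Qed.

Lemma le_norm_Rint f g : intg f -> intg g -> (forall x, `|f x| <= g x) ->
  `|\int[mu]_x f x| <= \int[mu]_x g x.
Proof.
move=> If Ig fg; apply: le_trans (le_normr_Rintegral measurableT If) _.
by apply: le_Rint => //; exact: intg_norm.
Qed.

Lemma EFin_Rint f : intg f -> (\int[mu]_x f x)%:E = (\int[mu]_x (f x)%:E)%E.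
Proof. by move=> If; rewrite /Rintegral fineK//; exact: integrable_fin_num. Qed.

Lemma ge0_intg f (c : R) : measurable_fun setT f -> (forall x, 0 <= f x) ->
  (\int[mu]_x (f x)%:E <= c%:E)%E -> intg f /\ \int[mu]_x f x <= c.
Proof.
move=> mf f0 fc; have If : intg f.
  apply/integrableP; split; first exact/measurable_EFinP.
  rewrite (eq_integral (EFin \o f)); first by rewrite (le_lt_trans fc)// ltry.
  by move=> x _; rewrite /= ger0_norm.
by split => //; rewrite -lee_fin EFin_Rint.
Qed.

(** Jensen's inequality for the probability density [k]: the tangent inequality at the mean of
    [|f|], integrated against [k]. The right side is an extended real because it may be infinite. *)
Lemma jensen_powR (p : R) (f k : T -> R) : 1 <= p ->
  (forall x, 0 <= k x) -> intg k -> \int[mu]_x k x = 1 -> measurable_fun setT f ->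
  intg (fun x => f x * k x) ->
  ((`|\int[mu]_x (f x * k x)| `^ p)%:E <= \int[mu]_x (`|f x| `^ p * k x)%:E)%E.
Proof.
move=> p1 k0 Ik k1 mf Ifk.
have mh : measurable_fun setT (fun x => `|f x| `^ p * k x).
  apply: measurable_funM; last exact: intg_measurable.
  exact: (measurableT_comp (measurable_powR p) (measurableT_comp (@normr_measurable R setT) mf)).
have h0 x : 0 <= `|f x| `^ p * k x by rewrite mulr_ge0 ?powR_ge0.
have [->|fin] := eqVneq (\int[mu]_x (`|f x| `^ p * k x)%:E)%E +oo%E; first exact: leey.
have Ih : intg (fun x => `|f x| `^ p * k x).
  apply/integrableP; split; first exact/measurable_EFinP.
  rewrite (eq_integral (fun x => (`|f x| `^ p * k x)%:E)); first by rewrite ltey.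
  by move=> x _; rewrite /= ger0_norm.
rewrite -EFin_Rint// lee_fin.
have Iafk : intg (fun x => `|f x| * k x).
  by apply: eq_intg (intg_norm Ifk) => x; rewrite normrM (ger0_norm (k0 x)).
pose s := \int[mu]_x (`|f x| * k x).
have s0 : 0 <= s by apply: Rint_ge0 => x; rewrite mulr_ge0.
have sle : `|\int[mu]_x (f x * k x)| <= s.
  by apply: le_norm_Rint => // x; rewrite normrM (ger0_norm (k0 x)).
apply: (@le_trans _ _ (s `^ p)).
  by rewrite ge0_ler_powR ?nnegrE//; lra.
(* The tangent line at the mean [s] integrates to [s ^ p], since its linear part has mean zero. *)
have -> : s `^ p = \int[mu]_x (s `^ p * k x + (p * s `^ (p - 1) * (`|f x| * k x) - p * s `^ (p - 1) * s * k x)).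
  rewrite RintD ?RintB ?RintZ//; [|exact: intgZ|exact: intgZ|exact: intgZ|by apply: intgB; exact: intgZ].
  by rewrite k1 -/s; ring.
apply: le_Rint => //.
  by apply: intgD; [exact: intgZ|apply: intgB; exact: intgZ].
move=> x; have := powR_tangent p1 s0 (normr_ge0 (f x)); have := k0 x.
move: (powR s p) (powR s (p-1)) (`|f x| `^ p) => A B C; nra.
Qed.

End real_integral.

Section kernel.
Variables (R : realType) (n : nat).
Local Notation mu := (lebesgue_rV R n).
Implicit Types (x y z h v : 'rV[R]_n) (e : R).

(** The bump [(1 - |z|^2 / e^2)_+^2], not normalised. It is only [C^1], which suffices for [C^1]
    approximation. *)
Definition mker e z := sqpos (1 - (e ^+ 2)^-1 * dot z z).

Definition mkerG e z : 'rV[R]_n :=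
  (2 * Num.max (1 - (e ^+ 2)^-1 * dot z z) 0) *: (- ((e ^+ 2)^-1 *: (2 *: z))).

Lemma C1_mker e : C1 (mker e) (mkerG e).
Proof.
apply: C1_ext (C1_sqpos (C1B (C1_cst _ 1) (C1Z (e ^+ 2)^-1 (@C1_sqnorm R n)))) _ => z.
by rewrite /mkerG /= sub0r.
Qed.

Lemma mker_ge0 e z : 0 <= mker e z.
Proof. exact: sqpos_ge0. Qed.

Lemma mker_arg_le1 e z : 1 - (e ^+ 2)^-1 * dot z z <= 1.
Proof. by rewrite lerBlDr lerDl mulr_ge0 ?dot_ge0// invr_ge0 sqr_ge0. Qed.

Lemma mker_le1 e z : mker e z <= 1.
Proof. by apply: sqpos_le1; exact: mker_arg_le1. Qed.

Lemma mker_arg_le0 e z : 0 < e -> e <= `|z| -> 1 - (e ^+ 2)^-1 * dot z z <= 0.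
Proof.
move=> e0 ez; rewrite subr_le0 mulrC ler_pdivlMr ?exprn_gt0// mul1r.
by rewrite (le_trans _ (sqr_norm_le_dot z))// lerXn2r ?nnegrE ?(ltW e0).
Qed.

Lemma mker_eq0 e z : 0 < e -> e <= `|z| -> mker e z = 0.
Proof. by move=> e0 ez; apply: sqpos_eq0; exact: mker_arg_le0. Qed.

Lemma mkerG_eq0 e z : 0 < e -> e <= `|z| -> mkerG e z = 0.
Proof. by move=> e0 ez; rewrite /mkerG max_r ?mulr0 ?scale0r// mker_arg_le0. Qed.

(** The constant is uniform in [z]: for [|z| >= e + 1] all three terms vanish because [|h| <= 1],
    and otherwise the increment of the argument of [sqpos] is at most linear in [|h|]. *)
Lemma mker_quadratic e : 0 < e -> exists K, forall z h, `|h| <= 1 ->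
  `|mker e (z + h) - mker e z - dot (mkerG e z) h| <= K * `|h| ^+ 2.
Proof.
move=> e0; pose c := (e ^+ 2)^-1.
have c0 : 0 < c by rewrite invr_gt0 exprn_gt0.
exists ((c * (n%:R * (2 * (e + 1) + 1))) ^+ 2 + 2 * c * n%:R) => z h h1.
have K0 : 0 <= ((c * (n%:R * (2 * (e + 1) + 1))) ^+ 2 + 2 * c * n%:R) * `|h| ^+ 2.
  by rewrite mulr_ge0 ?sqr_ge0// addr_ge0 ?sqr_ge0// mulr_ge0// mulr_ge0// ltW.
have [zb|zb] := leP (e + 1) `|z|.
  rewrite mker_eq0//; last first.
    have : `|z| <= `|z + h| + `|h| by rewrite -[X in `|X| <= _](addrK h) ler_normB.
    by lra.
  rewrite mker_eq0//; last lra.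
  by rewrite mkerG_eq0 ?dot0l ?subr0 ?normr0//; lra.
set s := 1 - c * dot z z; set t := - c * (2 * dot z h + dot h h).
have E1 : mker e (z + h) = sqpos (s + t).
  by rewrite /mker /s /t -/c; congr sqpos; rewrite dotDl !dotDr (dotC h z); ring.
have E2 : dot (mkerG e z) h = 2 * Num.max s 0 * t + 2 * Num.max s 0 * (c * dot h h).
  by rewrite /mkerG -/c -/s dotZl -scaleN1r !dotZl /t; ring.
have m1 : 0 <= Num.max s 0 by rewrite le_max lexx orbT.
have m2 : Num.max s 0 <= 1 by rewrite ge_max ler01 andbT mker_arg_le1.
have hh := dot_ge0 h; have hh2 := dot_le_sqr_norm h.
have tb : `|t| <= c * (n%:R * (2 * (e + 1) + 1)) * `|h|.
  rewrite /t normrM normrN (gtr0_norm c0) -mulrA ler_wpM2l ?(ltW c0)//.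
  rewrite (le_trans (ler_normD _ _))// normrM ger0_norm// (ger0_norm hh).
  have := normr_dot_le z h; set a := `|z| in zb *; set b := `|h| in h1 hh2 *.
  have a0 : 0 <= a := normr_ge0 z. have b0 : 0 <= b := normr_ge0 h.
  have n0 : 0 <= n%:R :> R by [].
  move=> H; apply: (@le_trans _ _ (2 * (n%:R * (a * b)) + n%:R * b ^+ 2)); first lra.
  have : n%:R * (a * b) <= n%:R * ((e + 1) * b) by rewrite ler_wpM2l// ler_wpM2r// ltW.
  have : n%:R * b ^+ 2 <= n%:R * b by rewrite ler_wpM2l// expr2 ler_piMl.
  lra.
rewrite E1 E2 -/s; have /andP[t1 t2] := sqpos_taylor s t.
have t3 : t ^+ 2 <= (c * (n%:R * (2 * (e + 1) + 1))) ^+ 2 * `|h| ^+ 2.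
  rewrite -exprMn.
  by rewrite -(real_normK (num_real t)) lerXn2r ?nnegrE// (le_trans _ tb).
have m3 : Num.max s 0 * (c * dot h h) <= c * n%:R * `|h| ^+ 2.
  apply: (@le_trans _ _ (1 * (c * dot h h))).
    by rewrite ler_wpM2r// mulr_ge0// ltW.
  by rewrite mul1r -mulrA ler_wpM2l// ltW.
have m4 : 0 <= Num.max s 0 * (c * dot h h) by rewrite mulr_ge0// mulr_ge0// ltW.
rewrite ler_norml; move: t1 t2 t3 m3 m4; rewrite /mker -/c -/s.
move: (sqpos (s + t)) (sqpos s) (Num.max s 0) ((c * (n%:R * (2 * (e + 1) + 1))) ^+ 2) => A B M D t1 t2 t3 m3 m4.
by apply/andP; split; lra.
Qed.

(** Same separation of far and near points as for [mker_quadratic]; it provides the continuity of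
    the gradient of a convolution. *)
Lemma mkerG_lipschitz e : 0 < e -> exists K, forall z h, `|h| <= 1 ->
  `|mkerG e (z + h) - mkerG e z| <= K * `|h|.
Proof.
move=> e0; pose c := (e ^+ 2)^-1.
have c0 : 0 < c by rewrite invr_gt0 exprn_gt0.
exists (4 * c * (c * (n%:R * (2 * (e + 1) + 1)) * (e + 2) + 1)) => z h h1.
have n0 : 0 <= n%:R :> R by [].
have K0 : 0 <= 4 * c * (c * (n%:R * (2 * (e + 1) + 1)) * (e + 2) + 1).
  have ? : 0 <= n%:R * (2 * (e + 1) + 1) by rewrite mulr_ge0//; lra.
  by rewrite mulr_ge0 ?addr_ge0 ?mulr_ge0//; lra.
have [zb|zb] := leP (e + 1) `|z|.
  rewrite !mkerG_eq0 ?subr0 ?normr0 ?(mulr_ge0 K0)//; first lra.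
  have : `|z| <= `|z + h| + `|h| by rewrite -[X in `|X| <= _](addrK h) ler_normB.
  by lra.
set s := 1 - c * dot z z; set s' := 1 - c * dot (z + h) (z + h).
have E : mkerG e (z + h) - mkerG e z =
    (- (4 * c * (Num.max s' 0 - Num.max s 0))) *: (z + h) + (- (4 * c * Num.max s 0)) *: h.
  rewrite /mkerG -/c -/s -/s'; move: (Num.max s' 0) (Num.max s 0) => A B.
  by apply/rowP => i; rewrite !mxE; ring.
have m1 : 0 <= Num.max s 0 by rewrite le_max lexx orbT.
have m2 : Num.max s 0 <= 1 by rewrite ge_max ler01 andbT mker_arg_le1.
have tb : `|s' - s| <= c * (n%:R * (2 * (e + 1) + 1)) * `|h|.
  have -> : s' - s = - (c * (2 * dot z h + dot h h)).
    by rewrite /s /s' dotDl !dotDr (dotC h z); ring.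
  have hh := dot_ge0 h; have hh2 := dot_le_sqr_norm h.
  rewrite normrN normrM (gtr0_norm c0) -mulrA ler_wpM2l ?(ltW c0)//.
  rewrite (le_trans (ler_normD _ _))// normrM ger0_norm// (ger0_norm hh).
  have := normr_dot_le z h; set a := `|z| in zb *; set b := `|h| in h1 hh2 *.
  have a0 : 0 <= a := normr_ge0 z. have b0 : 0 <= b := normr_ge0 h.
  move=> H; apply: (@le_trans _ _ (2 * (n%:R * (a * b)) + n%:R * b ^+ 2)); first lra.
  have : n%:R * (a * b) <= n%:R * ((e + 1) * b) by rewrite ler_wpM2l// ler_wpM2r// ltW.
  have : n%:R * b ^+ 2 <= n%:R * b by rewrite ler_wpM2l// expr2 ler_piMl.
  lra.
have tb2 : `|Num.max s' 0 - Num.max s 0| <= c * (n%:R * (2 * (e + 1) + 1)) * `|h|.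
  by rewrite (le_trans _ tb)// maxC (maxC s) max_nonexpansive.
rewrite E (le_trans (ler_normD _ _))// !normrZ !normrN.
have zh : `|z + h| <= e + 2 by rewrite (le_trans (ler_normD _ _))//; lra.
rewrite (normrM (4 * c)) (normrM (4 * c) (Num.max s 0)) (ger0_norm m1).
rewrite ger0_norm; last by rewrite mulr_ge0// ltW.
have A0 : 0 <= `|Num.max s' 0 - Num.max s 0| := normr_ge0 _.
move: tb2 A0; move: `|Num.max s' 0 - Num.max s 0| (c * (n%:R * (2 * (e + 1) + 1))) => A B tb2 A0.
have -> : 4 * c * A * `|z + h| + 4 * c * Num.max s 0 * `|h| = 4 * c * (A * `|z + h| + Num.max s 0 * `|h|) by ring.
have -> : 4 * c * (B * (e + 2) + 1) * `|h| = 4 * c * (B * `|h| * (e + 2) + `|h|) by ring.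
rewrite ler_wpM2l ?mulr_ge0 ?(ltW c0)// lerD//; last by rewrite ler_piMl.
exact: ler_pM.
Qed.

End kernel.

Section convolution.
Variables (R : realType) (n : nat).
Local Notation mu := (lebesgue_rV R n).
Implicit Types (x y z h v : 'rV[R]_n) (e : R) (F k : 'rV[R]_n -> R).

Definition convol k F x := \int[mu]_y (F y * k (x - y)).

Lemma sub_continuous x : continuous (fun y : 'rV[R]_n => x - y).
Proof. by move=> y; exact: (cvgB (@cst_continuous _ _ x y) cvg_id). Qed.

Lemma measurable_reflect k x : continuous k -> measurable_fun setT (fun y => k (x - y)).
Proof.
move=> ck; apply: continuous_measurable_rV => y.
by apply: continuous_comp; [exact: sub_continuous|exact: ck].
Qed.

Lemma intg_bounded_mul F k (M : R) : intg mu F -> measurable_fun setT k ->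
  (forall y, `|k y| <= M) -> intg mu (fun y => F y * k y).
Proof.
move=> IF mk kM; have IG := intgZ M (intg_norm IF).
apply: (intg_le _ _ IG).
  by apply: measurable_funM => //; exact: intg_measurable IF.
by move=> y; rewrite normrM mulrC ler_wpM2r.
Qed.

Lemma intg_mul_reflect F k (M : R) x : intg mu F -> continuous k ->
  (forall y, `|k y| <= M) -> intg mu (fun y => F y * k (x - y)).
Proof.
move=> IF ck kM; apply: (@intg_bounded_mul F (fun y => k (x - y)) M) => //.
exact: measurable_reflect.
Qed.

(** Differentiation under the integral sign, with no limit theorem: the uniform remainder and
    Lipschitz bounds on the kernel are integrated against [|F|]. *)
Lemma conv_C1 k (G : 'rV[R]_n -> 'rV[R]_n) (M K : R) F : intg mu F -> C1 k G ->
  (forall y, `|k y| <= M) -> (forall y, `|G y| <= M) ->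
  (forall z h, `|h| <= 1 -> `|k (z + h) - k z - dot (G z) h| <= K * `|h| ^+ 2) ->
  (forall z h, `|h| <= 1 -> `|G (z + h) - G z| <= K * `|h|) ->
  C1 (convol k F) (fun x => \row_i convol (fun z => G z ord0 i) F x).
Proof.
move=> IF kG kM GM kK GK.
have ck : continuous k := C1_continuous kG.
have cG i : continuous (fun z => G z ord0 i).
  move=> z; exact: (continuous_comp (kG.1 z) (@rV_coord_continuous R n i (G z))).
have GiM i y : `|G y ord0 i| <= M by rewrite (le_trans (ler_coord_norm _ _)).
have Ik x : intg mu (fun y => F y * k (x - y)) by exact: (intg_mul_reflect _ IF ck kM).
have IG i x : intg mu (fun y => F y * G (x - y) ord0 i).
  exact: (@intg_mul_reflect F (fun z => G z ord0 i) M).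
have IFn := intg_norm IF.
pose I := \int[mu]_y `|F y|.
split=> x.
- apply: rV_continuousP => i.
  have -> : (fun s : 'rV[R]_n => (\row_i0 convol (fun z => G z ord0 i0) F s) ord0 i) =
      convol (fun z => G z ord0 i) F by apply/funext => s; rewrite mxE.
  apply: (@lipschitz_continuous_at R _ (convol (fun z => G z ord0 i) F) x (`|K| * I)) => h xt.
  rewrite /convol -RintB//.
  apply: (@le_trans _ _ (\int[mu]_y (`|K| * `|h| * `|F y|))).
    apply: le_norm_Rint; [exact: intgB|exact: intgZ|].
    move=> y; rewrite -mulrBr normrM mulrC ler_wpM2r//.
    have := GK (x - y) h xt; rewrite addrAC => H.
    rewrite (le_trans _ (le_trans H _))//; last by rewrite ler_wpM2r// ler_norm.
    by have := ler_coord_norm (G (x + h - y) - G (x - y)) i; rewrite !mxE.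
  by rewrite RintZ// -/I mulrAC.
- apply: (@is_diff_quadratic R _ _ _ (dot (\row_i convol (fun z => G z ord0 i) F x)) (K * I)).
    exact: dot_linear_continuous.
  move=> h h1 /=.
  have IGh : intg mu (fun y => F y * dot (G (x - y)) h).
    have IS := intg_sum (index_enum 'I_n) (fun i => intgZ (h ord0 i) (IG i x)).
    apply: (eq_intg _ IS) => y.
    by rewrite mulr_sumr; apply: eq_bigr => i _; ring.
  have -> : dot (\row_i convol (fun z => G z ord0 i) F x) h =
      \int[mu]_y (F y * dot (G (x - y)) h).
    rewrite /dot; under eq_bigr do rewrite mxE mulrC -RintZ//.
    rewrite -Rint_sum//; last by move=> i; exact: intgZ.
    apply: eq_Rintegral => y _; rewrite mulr_sumr.
    by apply: eq_bigr => i _; ring.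
  rewrite /convol -RintB// -RintB//; last exact: intgB.
  apply: (@le_trans _ _ (\int[mu]_y (K * `|h| ^+ 2 * `|F y|))).
    apply: le_norm_Rint; [by apply: intgB => //; exact: intgB|exact: intgZ|].
    move=> y; rewrite -!mulrBr normrM mulrC ler_wpM2r//.
    by have := kK (x - y) h h1; rewrite (addrAC x (- y)).
  by rewrite RintZ// -/I mulrAC.
Qed.

Lemma mkerG_bounded e : 0 < e -> exists M, forall z, `|mkerG e z| <= M.
Proof.
move=> e0; exists (2 * (e ^- 2 * (2 * e))) => z.
have [ez|ez] := leP e `|z|.
  by rewrite mkerG_eq0// normr0 !mulr_ge0 ?invr_ge0 ?sqr_ge0 ?(ltW e0).
rewrite /mkerG !normrZ normrN !normrZ.
have m1 : 0 <= Num.max (1 - e ^- 2 * dot z z) 0 by rewrite le_max lexx orbT.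
have m2 : Num.max (1 - e ^- 2 * dot z z) 0 <= 1 by rewrite ge_max ler01 andbT mker_arg_le1.
rewrite (ger0_norm m1) (ger0_norm (ler0n _ 2)) [`|e ^- 2|]ger0_norm ?invr_ge0 ?sqr_ge0//.
have c0 : 0 <= e ^- 2 by rewrite invr_ge0 sqr_ge0.
rewrite -mulrA ler_wpM2l// -[leRHS]mul1r; apply: ler_pM => //.
  by rewrite !mulr_ge0.
by rewrite ler_wpM2l// ler_wpM2l// ltW.
Qed.

Lemma conv_mker_C1 e F : 0 < e -> intg mu F ->
  C1 (convol (mker e) F) (fun x => \row_i convol (fun z => mkerG e z ord0 i) F x).
Proof.
move=> e0 IF; have [M HM] := mkerG_bounded e0.
have [K1 H1] := @mker_quadratic R n e e0; have [K2 H2] := @mkerG_lipschitz R n e e0.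
apply: (@conv_C1 _ _ (Num.max 1 M) (Num.max K1 K2)) => //.
- exact: C1_mker.
- by move=> y; rewrite ger0_norm ?mker_ge0// le_max mker_le1.
- by move=> y; rewrite le_max HM orbT.
- by move=> z h h1; rewrite (le_trans (H1 _ _ h1))// ler_wpM2r ?sqr_ge0// le_max lexx.
- by move=> z h h1; rewrite (le_trans (H2 _ _ h1))// ler_wpM2r// le_max lexx orbT.
Qed.

Lemma C1c_closed_support (f : 'rV[R]_n -> R) G (A U : set 'rV[R]_n) (r : R) :
  C1 f G -> closed A -> A `<=` cube n r -> A `<=` U ->
  (forall x, ~ A x -> f x = 0) -> C1c U f.
Proof.
move=> fG cA Ar AU f0.
have sub : closure [set x | f x != 0] `<=` A.
  rewrite (closure_id A).1//; apply: closure_subset => x /= fx.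
  by apply: contrapT => /f0 H; rewrite H eqxx in fx.
split; first exact: (C1_C1_on fG).
  apply: (subclosed_compact _ (@compact_cube R n r)); first exact: closed_closure.
  by move=> x /sub/Ar.
by move=> x /sub/AU.
Qed.

Lemma closed_cube r : closed (cube (R := R) n r).
Proof. by apply: compact_closed; [exact: norm_hausdorff|exact: compact_cube]. Qed.

(** The reflected kernel is the test function through which weak derivatives are read off; the sign
    of its gradient cancels the one in the integration by parts. *)
Lemma mker_reflect_C1c e x : 0 < e -> C1c setT (fun y => mker e (x - y)) /\
  grad (fun y => mker e (x - y)) = fun y => - mkerG e (x - y).
Proof.
move=> e0; have H : C1 (fun y => mker e (x - y)) (fun y => - mkerG e (x - y)).
  have := C1_affine (-1) x (@C1_mker R n e).
  have E y : -1 *: y + x = x - y by rewrite scaleN1r addrC.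
  under eq_fun do rewrite E.
  by under [X in C1 _ X]eq_fun do rewrite E scaleN1r.
split; last exact: (C1_grad H).
apply: (C1c_closed_support H (@closed_cube (`|x| + e))) => //; first exact: subset_refl.
move=> y yc; apply: mker_eq0 => //; rewrite leNgt; apply/negP => xy; apply: yc.
apply/cubeP; first by rewrite addr_ge0// ltW.
have : `|y| <= `|x| + `|y - x| by rewrite -{1}(subrKC x y) ler_normD.
by rewrite distrC; lra.
Qed.

End convolution.

(** * Mollification *)

Section mollify.
Variables (R : realType) (n : nat).
Local Notation mu := (lebesgue_rV R n).
Implicit Types (x y z h v : 'rV[R]_n) (e r : R) (F g : 'rV[R]_n -> R).

(** Only [x] is confined to the compact set: the neighbour [y] may leave it, as happens when
    averaging near the boundary of a cube. *)
Lemma compact_uniform_continuity (K : set 'rV[R]_n) g (w : R) : compact K -> continuous g -> 0 < w ->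
  exists2 e0 : R, 0 < e0 & forall x y, K x -> `|x - y| < e0 -> `|g x - g y| <= w.
Proof.
move=> /compact_near_coveringP cK cg w0.
pose P (e : R) x := forall y, `|x - y| < e -> `|g x - g y| <= w.
have [x Kx|e0 /= e00 H] := cK R (0^'+) P _; last first.
  have e20 : 0 < e0 / 2 by rewrite divr_gt0.
  exists (e0 / 2) => // x y Kx xy; apply: (H (e0 / 2)) => //=.
  by rewrite sub0r normrN gtr0_norm//; lra.
have w20 : 0 < w / 2 by rewrite divr_gt0.
have /cvgrPdist_lt/(_ _ w20)/nbhs_normP[d /= d0 Hd] := cg x.
have d20 : 0 < d / 2 by rewrite divr_gt0.
exists (ball x (d / 2), [set e | e < d / 2]) => /=.
  split; first exact: nbhsx_ballx.
  by apply: nbhs_right_lt.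
case=> x' e /= [xx' ed] y xy.
move: xx'; rewrite mx_norm_ball /ball_/= => xx'.
have h1 := Hd x'; have h2 := Hd y.
have : `|g x - g x'| < w / 2 by apply: h1 => /=; lra.
have : `|g x - g y| < w / 2.
  by apply: h2 => /=; have := ler_normD (x - x') (x' - y); rewrite addrA subrK; lra.
have := ler_normB (g x - g y) (g x - g x').
have -> : g x - g y - (g x - g x') = g x' - g y by ring.
lra.
Qed.

Lemma integral_reflect (f : 'rV[R]_n -> \bar R) x : measurable_fun [set: 'rV[R]_n] f ->
  (forall y, 0 <= f y)%E -> (\int[mu]_y f (x - y)%R = \int[mu]_y f y)%E.
Proof.
move=> mf f0; have N1 : (-1 : R) != 0 by rewrite oppr_eq0 oner_eq0.
have := ge0_integral_rV_affine x N1 mf f0.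
rewrite normrN1 invr1 expr1n mul1e => <-; apply: eq_integral => y _.
by rewrite scaleN1r addrC.
Qed.

Lemma integral_translate (f : 'rV[R]_n -> \bar R) x : measurable_fun [set: 'rV[R]_n] f ->
  (forall y, 0 <= f y)%E -> (\int[mu]_y f (y - x)%R = \int[mu]_y f y)%E.
Proof.
move=> mf f0; have := ge0_integral_rV_affine (- x) (oner_neq0 R) mf f0.
rewrite normr1 invr1 expr1n mul1e => <-; apply: eq_integral => y _.
by rewrite scale1r.
Qed.

Lemma integral_mul_indic (A : set 'rV[R]_n) (f : 'rV[R]_n -> R) :
  (\int[mu]_x (f x * \1_A x)%:E = \int[mu]_(x in A) (f x)%:E)%E.
Proof.
rewrite [RHS]integral_mkcond; apply: eq_integral => x _; rewrite patchE indicE.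
by case: ifP => _; rewrite ?mulr1 ?mulr0.
Qed.

Lemma intg_indic_cube r : intg mu (\1_(cube n r) : _ -> R).
Proof.
have mC := measurable_cube (R := R) (n := n) r.
have fin : mu (cube n r) \is a fin_num by rewrite ge0_fin_numE ?lebesgue_cube_lty.
have [] := @ge0_intg _ _ _ mu (\1_(cube n r) : _ -> R) (fine (mu (cube n r))) _ _ _ => //.
by rewrite fineK// integral_indic// setIT.
Qed.

Lemma cubeN r x : ~ cube n r x -> 0 <= r -> r < `|x|.
Proof. by move=> H r0; rewrite ltNge; apply/negP => /(cubeP _ r0). Qed.

Lemma continuous_mker e : continuous (@mker R n e).
Proof. exact: (C1_continuous (@C1_mker R n e)). Qed.

Lemma intg_mker e : 0 < e -> intg mu (mker e).
Proof.
move=> e0; apply: (intg_le _ _ (intg_indic_cube e)).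
  by apply: continuous_measurable_rV; exact: continuous_mker.
move=> x; rewrite ger0_norm ?mker_ge0// indicE.
have [xc|xc] := pselect (cube n e x); first by rewrite mem_set// mker_le1.
by rewrite memNset// mker_eq0// ltW// cubeN// ltW.
Qed.

Lemma mass_gt0 e : 0 < e -> 0 < \int[mu]_z mker e z.
Proof.
move=> e0; pose s := e / (2 * (n%:R + 1)).
have n0 : 0 <= n%:R :> R by [].
have s0 : 0 < s by rewrite divr_gt0// mulr_gt0//; lra.
have Is := intg_indic_cube s.
apply: (@lt_le_trans _ _ (\int[mu]_z (1 / 4 * (\1_(cube n s) z : R)))).
  rewrite RintZ// mulr_gt0// /Rintegral integral_indic//; last exact: measurable_cube.
  rewrite (_ : fine _ = (2 * s) ^+ n) ?exprn_gt0 ?mulr_gt0//.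
  by rewrite setIT; exact: (congr1 fine (@lebesgue_cube R n s (ltW s0))).
apply: le_Rint; [exact: intgZ|exact: intg_mker|].
move=> x; rewrite indicE; case: (pselect (cube n s x)) => xc; last first.
  by rewrite memNset// mulr0 mker_ge0.
rewrite mem_set// mulr1 /mker /sqpos.
have xs := cube_norm_le (ltW s0) xc.
have h1 : dot x x <= n%:R * s ^+ 2.
  by rewrite (le_trans (dot_le_sqr_norm x))// ler_wpM2l// lerXn2r ?nnegrE// ltW.
have h2 : n%:R * s ^+ 2 <= e ^+ 2 / 4.
  rewrite /s expr_div_n mulrA ler_pdivrMr; last by rewrite exprn_gt0// mulr_gt0//; lra.
  rewrite mulrC exprMn; have := sqr_ge0 e; nra.
have c0 : 0 < e ^- 2 by rewrite invr_gt0 exprn_gt0.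
have h3 : e ^- 2 * dot x x <= 1 / 4.
  apply: (@le_trans _ _ (e ^- 2 * (e ^+ 2 / 4))); first by rewrite ler_wpM2l ?(ltW c0)//; lra.
  by rewrite mulrA mulVf ?mul1r ?expf_eq0 ?gt_eqF.
have : 3 / 4 <= Num.max (1 - e ^- 2 * dot x x) 0 by rewrite le_max; apply/orP; left; lra.
move: (Num.max _ _) => A; nra.
Qed.

Definition nker e z := (\int[mu]_z mker e z)^-1 * mker e z.

Lemma nker_ge0 e z : 0 < e -> 0 <= nker e z.
Proof. by move=> e0; rewrite mulr_ge0 ?mker_ge0// invr_ge0 ltW// mass_gt0. Qed.

Lemma nker_eq0 e z : 0 < e -> e <= `|z| -> nker e z = 0.
Proof. by move=> e0 ez; rewrite /nker mker_eq0// mulr0. Qed.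

Lemma continuous_nker e : continuous (nker e).
Proof. by move=> z; exact: (cvgM (@cst_continuous _ _ _ z) (@continuous_mker e z)). Qed.

Lemma nker_bounded e : 0 < e -> forall z, `|nker e z| <= (\int[mu]_z mker e z)^-1.
Proof.
move=> e0 z; rewrite ger0_norm ?nker_ge0// -[leRHS]mulr1 ler_wpM2l ?mker_le1//.
by rewrite invr_ge0 ltW// mass_gt0.
Qed.

Lemma integral_nker e : 0 < e -> (\int[mu]_z (nker e z)%:E = 1%:E)%E.
Proof.
move=> e0; have If := intgZ (\int[mu]_z mker e z)^-1 (intg_mker e0).
by rewrite -(EFin_Rint If) RintZ ?mulVf ?gt_eqF ?mass_gt0//; exact: intg_mker.
Qed.

Lemma measurable_nker e : measurable_fun setT (fun z => (nker e z)%:E).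
Proof. by apply/measurable_EFinP; apply: continuous_measurable_rV; exact: continuous_nker. Qed.

Lemma intg_nker_reflect e x : 0 < e ->
  intg mu (fun y => nker e (x - y)) /\ \int[mu]_y nker e (x - y) = 1.
Proof.
move=> e0.
have nk0 y : (0 <= (nker e y)%:E)%E by rewrite lee_fin nker_ge0.
have E : (\int[mu]_y (nker e (x - y))%:E = 1%:E)%E.
  by rewrite (integral_reflect x (measurable_nker e) nk0) integral_nker.
have [If _] : intg mu (fun y => nker e (x - y)) /\ \int[mu]_y nker e (x - y) <= 1.
  apply: ge0_intg; rewrite ?E//.
    by apply: measurable_reflect; exact: continuous_nker.
  by move=> y; rewrite nker_ge0.
by split => //; apply: EFin_inj; rewrite EFin_Rint.
Qed.

Lemma measurable_rV_sub : measurable_fun setT (fun z : 'rV[R]_n * 'rV[R]_n => z.1 - z.2).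
Proof.
apply: measurable_fun_rVP => i.
have -> : (fun t : 'rV[R]_n * 'rV[R]_n => (t.1 - t.2) ord0 i) =
    (fun t => t.1 ord0 i - t.2 ord0 i) by apply/funext => t; rewrite !mxE.
exact: (measurable_funB (measurableT_comp (@measurable_coord R n i) measurable_fst)
  (measurableT_comp (@measurable_coord R n i) measurable_snd)).
Qed.

(** Tonelli and the unit mass of the translated kernel: averaging a nonnegative function preserves
    its integral. *)
Lemma integral_conv_nker e (f : 'rV[R]_n -> R) : 0 < e -> measurable_fun setT f ->
  (forall x, 0 <= f x) ->
  (\int[mu]_x \int[mu]_y (f y * nker e (x - y))%:E = \int[mu]_y (f y)%:E)%E.
Proof.
move=> e0 mf f0.
have mh : measurable_fun setT (fun z : 'rV[R]_n * 'rV[R]_n => (f z.2 * nker e (z.1 - z.2))%:E).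
  apply/measurable_EFinP; apply: measurable_funM.
    exact: (measurableT_comp mf measurable_snd).
  apply: (measurableT_comp _ measurable_rV_sub).
  by apply: continuous_measurable_rV; exact: continuous_nker.
have h0 (z : 'rV[R]_n * 'rV[R]_n) : (0 <= (f z.2 * nker e (z.1 - z.2))%:E)%E.
  by rewrite lee_fin mulr_ge0 ?nker_ge0.
rewrite (fubini_tonelli (m1 := mu) (m2 := mu) _ mh h0)/=.
apply: eq_integral => y _.
under eq_integral do rewrite EFinM.
have nk0 z : (0 <= (nker e z)%:E)%E by rewrite lee_fin nker_ge0.
rewrite ge0_integralZl//.
- by rewrite (integral_translate y (measurable_nker e) nk0) integral_nker// mule1.
- apply/measurable_EFinP; apply: continuous_measurable_rV => x.
  apply: (@continuous_comp _ _ _ (fun x => x - y) (nker e)); last exact: continuous_nker.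
  exact: (cvgB cvg_id (@cst_continuous _ _ y x)).
- by rewrite lee_fin.
Qed.

Lemma measurable_conv_ereal e (f : 'rV[R]_n -> R) : 0 < e -> measurable_fun setT f ->
  (forall x, 0 <= f x) ->
  measurable_fun setT (fun x => \int[mu]_y (f y * nker e (x - y))%:E)%E.
Proof.
move=> e0 mf f0.
have mh : measurable_fun setT (fun z : 'rV[R]_n * 'rV[R]_n => (f z.2 * nker e (z.1 - z.2))%:E).
  apply/measurable_EFinP; apply: measurable_funM.
    exact: (measurableT_comp mf measurable_snd).
  apply: (measurableT_comp _ measurable_rV_sub).
  by apply: continuous_measurable_rV; exact: continuous_nker.
have h0 (z : 'rV[R]_n * 'rV[R]_n) : (0 <= (f z.2 * nker e (z.1 - z.2))%:E)%E.
  by rewrite lee_fin mulr_ge0 ?nker_ge0.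
exact: (measurable_fun_fubini_tonelli_F (m2 := mu) _ mh h0).
Qed.

(** Extension by zero outside a cube, which turns a locally integrable function into an integrable
    one so that [convol] and [intg] apply. *)
Definition on_cube r F x := F x * \1_(cube n r) x.

Lemma intg_on_cube p r F : 1 <= p -> measurable_fun setT F ->
  mu.-integrable (cube n r) (fun x => (`|F x| `^ p)%:E) -> intg mu (on_cube r F).
Proof.
move=> p1 mF IF.
have mC := measurable_cube (R := R) (n := n) r.
have mI : measurable_fun setT (\1_(cube n r) : 'rV[R]_n -> R) by exact: measurable_indic.
have mc : measurable_fun setT (on_cube r F) by exact: measurable_funM.
have mp : measurable_fun setT (fun x => `|F x| `^ p).
  exact: (measurableT_comp (measurable_powR p) (measurableT_comp (@normr_measurable R setT) mF)).
have I2 : intg mu (fun x => `|F x| `^ p * \1_(cube n r) x).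
  have [] := @ge0_intg _ _ _ mu (fun x => `|F x| `^ p * \1_(cube n r) x)
    (fine (\int[mu]_(x in cube n r) (`|F x| `^ p)%:E)) _ _ _ => //.
  - exact: measurable_funM.
  - rewrite fineK; last exact: integrable_fin_num.
    by rewrite integral_mul_indic.
apply: (intg_le mc _ (intgD I2 (intg_indic_cube r))) => x.
rewrite /on_cube normrM [`|\1__ _|]ger0_norm// -[X in _ <= _ + X]mul1r -mulrDl ler_wpM2r//.
have [F1|F1] := leP `|F x| 1; first by rewrite (le_trans F1)// lerDr powR_ge0.
have := ler_powR (ltW F1) p1; rewrite powRr1//; lra.
Qed.

Lemma conv_nker_C1 e F : 0 < e -> intg mu F ->
  C1 (convol (nker e) F)
     (fun x => \row_i ((\int[mu]_z mker e z)^-1 * convol (fun z => mkerG e z ord0 i) F x)).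
Proof.
move=> e0 IF; have H := C1Z (\int[mu]_z mker e z)^-1 (conv_mker_C1 e0 IF).
have -> : convol (nker e) F = fun x => (\int[mu]_z mker e z)^-1 * convol (mker e) F x.
  apply/funext => x; rewrite /convol -RintZ.
    by apply: eq_Rintegral => y _; rewrite /nker; ring.
  apply: (@intg_mul_reflect _ _ F (mker e) 1) => //; first exact: continuous_mker.
  by move=> y; rewrite ger0_norm ?mker_ge0 ?mker_le1.
by apply: C1_ext H _ => x; apply/rowP => i; rewrite !mxE.
Qed.

(** The difference [F y - F x] is compared through a continuous [g] close to [F] in [L^p]: Jensen
    moves the [p]-th power inside the average, Tonelli removes the average of [|F - g| ^ p], and
    uniform continuity controls [g y - g x]. The margin 1 in the radius leaves room for kernels of
    size [e < 1]. *)
Lemma mollify_Lp p r (w : R) F : 1 <= p -> 0 < w -> 0 <= r -> measurable_fun setT F ->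
  mu.-integrable (cube n (r + 1)) (fun x => (`|F x| `^ p)%:E) ->
  \forall e \near 0^'+, (\int[mu]_(x in cube n r)
     (`|convol (nker e) (on_cube (r + 1) F) x - F x| `^ p)%:E <= w%:E)%E.
Proof.
move=> p1 w0 r0 mF IF.
pose V := (2 * r) ^+ n.
have V0 : 0 <= V by rewrite exprn_ge0// mulr_ge0.
have p0 : 0 < p by lra.
(* [c] is such that [A c + A^2 c = w / 2]; the other half of [w] is left to the oscillation of
   [g]. *)
pose A := 2 `^ p; pose c := w / ((A + A * A) * 2).
have A0 : 0 < A by exact: powR_gt0.
have c0 : 0 < c by rewrite divr_gt0// !mulr_gt0 ?addr_gt0 ?mulr_gt0.
have [g cg gF] := continuous_dense_Lp p1 c0 mF IF.
(* The oscillation allowed for [g]: over the cube, of volume [V], it contributes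
   [A^2 om^p V <= w / 2]; [V + 1] avoids a division by zero. *)
pose om := (w / (2 * (A * A) * (V + 1))) `^ p^-1.
have om0 : 0 < om by rewrite powR_gt0// divr_gt0// !mulr_gt0//; lra.
have omp : om `^ p = w / (2 * (A * A) * (V + 1)).
  by rewrite /om -powRrM mulVf ?gt_eqF// powRr1// divr_ge0 ?(ltW w0)// !mulr_ge0 ?(ltW A0)//; lra.
have [e1 e10 He] := compact_uniform_continuity (@compact_cube R n r) cg om0.
have I1 := intg_on_cube p1 mF IF.
have mC s := measurable_cube (R := R) (n := n) s.
near=> e.
have e0 : 0 < e by near: e; exact: nbhs_right_gt.
have e1' : e < 1 by near: e; exact: nbhs_right_lt.
have ee1 : e < e1 by near: e; exact: nbhs_right_lt.
pose D y := (`|F y - g y| `^ p) * \1_(cube n (r + 1)) y.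
have mg := continuous_measurable_rV cg.
have mI s : measurable_fun setT (\1_(cube n s) : 'rV[R]_n -> R) by exact: measurable_indic.
have mD : measurable_fun setT D.
  apply: measurable_funM => //.
  exact: (measurableT_comp (measurable_powR p) (measurableT_comp (@normr_measurable R setT) (measurable_funB mF mg))).
have D0 y : 0 <= D y by rewrite mulr_ge0 ?powR_ge0.
have ID : (\int[mu]_y (D y)%:E <= c%:E)%E.
  by rewrite integral_mul_indic.
have sub : cube n r `<=` cube n (r + 1) by apply: sub_cube; lra.
have key x : cube n r x ->
  ((`|convol (nker e) (on_cube (r + 1) F) x - F x| `^ p)%:E <=
   A%:E * (\int[mu]_y (D y * nker e (x - y))%:E) + (A * A * (D x + om `^ p))%:E)%E.
  move=> xQ.
  have [Ik k1] := intg_nker_reflect x e0.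
  have ck : intg mu (fun y => on_cube (r + 1) F y * nker e (x - y)).
    exact: (intg_mul_reflect _ I1 (@continuous_nker e) (nker_bounded e0)).
  have If : intg mu (fun y => (on_cube (r + 1) F y - F x) * nker e (x - y)).
    by apply: eq_intg (intgB ck (intgZ (F x) Ik)) => y; rewrite mulrBl.
  have -> : convol (nker e) (on_cube (r + 1) F) x - F x =
      \int[mu]_y ((on_cube (r + 1) F y - F x) * nker e (x - y)).
    transitivity (\int[mu]_y (on_cube (r + 1) F y * nker e (x - y) - F x * nker e (x - y))).
      by rewrite (RintB ck (intgZ (F x) Ik)) (RintZ (F x) Ik) k1 mulr1.
    by apply: eq_Rintegral => y _; rewrite mulrBl.
  have k0 y : 0 <= nker e (x - y) by exact: nker_ge0.
  apply: le_trans (jensen_powR p1 k0 Ik k1 _ If) _.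
    by apply: measurable_funB => //; exact: intg_measurable I1.
  have mk : measurable_fun setT (fun y => nker e (x - y)).
    exact: (measurable_reflect x (@continuous_nker e)).
  have E1 : ((A * A * (D x + om `^ p))%:E =
      \int[mu]_y (A * A * (D x + om `^ p) * nker e (x - y))%:E)%E.
    by rewrite -(EFin_Rint (intgZ _ Ik)) (RintZ _ Ik) k1 mulr1.
  rewrite E1 -ge0_integralZl//; last 3 first.
  - by apply/measurable_EFinP; exact: measurable_funM.
  - by move=> y _; rewrite lee_fin mulr_ge0.
  - by rewrite lee_fin ltW.
  have dd0 : 0 <= A * A * (D x + om `^ p) by rewrite !mulr_ge0 ?addr_ge0 ?powR_ge0 ?(ltW A0).
  rewrite -ge0_integralD//; last 4 first.
  - by move=> y _; exact: (mulr_ge0 (ltW A0) (mulr_ge0 (D0 y) (k0 y))).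
  - by apply: measurable_funeM; apply/measurable_EFinP; exact: measurable_funM.
  - by move=> y _; exact: (mulr_ge0 dd0 (k0 y)).
  - by apply/measurable_EFinP; exact: measurable_funM.
  apply: ge0_le_integral => //.
  - by move=> y _; rewrite lee_fin mulr_ge0 ?powR_ge0.
  - apply/measurable_EFinP; apply: measurable_funM => //.
    apply: (measurableT_comp (measurable_powR p) (measurableT_comp (@normr_measurable R setT) _)).
    by apply: measurable_funB => //; exact: intg_measurable I1.
  - apply/measurable_EFinP; apply: measurable_funD; last exact: measurable_funM.
    by apply: measurable_funM => //; exact: measurable_funM.
  move=> y _; suff : `|on_cube (r + 1) F y - F x| `^ p * nker e (x - y) <=
    A * (D y * nker e (x - y)) + A * A * (D x + om `^ p) * nker e (x - y) by [].
  have [exy|exy] := leP e `|x - y|; first by rewrite nker_eq0// !mulr0 addr0.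
  rewrite mulrA -mulrDl ler_wpM2r//.
  have yQ : cube n (r + 1) y.
    apply/cubeP; first by lra.
    move/(cubeP x r0) : xQ => xQ.
    have := ler_normB x (x - y); rewrite opprB subrKC; lra.
  rewrite /D /on_cube !indicE !mem_set// ?mulr1; last exact: sub.
  have h1 := He x y xQ (lt_trans exy ee1).
  have h2 : `|F y - F x| <= `|F y - g y| + (`|F x - g x| + om).
    have := ler_normD (F y - g y) (g y - g x - (F x - g x)).
    have -> : F y - g y + (g y - g x - (F x - g x)) = F y - F x by ring.
    have := ler_normB (g y - g x) (F x - g x); rewrite (distrC (g y)); lra.
  have q0 : 0 <= p by exact: ltW.
  apply: (@le_trans _ _ ((`|F y - g y| + (`|F x - g x| + om)) `^ p)).
    by rewrite ge0_ler_powR ?nnegrE ?addr_ge0 ?(ltW om0).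
  have om00 := ltW om0.
  apply: (le_trans (powRD_le q0 (normr_ge0 _) (addr_ge0 (normr_ge0 _) om00))).
  rewrite -/A mulrDr lerD2l -mulrA ler_wpM2l ?(ltW A0)//.
  exact: (powRD_le q0 (normr_ge0 _) om00).
have mQ f : measurable_fun setT f -> measurable_fun (cube n r) (f : 'rV[R]_n -> \bar R).
  by move=> mf; exact: measurable_funS mf.
have mc := measurable_conv_ereal e0 mD D0.
have c0' x : (0 <= \int[mu]_y (D y * nker e (x - y))%:E)%E.
  by apply: integral_ge0 => y _; rewrite lee_fin mulr_ge0 ?nker_ge0.
have dd0 x : 0 <= A * A * (D x + om `^ p) by rewrite !mulr_ge0 ?addr_ge0 ?powR_ge0 ?(ltW A0).
have mdd : measurable_fun setT (fun x => (A * A * (D x + om `^ p))%:E).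
  by apply/measurable_EFinP; apply: measurable_funM => //; exact: measurable_funD.
apply: (@le_trans _ _ (\int[mu]_(x in cube n r) (A%:E * (\int[mu]_y (D y * nker e (x - y))%:E)
   + (A * A * (D x + om `^ p))%:E)))%E.
  apply: ge0_le_integral => //.
  - apply: mQ; apply/measurable_EFinP.
    apply: (measurableT_comp (measurable_powR p) (measurableT_comp (@normr_measurable R setT) _)).
    apply: measurable_funB => //; apply: continuous_measurable_rV.
    exact: (C1_continuous (conv_nker_C1 e0 I1)).
  - by apply: mQ; apply: emeasurable_funD => //; exact: measurable_funeM.
rewrite ge0_integralD//; last 4 first.
- by move=> x _; rewrite mule_ge0// lee_fin ltW.
- by apply: mQ; exact: measurable_funeM.
- by move=> x _; rewrite lee_fin.
- exact: mQ.
rewrite ge0_integralZl//; last 2 first.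
- exact: mQ.
- by rewrite lee_fin ltW.
have b1 : (\int[mu]_(x in cube n r) \int[mu]_y (D y * nker e (x - y))%:E <= c%:E)%E.
  apply: (@le_trans _ _ (\int[mu]_x \int[mu]_y (D y * nker e (x - y))%:E)%E).
    by apply: ge0_subset_integral.
  by rewrite integral_conv_nker.
have b2 : (\int[mu]_(x in cube n r) (A * A * (D x + om `^ p))%:E <=
   (A * A * (c + om `^ p * V))%:E)%E.
  under eq_integral do rewrite EFinM EFinD.
  rewrite ge0_integralZl//; last 3 first.
  - by apply: mQ; apply: emeasurable_funD => //; apply/measurable_EFinP.
  - by move=> z _; rewrite -EFinD lee_fin addr_ge0// powR_ge0.
  - by rewrite lee_fin mulr_ge0 ?(ltW A0).
  have AA0 : (0 <= (A * A)%:E)%E by rewrite lee_fin mulr_ge0 ?(ltW A0).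
  apply: (lee_wpmul2l (y := (c + om `^ p * V)%:E) AA0 _).
  rewrite ge0_integralD//; last 3 first.
  - by move=> z _; rewrite lee_fin.
  - by apply: mQ; apply/measurable_EFinP.
  - by move=> z _; rewrite lee_fin powR_ge0.
  have -> : (\int[mu]_(_ in cube n r) (om `^ p)%:E = (om `^ p * V)%:E)%E.
    by rewrite integral_cst// EFinM; congr (_ * _)%E; exact: lebesgue_cube.
  apply: (leeD (y := (om `^ p * V)%:E) (x := (om `^ p * V)%:E) (b := c%:E)) => //.
  apply: le_trans ID; apply: ge0_subset_integral => //.
    by apply/measurable_EFinP.
  by move=> z _; rewrite lee_fin.
have A0' : (0 <= A%:E)%E by rewrite lee_fin ltW.
apply: (le_trans (leeD (lee_wpmul2l A0' b1) b2)).
suff : A * c + A * A * (c + om `^ p * V) <= w by [].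
have h1 : A * c + A * A * c = w / 2.
  have h : A + A * A != 0 by rewrite gt_eqF// addr_gt0// mulr_gt0.
  by rewrite /c; field.
have h2 : A * A * (om `^ p * V) <= w / 2.
  have h : V + 1 != 0 by rewrite gt_eqF//; lra.
  have h' : A != 0 by rewrite gt_eqF.
  rewrite omp.
  have -> : A * A * (w / (2 * (A * A) * (V + 1)) * V) = w / 2 * (V / (V + 1)).
    by field; rewrite h h'.
  rewrite -[leRHS]mulr1 ler_wpM2l ?divr_ge0 ?(ltW w0)//.
  by rewrite ler_pdivrMr; lra.
lra.
Unshelve. all: by end_near.
Qed.

End mollify.

(** * Approximation of Sobolev functions by C^1 functions *)

Section smooth_approx.
Variables (R : realType) (n : nat).
Local Notation mu := (lebesgue_rV R n).

Lemma rV_coordN (v : 'rV[R]_n) i : (- v) ord0 i = - v ord0 i.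
Proof. by rewrite mxE. Qed.

(** The gradient of the mollification of [u] is the mollification of [Du], by the definition of the
    weak gradient tested with the reflected kernel. A single [e] serves [u] and all coordinates of
    [Du]. *)
Lemma smooth_approx (p r d : R) (u : 'rV[R]_n -> R) (Du : 'rV[R]_n -> 'rV[R]_n) :
  1 <= p -> 0 < d -> 0 <= r -> sobolev_loc p u Du ->
  exists v G, [/\ C1 v G,
    (\int[mu]_(x in cube n r) (`|v x - u x| `^ p)%:E <= d%:E)%E &
    forall i, (\int[mu]_(x in cube n r) (`|G x ord0 i - Du x ord0 i| `^ p)%:E <= d%:E)%E].
Proof.
move=> p1 d0 r0 [[mu_ Iu] IDu wd].
have r10 : 0 <= r + 1 by lra.
have Iu1 := Iu _ (@compact_cube R n (r + 1)).
have ID1 i := (IDu i).2 _ (@compact_cube R n (r + 1)).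
have Icu := intg_on_cube p1 mu_ Iu1.
have IcD i := intg_on_cube p1 (IDu i).1 (ID1 i).
have mC := measurable_cube (R := R) (n := n) r.
near (0 : R)^'+ => e.
have e0 : 0 < e by near: e; exact: nbhs_right_gt.
have e1 : e < 1 by near: e; exact: nbhs_right_lt.
have A1 : (\int[mu]_(x in cube n r)
    (`|convol (nker e) (on_cube (r + 1) u) x - u x| `^ p)%:E <= d%:E)%E.
  by near: e; exact: mollify_Lp.
have A2 i : (\int[mu]_(x in cube n r) (`|convol (nker e)
    (on_cube (r + 1) (fun x => Du x ord0 i)) x - Du x ord0 i| `^ p)%:E <= d%:E)%E.
  move: i; near: e; apply: filter_forall => i.
  exact: (mollify_Lp p1 d0 r0 (IDu i).1 (ID1 i)).
have H := conv_nker_C1 e0 Icu.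
eexists; eexists; split; [exact: H|exact: A1|move=> i].
(* For [x] in the cube [r] and a kernel of size [e < 1], the truncation to the cube [r + 1] is
   invisible. *)
have loc (k f : 'rV[R]_n -> R) x : cube n r x -> (forall z, e <= `|z| -> k z = 0) ->
    convol k (on_cube (r + 1) f) x = \int[mu]_y (f y * k (x - y)).
  move=> xQ k0; apply: eq_Rintegral => y _; rewrite /on_cube.
  have [exy|exy] := leP e `|x - y|; first by rewrite k0// !mulr0.
  rewrite indicE mem_set ?mulr1//; apply/cubeP => //.
  move/(cubeP x r0) : xQ => xQ.
  have := ler_normB x (x - y); rewrite opprB subrKC; lra.
suff -> : (\int[mu]_(x in cube n r) (`|(\row_j ((\int[mu]_z mker e z)^-1 *
    convol (fun z => mkerG e z ord0 j) (on_cube (r + 1) u) x)) ord0 i - Du x ord0 i| `^ p)%:E =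
  \int[mu]_(x in cube n r) (`|convol (nker e)
    (on_cube (r + 1) (fun x => Du x ord0 i)) x - Du x ord0 i| `^ p)%:E)%E by exact: A2.
apply: eq_integral => x; rewrite inE => xQ; congr ((`|_ - _| `^ _)%:E).
rewrite mxE.
rewrite (loc (fun z => mkerG e z ord0 i) u x xQ); last by move=> z ez; rewrite mkerG_eq0// mxE.
rewrite (loc (nker e) _ x xQ); last by move=> z ez; exact: nker_eq0.
(* Here the weak derivative enters: it transfers the gradient from the kernel to [u]. *)
have [phi gphi] := @mker_reflect_C1c R n e x e0.
have := wd i _ phi; rewrite gphi => wdi.
have ID' : intg mu (fun y => Du y ord0 i * mker e (x - y)).
  have := @intg_mul_reflect _ _ _ (mker e) 1 x (IcD i) (@continuous_mker R n e).
  have m1 y : `|mker (R := R) (n := n) e y| <= 1 by rewrite ger0_norm ?mker_ge0 ?mker_le1.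
  move=> /(_ m1); apply: eq_intg => y; rewrite /on_cube.
  have [exy|exy] := leP e `|x - y|; first by rewrite mker_eq0// !mulr0.
  rewrite indicE mem_set ?mulr1//; apply/cubeP => //.
  move/(cubeP x r0) : xQ => xQ.
  have := ler_normB x (x - y); rewrite opprB subrKC; lra.
transitivity ((\int[mu]_z mker e z)^-1 * \int[mu]_y (Du y ord0 i * mker e (x - y))).
  congr (_ * _); apply: oppr_inj; rewrite -wdi.
  have [M HM] := @mkerG_bounded R n e e0.
  have cG j : continuous (fun z => mkerG (R := R) (n := n) e z ord0 j).
    move=> z; exact: (continuous_comp ((@C1_mker R n e).1 z) (@rV_coord_continuous R n j _)).
  have IG : intg mu (fun y => u y * mkerG e (x - y) ord0 i).
    have GiM y : `|mkerG (R := R) (n := n) e y ord0 i| <= M by rewrite (le_trans (ler_coord_norm _ _)).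
    have := @intg_mul_reflect _ _ _ (fun z => mkerG e z ord0 i) M x Icu (cG i) GiM.
    apply: eq_intg => y; rewrite /on_cube.
    have [exy|exy] := leP e `|x - y|; first by rewrite mkerG_eq0// mxE !mulr0.
    rewrite indicE mem_set ?mulr1//; apply/cubeP => //.
    move/(cubeP x r0) : xQ => xQ.
    have := ler_normB x (x - y); rewrite opprB subrKC; lra.
  rewrite -RintN//; apply: eq_Rintegral => y _.
  by rewrite rV_coordN mulrN.
rewrite -RintZ//; apply: eq_Rintegral => y _; rewrite /nker; ring.
Unshelve. all: by end_near.
Qed.

End smooth_approx.

(** * The function B and the Finsler norm *)

Section growth.
Variables (R : realType) (p gam Gam : R) (B : R -> R).

Lemma mvt_pos (f : R -> R) s t : (forall r : R, 0 < r -> derivable f r 1) -> 0 < s -> s < t ->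
  exists2 c : R, s < c < t & f t - f s = derive1 f c * (t - s).
Proof.
move=> df s0 st.
have [||c] := @MVT _ f (derive1 f) s t st.
- move=> x; rewrite in_itv/= => /andP[sx _].
  by rewrite derive1E; apply/derivableP/df; exact: lt_trans sx.
- apply: derivable_within_continuous => x; rewrite in_itv/= => /andP[sx _].
  by apply: df; exact: lt_le_trans sx.
by rewrite in_itv/= => ct E; exists c.
Qed.

Hypothesis gB : growth p gam Gam B.
Hypothesis p2 : 2 <= p.

Let p_gt0 : 0 < p. Proof. exact: (lt_le_trans (ltr0Sn _ 1) p2). Qed.

Lemma powRB2 h : 0 < h -> h `^ p = h `^ (p - 2) * h ^+ 2.
Proof. by move=> h0; rewrite -powR_mulrn ?(ltW h0)// -powRD ?subrK// gt_eqF. Qed.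

Lemma growth_le_constants : gam <= Gam.
Proof.
have := growth_derive gB ltr01; rewrite powR1 !mulr1 => /andP[]; exact: le_trans.
Qed.

Lemma growth_Gam_ge0 : 0 <= Gam.
Proof.
have [_ h _] := growth_gt0 gB ltr01; have := growth_derive gB ltr01.
by rewrite powR1 !mulr1 => /andP[_]; apply: le_trans; exact: ltW.
Qed.

Lemma growth_derive_mono s t : 0 < s -> s <= t -> derive1 B s <= derive1 B t.
Proof.
move=> s0; rewrite le_eqVlt => /predU1P[->//|st].
have [c /andP[sc ct] E] := mvt_pos (growth_derivable2 gB) s0 st.
have c0 : 0 < c by exact: lt_trans sc.
rewrite -subr_ge0 E mulr_ge0//; last by rewrite subr_ge0 ltW.
by have [_ _] := growth_gt0 gB c0; rewrite /derive1n/= => /ltW.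
Qed.

(** The only access to the behaviour at 0, where [B] has just a vanishing one-sided derivative. *)
Lemma growth_small (e : R) : 0 < e -> exists2 d : R, 0 < d & forall t, 0 < t < d -> 0 < B t <= e * t.
Proof.
move=> e0; have := growth_derive0 gB; rewrite (growth0 gB).
move/cvgrPdist_le => /(_ _ e0)/nbhs_normP[d /= d0 H].
exists d => // t /andP[t0 td]; have [B0 _ _] := growth_gt0 gB t0.
rewrite B0/=; have := H t; rewrite /= sub0r normrN gtr0_norm// subr0 => /(_ td t0).
by rewrite sub0r normrN gtr0_norm ?divr_gt0// ler_pdivrMr.
Qed.

Lemma growth_tangent_gt0 s t : 0 < s -> 0 < t -> derive1 B s * (t - s) <= B t - B s.
Proof.
move=> s0 t0; case: (ltgtP s t) => [st|ts|->]; last by rewrite !subrr mulr0.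
- have [c /andP[sc ct] ->] := mvt_pos (growth_derivable gB) s0 st.
  rewrite ler_wpM2r ?subr_ge0 ?(ltW st)//; apply: growth_derive_mono => //; exact: ltW.
- have [c /andP[tc cs] E] := mvt_pos (growth_derivable gB) t0 ts.
  rewrite -(opprB (B s)) E -(opprB s t) mulrN lerN2.
  rewrite ler_wpM2r ?subr_ge0 ?(ltW ts)//; apply: growth_derive_mono; last exact: ltW.
  exact: lt_trans tc.
Qed.

(** For positive [t] this is monotonicity of [B']; the endpoint [t = 0] is reached through a small
    [t'], by [growth_small]. *)
Lemma growth_tangent s t : 0 < s -> 0 <= t -> derive1 B s * (t - s) <= B t - B s.
Proof.
move=> s0; rewrite le_eqVlt => /predU1P[<-|]; last exact: growth_tangent_gt0.
rewrite (growth0 gB); apply/ler_addgt0Pl => e e0.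
have [d d0 Hd] := growth_small ltr01.
pose t' := Num.min (d / 2) e.
have t'0 : 0 < t' by rewrite lt_min e0 divr_gt0.
have t'd : t' < d by rewrite gt_min ltr_pdivrMr//; apply/orP; left; lra.
have t'e : t' <= e by rewrite ge_min lexx orbT.
have /Hd/andP[_ h] : 0 < t' < d by rewrite t'0.
have h1 := growth_tangent_gt0 s0 t'0.
have [_ /ltW B0 _] := growth_gt0 gB s0.
have h2 := mulr_ge0 B0 (ltW t'0).
nra.
Qed.

Lemma growth_ge0 t : 0 <= t -> 0 <= B t.
Proof.
rewrite le_eqVlt => /predU1P[<-|t0]; first by rewrite (growth0 gB).
by have [/ltW] := growth_gt0 gB t0.
Qed.

Lemma growth_mul_derive t : 0 <= t -> gam * t `^ p <= derive1 B t * t <= Gam * t `^ p.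
Proof.
have p2' := p2; have p0 := p_gt0.
rewrite le_eqVlt => /predU1P[<-|t0]; first by rewrite mulr0 powR0 ?gt_eqF// !mulr0 lexx.
have /andP[h1 h2] := growth_derive gB t0.
by rewrite -(mul_powRB1 (ltW t0) p0) !mulrA !ler_wpM2r// ltW.
Qed.

(** The function [p B(s) - Gamma s^p] has nonpositive derivative on the positive reals and tends to
    0 at 0. *)
Lemma growth_le t : 0 <= t -> p * B t <= Gam * t `^ p.
Proof.
have p2' := p2; have p0 := p_gt0.
rewrite le_eqVlt => /predU1P[<-|t0]; first by rewrite (growth0 gB) powR0 ?gt_eqF// !mulr0.
pose f s := p * B s - Gam * s `^ p.
have df (s : R) : 0 < s -> is_derive s (1 : R) f (p * derive1 B s - Gam * (p * s `^ (p - 1))).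
  move=> s0; have d1 := derivableP (growth_derivable gB s0); rewrite -derive1E in d1.
  have d2 := is_derive1_powR p s0.
  exact: (is_deriveB (is_deriveZ p d1) (is_deriveZ Gam d2)).
rewrite -subr_le0; apply/ler_addgt0Pl => e e0; rewrite addr0 -/(f t).
have [d d0 Hd] := growth_small ltr01.
(* [s < d] gives [B s <= s], [s < t] allows the mean value theorem, and [s <= e / p] makes [p B(s)]
   at most [e]. *)
pose s := Num.min (d / 2) (Num.min (t / 2) (e / p)).
have s0 : 0 < s by rewrite !lt_min !divr_gt0.
have sd : s < d by rewrite gt_min ltr_pdivrMr//; apply/orP; left; lra.
have st : s < t by rewrite !gt_min ltr_pdivrMr//; apply/orP; right; apply/orP; left; lra.
have se : s <= e / p by rewrite !ge_min lexx !orbT.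
have /Hd/andP[_ h] : 0 < s < d by rewrite s0.
have [|c /andP[sc ct] E] := @mvt_pos f s t _ s0 st.
  by move=> r r0; have [] := df r r0.
have c0 : 0 < c by exact: lt_trans sc.
have dc := df c c0.
have dfc : derive1 f c <= 0.
  rewrite derive1E (derive_val (is_derive := dc)).
  have /andP[_ h2] := growth_derive gB c0.
  by rewrite subr_le0 mulrCA ler_wpM2l// ltW.
have h3 : f t <= f s.
  by rewrite -subr_le0 E mulr_le0_ge0// subr_ge0 ltW.
apply: (le_trans h3); rewrite /f.
have G0 := growth_Gam_ge0.
have := mulr_ge0 G0 (powR_ge0 s p).
have : p * B s <= p * s by rewrite ler_wpM2l ?(ltW p0)//; lra.
have : p * s <= e by rewrite mulrC -ler_pdivlMr.
lra.
Qed.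

(** The tangent at [(1 - t) h] gives the expansion with [B'((1 - t) h)]. Replacing it by [B'(h)]
    costs [B''(c) (t h)^2] with [c < h], and [c ^ (p - 2) <= h ^ (p - 2)] because [p >= 2]. *)
Lemma growth_dilation t h : 0 <= t <= 1 / 2 -> 0 <= h ->
  B ((1 - t) * h) <= B h - t * (derive1 B h * h) + Gam * (p - 1) * t ^+ 2 * h `^ p.
Proof.
have p2' := p2; have p0 := p_gt0.
have G0 := growth_Gam_ge0.
move=> /andP[t0 t1]; rewrite le_eqVlt => /predU1P[<-|h0].
  rewrite !mulr0 (growth0 gB) powR0 ?gt_eqF// !mulr0; lra.
move: t0; rewrite le_eqVlt => /predU1P[<-|t0].
  by rewrite subr0 mul1r mul0r expr0n/= !mulr0 mul0r; lra.
have s0 : 0 < (1 - t) * h by rewrite mulr_gt0//; lra.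
have sh : (1 - t) * h < h by nra.
have := growth_tangent s0 (ltW h0).
have [c /andP[sc ch]] := mvt_pos (growth_derivable2 gB) s0 sh.
have c0 : 0 < c by exact: lt_trans sc.
have -> : h - (1 - t) * h = t * h by ring.
move=> E T; have /andP[_ h2] := growth_derive2 gB c0.
have h3 : c `^ (p - 2) <= h `^ (p - 2).
  by rewrite ge0_ler_powR ?nnegrE ?(ltW c0) ?(ltW h0) ?(ltW ch)//; lra.
have h4 : derive1n 2 B c <= Gam * (p - 1) * h `^ (p - 2).
  by rewrite (le_trans h2)// ler_wpM2l// mulr_ge0//; lra.
have h5 := powRB2 h0.
have h6 : derive1n 2 B c * (t * h) ^+ 2 <= Gam * (p - 1) * h `^ (p - 2) * (t * h) ^+ 2.
  by rewrite ler_wpM2r ?sqr_ge0.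
rewrite h5; move: E h6 T; rewrite /derive1n/= exprMn.
move: (h `^ (p - 2)) (B h) (B _) (derive1 B h) (derive1 B ((1 - t) * h)) (derive1 (derive1 B) c) => a b b' d d' dd E h6 T.
have E' : d = d' + dd * (t * h) by lra.
rewrite E'; lra.
Qed.

Lemma growth_second_le h : 0 < h -> derive1n 2 B h * h ^+ 2 <= Gam * (p - 1) * h `^ p.
Proof.
move=> h0; have /andP[_ h2] := growth_derive2 gB h0.
by rewrite powRB2// mulrA ler_wpM2r// sqr_ge0.
Qed.

End growth.

Section finsler.
Variables (R : realType) (n : nat) (H : 'rV[R]_n -> R).
Implicit Types (x y z v xi : 'rV[R]_n).

Lemma is_diff_grad (f : 'rV[R]_n -> R) x : differentiable f x -> is_diff x f (dot (grad f x)).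
Proof.
move=> df; apply: (is_diff_congr (differentiableP df)) => // v.
rewrite {1}(row_sum_delta v) raddf_sum; apply: eq_bigr => i _.
have E (c : R) (w : 'rV[R]_n) : 'd f x (c *: w) = c * 'd f x w by exact: linearZ.
by apply: (etrans (E _ _)); rewrite [RHS]mulrC; congr (_ * _); rewrite mxE deriveE.
Qed.

Lemma derive_dot_grad (f : 'rV[R]_n -> R) x v : differentiable f x ->
  'D_v f x = dot (grad f x) v.
Proof. by move=> df; rewrite deriveE// (@diff_val _ _ _ _ _ _ _ (is_diff_grad df)). Qed.

Lemma compact_pointwise_bounded (K : set 'rV[R]_n) m l (g : 'rV[R]_n -> 'M[R]_(m, l)) :
  compact K -> (forall x, K x -> {for x, continuous g}) ->
  exists2 C : R, 0 < C & forall x, K x -> `|g x| <= C.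
Proof.
move=> cK cg.
have h : {within K, continuous (fun x => `|g x|)}.
  apply: continuous_in_subspaceT => x /set_mem Kx.
  exact: (continuous_comp (cg x Kx) (@norm_continuous _ _ _)).
have [M [_ HM]] := compact_bounded (continuous_compact h cK).
exists (`|M| + 1); first by rewrite ltr_wpDl.
move=> x Kx; have := HM (`|M| + 1); rewrite (le_lt_trans (ler_norm _)) ?ltrDl// => /(_ isT).
by move=> /(_ `|g x|); rewrite /= normr_id; apply; exists x.
Qed.

Hypothesis fH : finsler_norm H.

Lemma finsler0 : H 0 = 0.
Proof. by have := finslerZ fH 0 0; rewrite scaler0 normr0 mul0r. Qed.

Lemma finsler_gt0 xi : xi != 0 -> 0 < H xi.
Proof.
move=> x0; rewrite lt_neqAle (finsler_ge0 fH) andbT eq_sym.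
by apply: contra_neq x0; exact: finsler_eq0 fH _.
Qed.

Lemma finsler_ubound : exists2 C : R, 0 < C & forall xi, H xi <= C * `|xi|.
Proof.
pose C := \sum_(i < n) H (delta_mx ord0 i).
have C0 : 0 <= C by apply: sumr_ge0 => i _; exact: finsler_ge0 fH _.
exists (C + 1); first by rewrite ltr_wpDl.
move=> xi; apply: (@le_trans _ _ (C * `|xi|)); last by rewrite ler_wpM2r// lerDl.
have HS (I : Type) (r : seq I) (F : I -> 'rV[R]_n) : H (\sum_(i <- r) F i) <= \sum_(i <- r) H (F i).
  elim/big_rec2 : _ => [|i y1 y2 _ IH]; first by rewrite finsler0.
  by rewrite (le_trans (finslerD fH _ _))// lerD2l.
rewrite {1}(row_sum_delta xi) (le_trans (HS _ _ _))// /C mulr_suml ler_sum// => i _.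
by rewrite (finslerZ fH) mulrC ler_wpM2l ?ler_coord_norm// (finsler_ge0 fH).
Qed.

Lemma finsler_dist x y : `|H x - H y| <= H (x - y).
Proof.
have h a b : H a - H b <= H (a - b).
  by rewrite lerBlDr (le_trans _ (finslerD fH _ _))// subrK.
rewrite ler_norml h andbT lerNl opprB.
rewrite (_ : H (x - y) = H (y - x)) ?h//.
by rewrite -(opprB y) -scaleN1r (finslerZ fH) normrN1 mul1r.
Qed.

Lemma finsler_continuous : continuous H.
Proof.
move=> x; have [C _ HC] := finsler_ubound.
apply: (@lipschitz_continuous_at R _ H x C) => h _.
by rewrite (le_trans (finsler_dist _ _))// addrAC subrr add0r.
Qed.

Lemma sphere_compact : compact [set x : 'rV[R]_n | `|x| = 1].
Proof.
have sub : [set x : 'rV[R]_n | `|x| = 1] `<=` cube n 1.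
  by move=> x /= x1; apply/cubeP => //; rewrite x1.
apply: (subclosed_compact _ (@compact_cube R n 1) sub).
have -> : [set x : 'rV[R]_n | `|x| = 1] = (fun x => `|x|) @^-1` [set 1] by [].
apply: closed_comp => [x _|]; first exact: norm_continuous.
exact: closed_eq.
Qed.

Lemma normalize_norm xi : xi != 0 -> `| `|xi|^-1 *: xi| = 1.
Proof. by move=> x0; rewrite normrZ normfV normr_id mulVf// normr_eq0. Qed.

Lemma finsler_lbound : exists2 c : R, 0 < c & forall xi, c * `|xi| <= H xi.
Proof.
(* The unit sphere is empty in dimension 0, where any constant works. *)
have [S0|S0] := pselect (exists x : 'rV[R]_n, `|x| = 1); last first.
  exists 1 => // xi; have [->|x0] := eqVneq xi 0; first by rewrite normr0 mulr0 finsler0.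
  by exfalso; apply: S0; exists (`|xi|^-1 *: xi); exact: normalize_norm.
have cH : {within [set x : 'rV[R]_n | `|x| = 1], continuous H}.
  by apply: continuous_subspaceT => x; exact: finsler_continuous.
have [c cS cmin] := @compact_EVT_min _ R H _ S0 sphere_compact cH.
have c1 : `|c| = 1 by move: cS; rewrite inE.
have c0 : c != 0 by rewrite -normr_gt0 c1.
exists (H c); first exact: finsler_gt0.
move=> xi; have [->|x0] := eqVneq xi 0; first by rewrite normr0 mulr0 finsler0.
have := cmin (`|xi|^-1 *: xi); rewrite inE/= normalize_norm// => /(_ erefl).
by rewrite (finslerZ fH) normfV normr_id mulrC ler_pdivlMr ?normr_gt0.
Qed.

Lemma finsler_diff xi : xi != 0 -> is_diff xi H (dot (grad H xi)).
Proof. by move=> x0; apply: is_diff_grad; have [] := (finsler_C2 fH).1 xi x0. Qed.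

Lemma dot_grad_le (f : 'rV[R]_n -> R) x v (c : R) : differentiable f x ->
  (forall h : R, 0 < h < 1 -> f (h *: v + x) - f x <= h * c) -> dot (grad f x) v <= c.
Proof.
move=> df hc; rewrite -derive_dot_grad//.
have := cvg_dnbhs_at_right (@diff_derivable _ _ _ f x v df).
move/cvgr_to_le; apply.
near=> h; have h0 : 0 < h by near: h; exact: nbhs_right_gt.
have h1 : h < 1 by near: h; exact: nbhs_right_lt.
rewrite /= -[_ *: _]/(_ * _) mulrC ler_pdivrMr// mulrC.
by apply: hc; rewrite h0.
Unshelve. all: by end_near.
Qed.

(** By subadditivity every forward difference quotient of [H] in the direction [v] is at most
    [H v]. *)
Lemma finsler_dot_grad_le xi v : xi != 0 -> dot (grad H xi) v <= H v.
Proof.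
move=> x0; apply: dot_grad_le => [|h /andP[h0 _]]; first by have [] := (finsler_C2 fH).1 xi x0.
by rewrite lerBlDr (le_trans (finslerD fH _ _))// (finslerZ fH) gtr0_norm.
Qed.

(** Euler's identity; the inequality opposite to [finsler_dot_grad_le] comes from differentiating in
    the direction [- xi], along which [H] is linear. *)
Lemma finsler_dot_grad_self xi : xi != 0 -> dot (grad H xi) xi = H xi.
Proof.
move=> x0; apply/le_anti; rewrite finsler_dot_grad_le//= -lerN2 -dotNr.
apply: dot_grad_le => [|h /andP[h0 h1]]; first by have [] := (finsler_C2 fH).1 xi x0.
have -> : h *: - xi + xi = (1 - h) *: xi by rewrite scalerN scalerBl scale1r addrC.
by rewrite (finslerZ fH) gtr0_norm ?subr_gt0//; lra.
Qed.

Lemma scaler_is_diff (t : R) x : is_diff x (fun y : 'rV[R]_n => t *: y) ( *:%R t).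
Proof. by apply: (is_diff_congr (is_diff_scaler t x)). Qed.

Lemma finsler_gradZ (t : R) xi : 0 < t -> grad H (t *: xi) = grad H xi.
Proof.
move=> t0; have [->|x0] := eqVneq xi 0; first by rewrite scaler0.
have tx0 : t *: xi != 0 by rewrite scaler_eq0 negb_or x0 gt_eqF.
have d1 := is_diff_comp (scaler_is_diff t xi) (finsler_diff tx0).
have d2 : is_diff xi (H \o ( *:%R t)) (fun v => t * dot (grad H xi) v).
  have -> : H \o ( *:%R t) = fun y => t * H y.
    by apply/funext => y /=; rewrite (finslerZ fH) gtr0_norm.
  by apply: (is_diff_congr (is_diffZ t (finsler_diff x0))).
apply/rowP => i; have := congr1 (fun f => f (delta_mx ord0 i)) (@diff_val _ _ _ _ _ _ _ d1).
rewrite (@diff_val _ _ _ _ _ _ _ d2) /= dotZr !dot_delta.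
have tn : t != 0 by rewrite gt_eqF.
by move/(mulfI tn) => ->.
Qed.

Lemma mul_hess (f : 'rV[R]_n -> R) x v : v *m hess f x = 'd (grad f) x v.
Proof. exact: mul_rV_lin1. Qed.

(** The gradient is homogeneous of degree 0, so the chain rule makes the Hessian homogeneous of
    degree -1. *)
Lemma finsler_hessZ (t : R) xi v : 0 < t -> xi != 0 ->
  v *m hess H xi = t *: (v *m hess H (t *: xi)).
Proof.
move=> t0 x0.
have tx0 : t *: xi != 0 by rewrite scaler_eq0 negb_or x0 gt_eqF.
have dx := ((finsler_C2 fH).2 xi x0).1; have dtx := ((finsler_C2 fH).2 _ tx0).1.
have d1 := is_diff_comp (scaler_is_diff t xi) (differentiableP dtx).
have E : grad H \o ( *:%R t) = grad H by apply/funext => y /=; exact: finsler_gradZ.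
have d2 : is_diff xi (grad H) ('d (grad H) (t *: xi) \o *:%R t) by rewrite -{1}E.
apply: (etrans (mul_hess H xi v)).
transitivity (('d (grad H) (t *: xi) \o *:%R t) v).
  exact: (congr1 (fun f => f v) (@diff_val _ _ _ _ _ _ _ d2)).
have L : 'd (grad H) (t *: xi) (t *: v) = t *: 'd (grad H) (t *: xi) v by exact: linearZ.
by apply: (etrans L); congr (_ *: _); exact: (esym (mul_hess H (t *: xi) v)).
Qed.

(** The gradient is constant along rays. This removes [D^2 H] from the leading term of the stability
    inequality. *)
Lemma finsler_mul_hess_self xi : xi != 0 -> xi *m hess H xi = 0.
Proof.
move=> x0; have dx := ((finsler_C2 fH).2 xi x0).1.
rewrite /hess -deriveEjacobian// /derive; apply: lim_near_cst; first exact: norm_hausdorff.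
near=> h; have h1 : `|h| < 1 by near: h; apply: dnbhs0_lt.
rewrite /= (_ : h *: xi + xi = (h + 1) *: xi); last by rewrite scalerDl scale1r.
rewrite finsler_gradZ ?subrr ?scaler0//.
by move: h1; rewrite ltr_norml => /andP[h1 _]; lra.
Unshelve. all: by end_near.
Qed.

End finsler.

(** * The flux and the second variation *)

Section flux.
Variables (R : realType) (n : nat) (H : 'rV[R]_n -> R) (p gam Gam : R) (B : R -> R).
Implicit Types (x y z v w xi : 'rV[R]_n).
Hypotheses (fH : finsler_norm H) (p2 : 2 <= p) (gam0 : 0 < gam) (gB : growth p gam Gam B).

Let p_gt0 : 0 < p. Proof. exact: (lt_le_trans (ltr0Sn _ 1) p2). Qed.
Let p2_ge0 : 0 <= p - 2. Proof. by rewrite subr_ge0. Qed.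
Let p1_ge0 : 0 <= p - 1. Proof. by rewrite subr_ge0 (le_trans _ p2)// ler1n. Qed.

Lemma ler_mx_coord_norm (m l : nat) (M : 'M[R]_(m, l)) i j : `|M i j| <= `|M|.
Proof. rewrite [leRHS]mx_normrE; exact: (le_bigmax _ (fun ij => `|M ij.1 ij.2|) (i, j)). Qed.

Lemma normr_mulmx_le v (M : 'M[R]_n) : `|v *m M| <= n%:R * (`|v| * `|M|).
Proof.
apply: rV_norm_le => [|j]; first by rewrite mulr_ge0// mulr_ge0.
rewrite mxE (le_trans (ler_norm_sum _ _ _))//.
apply: (@le_trans _ _ (\sum_(i < n) (`|v| * `|M|))).
  by apply: ler_sum => i _; rewrite normrM ler_pM// ?ler_coord_norm// ler_mx_coord_norm.
by rewrite sumr_const card_ord mulr_natl.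
Qed.

Lemma normr_delta_mx_le1 (i : 'I_n) : `|delta_mx ord0 i : 'rV[R]_n| <= 1.
Proof.
apply: rV_norm_le => // j; rewrite mxE; case: (_ && _) => /=; by rewrite ?normr1 ?normr0.
Qed.

Lemma finsler_grad_bounded : exists2 C : R, 0 < C & forall xi, xi != 0 -> `|grad H xi| <= C.
Proof.
have [C C0 HC] := finsler_ubound fH; exists C => // xi x0.
have h v : dot (grad H xi) v <= C * `|v|.
  by rewrite (le_trans (finsler_dot_grad_le fH v x0)).
apply: rV_norm_le => [|i]; first exact: ltW.
rewrite -(dot_delta (grad H xi) i).
have hC (a : 'rV[R]_n) : `|a| <= 1 -> C * `|a| <= C by move=> a1; rewrite ler_piMr// ltW.
rewrite ler_norml (le_trans (h _))// ?hC ?normr_delta_mx_le1// andbT.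
by rewrite lerNl -dotNr (le_trans (h _))// hC// normrN normr_delta_mx_le1.
Qed.

(** Homogeneity of degree -1 together with compactness of the unit sphere, where the Hessian is
    continuous. *)
Lemma finsler_hess_bounded : exists2 C : R, 0 < C &
  forall xi v, xi != 0 -> `|v *m hess H xi| <= C * (`|v| / `|xi|).
Proof.
have cS : forall x : 'rV[R]_n, `|x| = 1 -> {for x, continuous (hess H)}.
  move=> x x1; have x0 : x != 0 by rewrite -normr_gt0 x1.
  exact: ((finsler_C2 fH).2 x x0).2.
have [C C0 HC] := compact_pointwise_bounded (@sphere_compact R n) cS.
exists (n%:R * C + 1); first by rewrite ltr_wpDl// mulr_ge0// ltW.
move=> xi v x0; have x0' : 0 < `|xi| by rewrite normr_gt0.
have t0 : 0 < `|xi|^-1 by rewrite invr_gt0.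
rewrite (finsler_hessZ fH v t0 x0) normrZ gtr0_norm// mulrA.
rewrite [leRHS]mulrC ler_wpM2l ?(ltW t0)//.
apply: (le_trans (normr_mulmx_le _ _)).
have := HC _ (normalize_norm x0) => h.
have v0 : 0 <= `|v| by [].
have n0 : 0 <= n%:R :> R by [].
have := mulr_ge0 n0 v0; have := ler_wpM2l v0 h.
have h2 : n%:R * (`|v| * `|hess H (`|xi|^-1 *: xi)|) <= n%:R * (`|v| * C).
  by rewrite ler_wpM2l// ler_wpM2l.
lra.
Qed.

Definition off0 (f : 'rV[R]_n -> R) xi := if xi == 0 then 0 else f xi.

Lemma measurable_off0 f : (forall xi, xi != 0 -> {for xi, continuous f}) ->
  measurable_fun setT (off0 f).
Proof.
move=> cf; have o0 : open [set x : 'rV[R]_n | x != 0].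
  have -> : [set x : 'rV[R]_n | x != 0] = ~` [set 0].
    by apply/seteqP; split => x /=; [move/eqP|move/eqP].
  by apply: closed_openC; apply: accessible_closed_set1; apply: hausdorff_accessible; exact: norm_hausdorff.
have -> : [set: 'rV[R]_n] = [set x | x != 0] `|` [set 0].
  by apply/seteqP; split => // x _ /=; have [->|] := eqVneq x 0; [right|left].
have m0 : measurable [set (0 : 'rV[R]_n)].
  by apply: closed_rV_measurable; apply: accessible_closed_set1; apply: hausdorff_accessible; exact: norm_hausdorff.
apply/measurable_funU => //; first exact: open_rV_measurable.
split.
  apply: (eq_measurable_fun f); last exact: open_continuous_measurable_rV.
  by move=> x; rewrite inE /off0/= => /negbTE ->.
apply: (eq_measurable_fun (cst 0 : 'rV[R]_n -> R)); last exact: measurable_cst.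
by move=> x; rewrite inE /off0/= => ->; rewrite eqxx.
Qed.

Lemma derive1_H_continuous xi : xi != 0 -> {for xi, continuous (fun x => derive1 B (H x))}.
Proof.
move=> x0; apply: continuous_comp; first exact: finsler_continuous.
apply: differentiable_continuous; apply/derivable1_diffP.
exact: (growth_derivable2 gB (finsler_gt0 fH x0)).
Qed.

Lemma flux_self xi : dot (flux H B xi) xi = derive1 B (H xi) * H xi.
Proof.
rewrite /flux; case: eqVneq => [->|x0]; first by rewrite dot0l (finsler0 fH) mulr0.
by rewrite dotZl (finsler_dot_grad_self fH x0).
Qed.

Lemma measurable_flux i : measurable_fun setT (fun xi => flux H B xi ord0 i).
Proof.
have -> : (fun xi => flux H B xi ord0 i) = off0 (fun xi => derive1 B (H xi) * grad H xi ord0 i).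
  by apply/funext => xi; rewrite /flux /off0; case: ifP => _; rewrite mxE.
apply: measurable_off0 => xi x0.
have cg : {for xi, continuous (grad H)} by have [] := (finsler_C2 fH).1 xi x0.
exact: (cvgM (derive1_H_continuous x0) (continuous_comp cg (@rV_coord_continuous R n i _))).
Qed.

Lemma measurable_growth_H : measurable_fun setT (fun xi => B (H xi)).
Proof.
have -> : (fun xi => B (H xi)) = off0 (fun xi => B (H xi)).
  apply/funext => xi; rewrite /off0; case: eqVneq => [->|//].
  by rewrite (finsler0 fH) (growth0 gB).
apply: measurable_off0 => xi x0; apply: continuous_comp; first exact: finsler_continuous.
apply: differentiable_continuous; apply/derivable1_diffP.
exact: (growth_derivable gB (finsler_gt0 fH x0)).
Qed.

Lemma finsler_powR_le : exists2 C : R, 0 < C & forall r xi, 0 <= r -> r <= p -> (H xi) `^ r <= C * `|xi| `^ r.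
Proof.
have [C C0 HC] := finsler_ubound fH.
pose D := Num.max 1 C; have D1 : 1 <= D by rewrite le_max lexx.
exists (D `^ p); first by rewrite powR_gt0// (lt_le_trans ltr01 D1).
move=> r xi r0 rp; apply: (@le_trans _ _ ((C * `|xi|) `^ r)).
  by rewrite ge0_ler_powR ?nnegrE ?(finsler_ge0 fH)// mulr_ge0// ltW.
rewrite powRM ?(ltW C0)// ler_wpM2r ?powR_ge0//.
apply: (@le_trans _ _ (D `^ r)); last by rewrite ler_powR.
by rewrite ge0_ler_powR ?nnegrE ?(ltW C0)// ?(le_trans ler01 D1)// le_max lexx orbT.
Qed.

Lemma finsler_powR_ge : exists2 c : R, 0 < c & forall xi, c * `|xi| `^ p <= (H xi) `^ p.
Proof.
have [c c0 Hc] := finsler_lbound fH; exists (c `^ p); first exact: powR_gt0.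
move=> xi; rewrite -powRM ?(ltW c0)// ge0_ler_powR ?nnegrE ?(ltW p_gt0) ?(finsler_ge0 fH)//.
by rewrite mulr_ge0// ltW.
Qed.

Lemma flux_le : exists2 C : R, 0 < C & forall xi, `|flux H B xi| <= C * `|xi| `^ (p - 1).
Proof.
have [C1 C10 H1] := finsler_powR_le; have [C2 C20 H2] := finsler_grad_bounded.
have G0 := growth_Gam_ge0 gB.
exists (Gam * C1 * C2 + 1); first by rewrite ltr_wpDl// !mulr_ge0// ltW.
have P xi : 0 <= `|xi| `^ (p - 1) by exact: powR_ge0.
move=> xi; apply: (@le_trans _ _ (Gam * C1 * C2 * `|xi| `^ (p - 1))); last first.
  by rewrite ler_wpM2r// lerDl.
rewrite /flux; case: eqVneq => [->|x0]; first by rewrite normr0 !mulr_ge0 ?powR_ge0// ltW.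
have h0 := finsler_gt0 fH x0; have [_ d0 _] := growth_gt0 gB h0.
rewrite normrZ (gtr0_norm d0) mulrAC ler_pM// ?(ltW d0) ?H2//.
have /andP[_ h] := growth_derive gB h0; rewrite (le_trans h)// -mulrA ler_wpM2l//.
apply: H1 => //; lra.
Qed.

Lemma flux_coercive : exists2 c : R, 0 < c & forall xi, c * `|xi| `^ p <= dot (flux H B xi) xi.
Proof.
have [c c0 Hc] := finsler_powR_ge; exists (gam * c); first exact: mulr_gt0.
move=> xi; rewrite flux_self -mulrA.
have /andP[h _] := growth_mul_derive gB p2 (finsler_ge0 fH xi).
by rewrite (le_trans _ h)// ler_wpM2l// ltW.
Qed.

(** Combines [p B(h) <= Gamma h^p] with [gamma h^p <= B'(h) h]; the resulting ratio [Gamma / gamma]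
    is the [k] of the vanishing argument. *)
Lemma flux_potential_le xi : p * B (H xi) <= Gam / gam * dot (flux H B xi) xi.
Proof.
rewrite flux_self (le_trans (growth_le gB p2 (finsler_ge0 fH xi)))//.
have /andP[h _] := growth_mul_derive gB p2 (finsler_ge0 fH xi).
by rewrite -mulrA ler_wpM2l ?(growth_Gam_ge0 gB)// -ler_pdivrMl ?invr_gt0// invrK.
Qed.

(** The flux is the gradient of the convex potential [B o H]; the tangent inequality for [B] is
    combined with [grad H (xi) . z <= H(z)], and the origin is handled by [B >= 0]. *)
Lemma flux_convex xi z : dot (flux H B xi) (z - xi) <= B (H z) - B (H xi).
Proof.
rewrite /flux; case: eqVneq => [->|x0].
  by rewrite dot0l (finsler0 fH) (growth0 gB) subr0 (growth_ge0 gB)// (finsler_ge0 fH).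
have h0 := finsler_gt0 fH x0; have [_ /ltW d0 _] := growth_gt0 gB h0.
apply: le_trans (growth_tangent gB h0 (finsler_ge0 fH z)).
rewrite dotZl ler_wpM2l// dotBr (finsler_dot_grad_self fH x0) lerD2r.
exact: finsler_dot_grad_le.
Qed.

Lemma potential_dilation : exists2 C : R, 0 <= C & forall t xi, 0 <= t <= 1 / 2 ->
  B (H ((1 - t) *: xi)) <= B (H xi) - t * dot (flux H B xi) xi + C * t ^+ 2 * `|xi| `^ p.
Proof.
have [C C0 HC] := finsler_powR_le; have G0 := growth_Gam_ge0 gB.
exists (Gam * (p - 1) * C); first by rewrite !mulr_ge0// ltW.
move=> t xi t01; rewrite (finslerZ fH) ger0_norm; last by move: t01 => /andP[]; lra.
rewrite (le_trans (growth_dilation gB p2 t01 (finsler_ge0 fH xi)))//.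
rewrite flux_self lerD2l -[X in _ <= X](_ : Gam * (p - 1) * t ^+ 2 * (C * `|xi| `^ p) = _); last by ring.
apply: ler_wpM2l; first exact: (mulr_ge0 (mulr_ge0 G0 p1_ge0) (sqr_ge0 t)).
by apply: HC => //; exact: ltW.
Qed.

(** The value of the quadratic form of the second variation in the direction [xi] itself, where the
    Hessian part vanishes. *)
Definition second_energy xi := derive1n 2 B (H xi) * H xi ^+ 2.

(** The origin of the lower bound on [q]: the constant [Gamma / gamma * (p - 1)] is what stability
    has to beat. *)
Lemma second_energy_le xi :
  0 <= second_energy xi <= Gam / gam * (p - 1) * dot (flux H B xi) xi.
Proof.
rewrite /second_energy flux_self; have [->|x0] := eqVneq xi 0.
  by rewrite (finsler0 fH) expr0n/= !mulr0 lexx.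
have h0 := finsler_gt0 fH x0; have [_ _ /ltW d0] := growth_gt0 gB h0.
rewrite mulr_ge0 ?sqr_ge0//= (le_trans (growth_second_le gB p2 h0))//.
have /andP[h _] := growth_mul_derive gB p2 (ltW h0).
have G0 := growth_Gam_ge0 gB.
rewrite -!mulrA ler_wpM2l// mulrCA ler_wpM2l// -ler_pdivrMl ?invr_gt0// invrK.
exact: h.
Qed.

Lemma measurable_second_energy : measurable_fun setT second_energy.
Proof.
have -> : second_energy = off0 second_energy.
  apply/funext => xi; rewrite /off0 /second_energy; case: eqVneq => [->|//].
  by rewrite (finsler0 fH) expr0n/= mulr0.
apply: measurable_off0 => xi x0.
have cH := finsler_continuous fH (x := xi).
have cB := continuous_comp cH (growth_continuous2 gB (finsler_gt0 fH x0)).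
exact: (cvgM cB (cvgM cH cH)).
Qed.

Definition variation1 xi z :=
  if xi == 0 then 0 else derive1n 2 B (H xi) * dot (grad H xi) z ^+ 2.

Definition variation2 xi z :=
  if xi == 0 then 0 else derive1 B (H xi) * dot (z *m hess H xi) z.

Lemma measurable_rV_coord_comp (f : 'rV[R]_n -> R) (D : 'rV[R]_n -> 'rV[R]_n) :
  measurable_fun setT f -> (forall i, measurable_fun setT (fun x => D x ord0 i)) ->
  measurable_fun setT (fun x => f (D x)).
Proof. by move=> mf mD; apply: (measurableT_comp mf); exact: measurable_fun_rVP. Qed.

Lemma measurable_variation (D G : 'rV[R]_n -> 'rV[R]_n) :
  (forall i, measurable_fun setT (fun x => D x ord0 i)) ->
  (forall i, measurable_fun setT (fun x => G x ord0 i)) ->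
  measurable_fun setT (fun x => variation1 (D x) (G x)) /\
  measurable_fun setT (fun x => variation2 (D x) (G x)).
Proof.
move=> mD mG; split.
- have -> : (fun x => variation1 (D x) (G x)) = fun x =>
      off0 (fun xi => derive1n 2 B (H xi)) (D x) *
      (\sum_i off0 (fun xi => grad H xi ord0 i) (D x) * G x ord0 i) ^+ 2.
    apply/funext => x; rewrite /variation1 /off0; case: ifP => _; first by rewrite mul0r.
    by [].
  have m1 : measurable_fun setT (fun x => off0 (fun xi => derive1n 2 B (H xi)) (D x)).
    apply: measurable_rV_coord_comp => //; apply: measurable_off0 => xi x0.
    exact: (continuous_comp (finsler_continuous fH (x := xi)) (growth_continuous2 gB (finsler_gt0 fH x0))).
  have m2 : measurable_fun setT (fun x => \sum_i off0 (fun xi => grad H xi ord0 i) (D x) * G x ord0 i).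
    apply: measurable_sum => i; apply: measurable_funM => //.
    apply: measurable_rV_coord_comp => //; apply: measurable_off0 => xi x0.
    have cg : {for xi, continuous (grad H)} by have [] := (finsler_C2 fH).1 xi x0.
    exact: (continuous_comp cg (@rV_coord_continuous R n i _)).
  exact: (measurable_funM m1 (measurable_funX 2 m2)).
- have -> : (fun x => variation2 (D x) (G x)) = fun x =>
      \sum_j (\sum_i G x ord0 i * off0 (fun xi => derive1 B (H xi) * hess H xi i j) (D x)) * G x ord0 j.
    apply/funext => x; rewrite /variation2 /off0; case: ifP => _.
      by rewrite big1// => j _; rewrite big1 ?mul0r// => i _; rewrite mulr0.
    rewrite /dot mulr_sumr; apply: eq_bigr => j _; rewrite mulrA; congr (_ * _).
    by rewrite mxE mulr_sumr; apply: eq_bigr => i _; rewrite mulrCA.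
  apply: measurable_sum => j; apply: measurable_funM => //.
  apply: measurable_sum => i; apply: measurable_funM => //.
  apply: measurable_rV_coord_comp => //; apply: measurable_off0 => xi x0.
  have ch := ((finsler_C2 fH).2 xi x0).2.
  have cc : {for xi, continuous (fun x => hess H x i j)}.
    exact: (continuous_comp ch (@coord_continuous _ _ _ i j _)).
  exact: (cvgM (derive1_H_continuous x0) cc).
Qed.

Lemma second_derivative_le : exists2 C : R, 0 < C &
  forall xi, xi != 0 -> 0 <= derive1n 2 B (H xi) <= C * `|xi| `^ (p - 2).
Proof.
have [C C0 HC] := finsler_powR_le; have G0 := growth_Gam_ge0 gB.
exists (Gam * (p - 1) * C + 1); first by rewrite ltr_wpDl// !mulr_ge0// ltW.
move=> xi x0; have h0 := finsler_gt0 fH x0; have [_ _ /ltW d0] := growth_gt0 gB h0.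
rewrite d0/=; have /andP[_ h] := growth_derive2 gB h0; rewrite (le_trans h)//.
apply: (@le_trans _ _ (Gam * (p - 1) * (C * `|xi| `^ (p - 2)))).
  apply: ler_wpM2l; first exact: mulr_ge0.
  by apply: HC => //; lra.
by rewrite mulrA ler_wpM2r ?powR_ge0// lerDl.
Qed.

Lemma first_derivative_le : exists2 C : R, 0 < C &
  forall xi, xi != 0 -> 0 <= derive1 B (H xi) <= C * (`|xi| `^ (p - 2) * `|xi|).
Proof.
have [C C0 HC] := finsler_powR_le; have G0 := growth_Gam_ge0 gB.
exists (Gam * C + 1); first by rewrite ltr_wpDl// !mulr_ge0// ltW.
move=> xi x0; have h0 := finsler_gt0 fH x0; have [_ /ltW d0 _] := growth_gt0 gB h0.
have x0' : 0 < `|xi| by rewrite normr_gt0.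
have -> : `|xi| `^ (p - 2) * `|xi| = `|xi| `^ (p - 1).
  have -> : p - 2 = p - 1 - 1 by ring.
  by rewrite mul_powRB1// subr_gt0 (lt_le_trans _ p2)// ltr1n.
rewrite d0/=; have /andP[_ h] := growth_derive gB h0; rewrite (le_trans h)//.
apply: (@le_trans _ _ (Gam * (C * `|xi| `^ (p - 1)))).
  by apply: ler_wpM2l => //; apply: HC => //; lra.
by rewrite mulrA ler_wpM2r ?powR_ge0// lerDl.
Qed.

(** In the second term [B'(H)] grows like [|xi| ^ (p - 1)] while the Hessian is of size [1 / |xi|],
    so both terms have the same growth. *)
Lemma second_variation_terms_le : exists2 C : R, 0 < C & forall xi z,
  `|variation1 xi z| <= C * (`|xi| `^ (p - 2) * `|z| ^+ 2) /\
  `|variation2 xi z| <= C * (`|xi| `^ (p - 2) * `|z| ^+ 2).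
Proof.
have [C1 C10 H1] := second_derivative_le; have [C2 C20 H2] := first_derivative_le.
have [C3 C30 H3] := finsler_grad_bounded; have [C4 C40 H4] := finsler_hess_bounded.
have n0 : 0 <= n%:R :> R by [].
pose D1 := C1 * (n%:R * C3) ^+ 2; pose D2 := C2 * (n%:R * C4).
have D10 : 0 <= D1 by rewrite mulr_ge0 ?sqr_ge0// ltW.
have D20 : 0 <= D2 by rewrite !mulr_ge0// ltW.
exists (D1 + D2 + 1); first by rewrite ltr_wpDl// addr_ge0.
move=> xi z; have P0 : 0 <= `|xi| `^ (p - 2) * `|z| ^+ 2 by rewrite mulr_ge0 ?powR_ge0 ?sqr_ge0.
rewrite /variation1 /variation2; case: eqVneq => [_|x0].
  by rewrite normr0; split; apply: mulr_ge0 => //; lra.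
have x0' : 0 < `|xi| by rewrite normr_gt0.
split.
- apply: (@le_trans _ _ (D1 * (`|xi| `^ (p - 2) * `|z| ^+ 2))); last by apply: ler_wpM2r => //; lra.
  have /andP[d0 d1] := H1 xi x0.
  rewrite normrM (ger0_norm d0) normrX.
  have h : `|dot (grad H xi) z| <= n%:R * C3 * `|z|.
    rewrite (le_trans (normr_dot_le _ _))// -mulrA ler_wpM2l// ler_wpM2r//.
    exact: H3.
  have h2 : `|dot (grad H xi) z| ^+ 2 <= (n%:R * C3) ^+ 2 * `|z| ^+ 2.
    by rewrite -exprMn lerXn2r ?nnegrE// !mulr_ge0// ltW.
  apply: (le_trans (ler_pM d0 (sqr_ge0 _) d1 h2)).
  by rewrite le_eqVlt; apply/orP; left; apply/eqP; rewrite /D1; ring.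
- apply: (@le_trans _ _ (D2 * (`|xi| `^ (p - 2) * `|z| ^+ 2))); last by apply: ler_wpM2r => //; lra.
  have /andP[d0 d1] := H2 xi x0.
  rewrite normrM (ger0_norm d0).
  have h : `|dot (z *m hess H xi) z| <= n%:R * (C4 * (`|z| / `|xi|) * `|z|).
    by rewrite (le_trans (normr_dot_le _ _))// ler_wpM2l// ler_wpM2r// H4.
  apply: (le_trans (ler_pM d0 (normr_ge0 _) d1 h)).
  rewrite le_eqVlt; apply/orP; left; apply/eqP; rewrite /D2; field.
  by rewrite gt_eqF.
Qed.

(** Meant for [grad (u eta) = eta Du + w]. The first term is split by Young with weight [e]; in the
    second one the Hessian kills [xi], which leaves only terms containing [w]. The parameter [e] is
    later paid for by the gap between [q] and its threshold. *)
Lemma variation_split (e : R) : 0 < e -> exists2 C : R, 0 <= C & forall xi (s : R) w, 0 <= s ->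
  variation1 xi (s *: xi + w) + variation2 xi (s *: xi + w) <=
  (1 + e) * (second_energy xi * s ^+ 2) +
  C * (`|xi| `^ (p - 2) * (`|xi| * s * `|w|) + `|xi| `^ (p - 2) * `|w| ^+ 2).
Proof.
move=> e0; have [C1 C10 H1] := second_derivative_le; have [C2 C20 H2] := first_derivative_le.
have [C3 C30 H3] := finsler_grad_bounded; have [C4 C40 H4] := finsler_hess_bounded.
have n0 : 0 <= n%:R :> R by [].
pose D1 := (1 + e^-1) * (C1 * (n%:R * C3) ^+ 2); pose D2 := C2 * (n%:R * C4).
have ei0 : 0 < e^-1 by rewrite invr_gt0.
have D10 : 0 <= D1 by rewrite mulr_ge0 ?mulr_ge0 ?sqr_ge0 ?(ltW C10)//; lra.
have D20 : 0 <= D2 by rewrite !mulr_ge0// ltW.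
exists (D1 + D2); first by rewrite addr_ge0.
move=> xi s w s0; rewrite /variation1 /variation2.
have [x0|x0] := eqVneq xi 0.
  rewrite addr0 addr_ge0// mulr_ge0//; first lra.
  - by rewrite mulr_ge0 ?sqr_ge0//; have /andP[] := second_energy_le xi.
  - by rewrite addr_ge0.
  - by rewrite addr_ge0 ?mulr_ge0 ?powR_ge0 ?sqr_ge0.
have x0' : 0 < `|xi| by rewrite normr_gt0.
have P0 : 0 <= `|xi| `^ (p - 2) by exact: powR_ge0.
have /andP[d0 d1] := H1 xi x0; have /andP[f0 f1] := H2 xi x0.
have h : `|dot (grad H xi) w| <= n%:R * C3 * `|w|.
  by rewrite (le_trans (normr_dot_le _ _))// -mulrA ler_wpM2l// ler_wpM2r// H3.
have h2 : dot (grad H xi) w ^+ 2 <= (n%:R * C3) ^+ 2 * `|w| ^+ 2.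
  by rewrite -exprMn -(@real_normK _ (dot _ _)) ?num_real// lerXn2r ?nnegrE// !mulr_ge0// ltW.
rewrite dotDr dotZr (finsler_dot_grad_self fH x0).
have A1 : derive1n 2 B (H xi) * (s * H xi + dot (grad H xi) w) ^+ 2 <=
    (1 + e) * (second_energy xi * s ^+ 2) + D1 * (`|xi| `^ (p - 2) * `|w| ^+ 2).
  have q : (s * H xi + dot (grad H xi) w) ^+ 2 <=
      (1 + e) * (s * H xi) ^+ 2 + (1 + e^-1) * dot (grad H xi) w ^+ 2.
    move: (s * H xi) (dot _ w) => a b; rewrite -subr_ge0.
    have -> : (1 + e) * a ^+ 2 + (1 + e^-1) * b ^+ 2 - (a + b) ^+ 2 = e^-1 * (e * a - b) ^+ 2.
      by field; rewrite gt_eqF.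
    by rewrite mulr_ge0 ?sqr_ge0// ltW.
  apply: (le_trans (ler_wpM2l d0 q)); rewrite mulrDr.
  have -> : derive1n 2 B (H xi) * ((1 + e) * (s * H xi) ^+ 2) = (1 + e) * (second_energy xi * s ^+ 2).
    by rewrite /second_energy; ring.
  rewrite lerD2l mulrCA /D1 -mulrA ler_wpM2l//; first lra.
  apply: (le_trans (ler_pM d0 (sqr_ge0 _) d1 h2)).
  by rewrite le_eqVlt; apply/orP; left; apply/eqP; ring.
have A2 : derive1 B (H xi) * dot ((s *: xi + w) *m hess H xi) (s *: xi + w) <=
    D2 * (`|xi| `^ (p - 2) * (`|xi| * s * `|w|) + `|xi| `^ (p - 2) * `|w| ^+ 2).
  (* One factor of the quadratic form loses its component along [xi]. *)
  rewrite mulmxDl -scalemxAl (finsler_mul_hess_self fH x0) scaler0 add0r.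
  have k : dot (w *m hess H xi) (s *: xi + w) <= n%:R * (C4 * (`|w| / `|xi|) * (s * `|xi| + `|w|)).
    apply: (le_trans (ler_norm _)); apply: (le_trans (normr_dot_le _ _)).
    rewrite ler_wpM2l// ler_pM// ?H4//.
    by rewrite (le_trans (ler_normD _ _))// normrZ ger0_norm.
  apply: (le_trans (ler_wpM2l f0 k)).
  have k0 : 0 <= n%:R * (C4 * (`|w| / `|xi|) * (s * `|xi| + `|w|)).
    by rewrite !mulr_ge0 ?invr_ge0 ?addr_ge0 ?mulr_ge0 ?(ltW C40) ?(ltW x0').
  apply: (le_trans (ler_wpM2r k0 f1)).
  rewrite le_eqVlt; apply/orP; left; apply/eqP; rewrite /D2; field.
  by rewrite gt_eqF.
apply: (le_trans (lerD A1 A2)).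
rewrite -addrA lerD2l mulrDl lerD2r ler_wpM2l// lerDr !mulr_ge0//.
Qed.

End flux.

(** * Local integrability and approximation by C^1 functions *)

Section local_integrability.
Variables (R : realType) (n : nat).
Local Notation mu := (lebesgue_rV R n).
Implicit Types (x y : 'rV[R]_n) (r M : R) (f g : 'rV[R]_n -> R).

Lemma measurable_indic_cube r : measurable_fun setT (\1_(cube n r) : 'rV[R]_n -> R).
Proof. by apply: measurable_indic; exact: measurable_cube. Qed.

Definition loc_intg f := measurable_fun setT f /\ forall r, intg mu (on_cube r f).

Lemma loc_intg_measurable f : loc_intg f -> measurable_fun setT f.
Proof. by case. Qed.

Lemma measurable_on_cube r f : measurable_fun setT f -> measurable_fun setT (on_cube r f).
Proof. by move=> mf; exact: (measurable_funM mf (measurable_indic_cube r)). Qed.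

Lemma loc_intg_le f g : measurable_fun setT f -> (forall x, `|f x| <= g x) -> loc_intg g -> loc_intg f.
Proof.
move=> mf fg [mg Ig]; split => // r.
apply: (intg_le (measurable_on_cube r mf) _ (Ig r)) => x.
by rewrite /on_cube normrM [`|\1__ _|]ger0_norm// ler_wpM2r.
Qed.

Lemma loc_intgD f g : loc_intg f -> loc_intg g -> loc_intg (fun x => f x + g x).
Proof.
move=> [mf If] [mg Ig]; split; first exact: (measurable_funD mf mg).
by move=> r; apply: eq_intg (intgD (If r) (Ig r)) => x; rewrite /on_cube mulrDl.
Qed.

Lemma loc_intgZ (c : R) f : loc_intg f -> loc_intg (fun x => c * f x).
Proof.
move=> [mf If]; split; first exact: (measurable_funM (measurable_cst c) mf).
by move=> r; apply: eq_intg (intgZ c (If r)) => x; rewrite /on_cube mulrA.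
Qed.

Lemma loc_intg_bounded f : measurable_fun setT f ->
  (forall r, 0 <= r -> exists M, forall x, cube n r x -> `|f x| <= M) -> loc_intg f.
Proof.
move=> mf bf; split => // r; have [M HM] := bf `|r| (normr_ge0 r).
apply: (intg_le (measurable_on_cube r mf) _ (intgZ M (intg_indic_cube n r))) => x.
rewrite /on_cube normrM [`|\1__ _|]ger0_norm// indicE.
have [xr|xr] := pselect (cube n r x); last by rewrite memNset// !mulr0.
by rewrite mem_set// !mulr1; apply: HM; apply: sub_cube xr; exact: ler_norm.
Qed.

Lemma loc_intg_cst (c : R) : loc_intg (cst c).
Proof. by apply: loc_intg_bounded => // r _; exists `|c|. Qed.

Lemma intg_loc (h g : 'rV[R]_n -> R) r M : measurable_fun setT h -> loc_intg g ->
  (forall x, ~ cube n r x -> h x = 0) -> (forall x, cube n r x -> `|h x| <= M * g x) -> intg mu h.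
Proof.
move=> mh [mg Ig] h0 hM; apply: (intg_le mh _ (intgZ M (Ig r))) => x.
rewrite /on_cube indicE; have [xr|xr] := pselect (cube n r x).
  by rewrite mem_set// mulr1 hM.
by rewrite memNset// h0// normr0 !mulr0.
Qed.

Lemma measurable_rV_norm (F : 'rV[R]_n -> 'rV[R]_n) :
  (forall i, measurable_fun setT (fun x => F x ord0 i)) -> measurable_fun setT (fun x => `|F x|).
Proof.
move=> mF; apply: (@measurable_rV_coord_comp R n (fun x => `|x|) F) => //.
by apply: continuous_measurable_rV; exact: norm_continuous.
Qed.

Lemma measurable_rV_dot (F G : 'rV[R]_n -> 'rV[R]_n) :
  (forall i, measurable_fun setT (fun x => F x ord0 i)) ->
  (forall i, measurable_fun setT (fun x => G x ord0 i)) ->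
  measurable_fun setT (fun x => dot (F x) (G x)).
Proof. by move=> mF mG; apply: measurable_sum => i; exact: (measurable_funM (mF i) (mG i)). Qed.

Lemma measurable_powR_norm (p : R) f : measurable_fun setT f -> measurable_fun setT (fun x => `|f x| `^ p).
Proof.
by move=> mf; exact: (measurableT_comp (measurable_powR p) (measurableT_comp (@normr_measurable R setT) mf)).
Qed.

Lemma measurable_powR_comp (p : R) f : measurable_fun setT f -> measurable_fun setT (fun x => f x `^ p).
Proof. by move=> mf; exact: (measurableT_comp (measurable_powR p) mf). Qed.

Lemma C1_measurable f G : C1 f G -> measurable_fun setT f /\
  forall i, measurable_fun setT (fun x => G x ord0 i).
Proof.
move=> fG; split; first by apply: continuous_measurable_rV; exact: (C1_continuous fG).
move=> i; apply: continuous_measurable_rV => x.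
exact: (continuous_comp (fG.1 x) (@rV_coord_continuous R n i _)).
Qed.

Lemma C1_cube_bounded f G r : 0 <= r -> C1 f G ->
  exists2 M, 0 < M & forall x, cube n r x -> `|f x| <= M /\ `|G x| <= M.
Proof.
move=> r0 fG; have [M1 H1] := continuous_cube_bounded r (C1_continuous fG).
have [M2 _ H2] := compact_pointwise_bounded (@compact_cube R n r) (fun x _ => fG.1 x).
exists (`|M1| + `|M2| + 1); first by rewrite ltr_wpDl// addr_ge0.
move=> x xr; split.
  by rewrite (le_trans (H1 x xr))// (le_trans (ler_norm _))// -addrA lerDl addr_ge0.
by rewrite (le_trans (H2 x xr))// (le_trans (ler_norm _))// addrAC lerDr addr_ge0.
Qed.

Lemma rV_norm_powR_le (p : R) (v : 'rV[R]_n) : 1 <= p ->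
  `|v| `^ p <= \sum_i `|v ord0 i| `^ p.
Proof.
move=> p1; have p0 : 0 < p by lra.
have S0 : 0 <= \sum_i `|v ord0 i| `^ p by apply: sumr_ge0 => i _; exact: powR_ge0.
have -> : \sum_i `|v ord0 i| `^ p = ((\sum_i `|v ord0 i| `^ p) `^ p^-1) `^ p.
  by rewrite -powRrM mulVf ?gt_eqF// powRr1.
rewrite ge0_ler_powR ?nnegrE ?powR_ge0 ?(ltW p0)//.
apply: rV_norm_le => [|i]; first exact: powR_ge0.
have {1}-> : `|v ord0 i| = (`|v ord0 i| `^ p) `^ p^-1.
  by rewrite -powRrM mulfV ?gt_eqF// powRr1.
rewrite ge0_ler_powR ?nnegrE ?powR_ge0 ?invr_ge0 ?(ltW p0)//.
by rewrite (bigD1 i)//= lerDl; apply: sumr_ge0 => j _; exact: powR_ge0.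
Qed.

End local_integrability.

Section approximable.
Variables (R : realType) (n : nat).
Local Notation mu := (lebesgue_rV R n).
Implicit Types (z v : 'rV[R]_n -> R) (Dz G : 'rV[R]_n -> 'rV[R]_n).

Definition Lp_dist (p : R) v G z Dz (x : 'rV[R]_n) : R := `|v x - z x| `^ p + `|G x - Dz x| `^ p.

(** What the argument keeps of [W^{1,p}_loc]: limits on cubes of [C^1] functions with their
    gradients. Unlike an integration by parts, this form passes directly to dilations. *)
Definition approximable (p : R) z Dz := [/\ loc_intg (fun x => `|z x| `^ p),
  measurable_fun setT z, (forall i, measurable_fun setT (fun x => Dz x ord0 i)),
  loc_intg (fun x => `|Dz x| `^ p) &
  forall r d : R, 0 <= r -> 0 < d -> exists v G, C1 v G /\
     \int[mu]_x on_cube r (Lp_dist p v G z Dz) x <= d].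

Lemma loc_intg_Lp_dist (p : R) v G z Dz : 1 <= p -> loc_intg (fun x => `|z x| `^ p) ->
  measurable_fun setT z -> (forall i, measurable_fun setT (fun x => Dz x ord0 i)) ->
  loc_intg (fun x => `|Dz x| `^ p) -> C1 v G -> loc_intg (Lp_dist p v G z Dz).
Proof.
move=> p1 Iz mz mDz IDz vG; have p0 : 0 <= p by lra.
have [mv mG] := C1_measurable vG.
have mGD : measurable_fun setT (fun x => `|G x - Dz x|).
  apply: measurable_rV_norm => i.
  have -> : (fun x => (G x - Dz x) ord0 i) = fun x => G x ord0 i - Dz x ord0 i.
    by apply/funext => x; rewrite !mxE.
  exact: (measurable_funB (mG i) (mDz i)).
have mL : measurable_fun setT (Lp_dist p v G z Dz).
  exact: (measurable_funD (measurable_powR_norm p (measurable_funB mv mz)) (measurable_powR_comp p mGD)).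
have Iv : loc_intg (fun x => `|v x| `^ p + `|G x| `^ p).
  apply: loc_intg_bounded.
    exact: (measurable_funD (measurable_powR_norm p mv) (measurable_powR_comp p (measurable_rV_norm mG))).
  move=> r r0; have [M M0 HM] := C1_cube_bounded r0 vG.
  exists (M `^ p + M `^ p) => x xr; rewrite ger0_norm ?addr_ge0 ?powR_ge0//.
  by have [h1 h2] := HM x xr; rewrite lerD// ge0_ler_powR ?nnegrE ?(ltW M0).
apply: (loc_intg_le mL _ (loc_intgZ (2 `^ p) (loc_intgD Iv (loc_intgD Iz IDz)))) => x.
rewrite ger0_norm ?addr_ge0 ?powR_ge0//.
have T (a b c : R) : 0 <= a -> 0 <= b -> c <= a + b -> 0 <= c -> c `^ p <= 2 `^ p * (a `^ p + b `^ p).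
  move=> a0 b0 cab c0; apply: (le_trans _ (powRD_le p0 a0 b0)).
  by rewrite ge0_ler_powR ?nnegrE ?addr_ge0.
have h1 := T _ _ _ (normr_ge0 (v x)) (normr_ge0 (z x)) (ler_normB _ _) (normr_ge0 _).
have h2 := T _ _ _ (normr_ge0 (G x)) (normr_ge0 (Dz x)) (ler_normB _ _) (normr_ge0 _).
rewrite /Lp_dist; apply: (le_trans (lerD h1 h2)).
rewrite le_eqVlt; apply/orP; left; apply/eqP; ring.
Qed.

Lemma Lp_loc_intg (p : R) z : Lp_loc p z -> loc_intg (fun x => `|z x| `^ p).
Proof.
move=> [mz Iz]; have mp := measurable_powR_norm p mz; split => // r.
have Ir := Iz _ (@compact_cube R n r).
have [] := @ge0_intg _ _ _ mu (on_cube r (fun x => `|z x| `^ p))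
  (fine (\int[mu]_(x in cube n r) (`|z x| `^ p)%:E)) _ _ _ => //.
- exact: measurable_on_cube.
- by move=> x; rewrite mulr_ge0 ?powR_ge0.
- by rewrite fineK ?integrable_fin_num//; [rewrite integral_mul_indic|exact: measurable_cube].
Qed.

Lemma sobolev_approximable (p : R) z Dz : 1 <= p -> sobolev_loc p z Dz -> approximable p z Dz.
Proof.
move=> p1 S; have [Lz LD _] := S.
have mz := Lz.1; have mD i := (LD i).1.
have Iz := Lp_loc_intg Lz; have ID i := Lp_loc_intg (LD i).
have IDz : loc_intg (fun x => `|Dz x| `^ p).
  have mN := measurable_powR_comp p (measurable_rV_norm mD).
  have IS : loc_intg (fun x => \sum_i `|Dz x ord0 i| `^ p).
    split; first by apply: measurable_sum => i; exact: (ID i).1.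
    move=> r; have := intg_sum (index_enum 'I_n) (fun i => (ID i).2 r).
    by apply: eq_intg => x; rewrite /on_cube mulr_suml.
  apply: (loc_intg_le mN _ IS) => x; rewrite ger0_norm ?powR_ge0//.
  exact: rV_norm_powR_le.
split => // r d r0 d0.
(* The function and its [n] partial derivatives make [n + 1] errors. *)
have d'0 : 0 < d / (n%:R + 1) by rewrite divr_gt0// ltr_wpDl.
have [v [G [vG h1 h2]]] := smooth_approx p1 d'0 r0 S.
exists v, G; split => //.
have [mv mG] := C1_measurable vG.
have mC := measurable_cube (R := R) (n := n) r.
have K (f : 'rV[R]_n -> R) : measurable_fun setT f -> (\int[mu]_(x in cube n r) (`|f x| `^ p)%:E <= (d / (n%:R + 1))%:E)%E ->
    intg mu (on_cube r (fun x => `|f x| `^ p)) /\ \int[mu]_x on_cube r (fun x => `|f x| `^ p) x <= d / (n%:R + 1).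
  move=> mf h; apply: ge0_intg.
  - by apply: measurable_on_cube; exact: measurable_powR_norm.
  - by move=> x; rewrite mulr_ge0 ?powR_ge0.
  - by rewrite integral_mul_indic.
have [I1 J1] := K _ (measurable_funB mv mz) h1.
have K2 i := K _ (measurable_funB (mG i) (mD i)) (h2 i).
have IS := intg_sum (index_enum 'I_n) (fun i => (K2 i).1).
apply: (@le_trans _ _ (\int[mu]_x (on_cube r (fun x => `|v x - z x| `^ p) x +
    \sum_i on_cube r (fun x => `|G x ord0 i - Dz x ord0 i| `^ p) x))).
  apply: le_Rint; [exact: (loc_intg_Lp_dist p1 Iz mz mD IDz vG).2|exact: intgD|].
  move=> x; rewrite /on_cube -mulr_suml -mulrDl ler_wpM2r// lerD2l.
  apply: (le_trans (rV_norm_powR_le _ p1)); apply: ler_sum => i _.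
  by rewrite !mxE.
rewrite RintD// Rint_sum//; last by move=> i; exact: (K2 i).1.
apply: (@le_trans _ _ (d / (n%:R + 1) + \sum_(i < n) d / (n%:R + 1))).
  by apply: lerD => //; apply: ler_sum => i _; exact: (K2 i).2.
by rewrite natr1 sumr_const card_ord -mulrS -[_ *+ _]mulr_natr divfK// pnatr_eq0.
Qed.

(** The errors caused by replacing [z] with [v]: the first is linear, for terms of flux type of size
    [b ^ (p - 1)], the second quadratic, for the second variation of size [b ^ (p - 2)]. *)
Definition approx_error (p : R) (b : 'rV[R]_n -> R) v G z Dz x :=
  b x `^ (p - 1) * (`|v x - z x| + `|G x - Dz x|) +
  b x `^ (p - 2) * (`|v x - z x| + `|G x - Dz x|) ^+ 2.

Lemma approximable_error (p r e : R) (b : 'rV[R]_n -> R) z Dz : 2 <= p -> (forall x, 0 <= b x) ->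
  measurable_fun setT b -> loc_intg (fun x => b x `^ p) -> approximable p z Dz ->
  0 <= r -> 0 < e -> exists v G, [/\ C1 v G, loc_intg (approx_error p b v G z Dz) &
    \int[mu]_x on_cube r (approx_error p b v G z Dz) x <= e].
Proof.
move=> p2 b0 mb Ib SA r0 e0; have [Iz mz mDz IDz A] := SA.
have p1 : 1 <= p by lra.
pose I := \int[mu]_x on_cube r (fun x => b x `^ p) x.
have I0 : 0 <= I by apply: Rint_ge0 => x; rewrite mulr_ge0 ?powR_ge0.
(* Young's inequality puts [2 e1 b^p] on the weight, at most [e / 2] after integration; the
   remainder is a multiple of [Lp_dist], made small by the choice of [v]. *)
pose e1 := e / (4 * (I + 1)).
have e10 : 0 < e1 by rewrite divr_gt0// mulr_gt0//; lra.
have [C1' C10 H1] := powR_young (p := p) ltr01 p1 e10.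
have [C2' C20 H2] := powR_young (p := p) (ltr0Sn R 1) p2 e10.
pose C := (C1' + C2') * 2 `^ p.
have C0 : 0 <= C by rewrite mulr_ge0 ?addr_ge0 ?powR_ge0.
have d0 : 0 < e / (2 * (C + 1)) by rewrite divr_gt0// mulr_gt0//; lra.
have [v [G [vG HvG]]] := A r _ r0 d0.
have IL := loc_intg_Lp_dist p1 Iz mz mDz IDz vG.
have bnd x : approx_error p b v G z Dz x <= 2 * e1 * b x `^ p + C * Lp_dist p v G z Dz x.
  pose D := `|v x - z x| + `|G x - Dz x|.
  have D0 : 0 <= D by rewrite addr_ge0.
  have := H1 _ _ (b0 x) D0; have := H2 _ _ (b0 x) D0.
  rewrite powRr1// (powR_mulrn 2 D0) => h2 h1.
  have h3 : D `^ p <= 2 `^ p * Lp_dist p v G z Dz x by apply: powRD_le => //; lra.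
  have h4 := ler_wpM2l (addr_ge0 C10 C20) h3.
  rewrite /approx_error -/D /C; lra.
have mGD : measurable_fun setT (fun x => `|G x - Dz x|).
  apply: measurable_rV_norm => i.
  have -> : (fun x => (G x - Dz x) ord0 i) = fun x => G x ord0 i - Dz x ord0 i.
    by apply/funext => x; rewrite !mxE.
  exact: (measurable_funB ((C1_measurable vG).2 i) (mDz i)).
have mD : measurable_fun setT (fun x => `|v x - z x| + `|G x - Dz x|).
  apply: measurable_funD => //.
  exact: (measurableT_comp (@normr_measurable R setT) (measurable_funB (C1_measurable vG).1 mz)).
have Ibnd := loc_intgD (loc_intgZ (2 * e1) Ib) (loc_intgZ C IL).
have Ierr : loc_intg (approx_error p b v G z Dz).
  apply: loc_intg_le Ibnd.
    apply: measurable_funD; apply: measurable_funM => //.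
    - exact: measurable_powR_comp.
    - exact: measurable_powR_comp.
    - exact: measurable_funX.
  move=> x; rewrite ger0_norm ?bnd//.
  by rewrite /approx_error addr_ge0// mulr_ge0 ?powR_ge0 ?sqr_ge0 ?addr_ge0.
exists v, G; split => //.
apply: (@le_trans _ _ (\int[mu]_x (2 * e1 * on_cube r (fun x => b x `^ p) x +
   C * on_cube r (Lp_dist p v G z Dz) x))).
  apply: le_Rint; [exact: Ierr.2|by apply: intgD; apply: intgZ; [exact: Ib.2|exact: IL.2]|].
  move=> x; have i0 : 0 <= \1_(cube n r) x :> R by [].
  by have := ler_wpM2r i0 (bnd x); rewrite /on_cube; lra.
rewrite RintD ?RintZ; [|exact: IL.2|exact: Ib.2|exact: (intgZ _ (Ib.2 r))|exact: (intgZ _ (IL.2 r))].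
rewrite -/I.
have h1 : 2 * e1 * I <= e / 2.
  have -> : 2 * e1 * I = e / 2 * (I / (I + 1)) by rewrite /e1; field; rewrite gt_eqF//; lra.
  by rewrite ler_piMr ?ler_pdivrMr//; lra.
have h2 : C * \int[mu]_x on_cube r (Lp_dist p v G z Dz) x <= e / 2.
  apply: (le_trans (ler_wpM2l C0 HvG)).
  have -> : C * (e / (2 * (C + 1))) = e / 2 * (C / (C + 1)) by field; rewrite gt_eqF//; lra.
  by rewrite ler_piMr ?ler_pdivrMr//; lra.
lra.
Qed.

End approximable.

(** * Energy identity and stability *)

Section stability_algebra.
Variable R : realFieldType.
Implicit Types P Q W a b s g d m w x y q f : R.

(** This lemma and the next two are pointwise bounds for [stability_estimate]. In the first two
    [P = |Du| ^ (p - 2)], [a = |Du|], [s = eta], [g = |u| |grad eta|], [d] is the approximation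
    error, and [W], [Q] are powers of [weight]. *)
Lemma cross_term_le P W a s g d m w : 0 <= P -> P * a <= W -> 0 <= a -> 0 <= s <= 1 ->
  0 <= d -> 0 <= m -> w <= g + m * d -> P * (a * s * w) <= P * (a * s * g) + m * (W * d).
Proof.
move=> P0 PaW a0 /andP[s0 s1] d0 m0 wg.
have h1 : P * (a * s * w) <= P * (a * s * (g + m * d)) by rewrite !ler_wpM2l ?mulr_ge0.
apply: (le_trans h1).
have -> : P * (a * s * (g + m * d)) = P * (a * s * g) + m * (P * a * (s * d)) by ring.
rewrite lerD2l ler_wpM2l// ler_pM ?mulr_ge0//.
by rewrite ler_piMl.
Qed.

Lemma square_term_le P Q g d m w : 0 <= P -> P <= Q -> 0 <= w -> w <= g + m * d ->
  P * w ^+ 2 <= 2 * (P * g ^+ 2) + 2 * m ^+ 2 * (Q * d ^+ 2).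
Proof.
move=> P0 PQ w0 wg.
have h1 : w ^+ 2 <= (g + m * d) ^+ 2 by rewrite lerXn2r// nnegrE (le_trans w0).
have h2 : (g + m * d) ^+ 2 <= 2 * g ^+ 2 + 2 * m ^+ 2 * d ^+ 2.
  have := sqr_ge0 (g - m * d); lra.
have h3 := ler_wpM2l P0 (le_trans h1 h2); apply: (le_trans h3).
have h4 : 2 * m ^+ 2 * (P * d ^+ 2) <= 2 * m ^+ 2 * (Q * d ^+ 2).
  by apply: ler_wpM2l; [rewrite mulr_ge0 ?sqr_ge0|rewrite ler_wpM2r ?sqr_ge0].
lra.
Qed.

(** Here [P = |u| ^ (q - 1)], [x = u] and [y] is its [C^1] approximation: only a lower bound on
    [y^2] is needed, so the square of [y - x] is dropped. *)
Lemma mass_term_le q P W f s x y d : 0 <= q -> 0 <= P -> 0 <= s <= 1 -> 0 <= f -> P * `|x| <= f ->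
  1 <= W -> `|y - x| <= d ->
  q * (P * x ^+ 2 * s ^+ 2) - 2 * q * f * (W * d) <= q * P * (y * s) ^+ 2.
Proof.
move=> q0 P0 /andP[s0 s1] f0 Pf W1 yx; have d0 := le_trans (normr_ge0 _) yx.
have h1 : x ^+ 2 - 2 * (`|x| * d) <= y ^+ 2.
  have l1 : - (x * (y - x)) <= `|x| * d.
    by rewrite (le_trans (ler_norm _))// normrN normrM ler_wpM2l.
  have := sqr_ge0 (y - x); lra.
have h2 : 0 <= P * s ^+ 2 by rewrite mulr_ge0 ?sqr_ge0.
have h3 := ler_wpM2l h2 h1.
have h4 : P * `|x| * (s ^+ 2 * d) <= f * (W * d).
  apply: ler_pM => //; [by rewrite mulr_ge0|by rewrite mulr_ge0 ?sqr_ge0|].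
  by rewrite ler_wpM2r// (le_trans _ W1)// exprn_ile1.
have := ler_wpM2l q0 h3; have := ler_wpM2l q0 h4; lra.
Qed.

End stability_algebra.

Section energy.
Variables (R : realType) (n : nat) (p q CA : R).
Local Notation mu := (lebesgue_rV R n).
Variables (u : 'rV[R]_n -> R) (Du A : 'rV[R]_n -> 'rV[R]_n).
Implicit Types (x xi : 'rV[R]_n) (z w v eta : 'rV[R]_n -> R) (Dz Gw G Geta : 'rV[R]_n -> 'rV[R]_n).
Hypotheses (p2 : 2 <= p) (q1 : 1 < q) (CA0 : 0 < CA).
Hypothesis Su : approximable p u Du.
Hypothesis bu : forall r : R, 0 <= r -> exists M : R, forall x, cube n r x -> `|u x| <= M.
Hypothesis mA : forall i, measurable_fun setT (fun xi => A xi ord0 i).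
Hypothesis hA : forall xi, `|A xi| <= CA * `|xi| `^ (p - 1).
Hypothesis weak : forall phi, C1c setT phi ->
  \int[mu]_x (dot (A (Du x)) (grad phi x)) = \int[mu]_x (sgnpow q (u x) * phi x).

Let p1_ge0 : 0 <= p - 1. Proof. by rewrite subr_ge0 (le_trans _ p2)// ler1n. Qed.
Let p_ge0 : 0 <= p. Proof. exact: (le_trans _ p2). Qed.
Let p_gt0 : 0 < p. Proof. exact: (lt_le_trans _ p2). Qed.
Let p_ge1 : 1 <= p. Proof. by rewrite (le_trans _ p2)// ler1n. Qed.

Let q_ge0 : 0 <= q. Proof. by rewrite (le_trans _ (ltW q1)). Qed.

(** The added 1 makes the powers of the weight increase with the exponent, so that [weight ^ p]
    dominates all lower powers of [|Du|] and constants. *)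
Definition weight (x : 'rV[R]_n) : R := 1 + `|Du x|.

Lemma weight_ge1 x : 1 <= weight x.
Proof. by rewrite lerDl. Qed.

Lemma weight_ge0 x : 0 <= weight x.
Proof. exact: le_trans (weight_ge1 x). Qed.

Lemma measurable_Du i : measurable_fun setT (fun x => Du x ord0 i).
Proof. by case: Su. Qed.

Lemma measurable_u : measurable_fun setT u.
Proof. by case: Su. Qed.

Lemma measurable_weight : measurable_fun setT weight.
Proof.
rewrite /weight; exact: (measurable_funD (measurable_cst (1 : R)) (measurable_rV_norm measurable_Du)).
Qed.

Lemma loc_intg_weight : loc_intg (fun x => weight x `^ p).
Proof.
have [_ _ _ ID _] := Su.
apply: (loc_intg_le (measurable_powR_comp p measurable_weight) _
  (loc_intgZ (2 `^ p) (loc_intgD (loc_intg_cst n (1 `^ p)) ID))) => x.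
by rewrite ger0_norm ?powR_ge0// powRD_le.
Qed.

Lemma powR_Du_le_weight (s : R) x : 0 <= s -> `|Du x| `^ s <= weight x `^ s.
Proof. by move=> s0; rewrite ge0_ler_powR ?nnegrE ?weight_ge0// lerDr. Qed.

Lemma measurable_flux_Du i : measurable_fun setT (fun x => A (Du x) ord0 i).
Proof. exact: (measurable_rV_coord_comp (mA i) measurable_Du). Qed.

Lemma sgnpow_u_bounded (r : R) : 0 <= r ->
  exists2 M : R, 0 < M & forall x, cube n r x -> `|sgnpow q (u x)| <= M.
Proof.
move=> r0; have [M HM] := bu r0; exists (`|M| `^ q + 1); first by rewrite ltr_wpDl// powR_ge0.
move=> x xr; rewrite normr_sgnpow// (@le_trans _ _ (`|M| `^ q))// ?lerDl//.
rewrite ge0_ler_powR ?nnegrE//.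
by rewrite (le_trans (HM x xr))// ler_norm.
Qed.

Lemma measurable_sgnpow_u : measurable_fun setT (fun x => sgnpow q (u x)).
Proof. exact: (measurable_funM (measurable_powR_norm (q - 1) measurable_u) measurable_u). Qed.

Lemma dot_flux_le x (y : 'rV[R]_n) : `|dot (A (Du x)) y| <= n%:R * CA * (`|Du x| `^ (p - 1) * `|y|).
Proof.
rewrite (le_trans (normr_dot_le _ _))// -!mulrA ler_wpM2l// mulrA ler_wpM2r//.
Qed.

Lemma powRB1_mul_le (a h : R) : 0 <= a -> 0 <= h -> a `^ (p - 1) * h <= a `^ p + h `^ p.
Proof.
move=> a0 h0; have [ah|ha] := leP a h.
  have : a `^ (p - 1) * h <= h `^ (p - 1) * h by rewrite ler_wpM2r// ge0_ler_powR ?nnegrE.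
  rewrite mul_powRB1// => /le_trans; apply; by rewrite lerDr powR_ge0.
have : a `^ (p - 1) * h <= a `^ (p - 1) * a by rewrite ler_wpM2l ?powR_ge0// ltW.
rewrite mul_powRB1// => /le_trans; apply; by rewrite lerDl powR_ge0.
Qed.

Lemma le1_powR (h : R) : 0 <= h -> h <= 1 + h `^ p.
Proof.
move=> h0; have [h1|h1] := leP h 1; first by rewrite (le_trans h1)// lerDl powR_ge0.
by have := ler_powR (ltW h1) p_ge1; rewrite powRr1// => /le_trans; apply; rewrite lerDr.
Qed.

Lemma eq_of_le_eps (K X Y : R) : 0 <= K -> (forall e : R, 0 < e -> `|X - Y| <= K * e) -> X = Y.
Proof.
move=> K0 H; apply/eqP; rewrite -subr_eq0 -normr_le0; apply/ler_addgt0Pl => e e0.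
have e1 : 0 < e / (K + 1) by rewrite divr_gt0// ltr_wpDl.
rewrite addr0 (le_trans (H _ e1))// mulrA ler_pdivrMr ?ltr_wpDl//.
by rewrite mulrC ler_wpM2l ?(ltW e0)// lerDl.
Qed.

(** The weak equation for test functions [w z] with [z] merely Sobolev: replacing [z] by a [C^1]
    approximation changes either side by [O(e)]. It is used with [z = u] and with [z] a dilation of
    [u]. *)
Lemma test_approximable z Dz w Gw (r : R) : approximable p z Dz -> 0 <= r -> C1 w Gw ->
  (forall x, ~ cube n r x -> w x = 0 /\ Gw x = 0) ->
  [/\ intg mu (fun x => dot (A (Du x)) (w x *: Dz x + z x *: Gw x)),
    intg mu (fun x => sgnpow q (u x) * (w x * z x)) &
    \int[mu]_x (dot (A (Du x)) (w x *: Dz x + z x *: Gw x)) =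
    \int[mu]_x (sgnpow q (u x) * (w x * z x))].
Proof.
move=> Sz r0 wG w0; have [Iz mz mDz IDz _] := Sz.
have [_ _ _ ID _] := Su.
have [M M0 HM] := C1_cube_bounded r0 wG; have [Mf Mf0 HMf] := sgnpow_u_bounded r0.
have [mw mGw] := C1_measurable wG.
have n0 : 0 <= n%:R :> R by [].
have mT (f : 'rV[R]_n -> R) (F : 'rV[R]_n -> 'rV[R]_n) : measurable_fun setT f ->
    (forall i, measurable_fun setT (fun x => F x ord0 i)) ->
    measurable_fun setT (fun x => dot (A (Du x)) (w x *: F x + f x *: Gw x)).
  move=> mf mF; apply: measurable_rV_dot => i; first exact: measurable_flux_Du.
  have -> : (fun x => (w x *: F x + f x *: Gw x) ord0 i) =
     fun x => w x * F x ord0 i + f x * Gw x ord0 i by apply/funext => x; rewrite !mxE.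
  exact: (measurable_funD (measurable_funM mw (mF i)) (measurable_funM mf (mGw i))).
have mS (f : 'rV[R]_n -> R) : measurable_fun setT f ->
    measurable_fun setT (fun x => sgnpow q (u x) * (w x * f x)).
  by move=> mf; exact: (measurable_funM measurable_sgnpow_u (measurable_funM mw mf)).
have off (f : 'rV[R]_n -> R) (F : 'rV[R]_n -> 'rV[R]_n) x : ~ cube n r x ->
    dot (A (Du x)) (w x *: F x + f x *: Gw x) = 0 /\ sgnpow q (u x) * (w x * f x) = 0.
  move=> xr; have [-> ->] := w0 x xr.
  by rewrite scale0r scaler0 addr0 dotC dot0l mul0r mulr0.
have bT x (s t : 'rV[R]_n) (f : R) : cube n r x ->
    `|dot (A (Du x)) (w x *: s + f *: Gw x)| <=
    n%:R * CA * M * (`|Du x| `^ (p - 1) * (`|s| + `|f|)).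
  move=> xr; have [h1 h2] := HM x xr.
  apply: (le_trans (dot_flux_le _ _)); rewrite -[in leRHS]mulrA.
  rewrite ler_wpM2l ?mulr_ge0 ?(ltW CA0)// mulrCA ler_wpM2l ?powR_ge0//.
  rewrite (le_trans (ler_normD _ _))// !normrZ mulrDr lerD ?ler_wpM2r//.
  by rewrite mulrC ler_wpM2r.
have IT : intg mu (fun x => dot (A (Du x)) (w x *: Dz x + z x *: Gw x)).
  apply: (@intg_loc _ _ _ (fun x => (`|Du x| `^ p + `|Dz x| `^ p) + (`|Du x| `^ p + `|z x| `^ p))
    r (n%:R * CA * M)).
  - exact: mT.
  - exact: (loc_intgD (loc_intgD ID IDz) (loc_intgD ID Iz)).
  - by move=> x /(off z Dz)[].
  - move=> x xr; apply: (le_trans (bT x (Dz x) 0 (z x) xr)).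
    by rewrite ler_wpM2l ?mulr_ge0 ?(ltW CA0) ?(ltW M0)// mulrDr lerD// powRB1_mul_le.
have IS : intg mu (fun x => sgnpow q (u x) * (w x * z x)).
  apply: (@intg_loc _ _ _ (fun x => 1 + `|z x| `^ p) r (Mf * M)).
  - exact: mS.
  - exact: (loc_intgD (loc_intg_cst n 1) Iz).
  - by move=> x /(off z Dz)[].
  - move=> x xr; rewrite normrM [X in _ * X]normrM mulrA; have [h1 h2] := HM x xr.
    by rewrite ler_pM ?mulr_ge0 ?le1_powR// ler_pM// HMf.
split => //.
apply: (@eq_of_le_eps (n%:R * CA * M + Mf * M)).
  by rewrite addr_ge0 ?mulr_ge0 ?(ltW CA0) ?(ltW M0) ?(ltW Mf0).
move=> e e0; have [v [G [vG Ierr Herr]]] :=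
  approximable_error p2 weight_ge0 measurable_weight loc_intg_weight Sz r0 e0.
have wvG := C1M wG vG.
have wv0 x : ~ cube n r x -> w x * v x = 0 by move=> /w0[-> _]; rewrite mul0r.
have cv : C1c setT (fun x => w x * v x).
  exact: (C1c_closed_support wvG (@closed_cube R n r) (@subset_refl _ _) (@subsetT _ _) wv0).
have := weak cv; rewrite (C1_grad wvG) => wk.
have [mv mG] := C1_measurable vG.
have [M' M'0 HM'] := C1_cube_bounded r0 vG.
have IT' : intg mu (fun x => dot (A (Du x)) (w x *: G x + v x *: Gw x)).
  apply: (@intg_loc _ _ _ (fun x => weight x `^ p) r (n%:R * CA * M * (M' + M'))).
  - exact: mT.
  - exact: loc_intg_weight.
  - by move=> x /(off v G)[].
  - move=> x xr; apply: (le_trans (bT x (G x) 0 (v x) xr)).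
    have [h1 h2] := HM' x xr.
    rewrite -[in leRHS]mulrA ler_wpM2l ?mulr_ge0 ?(ltW CA0) ?(ltW M0)// mulrC ler_pM ?powR_ge0 ?addr_ge0 ?lerD//.
    rewrite (le_trans (powR_Du_le_weight _ _))// ler_powR ?weight_ge1//.
    by rewrite gerBl.
have IS' : intg mu (fun x => sgnpow q (u x) * (w x * v x)).
  apply: (@intg_loc _ _ _ (cst 1) r (Mf * (M * M'))).
  - exact: mS.
  - exact: loc_intg_cst.
  - by move=> x /(off v G)[].
  - move=> x xr; have [h1 h2] := HM x xr; have [h3 h4] := HM' x xr.
    by rewrite mulr1 normrM [X in _ * X]normrM ler_pM ?mulr_ge0 ?HMf// ler_pM.
have errE x : weight x `^ (p - 1) * (`|v x - z x| + `|G x - Dz x|) <= approx_error p weight v G z Dz x.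
  by rewrite lerDl mulr_ge0 ?powR_ge0 ?sqr_ge0.
have d1 : `|\int[mu]_x (dot (A (Du x)) (w x *: Dz x + z x *: Gw x)) -
    \int[mu]_x (dot (A (Du x)) (w x *: G x + v x *: Gw x))| <= n%:R * CA * M * e.
  rewrite -RintB//; apply: (@le_trans _ _ (\int[mu]_x (n%:R * CA * M *
     on_cube r (approx_error p weight v G z Dz) x))); last first.
    by rewrite RintZ ?ler_wpM2l ?mulr_ge0 ?(ltW CA0) ?(ltW M0)//; exact: Ierr.2.
  apply: le_norm_Rint; [exact: intgB|exact: (intgZ _ (Ierr.2 r))|move=> x].
  have [xr|xr] := pselect (cube n r x); last first.
    by rewrite (off _ _ _ xr).1 (off _ _ _ xr).1 subrr normr0 /on_cube indicE memNset// !mulr0.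
  rewrite /on_cube indicE mem_set// mulr1 -dotBr.
  have -> : w x *: Dz x + z x *: Gw x - (w x *: G x + v x *: Gw x) =
      w x *: (Dz x - G x) + (z x - v x) *: Gw x.
    by rewrite scalerBr scalerBl opprD addrACA.
  apply: (le_trans (bT x _ 0 _ xr)); rewrite ler_wpM2l ?mulr_ge0 ?(ltW CA0) ?(ltW M0)//.
  apply: le_trans (errE x); rewrite (distrC (Dz x)) (distrC (z x)) [X in _ * X <= _]addrC.
  by rewrite ler_wpM2r ?addr_ge0// powR_Du_le_weight.
have d2 : `|\int[mu]_x (sgnpow q (u x) * (w x * z x)) -
    \int[mu]_x (sgnpow q (u x) * (w x * v x))| <= Mf * M * e.
  rewrite -RintB//; apply: (@le_trans _ _ (\int[mu]_x (Mf * M *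
     on_cube r (approx_error p weight v G z Dz) x))); last first.
    by rewrite RintZ ?ler_wpM2l ?mulr_ge0 ?(ltW Mf0) ?(ltW M0)//; exact: Ierr.2.
  apply: le_norm_Rint; [exact: intgB|exact: (intgZ _ (Ierr.2 r))|move=> x].
  have [xr|xr] := pselect (cube n r x); last first.
    by rewrite (off _ Dz _ xr).2 (off _ Dz _ xr).2 subrr normr0 /on_cube indicE memNset// !mulr0.
  rewrite /on_cube indicE mem_set// mulr1 -!mulrBr normrM [X in _ * X]normrM -mulrA ler_pM ?mulr_ge0 ?HMf//.
  have [h1 h2] := HM x xr; rewrite ler_pM//.
  apply: le_trans (errE x); rewrite distrC.
  have W1 : 1 <= weight x `^ (p - 1).
    by have := ler_powR (weight_ge1 x) p1_ge0; rewrite powRr0.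
  apply: (@le_trans _ _ (1 * (`|v x - z x| + `|G x - Dz x|))); first by rewrite mul1r lerDl.
  by rewrite ler_wpM2r ?addr_ge0.
move: d1 d2; rewrite wk mulrDl.
move: (\int[mu]_x _) (\int[mu]_x _) (\int[mu]_x _) => X Y Z d1 d2.
have -> : Z - X = (Z - Y) - (X - Y) by ring.
by rewrite (le_trans (ler_normB _ _))// lerD.
Qed.

Lemma energy_identity w Gw (r : R) : 0 <= r -> C1 w Gw ->
  (forall x, ~ cube n r x -> w x = 0 /\ Gw x = 0) ->
  \int[mu]_x (dot (A (Du x)) (w x *: Du x + u x *: Gw x)) = \int[mu]_x (`|u x| `^ (q + 1) * w x).
Proof.
move=> r0 wG w0; have [_ _ ->] := test_approximable Su r0 wG w0.
by apply: eq_Rintegral => x _; rewrite -(sgnpowM _ q1) mulrCA mulrC.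
Qed.

Lemma powRB2_mul (a : R) : 0 <= a -> a `^ (p - 2) * a = a `^ (p - 1).
Proof.
move=> a0; have -> : p - 2 = p - 1 - 1 by ring.
by rewrite mul_powRB1// subr_gt0 (lt_le_trans _ p2)// ltr1n.
Qed.

(** The part of the second variation along [u eta] that contains [grad eta]: the cross term and the
    square of [u grad eta]. *)
Definition cutoff_error eta Geta x :=
  `|Du x| `^ (p - 2) * (`|Du x| * eta x * (`|u x| * `|Geta x|) + (`|u x| * `|Geta x|) ^+ 2).

(** Stability with test function [u eta], reached through [v eta] with [v] a [C^1] approximation of
    [u]. [V1], [V2] and [e2] stand for [variation1], [variation2] and [second_energy], of which only
    the listed bounds matter. *)
Lemma stability_estimate (K S : set 'rV[R]_n) (V1 V2 : 'rV[R]_n -> 'rV[R]_n -> R)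
    (e2 : 'rV[R]_n -> R) (CV CE e C r : R) eta Geta :
  0 <= CV -> 0 <= C -> 0 <= r ->
  (forall F : 'rV[R]_n -> 'rV[R]_n, (forall i, measurable_fun setT (fun x => F x ord0 i)) ->
    measurable_fun setT (fun x => V1 (Du x) (F x)) /\
    measurable_fun setT (fun x => V2 (Du x) (F x))) ->
  (forall xi y : 'rV[R]_n, `|V1 xi y| <= CV * (`|xi| `^ (p - 2) * `|y| ^+ 2) /\
    `|V2 xi y| <= CV * (`|xi| `^ (p - 2) * `|y| ^+ 2)) ->
  (forall (xi : 'rV[R]_n) (s : R) (y : 'rV[R]_n), 0 <= s ->
    V1 xi (s *: xi + y) + V2 xi (s *: xi + y) <= (1 + e) * (e2 xi * s ^+ 2) +
    C * (`|xi| `^ (p - 2) * (`|xi| * s * `|y|) + `|xi| `^ (p - 2) * `|y| ^+ 2)) ->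
  measurable_fun setT e2 -> (forall xi, 0 <= e2 xi <= CE * `|xi| `^ p) ->
  (forall phi, C1c (~` K) phi -> 0 <= \int[mu]_x V1 (Du x) (grad phi x) +
    \int[mu]_x V2 (Du x) (grad phi x) - \int[mu]_x (q * `|u x| `^ (q - 1) * phi x ^+ 2)) ->
  closed S -> S `<=` cube n r -> S `<=` ~` K -> C1 eta Geta -> (forall x, 0 <= eta x <= 1) ->
  (forall x, ~ S x -> eta x = 0 /\ Geta x = 0) ->
  [/\ intg mu (cutoff_error eta Geta), intg mu (fun x => e2 (Du x) * eta x ^+ 2),
      intg mu (fun x => `|u x| `^ (q + 1) * eta x ^+ 2) &
    q * \int[mu]_x (`|u x| `^ (q + 1) * eta x ^+ 2) <=
    (1 + e) * \int[mu]_x (e2 (Du x) * eta x ^+ 2) + 2 * C * \int[mu]_x cutoff_error eta Geta x].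
Proof.
move=> CV0 C0 r0 mV Vle Vsplit me2 e2le stab cS Sr SK etaG eta01 eta0.
have [M M0 HM] := C1_cube_bounded r0 etaG; have [Mf Mf0 HMf] := sgnpow_u_bounded r0.
have [Mu HMu] := bu r0.
have [meta mGeta] := C1_measurable etaG.
have eta00 x : 0 <= eta x by have /andP[] := eta01 x.
have eta1 x : eta x <= 1 by have /andP[] := eta01 x.
have offc x : ~ cube n r x -> eta x = 0 /\ Geta x = 0 by move=> xr; apply: eta0 => /Sr.
have mDu := measurable_rV_norm measurable_Du; have mnu := measurable_u.
have mnG := measurable_rV_norm mGeta.
have nu : measurable_fun setT (fun x => `|u x|) := measurableT_comp (@normr_measurable R setT) mnu.
have mprod := measurable_funM nu mnG.
have b1 x := weight_ge1 x; have b0 x := weight_ge0 x.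
have W x (s : R) : 0 <= s -> s <= p -> `|Du x| `^ s <= weight x `^ p.
  by move=> s0 sp; rewrite (le_trans (powR_Du_le_weight _ s0))// ler_powR.
have sub1 : p - 1 <= p by rewrite gerBl.
have sub2 : p - 2 <= p by rewrite gerBl.
have p2' : 0 <= p - 2 by rewrite subr_ge0.
have IE : intg mu (cutoff_error eta Geta).
  apply: (@intg_loc _ _ _ (fun x => weight x `^ p) r (`|Mu| * M + (`|Mu| * M) ^+ 2)).
  - apply: (measurable_funM (measurable_powR_comp (p - 2) mDu)).
    exact: (measurable_funD (measurable_funM (measurable_funM mDu meta) mprod) (measurable_funX 2 mprod)).
  - exact: loc_intg_weight.
  - by move=> x /offc[e1 e3]; rewrite /cutoff_error e1 e3 normr0 !mulr0 expr0n/= addr0 mulr0.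
  - move=> x xr; have [h1 h2] := HM x xr; have h3 := le_trans (HMu x xr) (ler_norm Mu).
    have h4 : `|u x| * `|Geta x| <= `|Mu| * M by rewrite ler_pM.
    rewrite /cutoff_error ger0_norm; last by rewrite mulr_ge0 ?powR_ge0 ?addr_ge0 ?mulr_ge0 ?sqr_ge0.
    rewrite mulrDr mulrDl lerD//.
      have -> : `|Du x| `^ (p - 2) * (`|Du x| * eta x * (`|u x| * `|Geta x|)) =
        `|u x| * `|Geta x| * (`|Du x| `^ (p - 2) * `|Du x| * eta x) by ring.
      rewrite powRB2_mul//; apply: ler_pM; rewrite ?mulr_ge0 ?powR_ge0//.
      by rewrite -[leRHS]mulr1 ler_pM ?powR_ge0 ?W.
    by rewrite mulrC ler_pM ?sqr_ge0 ?powR_ge0 ?W// lerXn2r ?nnegrE ?mulr_ge0 ?(ltW M0).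
have Ie2 : intg mu (fun x => e2 (Du x) * eta x ^+ 2).
  apply: (@intg_loc _ _ _ (fun x => weight x `^ p) r `|CE|).
  - exact: (measurable_funM (measurable_rV_coord_comp me2 measurable_Du) (measurable_funX 2 meta)).
  - exact: loc_intg_weight.
  - by move=> x /offc[e1 _]; rewrite e1 expr0n/= mulr0.
  - move=> x xr; have /andP[h1 h2] := e2le (Du x).
    rewrite ger0_norm ?mulr_ge0 ?sqr_ge0// -[leRHS]mulr1 ler_pM ?sqr_ge0//; last by rewrite exprn_ile1.
    apply: (le_trans h2); apply: (@le_trans _ _ (`|CE| * `|Du x| `^ p)).
      by rewrite ler_wpM2r ?powR_ge0 ?ler_norm.
    by rewrite ler_wpM2l ?W.
have mu1 : measurable_fun setT (fun x => `|u x| `^ (q + 1)) by exact: measurable_powR_norm.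
have mu2 : measurable_fun setT (fun x => `|u x| `^ (q - 1)) by exact: measurable_powR_norm.
have Mq x (s : R) : 0 <= s -> cube n r x -> `|u x| `^ s <= `|Mu| `^ s.
  by move=> s0 xr; rewrite ge0_ler_powR ?nnegrE// (le_trans (HMu x xr)) ?ler_norm.
have Iu : intg mu (fun x => `|u x| `^ (q + 1) * eta x ^+ 2).
  apply: (@intg_loc _ _ _ (cst 1) r (`|Mu| `^ (q + 1))).
  - exact: (measurable_funM mu1 (measurable_funX 2 meta)).
  - exact: loc_intg_cst.
  - by move=> x /offc[e1 _]; rewrite e1 expr0n/= mulr0.
  - move=> x xr; rewrite ger0_norm ?mulr_ge0 ?powR_ge0 ?sqr_ge0//.
    by rewrite ler_pM ?powR_ge0 ?sqr_ge0 ?exprn_ile1 ?Mq ?addr_ge0.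
split => //.
(* Sum of the coefficients of the approximation error in the cross, square and mass terms; [M + 1]
   bounds the part of [w] that is due to [v - u]. *)
pose K1 := C * ((M + 1) + 2 * (M + 1) ^+ 2) + 2 * q * Mf.
have K10 : 0 <= K1.
  by rewrite addr_ge0 ?mulr_ge0 ?addr_ge0 ?mulr_ge0 ?sqr_ge0 ?addr_ge0 ?(ltW M0) ?(ltW Mf0).
apply/ler_addgt0Pl => e' e'0.
have e1 : 0 < e' / (K1 + 1) by rewrite divr_gt0// ltr_wpDl.
have [v [G [vG Ierr Herr]]] :=
  approximable_error p2 weight_ge0 measurable_weight loc_intg_weight Su r0 e1.
have vetaG := C1M vG etaG.
have [M' M'0 HM'] := C1_cube_bounded r0 vG.
have [mv mG] := C1_measurable vG.
have phi0 x : ~ S x -> v x * eta x = 0 by move=> /eta0[-> _]; rewrite mulr0.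
have cphi : C1c (~` K) (fun x => v x * eta x) by exact: (C1c_closed_support vetaG cS Sr SK phi0).
pose gp x := v x *: Geta x + eta x *: G x.
have := stab _ cphi; have -> : grad (fun x => v x * eta x) = gp by exact: (C1_grad vetaG).
have mgp : forall i, measurable_fun setT (fun x => gp x ord0 i).
  move=> i; have -> : (fun x => gp x ord0 i) = fun x => v x * Geta x ord0 i + eta x * G x ord0 i.
    by apply/funext => x; rewrite !mxE.
  exact: (measurable_funD (measurable_funM mv (mGeta i)) (measurable_funM meta (mG i))).
have gp0 x : ~ cube n r x -> gp x = 0 by move=> /offc[e3 e4]; rewrite /gp e3 e4 scaler0 scale0r addr0.
have gpM x : cube n r x -> `|gp x| <= M' * M + M'.
  move=> xr; have [h1 h2] := HM x xr; have [h3 h4] := HM' x xr.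
  rewrite (le_trans (ler_normD _ _))// !normrZ lerD ?ler_pM//.
  by rewrite -[leRHS]mul1r ler_pM// ger0_norm.
have IV (V : 'rV[R]_n -> 'rV[R]_n -> R) : measurable_fun setT (fun x => V (Du x) (gp x)) ->
   (forall xi y : 'rV[R]_n, `|V xi y| <= CV * (`|xi| `^ (p - 2) * `|y| ^+ 2)) -> intg mu (fun x => V (Du x) (gp x)).
  move=> mVg VV.
  apply: (@intg_loc _ _ _ (fun x => weight x `^ p) r (CV * (M' * M + M') ^+ 2)) => //.
  - exact: loc_intg_weight.
  - move=> x /gp0 E; apply/eqP; rewrite -normr_le0 E (le_trans (VV _ _))//.
    by rewrite normr0 expr0n/= !mulr0.
  - move=> x xr; rewrite (le_trans (VV _ _))// -mulrA ler_wpM2l// mulrC.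
    by rewrite ler_pM ?sqr_ge0 ?powR_ge0 ?W// lerXn2r ?nnegrE ?gpM// addr_ge0 ?mulr_ge0 ?ltW.
have [mV1 mV2] := mV gp mgp.
have IV1 := IV V1 mV1 (fun xi y => (Vle xi y).1).
have IV2 := IV V2 mV2 (fun xi y => (Vle xi y).2).
have I3 : intg mu (fun x => q * `|u x| `^ (q - 1) * (v x * eta x) ^+ 2).
  apply: (@intg_loc _ _ _ (cst 1) r (q * `|Mu| `^ (q - 1) * M' ^+ 2)).
  - exact: (measurable_funM (measurable_funM (measurable_cst q) mu2) (measurable_funX 2 (measurable_funM mv meta))).
  - exact: loc_intg_cst.
  - by move=> x /offc[e3 _]; rewrite e3 mulr0 expr0n/= mulr0.
  - move=> x xr; have [h3 h4] := HM' x xr.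
    have T0 := sqr_ge0 (v x * eta x); have Q0 := mulr_ge0 q_ge0 (powR_ge0 `|u x| (q - 1)).
    rewrite mulr1 (ger0_norm (mulr_ge0 Q0 T0)); apply: (ler_pM Q0 T0).
      by rewrite ler_wpM2l// Mq// subr_ge0 ltW.
    rewrite exprMn -[leRHS]mulr1 ler_pM ?sqr_ge0 ?exprn_ile1//.
    by rewrite -real_normK ?num_real// lerXn2r ?nnegrE// ltW.
rewrite -RintD// -RintB//; last exact: intgD.
pose Z x := (1 + e) * (e2 (Du x) * eta x ^+ 2) + 2 * C * cutoff_error eta Geta x -
  q * (`|u x| `^ (q + 1) * eta x ^+ 2).
have IZ1 := intgD (intgZ (1 + e) Ie2) (intgZ (2 * C) IE).
have IZ := intgB IZ1 (intgZ q Iu).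
have IK := intgZ K1 (Ierr.2 r).
move=> st; have : 0 <= \int[mu]_x (Z x + K1 * on_cube r (approx_error p weight v G u Du) x).
  apply: (le_trans st); apply: le_Rint; [by apply: intgB => //; exact: intgD|exact: intgD|].
  move=> x; have [xr|xr] := pselect (cube n r x); last first.
    have h (V : 'rV[R]_n -> 'rV[R]_n -> R) :
       (forall xi y : 'rV[R]_n, `|V xi y| <= CV * (`|xi| `^ (p - 2) * `|y| ^+ 2)) -> V (Du x) (gp x) = 0.
      move=> VV; apply/eqP; rewrite -normr_le0 (gp0 _ xr) (le_trans (VV _ _))//.
      by rewrite normr0 expr0n/= !mulr0.
    have [e3 e4] := offc x xr.
    rewrite (h _ (fun xi y => (Vle xi y).1)) (h _ (fun xi y => (Vle xi y).2)).
    rewrite /Z /cutoff_error /on_cube indicE memNset// e3 e4 normr0 !mulr0 !expr0n/= !mulr0.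
    by rewrite !addr0 !mulr0 !addr0 subr0.
  rewrite /on_cube indicE mem_set// mulr1.
  pose D : R := `|v x - u x| + `|G x - Du x|.
  have D0 : 0 <= D by rewrite addr_ge0.
  (* The gradient of [v eta] is [eta Du + w], where [w] gathers the gradient of the cut-off and the
     error [G - Du]. *)
  pose w := v x *: Geta x + eta x *: (G x - Du x).
  have gpE : gp x = eta x *: Du x + w.
    by rewrite /gp /w addrCA -scalerDr [Du x + _]addrC subrK.
  have [h1 h2] := HM x xr.
  pose g : R := `|u x| * `|Geta x|.
  have g0 : 0 <= g by rewrite mulr_ge0.
  have wle : `|w| <= g + (M + 1) * D.
    rewrite (le_trans (ler_normD _ _))// !normrZ (ger0_norm (eta00 x)).
    have k1 : `|v x| <= `|u x| + `|v x - u x| by rewrite -{1}(subrKC (u x) (v x)) ler_normD.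
    have k2 : `|v x| * `|Geta x| <= (`|u x| + `|v x - u x|) * `|Geta x| by rewrite ler_wpM2r.
    have k3 : `|v x - u x| * `|Geta x| <= `|v x - u x| * M by rewrite ler_wpM2l.
    have k4 : eta x * `|G x - Du x| <= `|G x - Du x| by rewrite ler_piMl.
    have k5 : 0 <= `|G x - Du x| by [].
    have k6 := mulr_ge0 k5 (ltW M0).
    have k7 : 0 <= `|v x - u x| by [].
    rewrite /g /D; lra.
  have sp := Vsplit (Du x) (eta x) w (eta00 x); rewrite -gpE in sp.
  have P0 : 0 <= `|Du x| `^ (p - 2) by exact: powR_ge0.
  have a0 : 0 <= `|Du x| by [].
  have M1 : 0 <= M + 1 by rewrite addr_ge0// ltW.
  have PaW : `|Du x| `^ (p - 2) * `|Du x| <= weight x `^ (p - 1).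
    by rewrite powRB2_mul// powR_Du_le_weight.
  have t1 := cross_term_le P0 PaW a0 (eta01 x) D0 M1 wle.
  have t2 := square_term_le P0 (powR_Du_le_weight x p2') (normr_ge0 _) wle.
  have W1 : 1 <= weight x `^ (p - 1) by have := ler_powR (b1 x) p1_ge0; rewrite powRr0.
  have uf : `|u x| `^ (q - 1) * `|u x| <= Mf.
    by have := HMf x xr; rewrite /sgnpow normrM (ger0_norm (powR_ge0 _ _)).
  have vD : `|v x - u x| <= D by rewrite lerDl.
  have t3 := mass_term_le q_ge0 (powR_ge0 `|u x| (q - 1)) (eta01 x) (ltW Mf0) uf W1 vD.
  have uE : `|u x| `^ (q - 1) * u x ^+ 2 = `|u x| `^ (q + 1).
    by rewrite -(sgnpowM _ q1) /sgnpow -mulrA -expr2.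
  rewrite uE in t3.
  have t4 := ler_wpM2l C0 (lerD t1 t2).
  have E1 : weight x `^ (p - 1) * D <= approx_error p weight v G u Du x.
    by rewrite lerDl mulr_ge0 ?powR_ge0 ?sqr_ge0.
  have E2 : weight x `^ (p - 2) * D ^+ 2 <= approx_error p weight v G u Du x.
    by rewrite lerDr mulr_ge0 ?powR_ge0.
  have c1 : 0 <= C * (M + 1) by rewrite mulr_ge0.
  have c2 : 0 <= C * (2 * (M + 1) ^+ 2) by rewrite mulr_ge0// mulr_ge0 ?sqr_ge0.
  have c3 : 0 <= 2 * q * Mf by rewrite !mulr_ge0// ltW.
  have f1 := ler_wpM2l c1 E1; have f2 := ler_wpM2l c2 E2; have f3 := ler_wpM2l c3 E1.
  have f4 : 0 <= C * (`|Du x| `^ (p - 2) * (`|Du x| * eta x * g)) by rewrite !mulr_ge0.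
  rewrite /Z /K1 /cutoff_error -/g.
  move: sp t3 t4 f1 f2 f3 f4; move: (approx_error _ _ _ _ _ _ _) (V1 _ _) (V2 _ _) (_ `^ (p - 1)) (_ `^ (p - 2)) (_ `^ (p - 2)).
  move=> *; lra.
rewrite RintD// RintB ?RintD ?RintZ//; try exact: intgZ; last exact: (Ierr.2 r).
have h : K1 * \int[mu]_x on_cube r (approx_error p weight v G u Du) x <= e'.
  apply: (le_trans (ler_wpM2l K10 Herr)).
  have -> : K1 * (e' / (K1 + 1)) = e' * (K1 / (K1 + 1)) by ring.
  by rewrite ler_piMr ?(ltW e'0)// ler_pdivrMr ?ltr_wpDl// mul1r lerDl.
lra.
Qed.

End energy.

(** * Cut-off functions *)

Section cutoff.
Variable R : realType.

(** A [C^1] transition from 1 on [t <= 1] to 0 on [t >= 2], built from two nested [sqpos]. *)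
Definition step (t : R) : R := sqpos (1 - sqpos (t - 1)).

Lemma step_ge0 t : 0 <= step t.
Proof. exact: sqpos_ge0. Qed.

Lemma step_le1 t : step t <= 1.
Proof. by apply: sqpos_le1; rewrite gerBl sqpos_ge0. Qed.

Lemma step_eq1 t : t <= 1 -> step t = 1.
Proof.
by move=> t1; rewrite /step (@sqpos_eq0 _ (t - 1)) ?subr_le0// subr0 /sqpos max_l// expr1n.
Qed.

Lemma step_eq0 t : 2 <= t -> step t = 0.
Proof.
move=> t2; apply: sqpos_eq0; rewrite /sqpos max_l; last lra.
have h : 1 <= t - 1 by lra.
by rewrite subr_le0 exprn_ege1.
Qed.

Lemma sqpos_mono (s t : R) : s <= t -> sqpos s <= sqpos t.
Proof.
move=> st; have m0 x : 0 <= Num.max x 0 :> R by rewrite le_max lexx orbT.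
have h : Num.max s 0 <= Num.max t 0 by rewrite ge_max !le_max st lexx orbT.
by rewrite /sqpos lerXn2r ?nnegrE.
Qed.

Lemma sqpos_lip (s t : R) : s <= t -> t <= 1 -> sqpos t - sqpos s <= 2 * (t - s).
Proof.
move=> st t1; have /andP[_ h] := sqpos_taylor t (s - t).
have /andP[h1 _] := sqpos_taylor t (s - t).
have : 0 <= sqpos s - sqpos t - 2 * Num.max t 0 * (s - t) by move: h1; rewrite subrKC.
have m1 : Num.max t 0 <= 1 by rewrite ge_max t1 ler01.
have m0 : 0 <= Num.max t 0 by rewrite le_max lexx orbT.
nra.
Qed.

Lemma step_nonincr s t : s <= t -> step t <= step s.
Proof. by move=> st; apply: sqpos_mono; rewrite lerD2l lerN2 sqpos_mono// lerD2r. Qed.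

(** Up to [t = 2] both nested [sqpos] have arguments at most 1, where [sqpos] is 2-Lipschitz; beyond
    2 the function is constant. *)
Lemma step_lip s t : s <= t -> step s - step t <= 4 * (t - s).
Proof.
have L a b : a <= b -> b <= 2 -> step a - step b <= 4 * (b - a).
  move=> ab b2; have h1 : sqpos (b - 1) - sqpos (a - 1) <= 2 * (b - a).
    have := @sqpos_lip (a - 1) (b - 1); rewrite lerD2r => /(_ ab) l.
    have /l : b - 1 <= 1 by lra.
    lra.
  have h2 : sqpos (1 - sqpos (a - 1)) - sqpos (1 - sqpos (b - 1)) <=
      2 * ((1 - sqpos (a - 1)) - (1 - sqpos (b - 1))).
    apply: sqpos_lip; first by rewrite lerD2l lerN2 sqpos_mono// lerD2r.
    by rewrite gerBl sqpos_ge0.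
  rewrite /step; lra.
move=> st; have [t2|t2] := leP t 2; first exact: L.
rewrite (step_eq0 (ltW t2)) subr0; have [s2|s2] := leP s 2.
  have := L s 2 s2 (lexx _); rewrite (step_eq0 (lexx _)); lra.
by rewrite (step_eq0 (ltW s2)); lra.
Qed.

Variable n : nat.
Implicit Types (x : 'rV[R]_n) (r : R).

(** Radial in the Euclidean sense: 1 for [|x| <= r] and 0 for [|x|^2 >= 2 r^2]. Being radially
    decreasing, it compares well with its own dilations. *)
Definition cutoff r x := step (r ^- 2 * dot x x).

Definition cutoffG r x : 'rV[R]_n :=
  (2 * Num.max (1 - sqpos (r ^- 2 * dot x x - 1)) 0) *:
  - ((2 * Num.max (r ^- 2 * dot x x - 1) 0) *: (r ^- 2 *: (2 *: x))).

Lemma C1_cutoff r : C1 (cutoff r) (cutoffG r).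
Proof.
have h1 := C1Z (r ^- 2) (C1_sqnorm R n).
have h2 := C1B h1 (C1_cst n 1).
have h3 := C1B (C1_cst n 1) (C1_sqpos h2).
by apply: C1_ext (C1_sqpos h3) _ => x; rewrite /cutoffG subr0 sub0r.
Qed.

Lemma cutoff_ge0 r x : 0 <= cutoff r x. Proof. exact: step_ge0. Qed.
Lemma cutoff_le1 r x : cutoff r x <= 1. Proof. exact: step_le1. Qed.

Lemma cutoff_eq1 r x : 0 < r -> dot x x <= r ^+ 2 -> cutoff r x = 1.
Proof. by move=> r0 xr; apply: step_eq1; rewrite mulrC ler_pdivrMr ?exprn_gt0// mul1r. Qed.

Lemma cutoff_eq0 r x : 0 < r -> 2 * r ^+ 2 <= dot x x -> cutoff r x = 0.
Proof. by move=> r0 xr; apply: step_eq0; rewrite mulrC ler_pdivlMr ?exprn_gt0. Qed.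

Lemma cutoffG_eq0l r x : 0 < r -> dot x x <= r ^+ 2 -> cutoffG r x = 0.
Proof.
move=> r0 xr; rewrite /cutoffG (max_r (x := r ^- 2 * dot x x - 1)); last first.
  by rewrite subr_le0 mulrC ler_pdivrMr ?exprn_gt0// mul1r.
by rewrite mulr0 scale0r oppr0 scaler0.
Qed.

Lemma cutoffG_eq0r r x : 0 < r -> 2 * r ^+ 2 <= dot x x -> cutoffG r x = 0.
Proof.
move=> r0 xr; rewrite /cutoffG (max_r (x := 1 - sqpos _)) ?mulr0 ?scale0r//.
have h : 2 <= r ^- 2 * dot x x by rewrite mulrC ler_pdivlMr ?exprn_gt0.
by rewrite /sqpos max_l ?subr_le0 ?exprn_ege1//; lra.
Qed.

Lemma cubeC_dot r x : 0 < r -> ~ cube n (2 * r) x -> 2 * r ^+ 2 <= dot x x.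
Proof.
move=> r0 xr; have r20 : 0 < 2 * r by rewrite mulr_gt0.
have := cubeN xr (ltW r20) => h; apply: le_trans (sqr_norm_le_dot x).
have : (2 * r) ^+ 2 <= `|x| ^+ 2 by rewrite lerXn2r ?nnegrE ?(ltW r20)// ltW.
have := sqr_ge0 r; lra.
Qed.

(** Each derivative of [sqpos] is at most 2 here, and the remaining [r^-2 |2 x|] is at most [4 / r]
    on the cube of half-side [2 r]. *)
Lemma cutoffG_le r x : 0 < r -> `|cutoffG r x| <= 16 / r * \1_(cube n (2 * r)) x.
Proof.
move=> r0; rewrite indicE; have [xr|xr] := pselect (cube n (2 * r) x); last first.
  by rewrite memNset// mulr0 cutoffG_eq0r ?normr0//; exact: cubeC_dot.
rewrite mem_set// mulr1.
have [hx|hx] := leP (2 * r ^+ 2) (dot x x).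
  by rewrite cutoffG_eq0r// normr0 divr_ge0// ltW.
have r20 : 0 < r ^- 2 by rewrite invr_gt0 exprn_gt0.
have h : r ^- 2 * dot x x < 2 by rewrite mulrC ltr_pdivrMr ?exprn_gt0.
rewrite /cutoffG [leLHS]normrZ normrN [X in _ * X]normrZ [`|r ^- 2 *: _|]normrZ [`|2 *: x|]normrZ.
have m1 : `|2 * Num.max (1 - sqpos (r ^- 2 * dot x x - 1)) 0| <= 2.
  have l : Num.max (1 - sqpos (r ^- 2 * dot x x - 1)) 0 <= 1 by rewrite ge_max ler01 gerBl sqpos_ge0.
  have l0 : 0 <= Num.max (1 - sqpos (r ^- 2 * dot x x - 1)) 0 by rewrite le_max lexx orbT.
  by rewrite ger0_norm; lra.
have m2 : `|2 * Num.max (r ^- 2 * dot x x - 1) 0| <= 2.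
  have l : Num.max (r ^- 2 * dot x x - 1) 0 <= 1 by rewrite ge_max ler01 andbT; lra.
  have l0 : 0 <= Num.max (r ^- 2 * dot x x - 1) 0 by rewrite le_max lexx orbT.
  by rewrite ger0_norm; lra.
have m3 : `|r ^- 2| * (`|2 : R| * `|x|) <= 4 / r.
  have xr2 : `|x| <= 2 * r by apply: cube_norm_le => //; rewrite mulr_ge0// ltW.
  rewrite (gtr0_norm r20) (ger0_norm (ler0n _ 2)).
  have -> : 4 / r = r ^- 2 * (2 * (2 * r)) by field; rewrite gt_eqF.
  by rewrite ler_pM2l// ler_pM2l.
have -> : 16 / r = 2 * (2 * (4 / r)) by ring.
have h3 : 0 <= `|r ^- 2| * (`|2 : R| * `|x|) := mulr_ge0 (normr_ge0 _) (mulr_ge0 (normr_ge0 _) (normr_ge0 _)).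
exact: (ler_pM (normr_ge0 _) (mulr_ge0 (normr_ge0 _) h3) m1 (ler_pM (normr_ge0 _) h3 m2 m3)).
Qed.

End cutoff.

(** * Exhaustion of the space by cubes *)

Section exhaustion.
Variables (R : realType) (n : nat).
Local Notation mu := (lebesgue_rV R n).
Implicit Types (x : 'rV[R]_n) (f : 'rV[R]_n -> R).

Lemma on_cube_cvg f : measurable_fun setT f -> (forall x, 0 <= f x) ->
  (\int[mu]_x (on_cube k%:R f x)%:E @[k --> \oo] --> \int[mu]_x (f x)%:E)%E.
Proof.
move=> mf f0.
have cvl x : (on_cube k%:R f x)%:E @[k --> \oo] --> (f x)%:E.
  apply: cvg_EFin; first by near=> k.
  apply: cvg_near_cst; near=> k; rewrite /on_cube/= indicE mem_set ?mulr1//.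
  apply/cubeP => //; near: k; exact: nbhs_infty_ger.
have -> : (\int[mu]_x (f x)%:E = \int[mu]_x (limn (fun k => (on_cube k%:R f x)%:E)))%E.
  by apply: eq_integral => x _; rewrite (cvg_lim _ (cvl x)).
apply: cvg_monotone_convergence => //.
- by move=> k; apply/measurable_EFinP; exact: measurable_on_cube.
- by move=> k x _; rewrite lee_fin mulr_ge0.
- move=> x _ k l kl; rewrite lee_fin /on_cube ler_wpM2l// !indicE ler_nat.
  have [xk|xk] := pselect (cube n k%:R x); last by rewrite (memNset xk).
  rewrite !mem_set//; apply: sub_cube xk; by rewrite ler_nat.
Unshelve. all: by end_near.
Qed.

Lemma intg_of_cube_bound f (C : R) : loc_intg f -> (forall x, 0 <= f x) ->
  (forall k : nat, \int[mu]_x on_cube k%:R f x <= C) -> intg mu f.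
Proof.
move=> [mf If] f0 HC; have [] := @ge0_intg _ _ _ mu f C mf f0; last by [].
apply: (cvge_to_le (on_cube_cvg mf f0)).
by apply: nearW => k; rewrite -EFin_Rint// lee_fin.
Qed.

Lemma cube_tail f (e : R) : intg mu f -> (forall x, 0 <= f x) -> 0 < e ->
  exists k : nat, \int[mu]_x f x - \int[mu]_x on_cube k%:R f x <= e.
Proof.
move=> If f0 e0; have mf := intg_measurable If.
have Ik k : intg mu (on_cube k%:R f).
  apply: (intg_le (measurable_on_cube _ mf) _ If) => x.
  rewrite /on_cube ger0_norm ?mulr_ge0// ler_piMr// indicE; by case: (_ \in _).
have := on_cube_cvg mf f0; rewrite -(EFin_Rint If).
under eq_fun do rewrite -(EFin_Rint (Ik _)).
move/fine_cvgP => [_] /cvgrPdist_le/(_ _ e0)[k _ Hk].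
by exists k; have := Hk k (leqnn _); apply: le_trans; exact: ler_norm.
Qed.

End exhaustion.

(** * Caccioppoli inequality *)

Section absorption.
Variable R : realFieldType.

(** [X], [Y], [P], [J] are the integrals of the source, the energy, [|Du|^p] and [|grad z|^sg]. The
    hypotheses are the energy identity, stability and coercivity; [q' < q] bounds [X], then [P], by
    multiples of [t], and [e] is chosen with [c4 e <= 1/2] so that the part [e (P + X)] of [t] is
    absorbed. *)
Lemma absorption (X Y P J c1 c2 q q' cc C : R)
    (c3 := (q' * c1 + c2) / (q - q')) (c4 := c3 + (c3 + c1) / cc)
    (e := (2 * (c4 + 1))^-1) (t := e * (P + X) + C * J) :
  0 <= c1 -> 0 <= c2 -> 0 <= q' -> q' < q -> 0 < cc -> 0 <= X -> 0 <= P ->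
  Y <= X + c1 * t -> q * X <= q' * Y + c2 * t -> cc * P <= Y ->
  P + X <= 2 * c4 * C * J.
Proof.
move=> c10 c20 q'0 q'q cc0 X0 P0 h1 h3 h4.
have qq0 : 0 < q - q' by rewrite subr_gt0.
have c30 : 0 <= c3 := divr_ge0 (addr_ge0 (mulr_ge0 q'0 c10) c20) (ltW qq0).
have c40 : 0 <= c4 := addr_ge0 c30 (divr_ge0 (addr_ge0 c30 c10) (ltW cc0)).
have h5 : X <= c3 * t.
  rewrite /c3 mulrAC ler_pdivlMr//; have := ler_wpM2l q'0 h1; lra.
have h6 : P <= (c3 + c1) / cc * t by rewrite mulrAC ler_pdivlMr//; lra.
have h7 : P + X <= c4 * t by rewrite /c4; lra.
have h8 : c4 * (e * (P + X)) <= (P + X) / 2.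
  have -> : c4 * (e * (P + X)) = (P + X) / 2 * (c4 / (c4 + 1)).
    by rewrite /e; field; rewrite gt_eqF//; lra.
  apply: ler_piMr; first by rewrite divr_ge0// addr_ge0.
  by rewrite ler_pdivrMr; lra.
have h9 : c4 * t = c4 * (e * (P + X)) + c4 * C * J by rewrite /t; ring.
lra.
Qed.

End absorption.

Section caccioppoli.
Variables (R : realType) (n : nat) (p q CA : R).
Local Notation mu := (lebesgue_rV R n).
Variables (u : 'rV[R]_n -> R) (Du A : 'rV[R]_n -> 'rV[R]_n).
Implicit Types (x xi : 'rV[R]_n) (z eta : 'rV[R]_n -> R) (Gz Geta : 'rV[R]_n -> 'rV[R]_n).
Hypotheses (p2 : 2 <= p) (q1 : 1 < q) (CA0 : 0 < CA).
Hypothesis Su : approximable p u Du.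
Hypothesis bu : forall r : R, 0 <= r -> exists M : R, forall x, cube n r x -> `|u x| <= M.
Hypothesis mA : forall i, measurable_fun setT (fun xi => A xi ord0 i).
Hypothesis hA : forall xi, `|A xi| <= CA * `|xi| `^ (p - 1).
Hypothesis weak : forall phi, C1c setT phi ->
  \int[mu]_x (dot (A (Du x)) (grad phi x)) = \int[mu]_x (sgnpow q (u x) * phi x).

Definition total_energy x : R := `|Du x| `^ p + `|u x| `^ (q + 1).

Lemma total_energy_ge0 x : 0 <= total_energy x.
Proof. by rewrite addr_ge0 ?powR_ge0. Qed.

Lemma loc_intg_u_powR : loc_intg (fun x => `|u x| `^ (q + 1)).
Proof.
have q0 : 0 <= q + 1 by have := q1; lra.
apply: loc_intg_bounded; first exact: (measurable_powR_norm (q + 1) (measurable_u Su)).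
move=> r r0; have [M HM] := bu r0; exists (`|M| `^ (q + 1)) => x xr.
rewrite ger0_norm ?powR_ge0// ge0_ler_powR ?nnegrE// (le_trans (HM x xr))//.
exact: ler_norm.
Qed.

Lemma loc_intg_total_energy : loc_intg total_energy.
Proof. by have [_ _ _ ID _] := Su; exact: (loc_intgD ID loc_intg_u_powR). Qed.

Definition energy x : R := dot (A (Du x)) (Du x).

Lemma measurable_energy : measurable_fun setT energy.
Proof. exact: (measurable_rV_dot (measurable_flux_Du Su mA) (measurable_Du Su)). Qed.

Lemma energy_le x : `|energy x| <= n%:R * CA * `|Du x| `^ p.
Proof.
apply: (le_trans (dot_flux_le Du hA x (Du x))).
by rewrite mul_powRB1// (lt_le_trans _ p2).
Qed.

Lemma loc_intg_energy : loc_intg energy.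
Proof.
have [_ _ _ ID _] := Su.
exact: (loc_intg_le measurable_energy energy_le (loc_intgZ (n%:R * CA) ID)).
Qed.

Lemma energy_balance w Gw (r : R) : 0 <= r -> C1 w Gw ->
  (forall x, ~ cube n r x -> w x = 0 /\ Gw x = 0) ->
  [/\ intg mu (fun x => energy x * w x), intg mu (fun x => `|u x| `^ (q + 1) * w x),
      intg mu (fun x => u x * dot (A (Du x)) (Gw x)) &
      \int[mu]_x (energy x * w x) + \int[mu]_x (u x * dot (A (Du x)) (Gw x)) =
      \int[mu]_x (`|u x| `^ (q + 1) * w x)].
Proof.
move=> r0 wG w0; have [M M0 HM] := C1_cube_bounded r0 wG.
have [mw mGw] := C1_measurable wG.
have Ie : intg mu (fun x => energy x * w x).
  apply: (@intg_loc _ _ _ (fun x => n%:R * CA * `|Du x| `^ p) r M).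
  - exact: (measurable_funM measurable_energy mw).
  - by have [_ _ _ ID _] := Su; exact: loc_intgZ.
  - by move=> x /w0[-> _]; rewrite mulr0.
  - by move=> x xr; rewrite normrM mulrC ler_pM ?energy_le//; have [] := HM x xr.
have Iu : intg mu (fun x => `|u x| `^ (q + 1) * w x).
  apply: (@intg_loc _ _ _ (fun x => `|u x| `^ (q + 1)) r M).
  - exact: (measurable_funM loc_intg_u_powR.1 mw).
  - exact: loc_intg_u_powR.
  - by move=> x /w0[-> _]; rewrite mulr0.
  - move=> x xr; rewrite normrM mulrC (ger0_norm (powR_ge0 _ _)) ler_wpM2r ?powR_ge0//.
    by have [] := HM x xr.
have [IT _ _] := test_approximable p2 q1 CA0 Su bu mA hA weak Su r0 wG w0.
have Ig : intg mu (fun x => u x * dot (A (Du x)) (Gw x)).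
  apply: eq_intg (intgB IT Ie) => x; rewrite dotDr !dotZr /energy; ring.
split => //; have := energy_identity p2 q1 CA0 Su bu mA hA weak r0 wG w0.
rewrite -RintD// => <-; apply: eq_Rintegral => x _.
by rewrite dotDr !dotZr /energy; ring.
Qed.

(** The equation is tested with [z ^ (2 m)] and stability with [z ^ m]. The power is large enough,
    [2 m >= sg], for the factors of [z] lost by differentiation to be compensated in
    [weighted_young]. *)
Lemma caccioppoli (cc q' C2 : R) (m : nat) (K : set 'rV[R]_n) (sg := p * (q + 1) / (q + 1 - p)) :
  0 < cc -> (forall xi, cc * `|xi| `^ p <= dot (A xi) xi) -> 0 <= q' -> q' < q -> 0 <= C2 ->
  p < q + 1 -> (0 < m)%N -> sg <= (2 * m)%:R ->
  (forall (r : R) S eta Geta, 0 <= r -> closed S -> S `<=` cube n r -> S `<=` ~` K ->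
    C1 eta Geta -> (forall x, 0 <= eta x <= 1) -> (forall x, ~ S x -> eta x = 0 /\ Geta x = 0) ->
    intg mu (cutoff_error p u Du eta Geta) /\
    q * \int[mu]_x (`|u x| `^ (q + 1) * eta x ^+ 2) <=
      q' * \int[mu]_x (energy x * eta x ^+ 2) + C2 * \int[mu]_x cutoff_error p u Du eta Geta x) ->
  exists2 Cb : R, 0 <= Cb & forall (r : R) S z Gz, 0 <= r -> closed S -> S `<=` cube n r ->
    S `<=` ~` K -> C1 z Gz -> (forall x, 0 <= z x <= 1) ->
    (forall x, ~ S x -> z x = 0 /\ Gz x = 0) ->
    intg mu (fun x => `|Gz x| `^ sg) /\
    \int[mu]_x (total_energy x * (z x ^+ m) ^+ 2) <= Cb * \int[mu]_x `|Gz x| `^ sg.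
Proof.
move=> cc0 hc q'0 q'q C20 pq m0 sgm Hst.
have p0 : 0 < p by rewrite (lt_le_trans _ p2).
have n0 : 0 <= n%:R :> R by [].
pose mr : R := m%:R; have mr0 : 0 <= mr by [].
pose c1 := 2 * mr * (n%:R * CA); pose c2 := C2 * (mr + mr ^+ 2).
have c10 : 0 <= c1 by rewrite !mulr_ge0// ltW.
have c20 : 0 <= c2 by rewrite mulr_ge0// addr_ge0// sqr_ge0.
pose c3 := (q' * c1 + c2) / (q - q').
have qq0 : 0 < q - q' by rewrite subr_gt0.
have c30 : 0 <= c3 := divr_ge0 (addr_ge0 (mulr_ge0 q'0 c10) c20) (ltW qq0).
pose c4 := c3 + (c3 + c1) / cc.
have c40 : 0 <= c4 := addr_ge0 c30 (divr_ge0 (addr_ge0 c30 c10) (ltW cc0)).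
pose e := (2 * (c4 + 1))^-1.
have e0 : 0 < e by rewrite invr_gt0 mulr_gt0// ltr_wpDl.
have p1 : 1 <= p by rewrite (le_trans _ p2)// ler1n.
(* The exponent [j = 1] serves the cross term [|Du|^(p-1) |u| |grad z|], and [j = 2] below serves
   [|Du|^(p-2) |u|^2 |grad z|^2]. *)
have [Y1 Y10 H1] := weighted_young p0 pq ltr01 p1 sgm e0.
have [Y2 Y20 H2] := weighted_young p0 pq (ltr0Sn R 1) p2 sgm e0.
pose C := Y1 + Y2; have C0 : 0 <= C by rewrite addr_ge0.
exists (2 * c4 * C); first by rewrite !mulr_ge0.
move=> r S z Gz r0 cS Sr SK zG z01 z0.
have sg0 : 0 < sg.
  by apply: divr_gt0; [apply: mulr_gt0 => //; rewrite addr_gt0// (lt_trans _ q1)|rewrite subr_gt0].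
have z00 x : 0 <= z x by have /andP[] := z01 x.
have z1 x : z x <= 1 by have /andP[] := z01 x.
have [M M0 HM] := C1_cube_bounded r0 zG.
have [mz mGz] := C1_measurable zG.
have IJ : intg mu (fun x => `|Gz x| `^ sg).
  apply: (@intg_loc _ _ _ (cst 1) r (M `^ sg)).
  - exact: (measurable_powR_comp sg (measurable_rV_norm mGz)).
  - exact: loc_intg_cst.
  - move=> x xr; have [|_ ->] := z0 x; first by move=> /Sr.
    by rewrite normr0 powR0 ?gt_eqF.
  - move=> x xr; rewrite mulr1 ger0_norm ?powR_ge0// ge0_ler_powR ?nnegrE ?(ltW sg0) ?(ltW M0)//.
    by have [] := HM x xr.
split => //.
pose eta x := z x ^+ m; pose Geta x := (m%:R * z x ^+ m.-1) *: Gz x.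
have etaG : C1 eta Geta by exact: C1X.
have eta01 x : 0 <= eta x <= 1 by rewrite exprn_ge0//= exprn_ile1.
have eta0 x : ~ S x -> eta x = 0 /\ Geta x = 0.
  move=> /z0[e1 e2]; rewrite /eta /Geta e1 e2 scaler0; split => //.
  by rewrite expr0n/= gtn_eqF.
pose w x := eta x ^+ 2; pose Gw x := (2%:R * eta x ^+ 1) *: Geta x.
have wG : C1 w Gw by exact: (C1X 2 etaG).
have w0 x : ~ cube n r x -> w x = 0 /\ Gw x = 0.
  move=> xr; have [|e1 e2] := eta0 x; first by move=> /Sr.
  by rewrite /w /Gw e1 e2 expr0n/= scaler0.
have w_ge0 x : 0 <= w x by exact: sqr_ge0.
have [IY IX IG EB] := energy_balance r0 wG w0.
have [IE Hq] := Hst r S eta Geta r0 cS Sr SK etaG eta01 eta0.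
have [_ _ _ ID _] := Su.
have IP : intg mu (fun x => `|Du x| `^ p * w x).
  apply: (@intg_loc _ _ _ (fun x => `|Du x| `^ p) r 1) => //.
  - exact: (measurable_funM ID.1 (C1_measurable wG).1).
  - by move=> x /w0[-> _]; rewrite mulr0.
  - move=> x xr; rewrite (ger0_norm (mulr_ge0 (powR_ge0 _ _) (w_ge0 x))) mulrC.
    by apply: ler_wpM2r; rewrite ?powR_ge0// exprn_ile1//; have /andP[] := eta01 x.
pose X := \int[mu]_x (`|u x| `^ (q + 1) * w x).
pose Y := \int[mu]_x (energy x * w x).
pose P := \int[mu]_x (`|Du x| `^ p * w x).
pose J := \int[mu]_x `|Gz x| `^ sg.
have EF : \int[mu]_x (total_energy x * (z x ^+ m) ^+ 2) = P + X.
  by rewrite -RintD//; apply: eq_Rintegral => x _; rewrite mulrDl.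
have J0 : 0 <= J by apply: Rint_ge0 => x; exact: powR_ge0.
have P0 : 0 <= P by apply: Rint_ge0 => x; rewrite mulr_ge0 ?powR_ge0.
have X0 : 0 <= X by apply: Rint_ge0 => x; rewrite mulr_ge0 ?powR_ge0.
pose t := e * (P + X) + C * J.
have IF : intg mu (fun x => total_energy x * w x).
  by apply: eq_intg (intgD IP IX) => x; rewrite -mulrDl.
have It := intgD (intgZ e IF) (intgZ C IJ).
have Et : \int[mu]_x (e * (total_energy x * w x) + C * `|Gz x| `^ sg) = t.
  by rewrite (RintD (intgZ e IF) (intgZ C IJ)) (RintZ e IF) (RintZ C IJ) EF.
(* [T1] carries [z ^ (2 m - 1)] and [T2] carries [z ^ (2 m - 2)], the exponents [M - j] of
   [weighted_young] for [M = 2 m]. *)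
pose T1 x := `|Du x| `^ (p - 1) * `|u x| * `|Gz x| * (z x * (z x ^+ m.-1) ^+ 2).
pose T2 x := `|Du x| `^ (p - 2) * `|u x| ^+ 2 * `|Gz x| ^+ 2 * (z x ^+ m.-1) ^+ 2.
have wE x : w x = z x `^ (2 * m)%:R.
  by rewrite powR_mulrn// /w /eta -exprM mulnC.
have T1le x : T1 x <= e * (total_energy x * w x) + C * `|Gz x| `^ sg.
  have := H1 _ _ _ _ (normr_ge0 (Du x)) (normr_ge0 (u x)) (normr_ge0 (Gz x)) (z01 x).
  rewrite !powRr1//.
  have -> : z x `^ ((2 * m)%:R - 1) = z x * (z x ^+ m.-1) ^+ 2.
    have -> : (2 * m)%:R - 1 = (2 * m).-1%:R :> R by rewrite -subn1 natrB// muln_gt0.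
    rewrite powR_mulrn// -exprM -exprS; congr (_ ^+ _).
    by rewrite -[in LHS](prednK m0) mulnS mulnC.
  rewrite -wE [_ * w x]mulrC -/(total_energy x) [w x * _]mulrC => h; apply: (le_trans h).
  by rewrite lerD2l ler_wpM2r ?powR_ge0// lerDl.
have T2le x : T2 x <= e * (total_energy x * w x) + C * `|Gz x| `^ sg.
  have := H2 _ _ _ _ (normr_ge0 (Du x)) (normr_ge0 (u x)) (normr_ge0 (Gz x)) (z01 x).
  rewrite !(powR_mulrn 2)//.
  have -> : z x `^ ((2 * m)%:R - 2) = (z x ^+ m.-1) ^+ 2.
    have -> : (2 * m)%:R - 2 = (2 * m.-1)%:R :> R by rewrite -[in LHS](prednK m0) mulnS natrD; ring.
    by rewrite powR_mulrn// -exprM mulnC.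
  rewrite -wE [_ * w x]mulrC -/(total_energy x) [w x * _]mulrC => h; apply: (le_trans h).
  by rewrite lerD2l ler_wpM2r ?powR_ge0// lerDr.
have zm x : z x ^+ m = z x * z x ^+ m.-1 by rewrite -exprS prednK.
have h1 : Y <= X + c1 * t.
  have : `|\int[mu]_x (u x * dot (A (Du x)) (Gw x))| <=
      \int[mu]_x (c1 * (e * (total_energy x * w x) + C * `|Gz x| `^ sg)).
    apply: le_norm_Rint => //; first exact: intgZ.
    move=> x; apply: (@le_trans _ _ (c1 * T1 x)); last by rewrite ler_wpM2l.
    rewrite normrM; apply: (le_trans (ler_wpM2l (normr_ge0 _) (dot_flux_le Du hA x (Gw x)))).
    rewrite /Gw /Geta scalerA normrZ ger0_norm; last first.
      by rewrite !mulr_ge0 ?exprn_ge0.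
    by rewrite le_eqVlt; apply/orP; left; apply/eqP; rewrite /T1 /c1 /eta zm expr1 -/mr; ring.
  rewrite (RintZ c1 It) Et ler_norml => /andP[h _].
  have EB' : Y + \int[mu]_x (u x * dot (A (Du x)) (Gw x)) = X := EB.
  by rewrite -EB' -addrA lerDl -lerBlDr sub0r.
have h2 : \int[mu]_x cutoff_error p u Du eta Geta x <= (mr + mr ^+ 2) * t.
  rewrite -Et -(RintZ _ It); apply: le_Rint => //; first exact: intgZ.
  move=> x; apply: (@le_trans _ _ (mr * T1 x + mr ^+ 2 * T2 x)); last first.
    by rewrite mulrDl lerD// ler_wpM2l ?sqr_ge0.
  rewrite /cutoff_error /Geta normrZ ger0_norm; last by rewrite mulr_ge0 ?exprn_ge0.
  rewrite le_eqVlt; apply/orP; left; apply/eqP.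
  by rewrite /T1 /T2 -(powRB2_mul p2 (normr_ge0 (Du x))) /eta zm -/mr; ring.
have h3 : q * X <= q' * Y + c2 * t.
  apply: (le_trans Hq); rewrite lerD2l /c2 -mulrA ler_wpM2l//.
have h4 : cc * P <= Y.
  rewrite /P -RintZ//; apply: le_Rint => //; first exact: intgZ.
  by move=> x; rewrite mulrA ler_wpM2r// hc.
rewrite EF -/J; exact: (@absorption R X Y P J c1 c2 q q' cc C).
Qed.

End caccioppoli.

(** * Integrability of the total energy *)

Section global_energy.
Variables (R : realType) (n : nat) (p q CA : R).
Local Notation mu := (lebesgue_rV R n).
Variables (u : 'rV[R]_n -> R) (Du A : 'rV[R]_n -> 'rV[R]_n).
Implicit Types (x xi : 'rV[R]_n) (z eta : 'rV[R]_n -> R) (Gz Geta : 'rV[R]_n -> 'rV[R]_n).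
Hypotheses (p2 : 2 <= p) (q1 : 1 < q) (CA0 : 0 < CA).
Hypothesis Su : approximable p u Du.
Hypothesis bu : forall r : R, 0 <= r -> exists M : R, forall x, cube n r x -> `|u x| <= M.
Hypothesis mA : forall i, measurable_fun setT (fun xi => A xi ord0 i).
Hypothesis hA : forall xi, `|A xi| <= CA * `|xi| `^ (p - 1).
Hypothesis weak : forall phi, C1c setT phi ->
  \int[mu]_x (dot (A (Du x)) (grad phi x)) = \int[mu]_x (sgnpow q (u x) * phi x).

Local Notation total_energy := (total_energy p q u Du).

Lemma normrZ_le (c : R) (v : 'rV[R]_n) : 0 <= c <= 1 -> `|c *: v| <= `|v|.
Proof. by move=> /andP[c0 c1]; rewrite normrZ ger0_norm// ler_piMl. Qed.

Lemma cutoffG_powR_integral (r s : R) : 0 < r -> 0 < s ->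
  intg mu (fun x => `|cutoffG r x| `^ s) /\
  \int[mu]_x `|cutoffG r x| `^ s <= (16 / r) `^ s * (4 * r) ^+ n.
Proof.
move=> r0 s0; have [_ mG] := C1_measurable (@C1_cutoff R n r).
have c0 : 0 <= 16 / r by rewrite divr_ge0// ltW.
have le x : `|cutoffG r x| `^ s <= (16 / r) `^ s * \1_(cube n (2 * r)) x.
  have h := cutoffG_le x r0; move: h; rewrite indicE; case: (_ \in _) => /=.
    by rewrite !mulr1 => h; rewrite ge0_ler_powR ?nnegrE// ltW.
  by rewrite !mulr0 normr_le0 => /eqP->; rewrite normr0 powR0 ?gt_eqF.
have I1 := intg_indic_cube (R := R) n (2 * r).
have IG : intg mu (fun x => `|cutoffG r x| `^ s).
  apply: (intg_le (measurable_powR_comp s (measurable_rV_norm mG)) _ (intgZ ((16 / r) `^ s) I1)).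
  by move=> x; rewrite ger0_norm ?powR_ge0.
split => //; apply: (le_trans (le_Rint IG (intgZ ((16 / r) `^ s) I1) le)).
rewrite (RintZ _ I1) ler_wpM2l ?powR_ge0//.
have r20 : 0 <= 2 * r by rewrite mulr_ge0// ltW.
rewrite le_eqVlt; apply/orP; left; apply/eqP.
have -> : 4 * r = 2 * (2 * r) by ring.
apply: EFin_inj; rewrite EFin_Rint// -(@lebesgue_cube R n (2 * r) r20).
by rewrite integral_indic ?setIT//; exact: measurable_cube.
Qed.

(** The cut-off gradient at scale [r >= 1] contributes at most a constant times [r ^ (n - sg)],
    bounded because [n <= sg]; hence the energy on the cubes [k] is bounded independently of [k]. *)
Lemma total_energy_integrable (sg : R) (m : nat) (K : set 'rV[R]_n) : compact K ->
  n%:R <= sg -> 0 < sg -> (0 < m)%N ->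
  (exists2 Cb : R, 0 <= Cb & forall (r : R) S z Gz, 0 <= r -> closed S -> S `<=` cube n r ->
    S `<=` ~` K -> C1 z Gz -> (forall x, 0 <= z x <= 1) ->
    (forall x, ~ S x -> z x = 0 /\ Gz x = 0) ->
    intg mu (fun x => `|Gz x| `^ sg) /\
    \int[mu]_x (total_energy x * (z x ^+ m) ^+ 2) <= Cb * \int[mu]_x `|Gz x| `^ sg) ->
  intg mu total_energy.
Proof.
move=> cK nsg sg0 m0 [Cb Cb0 H].
have [r1 r10 Kr1] := compact_sub_cube cK.
have n0 : 0 <= n%:R :> R by [].
(* Large enough for the Euclidean ball of radius [r0] to contain the cube around [K]; the summand 1
   also makes [r0 >= 1]. *)
pose r0 : R := (n%:R + 1) * r1 + 1.
have r00 : 0 < r0 by rewrite ltr_wpDl// mulr_ge0 ?addr_ge0// ltW.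
have Kr x : K x -> dot x x < r0 ^+ 2.
  move=> /Kr1 xr; apply: (le_lt_trans (dot_le_sqr_norm x)).
  have xr1 := cube_norm_le (ltW r10) xr.
  apply: (@le_lt_trans _ _ (((n%:R + 1) * r1) ^+ 2)).
    rewrite exprMn ler_pM ?sqr_ge0//; last by rewrite lerXn2r ?nnegrE// ltW.
    by have := sqr_ge0 (n%:R : R); nra.
  by rewrite ltrXn2r ?nnegrE ?ltrDl ?mulr_ge0 ?addr_ge0 ?(ltW r10) ?(ltW r00).
have cbd (r : R) : 1 <= r -> \int[mu]_x `|cutoffG r x| `^ sg <= 16 `^ sg * 4 ^+ n.
  move=> r1'; have rp : 0 < r by rewrite (lt_le_trans _ r1').
  have [_ h] := cutoffG_powR_integral rp sg0; apply: (le_trans h).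
  rewrite powRM ?invr_ge0 ?(ltW rp)// exprMn -mulrA ler_wpM2l ?powR_ge0// mulrCA.
  rewrite -[leRHS]mulr1 ler_wpM2l ?exprn_ge0//.
  rewrite -powR_inv1 ?(ltW rp)// -powRrM -powR_mulrn ?(ltW rp)// -powRD ?(gt_eqF rp) ?implybT//.
  have h' : -1 * sg + n%:R <= 0 by rewrite mulN1r addrC subr_le0.
  by have := ler_powR r1' h'; rewrite powRr0.
have c0' : 0 <= 16 `^ sg * 4 ^+ n :> R by rewrite mulr_ge0 ?powR_ge0 ?exprn_ge0.
pose C0 := \int[mu]_x on_cube (2 * r0) total_energy x.
apply: (intg_of_cube_bound (loc_intg_total_energy q1 Su bu) (@total_energy_ge0 _ _ p q u Du)
  (C := Cb * (2 `^ sg * (16 `^ sg * 4 ^+ n + 16 `^ sg * 4 ^+ n)) + C0)) => k.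
(* The outer cut-off has to be 1 on the cube [k], whose points have Euclidean norm at most
   [(n + 1) k]. *)
pose r : R := (n%:R + 1) * k%:R + r0 + 1.
have nk0 : 0 <= (n%:R + 1) * k%:R :> R by rewrite mulr_ge0// addr_ge0.
have rr1 : 1 <= r by rewrite lerDr; exact: (addr_ge0 nk0 (ltW r00)).
have rp : 0 < r by rewrite (lt_le_trans _ rr1).
have r01 : 1 <= r0 by rewrite lerDr mulr_ge0// ?addr_ge0// ltW.
(* The factor [1 - cutoff r0] keeps the support away from [K], so that stability applies. *)
pose z x := (1 - cutoff r0 x) * cutoff r x.
pose Gz x := (1 - cutoff r0 x) *: cutoffG r x + cutoff r x *: (0 - cutoffG r0 x).
have zG : C1 z Gz := C1M (C1B (C1_cst n 1) (C1_cutoff n r0)) (C1_cutoff n r).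
have z01 x : 0 <= z x <= 1.
  rewrite mulr_ge0 ?cutoff_ge0 ?subr_ge0 ?cutoff_le1//=.
  by rewrite mulr_ile1 ?cutoff_ge0 ?subr_ge0 ?cutoff_le1// gerBl cutoff_ge0.
pose S := [set x : 'rV[R]_n | r0 ^+ 2 <= dot x x] `&` cube n (2 * r).
have cS : closed S.
  apply: closedI; last exact: closed_cube.
  apply: (@closed_comp _ _ (fun x : 'rV[R]_n => dot x x) [set t | r0 ^+ 2 <= t]) => [x _|]; last exact: closed_ge.
  by apply: dot_continuous; exact: cvg_id.
have SK : S `<=` ~` K by move=> x [/= h _] /Kr; rewrite ltNge h.
have zS x : ~ S x -> z x = 0 /\ Gz x = 0.
  move=> xS; rewrite /z /Gz; have [h|h] := leP (r0 ^+ 2) (dot x x).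
    have xr : ~ cube n (2 * r) x by move=> xr; apply: xS.
    have xd := cubeC_dot rp xr.
    by rewrite (cutoff_eq0 rp xd) (cutoffG_eq0r rp xd) scaler0 scale0r mulr0 addr0.
  by rewrite (cutoff_eq1 r00 (ltW h)) (cutoffG_eq0l r00 (ltW h)) subrr mul0r scale0r subr0 scaler0 addr0.
have r20 : 0 <= 2 * r by rewrite mulr_ge0// ltW.
have [IJ HJ] := H (2 * r) S z Gz r20 cS (@subIsetr _ _ _) SK zG z01 zS.
have [I1 _] := cutoffG_powR_integral rp sg0; have [I2 _] := cutoffG_powR_integral r00 sg0.
have Jle : \int[mu]_x `|Gz x| `^ sg <= 2 `^ sg * (16 `^ sg * 4 ^+ n + 16 `^ sg * 4 ^+ n).
  apply: (@le_trans _ _ (\int[mu]_x (2 `^ sg * (`|cutoffG r x| `^ sg + `|cutoffG r0 x| `^ sg)))).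
    apply: (le_Rint IJ (intgZ _ (intgD I1 I2))).
    move=> x; apply: (@le_trans _ _ ((`|cutoffG r x| + `|cutoffG r0 x|) `^ sg)).
      rewrite ge0_ler_powR ?nnegrE ?addr_ge0 ?(ltW sg0)//.
      apply: (le_trans (ler_normD _ _)); rewrite sub0r; apply: lerD.
        by apply: normrZ_le; rewrite subr_ge0 cutoff_le1 gerBl cutoff_ge0.
      by rewrite -(normrN (cutoffG r0 x)); apply: normrZ_le; rewrite cutoff_ge0 cutoff_le1.
    exact: (powRD_le (ltW sg0) (normr_ge0 _) (normr_ge0 _)).
  rewrite (RintZ _ (intgD I1 I2)) (RintD I1 I2) ler_wpM2l ?powR_ge0//.
  exact: (lerD (cbd _ rr1) (cbd _ r01)).
have [_ IE] := loc_intg_total_energy q1 Su bu.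
have IF : intg mu (fun x => total_energy x * (z x ^+ m) ^+ 2).
  apply: (@intg_loc _ _ _ total_energy (2 * r) 1).
  - apply: measurable_funM; first exact: (loc_intg_total_energy q1 Su bu).1.
    exact: (measurable_funX 2 (measurable_funX m (C1_measurable zG).1)).
  - exact: (loc_intg_total_energy q1 Su bu).
  - move=> x xr; have [|-> _] := zS x; first by move=> [].
    by rewrite expr0n/= gtn_eqF// expr0n/= mulr0.
  - move=> x xr; have /andP[z0 z1] := z01 x.
    rewrite (ger0_norm (mulr_ge0 (total_energy_ge0 p q u Du x) (sqr_ge0 _))) mulrC.
    by rewrite ler_wpM2r ?total_energy_ge0// !exprn_ile1 ?exprn_ge0.
(* The inner cube of half-side [2 r0], where [z] may be small, is charged to the fixed constant
   [C0]; on the rest of the cube [k] one has [z = 1]. *)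
apply: (@le_trans _ _ (\int[mu]_x (total_energy x * (z x ^+ m) ^+ 2 + on_cube (2 * r0) total_energy x))).
  apply: (le_Rint (IE _) (intgD IF (IE _))).
  move=> x; have t0 := total_energy_ge0 p q u Du x; have z2 := sqr_ge0 (z x ^+ m).
  have [xc|xc] := pselect (cube n (2 * r0) x).
    rewrite {2}/on_cube indicE mem_set// mulr1 -[leLHS]add0r; apply: lerD; first exact: (mulr_ge0 t0 z2).
    by rewrite /on_cube ler_piMr// indicE; case: (_ \in _).
  rewrite {2}/on_cube indicE memNset// mulr0 addr0 /on_cube ler_wpM2l// indicE.
  have [xk|xk] := pselect (cube n k%:R x); last by rewrite memNset.
  rewrite mem_set//.
  have b0 : cutoff r0 x = 0 by apply: cutoff_eq0 => //; exact: cubeC_dot.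
  have b1 : cutoff r x = 1.
    apply: cutoff_eq1 => //; apply: (le_trans (dot_le_sqr_norm x)).
    have xk' := cube_norm_le (ler0n R k) xk.
    apply: (@le_trans _ _ (((n%:R + 1) * k%:R) ^+ 2)).
      rewrite exprMn ler_pM ?sqr_ge0//; last by rewrite lerXn2r ?nnegrE.
      by have := sqr_ge0 (n%:R : R); nra.
    apply: (lerXn2r 2 nk0 (ltW rp)).
    by rewrite /r -addrA lerDl (addr_ge0 (ltW r00)).
  by rewrite /z b0 b1 subr0 mulr1 !expr1n.
rewrite (RintD IF (IE _)) lerD2r; apply: (le_trans HJ); exact: ler_wpM2l.
Qed.

End global_energy.

(** * Dilations *)

Section dilation.
Variables (R : realType) (n : nat).
Local Notation mu := (lebesgue_rV R n).
Implicit Types (x : 'rV[R]_n) (f g : 'rV[R]_n -> R) (l t s r : R).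

Lemma measurable_dilation l : measurable_fun setT (fun x : 'rV[R]_n => l *: x).
Proof.
apply: measurable_fun_rVP => i.
have -> : (fun x : 'rV[R]_n => (l *: x) ord0 i) = fun x => l * x ord0 i by apply/funext => x; rewrite mxE.
exact: (measurable_funM (measurable_cst l) (measurable_coord i)).
Qed.

Lemma measurable_comp_dilation f l : measurable_fun setT f -> measurable_fun setT (fun x => f (l *: x)).
Proof. by move=> mf; exact: (measurableT_comp mf (measurable_dilation l)). Qed.

Lemma ge0_integral_dilation f l : 0 < l -> measurable_fun setT f -> (forall x, 0 <= f x) ->
  (\int[mu]_x (f (l *: x))%:E = (l^-1 ^+ n)%:E * \int[mu]_x (f x)%:E)%E.
Proof.
move=> l0 mf f0; have ln0 : l != 0 by rewrite gt_eqF.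
have mf' : measurable_fun setT (EFin \o f) by apply/measurable_EFinP.
have f0' x : (0 <= (EFin \o f) x)%E by rewrite lee_fin.
have := ge0_integral_rV_affine (0 : 'rV[R]_n) ln0 mf' f0'; rewrite gtr0_norm// => <-.
by apply: eq_integral => x _; rewrite /= addr0.
Qed.

Lemma intg_dilation f l : 0 < l -> intg mu f -> (forall x, 0 <= f x) ->
  intg mu (fun x => f (l *: x)) /\ \int[mu]_x f (l *: x) = l^-1 ^+ n * \int[mu]_x f x.
Proof.
move=> l0 If f0; have mf := intg_measurable If.
have E := ge0_integral_dilation l0 mf f0; rewrite -(EFin_Rint If) in E.
have [I' _] : intg mu (fun x => f (l *: x)) /\ \int[mu]_x f (l *: x) <= l^-1 ^+ n * \int[mu]_x f x.
  by apply: ge0_intg => //; [exact: measurable_comp_dilation|rewrite E].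
by split => //; apply: EFin_inj; rewrite (EFin_Rint I') E.
Qed.

Lemma cube_dilation l r x : 0 < l <= 1 -> cube n r x -> cube n r (l *: x).
Proof.
move=> /andP[l0 l1] xr i; have := xr i; rewrite /= !in_itv/= mxE => /andP[h1 h2].
apply/andP; split; have [x0|x0] := leP 0 (x ord0 i); nra.
Qed.

Lemma on_cube_dilation_le f l r x : 0 < l <= 1 -> (forall x, 0 <= f x) ->
  on_cube r (fun x => f (l *: x)) x <= on_cube r f (l *: x).
Proof.
move=> l01 f0; rewrite /on_cube ler_wpM2l// !indicE.
have [xr|xr] := pselect (cube n r x); last by rewrite (memNset xr).
by rewrite !mem_set//; exact: cube_dilation.
Qed.

Lemma loc_intg_dilation f l : 0 < l <= 1 -> (forall x, 0 <= f x) -> loc_intg f ->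
  loc_intg (fun x => f (l *: x)) /\
  forall r, \int[mu]_x on_cube r (fun x => f (l *: x)) x <= l^-1 ^+ n * \int[mu]_x on_cube r f x.
Proof.
move=> l01 f0 [mf If]; have l0 : 0 < l by have /andP[] := l01.
have ge0 r x : 0 <= on_cube r f x by rewrite mulr_ge0.
have I' r : intg mu (on_cube r (fun x => f (l *: x))).
  apply: (intg_le _ _ (intg_dilation l0 (If r) (ge0 r)).1).
    by apply: measurable_on_cube; exact: measurable_comp_dilation.
  by move=> x; rewrite ger0_norm ?mulr_ge0// on_cube_dilation_le.
split; first by split => //; exact: measurable_comp_dilation.
move=> r; rewrite -(intg_dilation l0 (If r) (ge0 r)).2.
apply: le_Rint => //; first exact: (intg_dilation l0 (If r) (ge0 r)).1.
by move=> x; exact: on_cube_dilation_le.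
Qed.

Lemma approximable_dilation (p l : R) (z : 'rV[R]_n -> R) (Dz : 'rV[R]_n -> 'rV[R]_n) :
  1 <= p -> 0 < l <= 1 -> approximable p z Dz ->
  approximable p (fun x => z (l *: x)) (fun x => l *: Dz (l *: x)).
Proof.
move=> p1 l01 [Iz mz mDz IDz A]; have /andP[l0 l1] := l01.
have p0 : 0 <= p by lra.
have mDl i : measurable_fun setT (fun x => (l *: Dz (l *: x)) ord0 i).
  have -> : (fun x => (l *: Dz (l *: x)) ord0 i) = fun x => l * Dz (l *: x) ord0 i.
    by apply/funext => x; rewrite mxE.
  exact: (measurable_funM (measurable_cst l) (measurable_comp_dilation l (mDz i))).
have shrink (v : 'rV[R]_n) : `|l *: v| `^ p <= `|v| `^ p.
  by rewrite ge0_ler_powR ?nnegrE// normrZ gtr0_norm// ler_piMl.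
have ge0 (f : 'rV[R]_n -> R) x : 0 <= `|f x| `^ p by exact: powR_ge0.
split.
- by have [] := loc_intg_dilation l01 (ge0 z) Iz.
- exact: measurable_comp_dilation.
- exact: mDl.
- have [I' _] := loc_intg_dilation l01 (fun x => powR_ge0 `|Dz x| p) IDz.
  apply: (loc_intg_le _ _ I'); first exact: (measurable_powR_comp p (measurable_rV_norm mDl)).
  by move=> x; rewrite ger0_norm ?powR_ge0.
(* The factor [l ^+ n] compensates the Jacobian of the dilation. *)
move=> r d r0 d0; have d'0 : 0 < l ^+ n * d by rewrite mulr_gt0// exprn_gt0.
have [v [G [vG HvG]]] := A r _ r0 d'0.
have vlG : C1 (fun x => v (l *: x)) (fun x => l *: G (l *: x)).
  have := C1_affine l (0 : 'rV[R]_n) vG.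
  under eq_fun do rewrite addr0.
  by under [X in C1 _ X]eq_fun do rewrite addr0.
exists (fun x => v (l *: x)), (fun x => l *: G (l *: x)); split => //.
have IL := loc_intg_Lp_dist p1 Iz mz mDz IDz vG.
have L0 x : 0 <= Lp_dist p v G z Dz x by rewrite addr_ge0 ?powR_ge0.
have [I1 H1] := loc_intg_dilation l01 L0 IL.
have [I2 _] := loc_intg_dilation l01 (ge0 z) Iz.
have [I3 _] := loc_intg_dilation l01 (fun x => powR_ge0 `|Dz x| p) IDz.
have I4 : loc_intg (fun x => `|l *: Dz (l *: x)| `^ p).
  apply: (loc_intg_le _ _ I3); first exact: (measurable_powR_comp p (measurable_rV_norm mDl)).
  by move=> x; rewrite ger0_norm ?powR_ge0.
have I5 := loc_intg_Lp_dist p1 I2 (measurable_comp_dilation l mz) mDl I4 vlG.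
apply: (@le_trans _ _ (\int[mu]_x on_cube r (fun x => Lp_dist p v G z Dz (l *: x)) x)).
  apply: le_Rint; [exact: I5.2|exact: I1.2|move=> x].
  rewrite /on_cube ler_wpM2r// /Lp_dist lerD2l -scalerBr; exact: shrink.
apply: (le_trans (H1 r)); rewrite exprVn mulrC ler_pdivrMr ?exprn_gt0// mulrC.
exact: HvG.
Qed.

Local Notation lam := (@lebesgue_measure R).

(** The uniform probability density on [[l, 1]]. *)
Definition itv_weight l (s : R) : R := (1 - l)^-1 * \1_(`[l, 1%R]%classic) s.

Lemma itv_weightP l : l < 1 -> [/\ measurable_fun setT (itv_weight l), forall s, 0 <= itv_weight l s,
  intg lam (itv_weight l), \int[lam]_s itv_weight l s = 1 &
  (forall s, ~~ (l <= s <= 1) -> itv_weight l s = 0)].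
Proof.
move=> l1; have t0 : 0 < 1 - l by rewrite subr_gt0.
have mi : measurable (`[l, 1]%classic : set R) by exact: measurable_itv.
have m1 : measurable_fun setT (\1_(`[l, 1%R]%classic) : R -> R) by exact: measurable_indic.
have mI : lam `[l, 1]%classic = (1 - l)%:E by rewrite lebesgue_measure_itv/= lte_fin l1.
have E0 : (\int[lam]_s (\1_(`[l, 1%R]%classic) s : R)%:E = (1 - l)%:E)%E.
  by rewrite (integral_indic lam measurableT mi) setIT; exact: mI.
have [I1 _] : intg lam (\1_(`[l, 1%R]%classic) : R -> R) /\
    \int[lam]_s (\1_(`[l, 1%R]%classic) s : R) <= 1 - l.
  by apply: ge0_intg => //; rewrite E0.
split.
- exact: (measurable_funM (measurable_cst _) m1).
- by move=> s; rewrite mulr_ge0// invr_ge0 ltW.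
- exact: (intgZ (1 - l)^-1 I1).
- rewrite (RintZ _ I1) (_ : \int[lam]_s _ = 1 - l) ?mulVf ?gt_eqF//.
  by apply: EFin_inj; rewrite EFin_Rint.
- by move=> s sl; rewrite /itv_weight indicE memNset ?mulr0//= in_itv/=; exact/negP.
Qed.

(* Fundamental theorem of calculus along the segment from l x to x, then Jensen. *)
Lemma radial_increment_le (p l : R) v G x : 1 <= p -> 0 < l < 1 -> C1 v G ->
  ((`|v (l *: x) - v x| `^ p)%:E <= ((n%:R * `|x| * (1 - l)) `^ p)%:E *
    \int[lam]_s (`|G (s *: x)| `^ p * itv_weight l s)%:E)%E.
Proof.
move=> p1 /andP[l0 l1] vG; have p0 : 0 <= p by lra.
have t0 : 0 < 1 - l by rewrite subr_gt0.
have cG := vG.1.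
have cs : continuous (fun s : R => s *: x) by move=> s; exact: scalel_continuous.
pose phi s := v (s *: x); pose h s := dot (G (s *: x)) x.
have ch : continuous h.
  move=> s; apply: dot_continuous; last exact: cst_continuous.
  exact: (continuous_comp (cs s) (cG _)).
have dphi (s : R) : is_diff s phi (fun k => k * h s).
  apply: (is_diff_congr (is_diff_comp (is_diff_scalel s x) (vG.2 (s *: x)))) => // k.
  by rewrite /= dotZr.
have d1phi s : derivable phi s 1 by apply/derivable1_diffP; have [] := dphi s.
have phi' s : derive1 phi s = h s.
  have df : differentiable phi s by have [] := dphi s.
  by rewrite derive1E'// (@diff_val _ _ _ _ _ _ _ (dphi s)) mul1r.
have cphi : continuous phi by move=> s; apply: differentiable_continuous; have [] := dphi s.
have FTC : (\int[lam]_(s in `[l, 1%R]%classic) (h s)%:E = (phi 1)%:E - (phi l)%:E)%E.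
  apply: continuous_FTC2 => //.
  - exact: continuous_subspaceT.
  - split=> [s _||]; first exact: d1phi.
    + by apply: cvg_at_right_filter; exact: cphi.
    + by apply: cvg_at_left_filter; exact: cphi.
have [mk k0 Ik k1 koff] := itv_weightP l1.
set k := itv_weight l in mk k0 Ik k1 koff *.
have mh : measurable_fun setT h by exact: continuous_measurable_fun.
have [M [_ HM]] : exists M, M > 0 /\ forall s, l <= s <= 1 -> `|h s| <= M.
  have [c cin Hc] := EVT_max (ltW l1) (continuous_subspaceT (fun s => continuous_comp (ch s) (@norm_continuous _ _ _))).
  exists (`|h c| + 1); split; first by rewrite ltr_wpDl.
  by move=> s sl; have := Hc s; rewrite in_itv/= => /(_ sl) /= H; rewrite (le_trans H)// lerDl.
have Ihk : intg lam (fun s => h s * k s).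
  apply: (intg_le _ _ (intgZ M Ik)); first exact: (measurable_funM mh (intg_measurable Ik)).
  move=> s; rewrite normrM (ger0_norm (k0 s)).
  have [sl|sl] := boolP (l <= s <= 1); last by rewrite koff// !mulr0.
  by rewrite ler_wpM2r ?HM.
have Eh : phi 1 - phi l = (1 - l) * \int[lam]_s (h s * k s).
  rewrite -RintZ//; apply: EFin_inj; rewrite EFin_Rint; last exact: intgZ.
  rewrite EFinB -FTC [LHS]integral_mkcond; apply: eq_integral => s _.
  rewrite patchE /k /itv_weight indicE; case: ifP => _; last by rewrite !mulr0.
  by congr (_%:E); rewrite mulr1; field; rewrite gt_eqF.
have J := @jensen_powR _ _ _ lam p h k p1 k0 Ik k1 mh Ihk.
have -> : v (l *: x) - v x = - (phi 1 - phi l) by rewrite /phi scale1r opprB.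
rewrite normrN Eh normrM (gtr0_norm t0) powRM ?(ltW t0)// EFinM.
apply: (@le_trans _ _ (((1 - l) `^ p)%:E * \int[lam]_s (`|h s| `^ p * k s)%:E)%E).
  by apply: lee_wpmul2l => //; rewrite lee_fin powR_ge0.
have -> : (n%:R * `|x| * (1 - l)) `^ p = (1 - l) `^ p * (n%:R * `|x|) `^ p.
  by rewrite mulrC powRM ?mulr_ge0// ltW.
rewrite EFinM -muleA; apply: lee_wpmul2l; first by rewrite lee_fin powR_ge0.
have mGx : measurable_fun setT (fun s : R => `|G (s *: x)| `^ p * k s).
  apply: measurable_funM; last exact: intg_measurable Ik.
  apply: (measurableT_comp (measurable_powR p)); apply: continuous_measurable_fun => s.
  exact: (continuous_comp (continuous_comp (cs s) (cG _)) (@norm_continuous _ _ _)).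
rewrite -ge0_integralZl//; last 2 first.
- by apply/measurable_EFinP.
- by move=> s _; rewrite lee_fin mulr_ge0 ?powR_ge0 ?k0.
apply: ge0_le_integral => //.
- by move=> s _; rewrite lee_fin mulr_ge0 ?powR_ge0.
- apply/measurable_EFinP; apply: measurable_funM; last exact: intg_measurable Ik.
  exact: (measurableT_comp (measurable_powR p) (measurableT_comp (@normr_measurable R setT) mh)).
- by apply: measurable_funeM; apply/measurable_EFinP.
move=> s _; suff : `|h s| `^ p * k s <= (n%:R * `|x|) `^ p * (`|G (s *: x)| `^ p * k s) by [].
rewrite mulrA; apply: (ler_wpM2r (k0 s)); rewrite -powRM ?mulr_ge0//.
rewrite ge0_ler_powR ?nnegrE ?mulr_ge0//.
by rewrite (le_trans (normr_dot_le _ _))// mulrAC mulrA.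
Qed.

(** [radial_increment_le] is integrated over [D] and the order of integration exchanged. The
    substitution of [s x] by [x] costs [s^-n <= 2^n], as [s >= 1/2], and [D'] has to contain all the
    dilates [s D]. *)
Lemma C1_dilation_diff (p l rho : R) (D D' : set 'rV[R]_n) v G :
  1 <= p -> 1 / 2 <= l < 1 -> 0 <= rho -> measurable D -> measurable D' ->
  D `<=` cube n rho -> D' `<=` cube n rho ->
  (forall (s : R) x, l <= s <= 1 -> D x -> D' (s *: x)) -> C1 v G ->
  intg mu (fun x => `|v (l *: x) - v x| `^ p * \1_D x) /\
  \int[mu]_x (`|v (l *: x) - v x| `^ p * \1_D x) <=
    (n%:R * rho * (1 - l)) `^ p * 2 ^+ n * \int[mu]_x (`|G x| `^ p * \1_D' x).
Proof.
move=> p1 /andP[l2 l1] rho0 mD mD' Dr D'r DD' vG; have p0 : 0 <= p by lra.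
have l0 : 0 < l by lra.
have t0 : 0 < 1 - l by rewrite subr_gt0.
have [mv mG] := C1_measurable vG; have mGn := measurable_powR_comp p (measurable_rV_norm mG).
have mi (E : set 'rV[R]_n) : measurable E -> measurable_fun setT (\1_E : 'rV[R]_n -> R).
  by move=> mE; exact: measurable_indic.
pose g x := `|G x| `^ p * \1_D' x.
have g0 x : 0 <= g x by rewrite mulr_ge0 ?powR_ge0.
have mg : measurable_fun setT g by exact: (measurable_funM mGn (mi _ mD')).
have Ig : intg mu g.
  have [M M0 HM] := C1_cube_bounded rho0 vG.
  apply: (@intg_loc _ _ _ (cst 1) rho (M `^ p)) => //.
  - exact: loc_intg_cst.
  - by move=> x xr; rewrite /g indicE memNset ?mulr0// => /D'r.
  - move=> x xr; rewrite mulr1 ger0_norm ?g0// -[leRHS]mulr1 ler_pM ?powR_ge0//.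
    by rewrite ge0_ler_powR ?nnegrE ?(ltW M0)//; have [] := HM x xr.
have [mk k0 Ik k1 koff] := itv_weightP l1.
set k := itv_weight l in mk k0 Ik k1 koff *.
have Ek : (\int[lam]_s (k s)%:E = 1%:E)%E by rewrite -(EFin_Rint Ik) k1.
set c := (n%:R * rho * (1 - l)) `^ p.
have c0 : 0 <= c by exact: powR_ge0.
have mcomp : measurable_fun setT (fun z : 'rV[R]_n * R => z.2 *: z.1).
  apply: measurable_fun_rVP => i.
  have -> : (fun z : 'rV[R]_n * R => (z.2 *: z.1) ord0 i) = fun z => z.2 * z.1 ord0 i.
    by apply/funext => z; rewrite mxE.
  exact: (measurable_funM measurable_snd (measurableT_comp (measurable_coord i) measurable_fst)).
pose f (z : 'rV[R]_n * R) : R := g (z.2 *: z.1) * k z.2.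
have f0 z : (0 <= (f z)%:E)%E by rewrite lee_fin mulr_ge0.
have mf : measurable_fun setT (fun z => (f z)%:E).
  apply/measurable_EFinP.
  exact: (measurable_funM (measurableT_comp mg mcomp) (measurableT_comp mk measurable_snd)).
have pt x : ((`|v (l *: x) - v x| `^ p * \1_D x)%:E <= c%:E * \int[lam]_s (f (x, s))%:E)%E.
  rewrite indicE; have [xD|xD] := pselect (D x); last first.
    rewrite memNset// mulr0 mule_ge0// ?lee_fin//.
    by apply: integral_ge0 => s _; exact: f0.
  rewrite mem_set// mulr1.
  have l01 : 0 < l < 1 by rewrite l0.
  apply: (le_trans (radial_increment_le x p1 l01 vG)).
  have xr := cube_norm_le rho0 (Dr x xD).
  apply: lee_pmul => //.
  - by rewrite lee_fin powR_ge0.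
  - by apply: integral_ge0 => s _; rewrite lee_fin mulr_ge0 ?powR_ge0// k0.
  - rewrite lee_fin ge0_ler_powR ?nnegrE ?mulr_ge0 ?(ltW t0)//.
    by rewrite ler_wpM2r ?(ltW t0)// ler_wpM2l.
  have mx : measurable_fun setT (fun s : R => (x, s)) by exact: measurable_pair1.
  apply: ge0_le_integral => //.
  - by move=> s _; rewrite lee_fin mulr_ge0 ?powR_ge0// k0.
  - apply/measurable_EFinP; apply: (measurable_funM _ mk).
    exact: (measurableT_comp mGn (measurableT_comp mcomp mx)).
  - exact: (measurableT_comp mf mx).
  move=> s _; suff : `|G (s *: x)| `^ p * k s <= f (x, s) by [].
  rewrite /f /g /=; have [sl|sl] := boolP (l <= s <= 1); last by rewrite koff// !mulr0.
  by rewrite indicE (mem_set (DD' _ _ sl xD)) mulr1.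
have main : (\int[mu]_x (`|v (l *: x) - v x| `^ p * \1_D x)%:E <= (c * 2 ^+ n * \int[mu]_x g x)%:E)%E.
  have mF : measurable_fun setT (fun x => \int[lam]_s (f (x, s))%:E)%E.
    exact: (measurable_fun_fubini_tonelli_F (m2 := lam) _ mf f0).
  have F0 x : (0 <= \int[lam]_s (f (x, s))%:E)%E by apply: integral_ge0 => s _; exact: f0.
  apply: (@le_trans _ _ (\int[mu]_x (c%:E * \int[lam]_s (f (x, s))%:E))%E).
    apply: ge0_le_integral => //.
    - apply/measurable_EFinP; apply: (measurable_funM _ (mi _ mD)).
      apply: measurable_powR_norm; apply: measurable_funB => //.
      exact: measurable_comp_dilation.
    - exact: measurable_funeM.
  rewrite ge0_integralZl//.
  rewrite (fubini_tonelli (m1 := mu) (m2 := lam) _ mf f0)/=.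
  rewrite -mulrA EFinM; apply: lee_wpmul2l; first by rewrite lee_fin.
  have inner s : (\int[mu]_x (f (x, s))%:E <= (k s)%:E * (2 ^+ n * \int[mu]_x g x)%:E)%E.
    rewrite /f/=; have [ks|ks] := eqVneq (k s) 0.
      rewrite ks mul0e; under eq_integral do rewrite mulr0.
      by rewrite integral0.
    have sl : l <= s <= 1.
      by apply: contraNT ks => sl; rewrite koff.
    have s0 : 0 < s by move: sl => /andP[h _]; lra.
    under eq_integral do rewrite mulrC EFinM.
    rewrite ge0_integralZl//; last 3 first.
    - by apply/measurable_EFinP; exact: measurable_comp_dilation.
    - by move=> x _; rewrite lee_fin.
    - by rewrite lee_fin.
    apply: lee_wpmul2l; first by rewrite lee_fin.
    rewrite ge0_integral_dilation// -(EFin_Rint Ig) -EFinM lee_fin.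
    apply: ler_wpM2r; first exact: Rint_ge0.
    rewrite lerXn2r ?nnegrE ?invr_ge0 ?(ltW s0)//.
    rewrite -[leRHS]invrK lef_pV2 ?posrE ?invr_gt0//.
    by move: sl => /andP[h _]; lra.
  apply: (@le_trans _ _ (\int[lam]_s ((2 ^+ n * \int[mu]_x g x)%:E * (k s)%:E))%E).
    apply: ge0_le_integral => //.
    - by move=> s _; apply: integral_ge0 => x _; exact: f0.
    - exact: (measurable_fun_fubini_tonelli_G (m1 := mu) _ mf f0).
    - by apply: measurable_funeM; apply/measurable_EFinP.
    - by move=> s _; rewrite muleC; exact: inner.
  rewrite ge0_integralZl//; last 3 first.
  - by apply/measurable_EFinP.
  - by move=> s _; rewrite lee_fin.
  - by rewrite lee_fin mulr_ge0 ?exprn_ge0//; exact: Rint_ge0.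
  by rewrite Ek mule1.
apply: ge0_intg main.
- apply: (measurable_funM _ (mi _ mD)).
  by apply: measurable_powR_norm; apply: measurable_funB => //; exact: measurable_comp_dilation.
- by move=> x; rewrite mulr_ge0 ?powR_ge0.
Qed.

End dilation.

Section dilation_difference.
Variables (R : realType) (n : nat).
Local Notation mu := (lebesgue_rV R n).
Implicit Types (x : 'rV[R]_n).

(** Passage from [C1_dilation_diff] to Sobolev functions. Two triangle inequalities on the left and
    one on the right, each costing [2 ^ p], account for the cube. *)
Lemma dilation_diff (p l rho : R) (D D' : set 'rV[R]_n) (z : 'rV[R]_n -> R) (Dz : 'rV[R]_n -> 'rV[R]_n) :
  1 <= p -> 1 / 2 <= l < 1 -> 0 <= rho -> measurable D -> measurable D' ->
  D `<=` cube n rho -> D' `<=` cube n rho ->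
  (forall (s : R) x, l <= s <= 1 -> D x -> D' (s *: x)) -> approximable p z Dz ->
  intg mu (fun x => `|z (l *: x) - z x| `^ p * \1_D x) /\
  \int[mu]_x (`|z (l *: x) - z x| `^ p * \1_D x) <=
    (2 `^ p) ^+ 3 * 2 ^+ n * (n%:R * rho * (1 - l)) `^ p * \int[mu]_x (`|Dz x| `^ p * \1_D' x).
Proof.
move=> p1 l21 rho0 mD mD' Dr D'r DD' Sz; have [Iz mz mDz IDz A] := Sz.
have /andP[l2 l1] := l21; have p0 : 0 <= p by lra.
have l0 : 0 < l by lra.
have l01 : 0 < l <= 1 by rewrite l0 ltW.
have mi (E : set 'rV[R]_n) : measurable E -> measurable_fun setT (\1_E : 'rV[R]_n -> R).
  by move=> mE; exact: measurable_indic.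
have i1 (E : set 'rV[R]_n) x : (\1_E x : R) <= 1 by rewrite indicE; case: (_ \in _).
have ion (E : set 'rV[R]_n) x : E `<=` cube n rho -> (\1_E x : R) <= \1_(cube n rho) x.
  move=> Er; rewrite !indicE; have [xE|xE] := pselect (E x); last by rewrite (memNset xE).
  by rewrite !mem_set//; exact: Er.
have mzl := measurable_comp_dilation l mz.
have IDz' : intg mu (fun x => `|Dz x| `^ p * \1_D' x).
  apply: (intg_le _ _ (IDz.2 rho)); first exact: (measurable_funM IDz.1 (mi _ mD')).
  by move=> x; rewrite ger0_norm ?mulr_ge0 ?powR_ge0// ler_wpM2l ?powR_ge0// ion.
have Izl : intg mu (fun x => `|z (l *: x) - z x| `^ p * \1_D x).
  have [Il _] := loc_intg_dilation l01 (fun x => powR_ge0 `|z x| p) Iz.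
  apply: (intg_le _ _ (intgZ (2 `^ p) ((loc_intgD Il Iz).2 rho))).
    exact: (measurable_funM (measurable_powR_norm p (measurable_funB mzl mz)) (mi _ mD)).
  move=> x; rewrite ger0_norm ?mulr_ge0 ?powR_ge0// /on_cube mulrA.
  apply: ler_pM => //; rewrite ?powR_ge0 ?ion//.
  apply: le_trans (powRD_le p0 (normr_ge0 _) (normr_ge0 _)).
  by rewrite ge0_ler_powR ?nnegrE ?addr_ge0 ?ler_normB.
split => //.
pose c := (n%:R * rho * (1 - l)) `^ p; have c0 : 0 <= c by exact: powR_ge0.
pose T : R := 2 `^ p; have T0 : 0 < T by exact: powR_gt0.
pose Y := \int[mu]_x (`|Dz x| `^ p * \1_D' x).
(* The coefficient with which the approximation error enters the final estimate. *)
pose K := T * 2 ^+ n + T ^+ 3 * 2 ^+ n * c + T ^+ 2.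
have q0 : 0 <= 2 ^+ n :> R by exact: exprn_ge0.
have K0 : 0 <= K by rewrite !addr_ge0 ?mulr_ge0 ?exprn_ge0 ?(ltW T0).
apply/ler_addgt0Pl => e e0.
have e1 : 0 < e / (K + 1) by rewrite divr_gt0// ltr_wpDl.
have [v [G [vG HvG]]] := A rho _ rho0 e1.
have IL := loc_intg_Lp_dist p1 Iz mz mDz IDz vG.
have L0 x : 0 <= Lp_dist p v G z Dz x by rewrite addr_ge0 ?powR_ge0.
have [Idl Hdl] := loc_intg_dilation l01 L0 IL.
have [Iv Hv] := C1_dilation_diff p1 l21 rho0 mD mD' Dr D'r DD' vG.
pose B1 := on_cube rho (fun x => Lp_dist p v G z Dz (l *: x)).
pose B2 := on_cube rho (Lp_dist p v G z Dz).
have I1 : intg mu B1 := Idl.2 rho.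
have I2 : intg mu B2 := IL.2 rho.
have H1 : \int[mu]_x B1 x <= 2 ^+ n * (e / (K + 1)).
  apply: (le_trans (Hdl rho)); rewrite ler_pM//.
  - by rewrite exprn_ge0// invr_ge0 ltW.
  - by apply: Rint_ge0 => x; rewrite mulr_ge0.
  - rewrite lerXn2r ?nnegrE ?invr_ge0 ?(ltW l0)//.
    by rewrite -[leRHS]invrK lef_pV2 ?posrE ?invr_gt0//; lra.
have IG : intg mu (fun x => `|G x| `^ p * \1_D' x).
  have [M M0 HM] := C1_cube_bounded rho0 vG.
  apply: (@intg_loc _ _ _ (cst 1) rho (M `^ p)) => //.
  - exact: (measurable_funM (measurable_powR_comp p (measurable_rV_norm (C1_measurable vG).2)) (mi _ mD')).
  - exact: loc_intg_cst.
  - by move=> x xr; rewrite indicE memNset ?mulr0// => /D'r.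
  - move=> x xr; rewrite mulr1 ger0_norm ?mulr_ge0 ?powR_ge0// -[leRHS]mulr1 ler_pM ?powR_ge0//.
    by rewrite ge0_ler_powR ?nnegrE ?(ltW M0)//; have [] := HM x xr.
have HG : \int[mu]_x (`|G x| `^ p * \1_D' x) <= T * (Y + e / (K + 1)).
  apply: (@le_trans _ _ (\int[mu]_x (T * (`|Dz x| `^ p * \1_D' x + B2 x)))).
    apply: (le_Rint IG (intgZ T (intgD IDz' I2))) => x.
    apply: (@le_trans _ _ (T * (`|Dz x| `^ p + `|G x - Dz x| `^ p) * \1_D' x)).
      rewrite ler_wpM2r//; apply: le_trans (powRD_le p0 (normr_ge0 _) (normr_ge0 _)).
      by rewrite ge0_ler_powR ?nnegrE ?addr_ge0// -{1}(subrKC (Dz x) (G x)) ler_normD.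
    rewrite -mulrA; apply: (ler_wpM2l (ltW T0)); rewrite mulrDl lerD2l /B2 /on_cube.
    by rewrite ler_pM ?powR_ge0 ?ion// lerDr powR_ge0.
  rewrite (RintZ T (intgD IDz' I2)) (RintD IDz' I2) ler_wpM2l ?(ltW T0)// lerD2l.
  exact: HvG.
apply: (@le_trans _ _ (\int[mu]_x (T * (B1 x + T * (`|v (l *: x) - v x| `^ p * \1_D x + B2 x))))).
  apply: (le_Rint Izl (intgZ T (intgD I1 (intgZ T (intgD Iv I2))))) => x.
  have pd (a b d : R) : 0 <= a -> 0 <= b -> 0 <= d -> d <= a + b -> d `^ p <= T * (a `^ p + b `^ p).
    move=> a0 b0 d0 dab; apply: le_trans (powRD_le p0 a0 b0).
    by rewrite ge0_ler_powR ?nnegrE ?addr_ge0.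
  have s1 : `|z (l *: x) - z x| <= `|v (l *: x) - z (l *: x)| + (`|v (l *: x) - v x| + `|v x - z x|).
    rewrite (distrC (v (l *: x)) (z _)).
    have -> : z (l *: x) - z x = (z (l *: x) - v (l *: x)) + ((v (l *: x) - v x) + (v x - z x)) by ring.
    by rewrite (le_trans (ler_normD _ _))// lerD2l ler_normD.
  have h1 := pd _ _ _ (normr_ge0 _) (addr_ge0 (normr_ge0 _) (normr_ge0 _)) (normr_ge0 _) s1.
  have h2 := pd _ _ _ (normr_ge0 (v (l *: x) - v x)) (normr_ge0 (v x - z x)) (addr_ge0 (normr_ge0 _) (normr_ge0 _)) (lexx _).
  have h3 : `|v (l *: x) - z (l *: x)| `^ p * \1_D x <= B1 x.
    by rewrite /B1 /on_cube ler_pM ?powR_ge0 ?ion// lerDl powR_ge0.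
  have h4 : `|v x - z x| `^ p * \1_D x <= B2 x.
    by rewrite /B2 /on_cube ler_pM ?powR_ge0 ?ion// lerDl powR_ge0.
  apply: (le_trans (ler_wpM2r (_ : 0 <= \1_D x) h1)) => //.
  rewrite -mulrA; apply: (ler_wpM2l (ltW T0)); rewrite mulrDl lerD//.
  apply: (le_trans (ler_wpM2r (_ : 0 <= \1_D x) h2)) => //.
  by rewrite -mulrA; apply: (ler_wpM2l (ltW T0)); rewrite mulrDl lerD2l.
rewrite (RintZ T (intgD I1 (intgZ T (intgD Iv I2)))) (RintD I1 (intgZ T (intgD Iv I2))).
rewrite (RintZ T (intgD Iv I2)) (RintD Iv I2).
have Hv' : \int[mu]_x (`|v (l *: x) - v x| `^ p * \1_D x) <= c * 2 ^+ n * (T * (Y + e / (K + 1))).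
  by apply: (le_trans Hv); apply: ler_wpM2l => //; exact: mulr_ge0.
have S1 : T * (\int[mu]_x B1 x + T * (\int[mu]_x (`|v (l *: x) - v x| `^ p * \1_D x) + \int[mu]_x B2 x)) <=
   T * (2 ^+ n * (e / (K + 1)) + T * (c * 2 ^+ n * (T * (Y + e / (K + 1))) + e / (K + 1))).
  by apply: (ler_wpM2l (ltW T0)); apply: lerD => //; apply: (ler_wpM2l (ltW T0)); exact: lerD.
apply: (le_trans S1).
have -> : T * (2 ^+ n * (e / (K + 1)) + T * (c * 2 ^+ n * (T * (Y + e / (K + 1))) + e / (K + 1))) =
   K * (e / (K + 1)) + T ^+ 3 * 2 ^+ n * c * Y by rewrite /K; ring.
rewrite lerD2r mulrCA ler_piMr ?(ltW e0)// ler_pdivrMr ?ltr_wpDl// mul1r.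
by rewrite lerDl.
Qed.

End dilation_difference.

(** * Pohozaev inequality *)

Section annulus.
Variables (R : realType) (n : nat).
Local Notation mu := (lebesgue_rV R n).
Implicit Types (x : 'rV[R]_n) (r t : R).

(** The Euclidean ball of radius [sqrt 2 * r], outside which [cutoff r] vanishes. *)
Definition disc r : set 'rV[R]_n := [set x | dot x x <= 2 * r ^+ 2].
Definition outer_annulus r : set 'rV[R]_n := [set x | r ^+ 2 <= dot x x <= 2 * r ^+ 2].
(** The shell [outer_annulus] carries the gradient of the cut-off; the inner radius is halved here
    so that all dilates by factors in [[1/2, 1]] of that shell remain inside. *)
Definition annulus r : set 'rV[R]_n := [set x | r ^+ 2 / 4 <= dot x x <= 2 * r ^+ 2].

Lemma measurable_sqnorm : measurable_fun setT (fun x => dot x x).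
Proof. by apply: measurable_rV_dot => i; exact: measurable_coord. Qed.

Lemma measurable_sqnorm_itv (i : interval R) : measurable [set x : 'rV[R]_n | dot x x \in i].
Proof. by have := measurable_sqnorm measurableT (measurable_itv i); rewrite setTI. Qed.

Lemma measurable_disc r : measurable (disc r).
Proof.
by have := measurable_sqnorm_itv `]-oo, 2 * r ^+ 2]; under eq_set do rewrite in_itv.
Qed.

Lemma measurable_outer_annulus r : measurable (outer_annulus r).
Proof.
by have := measurable_sqnorm_itv `[r ^+ 2, 2 * r ^+ 2]; under eq_set do rewrite in_itv.
Qed.

Lemma measurable_annulus r : measurable (annulus r).
Proof.
by have := measurable_sqnorm_itv `[r ^+ 2 / 4, 2 * r ^+ 2]; under eq_set do rewrite in_itv.
Qed.

Lemma sub_disc_cube r : 0 <= r -> disc r `<=` cube n (2 * r).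
Proof.
move=> r0 x; rewrite /disc /= => h; apply/cubeP; first by rewrite mulr_ge0.
have h1 := sqr_norm_le_dot x; rewrite -(@ler_sqr _ `|x|) ?nnegrE ?mulr_ge0//.
have := sqr_ge0 r; have -> : (2 * r) ^+ 2 = 4 * r ^+ 2 by ring.
by lra.
Qed.

Lemma sub_annulus_disc r : annulus r `<=` disc r.
Proof. by move=> x /= /andP[]. Qed.

Lemma sub_outer_annulus r : outer_annulus r `<=` annulus r.
Proof.
by move=> x /andP[h1 h2]; apply/andP; split => //; have := sqr_ge0 r; lra.
Qed.

Lemma dotZZ (s : R) x : dot (s *: x) (s *: x) = s ^+ 2 * dot x x.
Proof. by rewrite dotZl dotZr; ring. Qed.

Lemma disc_dilation r (s : R) x : 0 <= s <= 1 -> disc r x -> disc r (s *: x).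
Proof.
move=> /andP[s0 s1]; rewrite /disc /= dotZZ; apply: le_trans.
by rewrite ler_piMl ?dot_ge0// exprn_ile1.
Qed.

Lemma annulus_dilation r (s : R) x : 1 / 2 <= s <= 1 -> outer_annulus r x -> annulus r (s *: x).
Proof.
move=> /andP[s0 s1] /andP[h1 h2].
have s00 : 0 <= s by apply: le_trans s0; lra.
apply/andP; split; last by apply: disc_dilation => //; rewrite s00.
rewrite /= dotZZ; have : (1 / 2) ^+ 2 <= s ^+ 2 by rewrite ler_sqr ?nnegrE//; lra.
move=> h3; have := ler_pM (sqr_ge0 (1 / 2 : R)) (sqr_ge0 r) h3 h1.
by have -> : (1 / 2) ^+ 2 * r ^+ 2 = r ^+ 2 / 4 by field.
Qed.

Lemma cutoff_support r x : 0 < r -> ~ cube n (2 * r) x -> cutoff r x = 0 /\ cutoffG r x = 0.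
Proof. by move=> r0 /(cubeC_dot r0) h; rewrite cutoff_eq0 ?cutoffG_eq0r. Qed.

Lemma indic_real_ge0 (D : set 'rV[R]_n) x : 0 <= \1_D x :> R.
Proof. by rewrite indicE; case: (_ \in _). Qed.

Lemma normr_cutoffG_le r x : 0 < r -> `|cutoffG r x| <= 16 / r * \1_(outer_annulus r) x.
Proof.
move=> r0; have r16 : 0 <= 16 / r by rewrite divr_ge0 ?ltW.
case: (leP (r ^+ 2) (dot x x)) => h1; last first.
  have -> : `|cutoffG r x| = 0 :> R by rewrite cutoffG_eq0l ?ltW// normr0.
  by apply: (mulr_ge0 r16); exact: indic_real_ge0.
case: (leP (dot x x) (2 * r ^+ 2)) => h2; last first.
  have -> : `|cutoffG r x| = 0 :> R by rewrite cutoffG_eq0r ?ltW// normr0.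
  by apply: (mulr_ge0 r16); exact: indic_real_ge0.
have -> : \1_(outer_annulus r) x = 1 :> R by rewrite indicE mem_set//; apply/andP.
apply: (le_trans (cutoffG_le x r0)); apply: ler_wpM2l; first by rewrite divr_ge0 ?ltW.
by rewrite indicE; case: (_ \in _).
Qed.

Lemma cutoff_le_disc r x : 0 < r -> cutoff r x <= \1_(disc r) x.
Proof.
move=> r0; rewrite indicE; case: (asboolP (disc r x)) => h.
  by rewrite mem_set//; exact: cutoff_le1.
rewrite memNset// cutoff_eq0//; move/negP: h; rewrite -ltNge; exact: ltW.
Qed.

Lemma cutoff_dilation_ge r t x : 0 < r -> 0 < t <= 1 / 2 -> cutoff r x <= cutoff r ((1 - t) *: x).
Proof.
move=> r0 /andP[t0 t1]; apply: step_nonincr; apply: ler_wpM2l.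
  by rewrite invr_ge0 exprn_ge0// ltW.
by rewrite dotZZ ler_piMl ?dot_ge0// exprn_ile1//; lra.
Qed.

(** For [t <= 1/2] the argument of [step] is multiplied by [k <= 1 + 8 t], hence grows by at most
    [16 t] where it is at most 2, and [step] is 4-Lipschitz. Outside the annulus nothing is lost:
    below [1/4] the factor [k <= 4] keeps the argument at most 1, and beyond 2 the cut-off is
    already 0. *)
Lemma cutoff_expansion_ge r t x : 0 < r -> 0 < t <= 1 / 2 ->
  cutoff r x - 64 * t * \1_(annulus r) x <= cutoff r ((1 - t)^-1 *: x).
Proof.
move=> r0 /andP[t0 t1]; have l0 : 0 < 1 - t by lra.
have r2 : 0 < r ^+ 2 by rewrite exprn_gt0.
set s : R := r ^- 2 * dot x x.
have s0 : 0 <= s by apply: mulr_ge0 (dot_ge0 x); rewrite invr_ge0 ltW.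
have Es : dot x x = s * r ^+ 2 by rewrite /s mulrAC mulVf ?mul1r// gt_eqF.
rewrite /cutoff dotZZ -/s mulrCA -/s.
set k : R := (1 - t)^-1 ^+ 2.
have k1 : k <= 1 + 8 * t.
  rewrite /k exprVn -div1r ler_pdivrMr ?exprn_gt0//.
  have -> : (1 + 8 * t) * (1 - t) ^+ 2 = 1 + t * (6 * (1 - 2 * t) + t * (8 * t - 3)) by ring.
  suff : 0 <= t * (6 * (1 - 2 * t) + t * (8 * t - 3)) by lra.
  apply: mulr_ge0; first exact: ltW.
  have -> : 6 * (1 - 2 * t) + t * (8 * t - 3) = (1 - 2 * t) * (6 - 4 * t) + t by ring.
  by apply: addr_ge0; [apply: mulr_ge0; lra|exact: ltW].
have k2 : 1 <= k by rewrite /k exprVn -div1r ler_pdivlMr ?exprn_gt0// mul1r exprn_ile1//; lra.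
have k3 : k <= 4.
  rewrite /k exprVn -div1r ler_pdivrMr ?exprn_gt0//.
  have : (1 / 2) ^+ 2 <= (1 - t) ^+ 2 by rewrite ler_sqr ?nnegrE; lra.
  lra.
case: (asboolP (annulus r x)) => hx.
  rewrite indicE mem_set// mulr1.
  have hs : s <= 2 by move/andP: hx => [_]; rewrite Es ler_pM2r.
  have ks : s <= k * s by rewrite ler_peMl.
  have := step_lip ks.
  suff : k * s - s <= 16 * t by lra.
  have -> : k * s - s = (k - 1) * s by ring.
  have : (k - 1) * s <= 8 * t * 2 by apply: ler_pM; lra.
  by lra.
rewrite indicE memNset// mulr0 subr0.
have [h|h] := leP 2 s; first by rewrite (step_eq0 h); exact: step_ge0.
have [h'|h'] := ltP s (1 / 4).
  by rewrite [leRHS]step_eq1 ?step_le1//; apply: (@le_trans _ _ (4 * s)); [apply: ler_wpM2r|lra].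
exfalso; apply: hx; rewrite /annulus /= Es; apply/andP; split.
  by apply: (@le_trans _ _ (1 / 4 * r ^+ 2)); [lra|rewrite ler_pM2r].
by rewrite ler_pM2r// ltW.
Qed.

End annulus.

Lemma powR_div (R : realType) (p a b : R) : 0 <= a -> 0 < b -> (a / b) `^ p = (b `^ p)^-1 * a `^ p.
Proof.
move=> a0 b0; have bp : b `^ p != 0 by rewrite gt_eqF// powR_gt0.
apply: (mulIf bp); rewrite -powRM ?divr_ge0 ?(ltW b0)// divfK ?gt_eqF//.
by rewrite mulrAC mulVf// mul1r.
Qed.

(** * Elementary inequalities for the limit of small dilations *)

Section elementary.
Variable R : realType.
Implicit Types a b c d e s t x y : R.

Lemma sqr_le_powR p s : 2 <= p -> 0 <= s -> s ^+ 2 <= 1 + s `^ p.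
Proof.
move=> p2 s0; have h0 := powR_ge0 s p; have [s1|s1] := leP s 1.
  by have := exprn_ile1 2 s0 s1; lra.
rewrite -powR_mulrn//; have := ler_powR (ltW s1) p2; lra.
Qed.

Lemma bernoulli_lower n t : 0 <= t <= 1 -> 1 - n%:R * t <= (1 - t) ^+ n.
Proof.
move=> /andP[t0 t1]; elim: n => [|n IH]; first by rewrite expr0; lra.
rewrite exprS; have h1 : 0 <= 1 - t by lra.
have := ler_wpM2l h1 IH; rewrite -natr1.
have : 0 <= n%:R * t * t by rewrite !mulr_ge0.
have -> : (1 - t) * (1 - n%:R * t) = 1 - (n%:R + 1) * t + n%:R * t * t by ring.
lra.
Qed.

Lemma bernoulli_upper n t : 0 <= t <= 1 -> (1 - t) ^+ n <= 1 - n%:R * t + n%:R ^+ 2 * t ^+ 2.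
Proof.
move=> /andP[t0 t1]; elim: n => [|n IH]; first by rewrite expr0; lra.
rewrite exprS; have h1 : 0 <= 1 - t by lra.
have := ler_wpM2l h1 IH; rewrite -natr1.
have h2 : 0 <= n%:R * t ^+ 2 by rewrite mulr_ge0 ?exprn_ge0.
have h3 : 0 <= n%:R ^+ 2 * t ^+ 2 * t by rewrite !mulr_ge0 ?exprn_ge0.
have h4 : 0 <= t ^+ 2 by rewrite exprn_ge0.
have -> : (1 - t) * (1 - n%:R * t + n%:R ^+ 2 * t ^+ 2) =
  1 - (n%:R + 1) * t + (n%:R + 1) ^+ 2 * t ^+ 2 - n%:R * t ^+ 2 - t ^+ 2 - n%:R ^+ 2 * t ^+ 2 * t by ring.
lra.
Qed.

Lemma le_of_linear_error (K X Y : R) : 0 <= K ->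
  (forall t, 0 < t <= 1 / 2 -> X <= Y + K * t) -> X <= Y.
Proof.
move=> K0 h; apply/ler_addgt0Pr => e e0.
have K1 : 0 < K + 1 by lra.
pose t : R := Num.min (1 / 2) (e / (K + 1)).
have t0 : 0 < t by rewrite lt_min; apply/andP; split; [lra|exact: divr_gt0].
have t1 : t <= 1 / 2 by rewrite ge_min lexx.
have t2 : t <= e / (K + 1) by rewrite ge_min lexx orbT.
have t01 : 0 < t <= 1 / 2 by rewrite t0.
apply: (le_trans (h _ t01)); rewrite lerD2l.
rewrite ler_pdivlMr// in t2; apply: le_trans t2.
by rewrite mulrC ler_pM2l// lerDl.
Qed.

(** The real-number content of the limit [t -> 0]: after multiplication by [(1 - t) ^ n] the
    zeroth-order terms cancel, and division by [t] leaves the first-order inequality with an error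
    linear in [t]. [IF], [IW], [IE] are the integrals of source, potential and energy against the
    cut-off, [ID] that of the total energy over the annulus. *)
Lemma dilation_limit_step (n : nat) (t IF IW IE P ID IFD C CW c : R) :
  0 < t <= 1 / 2 -> 0 <= IF -> 0 <= IW -> 0 <= C -> 0 <= c -> 0 <= ID -> IFD <= ID ->
  (1 - t)^-1 ^+ n * (IF + (- (64 * t)) * IFD) - IF - C * t ^+ 2 <=
  (1 - t)^-1 ^+ n * (IW + ((- t) * IE + CW * t ^+ 2 * P)) - IW + c * t * ID ->
  n%:R * IF <= n%:R * IW - IE + (64 + c) * ID + (n%:R ^+ 2 * IF + CW * P + C) * t.
Proof.
move=> /andP[t0 t1] IF0 IW0 C0 c0 ID0 hD.
have t01 : 0 <= t <= 1 by apply/andP; split; lra.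
have l0 : 0 < 1 - t by lra.
set m : R := (1 - t) ^+ n; have m0 : 0 < m by rewrite exprn_gt0.
have m1 : m <= 1 by rewrite exprn_ile1//; lra.
have mV : m * (1 - t)^-1 ^+ n = 1 by rewrite exprVn mulfV// gt_eqF.
have b1 := bernoulli_lower n t01; have b2 := bernoulli_upper n t01; rewrite -/m in b1 b2.
move=> /(ler_wpM2l (ltW m0)).
have -> : m * ((1 - t)^-1 ^+ n * (IF + (- (64 * t)) * IFD) - IF - C * t ^+ 2) =
  m * (1 - t)^-1 ^+ n * (IF + (- (64 * t)) * IFD) - m * IF - m * (C * t ^+ 2) by ring.
have -> : m * ((1 - t)^-1 ^+ n * (IW + ((- t) * IE + CW * t ^+ 2 * P)) - IW + c * t * ID) =
  m * (1 - t)^-1 ^+ n * (IW + ((- t) * IE + CW * t ^+ 2 * P)) - m * IW + m * (c * t * ID) by ring.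
rewrite mV !mul1r => h.
have h1 : m * (C * t ^+ 2) <= C * t ^+ 2 by exact: (ler_piMl (mulr_ge0 C0 (sqr_ge0 t)) m1).
have h2 : m * (c * t * ID) <= c * t * ID.
  by exact: (ler_piMl (mulr_ge0 (mulr_ge0 c0 (ltW t0)) ID0) m1).
have h3 : t * IFD <= t * ID by rewrite ler_pM2l.
have h4 : (n%:R * t - n%:R ^+ 2 * t ^+ 2) * IF <= (1 - m) * IF by apply: ler_wpM2r => //; lra.
have h5 : (1 - m) * IW <= (n%:R * t) * IW by apply: ler_wpM2r => //; lra.
rewrite -(ler_pM2l t0); lra.
Qed.

Lemma convexity_step (c c' l d0 d1 g u u' w w' S : R) : c * (l * d1 - d0) <= c * (w' - w) ->
  w' * c <= w' * c' -> (u' - u) * g <= S ->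
  c * (l * d1) + u' * g - (c * d0 + u * g) <= w' * c' - w * c + S.
Proof. lra. Qed.

Lemma chain_le (a g f s s' w b b1 b2 v v' : R) : a <= g -> g - f - s <= v - w + b -> s <= s' ->
  b <= b1 -> b1 <= b2 -> v <= v' -> a - f - s' <= v' - w + b2.
Proof. lra. Qed.

End elementary.

Section pohozaev.
Variables (R : realType) (n : nat) (p q CA : R).
Local Notation mu := (lebesgue_rV R n).
Variables (u W : 'rV[R]_n -> R) (Du A : 'rV[R]_n -> 'rV[R]_n).
Implicit Types (x xi : 'rV[R]_n) (r t : R).
Hypotheses (p2 : 2 <= p) (q1 : 1 < q) (CA0 : 0 < CA).
Hypothesis Su : approximable p u Du.
Hypothesis bu : forall r : R, 0 <= r -> exists M : R, forall x, cube n r x -> `|u x| <= M.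
Hypothesis mA : forall i, measurable_fun setT (fun xi => A xi ord0 i).
Hypothesis hA : forall xi, `|A xi| <= CA * `|xi| `^ (p - 1).
Hypothesis weak : forall phi, C1c setT phi ->
  \int[mu]_x (dot (A (Du x)) (grad phi x)) = \int[mu]_x (sgnpow q (u x) * phi x).
Hypothesis mW : measurable_fun setT W.
Hypothesis W0 : forall xi, 0 <= W xi.
Variables CB CW : R.
Hypotheses (CB0 : 0 <= CB) (CW0 : 0 <= CW).
Hypothesis hWB : forall xi, W xi <= CB * `|xi| `^ p.
Hypothesis convex_W : forall xi zeta : 'rV[R]_n, dot (A xi) (zeta - xi) <= W zeta - W xi.
Hypothesis dilation_W : forall t xi, 0 <= t <= 1 / 2 ->
  W ((1 - t) *: xi) <= W xi - t * dot (A xi) xi + CW * t ^+ 2 * `|xi| `^ p.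
Local Notation total_energy := (total_energy p q u Du).
Local Notation energy := (energy Du A).
Local Notation F := (fun x => `|u x| `^ (q + 1) / (q + 1)).

Let mDu i : measurable_fun setT (fun x => Du x ord0 i). Proof. exact: (measurable_Du Su). Qed.
Let mu_ : measurable_fun setT u. Proof. exact: (measurable_u Su). Qed.
Let loc_Du : loc_intg (fun x => `|Du x| `^ p). Proof. by case: Su. Qed.
Let loc_F : loc_intg F.
Proof.
apply: (loc_intg_le _ _ (loc_intg_u_powR q1 Su bu)).
  by apply: measurable_funM => //; apply: measurable_powR_norm.
move=> x; rewrite ger0_norm ?divr_ge0 ?powR_ge0//; last by have := q1; lra.
by rewrite ler_pdivrMr ?ler_peMr ?powR_ge0//; have := q1; lra.
Qed.
Let mW_Du : measurable_fun setT (fun x => W (Du x)).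
Proof. exact: (measurable_rV_coord_comp mW mDu). Qed.
Let loc_W : loc_intg (fun x => W (Du x)).
Proof.
apply: (loc_intg_le mW_Du _ (loc_intgZ CB loc_Du)) => x.
by rewrite ger0_norm.
Qed.
Let loc_E : loc_intg energy.
Proof. exact: (loc_intg_energy p2 Su mA hA). Qed.

Let mcut r : measurable_fun setT (cutoff (R := R) (n := n) r).
Proof. exact: (C1_measurable (C1_cutoff n r)).1. Qed.

Lemma intg_loc_mul (f k : 'rV[R]_n -> R) r (M : R) : loc_intg f -> measurable_fun setT k ->
  (forall x, ~ cube n r x -> k x = 0) -> (forall x, `|k x| <= M) -> intg mu (fun x => f x * k x).
Proof.
move=> lf mk k0 kM; apply: (@intg_le_norm _ _ _ mu _ (fun x => M * on_cube r f x)).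
- exact: measurable_funM (loc_intg_measurable lf) mk.
- move=> x; rewrite /on_cube indicE; case: (asboolP (cube n r x)) => hx.
    rewrite mem_set// mulr1 mulrC [X in X <= _]normrM [X in _ <= X]normrM.
    by apply: ler_wpM2r => //; apply: le_trans (ler_norm _).
  by rewrite k0// mulr0 normr0.
- by apply: intgZ; case: lf.
Qed.

Lemma intg_cutoff (f : 'rV[R]_n -> R) r : 0 < r -> loc_intg f -> intg mu (fun x => f x * cutoff r x).
Proof.
move=> r0 lf; apply: (@intg_loc_mul _ _ (2 * r) 1) => // x.
  by move=> /(cutoff_support r0)[].
by rewrite ger0_norm ?cutoff_ge0 ?cutoff_le1.
Qed.

Lemma intg_indic_disc (f : 'rV[R]_n -> R) r (D : set 'rV[R]_n) : 0 < r -> loc_intg f -> measurable D ->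
  D `<=` disc r -> intg mu (fun x => f x * \1_D x).
Proof.
move=> r0 lf mD Dr; apply: (@intg_loc_mul _ _ (2 * r) 1) => // x.
  move=> hx; rewrite indicE memNset// => /Dr /(sub_disc_cube (ltW r0)).
  exact: hx.
by rewrite ger0_norm ?indic_real_ge0// indicE; case: (_ \in _).
Qed.

(** Potential and cut-off are both evaluated at the dilated point, so the integral is an exact
    change of variables; [dilation_W] then expands it up to second order in [t]. *)
Lemma potential_term r t : 0 < r -> 0 < t <= 1 / 2 ->
  intg mu (fun x => W ((1 - t) *: Du ((1 - t) *: x)) * cutoff r ((1 - t) *: x)) /\
  \int[mu]_x (W ((1 - t) *: Du ((1 - t) *: x)) * cutoff r ((1 - t) *: x)) <=
  (1 - t)^-1 ^+ n * (\int[mu]_x (W (Du x) * cutoff r x) +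
    ((- t) * \int[mu]_x (energy x * cutoff r x) +
     (CW * t ^+ 2) * \int[mu]_x (`|Du x| `^ p * cutoff r x))).
Proof.
move=> r0 /andP[t0 t1]; have l0 : 0 < 1 - t by lra.
have t01 : 0 <= t <= 1 / 2 by rewrite ltW.
have mh : measurable_fun setT (fun x => W ((1 - t) *: Du x)).
  apply: (measurable_rV_coord_comp mW) => i; under eq_fun do rewrite mxE.
  exact: measurable_funM.
have lh : loc_intg (fun x => W ((1 - t) *: Du x)).
  apply: (loc_intg_le mh _ (loc_intgZ CB loc_Du)) => x; rewrite ger0_norm//.
  apply: (le_trans (hWB _)); apply: (ler_wpM2l CB0); apply: ge0_ler_powR; rewrite ?nnegrE//.
    by have := p2; lra.
  by apply: normrZ_le; apply/andP; split; lra.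
have Ih := intg_cutoff r0 lh.
have h0 x : 0 <= W ((1 - t) *: Du x) * cutoff r x by rewrite mulr_ge0 ?cutoff_ge0.
have [I1 ->] := intg_dilation l0 Ih h0; split => //.
apply: ler_wpM2l; first by rewrite exprn_ge0// invr_ge0 ltW.
have I2 := intg_cutoff r0 loc_W; have I3 := intg_cutoff r0 loc_E; have I4 := intg_cutoff r0 loc_Du.
rewrite -(RintZ _ I3) -(RintZ _ I4) -(RintD (intgZ _ I3) (intgZ _ I4)).
rewrite -(RintD I2 (intgD (intgZ _ I3) (intgZ _ I4))).
apply: (le_Rint Ih (intgD I2 (intgD (intgZ _ I3) (intgZ _ I4)))) => x.
have := ler_wpM2r (cutoff_ge0 r x) (dilation_W (Du x) t01).
rewrite /energy; lra.
Qed.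

(** The constant depends on neither [r] nor [t]; all the scaling is in [(r t) ^ p], as the segment
    from [(1 - t) x] to [x] has length of order [r t]. *)
Lemma increment_bound r t (D D' : set 'rV[R]_n) : 0 < r -> 0 < t <= 1 / 2 ->
  measurable D -> measurable D' -> D `<=` disc r -> D' `<=` disc r ->
  (forall (s : R) x, 1 / 2 <= s <= 1 -> D x -> D' (s *: x)) ->
  intg mu (fun x => `|u ((1 - t) *: x) - u x| `^ p * \1_D x) /\
  \int[mu]_x (`|u ((1 - t) *: x) - u x| `^ p * \1_D x) <=
    ((2 `^ p) ^+ 3 * 2 ^+ n * (n%:R * 2) `^ p) * (r * t) `^ p * \int[mu]_x (`|Du x| `^ p * \1_D' x).
Proof.
move=> r0 /andP[t0 t1] mD mD' Dr D'r DD'.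
have hp : 1 <= p by have := p2; lra.
have hl : 1 / 2 <= 1 - t < 1 by apply/andP; split; lra.
have hr : 0 <= 2 * r by rewrite mulr_ge0 ?ltW.
have sc := sub_disc_cube (n := n) (ltW r0).
have dd (s : R) x : 1 - t <= s <= 1 -> D x -> D' (s *: x).
  by move=> /andP[s0 s1]; apply: DD'; rewrite s1 andbT; lra.
have [I1 I2] := dilation_diff hp hl hr mD mD' (subset_trans Dr sc) (subset_trans D'r sc) dd Su.
split => //; apply: (le_trans I2); rewrite le_eqVlt; apply/orP; left; apply/eqP.
have -> : n%:R * (2 * r) * (1 - (1 - t)) = (n%:R * 2) * (r * t) by ring.
have h1 : 0 <= n%:R * 2 :> R by rewrite mulr_ge0.
rewrite (powRM p h1 (mulr_ge0 (ltW r0) (ltW t0))).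
by rewrite !mulrA.
Qed.

Let K := (2 `^ p) ^+ 3 * 2 ^+ n * (n%:R * 2) `^ p : R.

Let K_ge0 : 0 <= K.
Proof. by rewrite /K mulr_ge0 ?powR_ge0// mulr_ge0 ?exprn_ge0 ?powR_ge0. Qed.

(** Increments of [u] measured in units of [r t] are controlled by [|Du|] on the annulus, uniformly
    in [r]. This is why the constant of [pohozaev] does not depend on the radius. *)
Lemma annulus_term r t : 0 < r -> 0 < t <= 1 / 2 ->
  intg mu (fun x => (`|Du x| `^ p + (`|u ((1 - t) *: x) - u x| / (r * t)) `^ p) *
    \1_(outer_annulus r) x) /\
  \int[mu]_x ((`|Du x| `^ p + (`|u ((1 - t) *: x) - u x| / (r * t)) `^ p) *
    \1_(outer_annulus r) x) <= (1 + K) * \int[mu]_x (`|Du x| `^ p * \1_(annulus r) x).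
Proof.
move=> r0 t01; have [t0 t1] := andP t01.
have rt : 0 < r * t by rewrite mulr_gt0.
have so := subset_trans (sub_outer_annulus (n := n) (r := r)) (@sub_annulus_disc _ _ r).
have [I1 I2] := increment_bound r0 t01 (measurable_outer_annulus r) (measurable_annulus r)
  so (@sub_annulus_disc _ _ r) (@annulus_dilation _ _ r).
have Io := intg_indic_disc r0 loc_Du (measurable_outer_annulus r) so.
have Ia := intg_indic_disc r0 loc_Du (measurable_annulus r) (@sub_annulus_disc _ _ r).
have E x : (`|Du x| `^ p + (`|u ((1 - t) *: x) - u x| / (r * t)) `^ p) * \1_(outer_annulus r) x =
  `|Du x| `^ p * \1_(outer_annulus r) x +
  ((r * t) `^ p)^-1 * (`|u ((1 - t) *: x) - u x| `^ p * \1_(outer_annulus r) x).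
  by rewrite (powR_div p (normr_ge0 _) rt); ring.
split; first by apply: (eq_intg (fun x => esym (E x))); exact: intgD Io (intgZ _ I1).
under eq_Rintegral do rewrite E.
rewrite (RintD Io (intgZ _ I1)) (RintZ _ I1) [leRHS]mulrDl mul1r; apply: lerD.
  apply: (le_Rint Io Ia) => x; apply: ler_wpM2l; first exact: powR_ge0.
  rewrite !indicE; case: (asboolP (outer_annulus r x)) => h.
    by rewrite !mem_set//; exact: sub_outer_annulus.
  by rewrite memNset//; case: (_ \in _).
rewrite mulrC ler_pdivrMr ?powR_gt0//; apply: (le_trans I2).
by rewrite le_eqVlt; apply/orP; left; apply/eqP; rewrite /K; ring.
Qed.

(** This constant depends on [r], but it only multiplies [t^2] and disappears as [t -> 0] with [r]
    fixed. *)
Lemma disc_term r : 0 < r -> exists2 C : R, 0 <= C & forall t, 0 < t <= 1 / 2 ->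
  intg mu (fun x => (1 + (`|u ((1 - t) *: x) - u x| / t) `^ p) * \1_(disc r) x) /\
  \int[mu]_x ((1 + (`|u ((1 - t) *: x) - u x| / t) `^ p) * \1_(disc r) x) <= C.
Proof.
move=> r0; have Id := intg_indic_disc r0 (@loc_intg_cst R n 1) (measurable_disc r) (@subset_refl _ _).
pose P : R := \int[mu]_x (`|Du x| `^ p * \1_(disc r) x).
have P0 : 0 <= P.
  by apply: Rint_ge0 => x; exact: (mulr_ge0 (powR_ge0 _ _) (indic_real_ge0 _ _)).
have Q0 : 0 <= \int[mu]_x ((1 : R) * \1_(disc r) x).
  by apply: Rint_ge0 => x; exact: (mulr_ge0 ler01 (indic_real_ge0 _ _)).
exists (\int[mu]_x ((1 : R) * \1_(disc r) x) + K * r `^ p * P).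
  by apply: (addr_ge0 Q0); apply: (mulr_ge0 _ P0); exact: (mulr_ge0 K_ge0 (powR_ge0 _ _)).
move=> t t01; have [t0 t1] := andP t01.
have dd (s : R) x : 1 / 2 <= s <= 1 -> disc r x -> disc r (s *: x).
  by move=> /andP[s0 s1]; apply: disc_dilation; rewrite s1 andbT; lra.
have [I1 I2] := increment_bound r0 t01 (measurable_disc r) (measurable_disc r)
  (@subset_refl _ _) (@subset_refl _ _) dd.
have E x : (1 + (`|u ((1 - t) *: x) - u x| / t) `^ p) * \1_(disc r) x =
  1 * \1_(disc r) x + (t `^ p)^-1 * (`|u ((1 - t) *: x) - u x| `^ p * \1_(disc r) x).
  by rewrite (powR_div p (normr_ge0 _) t0); ring.
split; first by apply: (eq_intg (fun x => esym (E x))); exact: intgD Id (intgZ _ I1).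
under eq_Rintegral do rewrite E.
rewrite (RintD Id (intgZ _ I1)) (RintZ _ I1); apply: lerD => //.
rewrite mulrC ler_pdivrMr ?powR_gt0//; apply: (le_trans I2).
by rewrite (powRM p (ltW r0) (ltW t0)) le_eqVlt; apply/orP; left; apply/eqP; rewrite /K /P; ring.
Qed.

(** After the change of variables the cut-off is evaluated at [(1 - t)^-1 x], where it is smaller;
    [cutoff_expansion_ge] confines the loss to the annulus. *)
Lemma source_term r t : 0 < r -> 0 < t <= 1 / 2 ->
  intg mu (fun x => `|u ((1 - t) *: x)| `^ (q + 1) / (q + 1) * cutoff r x) /\
  (1 - t)^-1 ^+ n * (\int[mu]_x (`|u x| `^ (q + 1) / (q + 1) * cutoff r x) +
    (- (64 * t)) * \int[mu]_x (`|u x| `^ (q + 1) / (q + 1) * \1_(annulus r) x)) <=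
  \int[mu]_x (`|u ((1 - t) *: x)| `^ (q + 1) / (q + 1) * cutoff r x).
Proof.
move=> r0 t01; have [t0 t1] := andP t01; have l0 : 0 < 1 - t by lra.
have F0 x : 0 <= F x by rewrite divr_ge0 ?powR_ge0//; have := q1; lra.
pose g x : R := F x * cutoff r ((1 - t)^-1 *: x).
have mc : measurable_fun setT (fun x => cutoff r ((1 - t)^-1 *: x)).
  exact: (measurable_comp_dilation (1 - t)^-1 (mcut r)).
have Ig : intg mu g.
  apply: (@intg_loc_mul _ _ (2 * r) 1 loc_F mc) => x; last first.
    by rewrite ger0_norm ?cutoff_ge0 ?cutoff_le1.
  move=> hx; have [E _] := cutoff_support r0 hx; apply/eqP; rewrite eq_le cutoff_ge0 andbT -E.
  have -> : cutoff r x = cutoff r ((1 - t) *: ((1 - t)^-1 *: x)).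
    by rewrite scalerA mulfV ?scale1r// gt_eqF.
  exact: cutoff_dilation_ge.
have g0 x : 0 <= g x by exact: (mulr_ge0 (F0 x) (cutoff_ge0 _ _)).
have [I1 I2] := intg_dilation l0 Ig g0.
have E x : g ((1 - t) *: x) = `|u ((1 - t) *: x)| `^ (q + 1) / (q + 1) * cutoff r x.
  by rewrite /g scalerA mulVf ?scale1r// gt_eqF.
split; first exact: (eq_intg E).
under [leRHS]eq_Rintegral do rewrite -E.
rewrite I2; apply: ler_wpM2l; first by rewrite exprn_ge0// invr_ge0 ltW.
have If := intg_cutoff r0 loc_F.
have Ia := intg_indic_disc r0 loc_F (measurable_annulus r) (@sub_annulus_disc _ _ r).
rewrite -(RintZ _ Ia) -(RintD If (intgZ _ Ia)).
apply: (le_Rint (intgD If (intgZ _ Ia)) Ig) => x.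
have := ler_wpM2l (F0 x) (cutoff_expansion_ge x r0 t01).
rewrite /g; lra.
Qed.

(* Convexity replaces the flux at Du by potentials; the radially decreasing cut-off is then
   moved from x to (1 - t) x, so that the potential term is an exact dilation. *)
Lemma dilation_left_le r t x : 0 < r -> 0 < t <= 1 / 2 ->
  dot (A (Du x)) (cutoff r x *: ((1 - t) *: Du ((1 - t) *: x)) + u ((1 - t) *: x) *: cutoffG r x) -
  dot (A (Du x)) (cutoff r x *: Du x + u x *: cutoffG r x) <=
  W ((1 - t) *: Du ((1 - t) *: x)) * cutoff r ((1 - t) *: x) - W (Du x) * cutoff r x +
  16 * (n%:R * CA) * t * ((`|Du x| `^ p + (`|u ((1 - t) *: x) - u x| / (r * t)) `^ p) *
    \1_(outer_annulus r) x).
Proof.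
move=> r0 t01; have [t0 t1] := andP t01.
have h1 := ler_wpM2l (cutoff_ge0 r x) (convex_W (Du x) ((1 - t) *: Du ((1 - t) *: x))).
have h2 := ler_wpM2l (W0 ((1 - t) *: Du ((1 - t) *: x))) (cutoff_dilation_ge x r0 t01).
set h : R := u ((1 - t) *: x) - u x.
have rt : 0 < r * t by rewrite mulr_gt0.
have CAn : 0 <= n%:R * CA by rewrite mulr_ge0// ltW.
have h3 : h * dot (A (Du x)) (cutoffG r x) <=
    16 * (n%:R * CA) * t * ((`|Du x| `^ p + (`|h| / (r * t)) `^ p) * \1_(outer_annulus r) x).
  apply: (le_trans (ler_norm _)); rewrite [X in X <= _]normrM.
  have e1 := dot_flux_le Du hA x (cutoffG r x).
  have e2 : 0 <= `|Du x| `^ (p - 1) by exact: powR_ge0.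
  have e3 := ler_wpM2l e2 (normr_cutoffG_le x r0).
  have e4 := ler_wpM2l (normr_ge0 h) (le_trans e1 (ler_wpM2l CAn e3)).
  apply: (le_trans e4).
  have e5 := powRB1_mul_le p2 (normr_ge0 (Du x)) (divr_ge0 (normr_ge0 h) (ltW rt)).
  have e6 : 0 <= 16 * (n%:R * CA) * t by exact: (mulr_ge0 (mulr_ge0 (ler0n _ _) CAn) (ltW t0)).
  apply: le_trans (ler_wpM2l e6 (ler_wpM2r (indic_real_ge0 (outer_annulus r) x) e5)).
  rewrite le_eqVlt; apply/orP; left; apply/eqP; field.
  by rewrite !gt_eqF.
rewrite dotBr dotZr in h1; rewrite !dotDr !(dotZr (A (Du x)) (cutoffG r x)) (dotZr (A (Du x)) (Du x)).
rewrite (dotZr (A (Du x)) ((1 - t) *: Du ((1 - t) *: x))) dotZr; exact: convexity_step h1 h2 h3.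
Qed.

(** A lower bound is needed, whereas convexity at [u x] bounds the source term from above. The
    tangent is therefore taken at the dilated value [a]; returning to [b = u x] costs a Lipschitz
    constant times [|a - b|^2], of second order in [t]. *)
Lemma dilation_right_ge r : 0 < r -> exists2 C : R, 0 <= C & forall t x, 0 < t <= 1 / 2 ->
  `|u ((1 - t) *: x)| `^ (q + 1) / (q + 1) * cutoff r x - F x * cutoff r x -
  C * t ^+ 2 * ((1 + (`|u ((1 - t) *: x) - u x| / t) `^ p) * \1_(disc r) x) <=
  sgnpow q (u x) * (cutoff r x * u ((1 - t) *: x)) - sgnpow q (u x) * (cutoff r x * u x).
Proof.
move=> r0; have r2 : 0 <= 2 * r by rewrite mulr_ge0 ?ltW.
have [M hM] := bu r2; have q0 : 0 <= q by have := q1; lra.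
exists (q * `|M| `^ (q - 1)); first exact: (mulr_ge0 q0 (powR_ge0 _ _)).
move=> t x t01; have [t0 t1] := andP t01.
case: (asboolP (disc r x)) => hx; last first.
  have -> : cutoff r x = 0.
    apply/eqP; rewrite eq_le cutoff_ge0 andbT; apply: (le_trans (cutoff_le_disc x r0)).
    by rewrite indicE memNset.
  by rewrite indicE memNset// !mulr0 !mul0r !mulr0 !subr0.
rewrite indicE mem_set// mulr1.
have l01 : 0 < 1 - t <= 1 by apply/andP; split; lra.
have cx := sub_disc_cube (ltW r0) hx; have clx := cube_dilation l01 cx.
have ux := le_trans (hM _ cx) (ler_norm M); have ulx := le_trans (hM _ clx) (ler_norm M).
have e1 := sgnpow_convex (u x) (u ((1 - t) *: x)) q1.
have e2 := sgnpow_lipschitz q1 ulx ux.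
set a := u ((1 - t) *: x) in e1 e2 *; set b := u x in e1 e2 *.
have e3 : (sgnpow q a - sgnpow q b) * (a - b) <= q * `|M| `^ (q - 1) * `|a - b| ^+ 2.
  apply: (le_trans (ler_norm _)); rewrite [X in X <= _]normrM.
  by apply: (le_trans (ler_wpM2r (normr_ge0 _) e2)); rewrite expr2 [leRHS]mulrA.
have e4 := sqr_le_powR p2 (divr_ge0 (normr_ge0 (a - b)) (ltW t0)).
have e5 : `|a - b| ^+ 2 <= t ^+ 2 * (1 + (`|a - b| / t) `^ p).
  have := ler_wpM2l (sqr_ge0 t) e4; rewrite -exprMn mulrCA mulfV ?mulr1// gt_eqF//.
have qM : 0 <= q * `|M| `^ (q - 1) by exact: (mulr_ge0 q0 (powR_ge0 _ _)).
have e6 := ler_wpM2l qM e5.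
have e7 : (`|a| `^ (q + 1) - `|b| `^ (q + 1)) / (q + 1) -
    q * `|M| `^ (q - 1) * t ^+ 2 * (1 + (`|a - b| / t) `^ p) <= sgnpow q b * (a - b).
  have -> : sgnpow q b * (a - b) = sgnpow q a * (a - b) - (sgnpow q a - sgnpow q b) * (a - b) by ring.
  rewrite -[X in _ - X <= _]mulrA; lra.
have e8 := ler_wpM2l (cutoff_ge0 r x) e7.
have e9 : 0 <= q * `|M| `^ (q - 1) * t ^+ 2 * (1 + (`|a - b| / t) `^ p).
  by apply: (mulr_ge0 (mulr_ge0 qM (sqr_ge0 t))); apply: (addr_ge0 ler01); exact: powR_ge0.
have e10 := ler_wpM2r e9 (cutoff_le1 r x); rewrite mul1r in e10.
have e11 : (`|a| `^ (q + 1) - `|b| `^ (q + 1)) / (q + 1) =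
  `|a| `^ (q + 1) / (q + 1) - `|b| `^ (q + 1) / (q + 1) by rewrite mulrBl.
rewrite e11 in e8; lra.
Qed.

Lemma pohozaev : exists2 C : R, 0 <= C & forall r, 0 < r ->
  n%:R * \int[mu]_x (F x * cutoff r x) <=
  n%:R * \int[mu]_x (W (Du x) * cutoff r x) - \int[mu]_x (energy x * cutoff r x) +
  C * \int[mu]_x (total_energy x * \1_(annulus r) x).
Proof.
pose c : R := 16 * (n%:R * CA) * (1 + K).
have CAn : 0 <= n%:R * CA by rewrite mulr_ge0// ltW.
have c0 : 0 <= c by apply: mulr_ge0; [exact: mulr_ge0|exact: addr_ge0].
exists (64 + c); first exact: addr_ge0.
move=> r r0; have r2 : 0 <= 2 * r by rewrite mulr_ge0 ?ltW.
have hq : 0 < q + 1 by have := q1; lra.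
have F0 x : 0 <= F x by rewrite divr_ge0 ?powR_ge0// ltW.
have [C1' C10 hC1] := dilation_right_ge r0.
have [C2 C20 hC2] := disc_term r0.
have sa := @sub_annulus_disc R n r; have ma := measurable_annulus (n := n) r.
have lT := loc_intg_total_energy q1 Su bu.
have IT := intg_indic_disc r0 lT ma sa.
have IFa := intg_indic_disc r0 loc_F ma sa.
have IDa := intg_indic_disc r0 loc_Du ma sa.
have If := intg_cutoff r0 loc_F; have Iw := intg_cutoff r0 loc_W.
have IF0 : 0 <= \int[mu]_x (F x * cutoff r x).
  by apply: Rint_ge0 => x; exact: (mulr_ge0 (F0 x) (cutoff_ge0 _ _)).
have IW0 : 0 <= \int[mu]_x (W (Du x) * cutoff r x).
  by apply: Rint_ge0 => x; exact: (mulr_ge0 (W0 _) (cutoff_ge0 _ _)).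
have IP0 : 0 <= \int[mu]_x (`|Du x| `^ p * cutoff r x).
  by apply: Rint_ge0 => x; exact: (mulr_ge0 (powR_ge0 _ _) (cutoff_ge0 _ _)).
have ID0 : 0 <= \int[mu]_x (total_energy x * \1_(annulus r) x).
  by apply: Rint_ge0 => x; exact: (mulr_ge0 (total_energy_ge0 _ _ _ _ _) (indic_real_ge0 _ _)).
have hFD : \int[mu]_x (F x * \1_(annulus r) x) <= \int[mu]_x (total_energy x * \1_(annulus r) x).
  apply: (le_Rint IFa IT) => x; apply: (ler_wpM2r (indic_real_ge0 _ _)).
  have e1 : F x <= `|u x| `^ (q + 1).
    by rewrite ler_pdivrMr// ler_peMr ?powR_ge0//; have := q1; lra.
  by apply: (le_trans e1); rewrite /total_energy lerDr powR_ge0.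
have hDD : \int[mu]_x (`|Du x| `^ p * \1_(annulus r) x) <= \int[mu]_x (total_energy x * \1_(annulus r) x).
  apply: (le_Rint IDa IT) => x; apply: (ler_wpM2r (indic_real_ge0 _ _)).
  by rewrite /total_energy lerDl powR_ge0.
(* The radius is now fixed and [t] tends to 0; this coefficient of [t] may depend on [r]. *)
apply: (@le_of_linear_error _ (n%:R ^+ 2 * \int[mu]_x (F x * cutoff r x) +
   CW * \int[mu]_x (`|Du x| `^ p * cutoff r x) + C1' * C2)).
  apply: addr_ge0; last exact: mulr_ge0.
  by apply: addr_ge0; [exact: (mulr_ge0 (sqr_ge0 _) IF0)|exact: (mulr_ge0 CW0 IP0)].
move=> t t01; have [t0 t1] := andP t01.
apply: (dilation_limit_step t01 IF0 IW0 (mulr_ge0 C10 C20) c0 ID0 hFD).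
have l01 : 0 < 1 - t <= 1 by apply/andP; split; lra.
have hp : 1 <= p by have := p2; lra.
have Sl := approximable_dilation hp l01 Su.
have supp x : ~ cube n (2 * r) x -> cutoff r x = 0 /\ cutoffG r x = 0 := cutoff_support r0.
have [L1 R1 E1] := test_approximable p2 q1 CA0 Su bu mA hA weak Sl r2 (C1_cutoff n r) supp.
have [L2 R2 E2] := test_approximable p2 q1 CA0 Su bu mA hA weak Su r2 (C1_cutoff n r) supp.
have [A1 A2] := potential_term r0 t01.
have [B1 B2] := annulus_term r0 t01.
have [D1 D2] := hC2 t t01.
have [G1 G2] := source_term r0 t01.
have IU := intgD (intgB A1 Iw) (intgZ (16 * (n%:R * CA) * t) B1).
have IV := intgB (intgB G1 If) (intgZ (C1' * t ^+ 2) D1).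
have hU := le_Rint (intgB L1 L2) IU (fun x => dilation_left_le x r0 t01).
have hV := le_Rint IV (intgB R1 R2) (fun x => hC1 t x t01).
(* The equation is used twice, with the dilation and with [u] itself as test function; the
   difference converts the flux side into the source side. *)
rewrite (RintB L1 L2) E1 E2 -(RintB R1 R2) in hU.
have hVU := le_trans hV hU.
rewrite (RintD (intgB A1 Iw) (intgZ _ B1)) (RintB A1 Iw) (RintZ _ B1) in hVU.
rewrite (RintB (intgB G1 If) (intgZ _ D1)) (RintB G1 If) (RintZ _ D1) in hVU.
have k1 := ler_wpM2l (mulr_ge0 C10 (sqr_ge0 t)) D2.
have k0 : 0 <= 16 * (n%:R * CA) * t by exact: (mulr_ge0 (mulr_ge0 (ler0n _ _) CAn) (ltW t0)).
have k2 := ler_wpM2l k0 B2.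
have k3 := ler_wpM2l (mulr_ge0 c0 (ltW t0)) hDD.
have k4 : c * t * \int[mu]_x (`|Du x| `^ p * \1_(annulus r) x) =
  16 * (n%:R * CA) * t * ((1 + K) * \int[mu]_x (`|Du x| `^ p * \1_(annulus r) x)) by rewrite /c; ring.
rewrite -k4 in k2; rewrite [C1' * C2 * _]mulrAC.
exact: chain_le G2 hVU k1 k2 k3 A2.
Qed.

End pohozaev.

(** * Vanishing *)

Section subcritical.
Variable R : realType.
Implicit Types p q k C CA ID J : R.

Lemma subcritical (n : nat) p q k : 2 <= p -> 1 <= k -> (0 < n)%N -> k * (p - 1) < q ->
  (p < n%:R * k -> q < (n%:R * (p - k) + p) / (n%:R * k - p)) ->
  [/\ 1 < q, p < q + 1, n%:R < p * (q + 1) / (q + 1 - p) & n%:R * k / p < 1 + n%:R / (q + 1)].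
Proof.
move=> p2 k1 n0 qk hs.
have n1 : 0 < n%:R :> R by rewrite ltr0n.
have kp : p - 1 <= k * (p - 1) by rewrite ler_peMl//; lra.
have q1 : 1 < q by lra.
have pq : p < q + 1 by lra.
(* The upper bound on [q] cleared of its denominator; when [n k <= p] the left side is nonpositive.
   Both remaining conclusions follow from it. *)
have key : (n%:R * k - p) * (q + 1) < n%:R * p.
  have [h|h] := ltP p (n%:R * k).
    have h' : 0 < n%:R * k - p by lra.
    have := hs h; rewrite ltr_pdivlMr//; lra.
  apply: (@le_lt_trans _ _ 0); last by rewrite mulr_gt0//; lra.
  by rewrite mulr_le0_ge0//; lra.
split => //.
  rewrite ltr_pdivlMr; last by lra.
  have : n%:R * (q + 1) <= n%:R * k * (q + 1).
    by apply: ler_wpM2r; [lra|rewrite ler_peMr// ltW].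
  lra.
rewrite ltr_pdivrMr; last by lra.
have q10 : 0 < q + 1 by lra.
have -> : (1 + n%:R / (q + 1)) * p = (p * (q + 1) + n%:R * p) / (q + 1).
  by field; rewrite gt_eqF.
rewrite ltr_pdivlMr//; lra.
Qed.

(** [IE = IB - Err] and [IW <= (k / p) IE] eliminate energy and potential from the Pohozaev
    inequality. What is left is [IB] with the coefficient that subcriticality makes positive. *)
Lemma decay_step (n k p q1 C IE IB IW Err ID : R) : 0 <= n -> 0 < p -> 0 < q1 ->
  0 <= C -> 0 <= ID -> IE + Err = IB -> p * IW <= k * IE ->
  n * (IB / q1) <= n * IW - IE + C * ID ->
  (1 + n / q1 - n * k / p) * IB <= C * ID + (1 + `|n * k / p|) * `|Err|.
Proof.
move=> n0 p0 q10 C0 ID0 E hW h.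
have h1 : n * IW <= n * k / p * IE.
  have -> : n * k / p * IE = n * (k * IE / p) by ring.
  by apply: ler_wpM2l => //; rewrite ler_pdivlMr// mulrC.
have h2 : n * (IB / q1) = n / q1 * IB by ring.
have h3 : Err <= `|Err| := ler_norm _.
have h4 : - (n * k / p * Err) <= `|n * k / p| * `|Err|.
  by rewrite -normrM -normrN ler_norm.
have h5 : (1 - n * k / p) * Err <= (1 + `|n * k / p|) * `|Err|.
  have -> : (1 - n * k / p) * Err = Err + - (n * k / p * Err) by ring.
  by rewrite [leRHS]mulrDl mul1r; exact: lerD.
rewrite h2 in h; have E' : IE = IB - Err by rewrite -E addrK.
rewrite E' in h h1; lra.
Qed.

(** The quantity is a constant times [r ^ (n - s)]; the strict inequality is what makes it decay
    rather than stay bounded. *)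
Lemma powR_large_radius (s e : R) (n : nat) : n%:R < s -> 0 < e -> exists2 r0 : R, 0 < r0 &
  forall r : R, r0 <= r -> (16 / r) `^ s * (4 * r) ^+ n <= e.
Proof.
move=> ns e0; have d0 : 0 < s - n%:R by rewrite subr_gt0.
pose K : R := 16 `^ s * 4 ^+ n.
have K0 : 0 < K by rewrite mulr_gt0 ?powR_gt0 ?exprn_gt0.
exists ((K / e) `^ (s - n%:R)^-1); first by rewrite powR_gt0//; exact: divr_gt0.
move=> r hr; have Ke := divr_gt0 K0 e0.
have r0 : 0 < r by apply: lt_le_trans hr; rewrite powR_gt0.
have h1 : K / e <= r `^ (s - n%:R).
  have E : ((K / e) `^ (s - n%:R)^-1) `^ (s - n%:R) = K / e.
    by rewrite -powRrM mulVf ?gt_eqF// powRr1// ltW.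
  by rewrite -[leLHS]E; apply: (ge0_ler_powR (ltW d0)); rewrite ?nnegrE ?powR_ge0 ?(ltW r0).
have -> : (16 / r) `^ s * (4 * r) ^+ n = K / r `^ (s - n%:R).
  rewrite powR_div// exprMn powRD; last by rewrite gt_eqF ?implybT.
  rewrite powRN powR_mulrn ?ltW// /K invfM invrK; ring.
by rewrite ler_pdivrMr ?powR_gt0// mulrC -ler_pdivrMr.
Qed.

End subcritical.

Section vanishing.
Variables (R : realType) (n : nat) (p q CA : R).
Local Notation mu := (lebesgue_rV R n).
Variables (u W : 'rV[R]_n -> R) (Du A : 'rV[R]_n -> 'rV[R]_n).
Implicit Types (x xi : 'rV[R]_n) (r t : R).
Hypotheses (p2 : 2 <= p) (q1 : 1 < q) (CA0 : 0 < CA).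
Hypothesis Su : approximable p u Du.
Hypothesis bu : forall r : R, 0 <= r -> exists M : R, forall x, cube n r x -> `|u x| <= M.
Hypothesis mA : forall i, measurable_fun setT (fun xi => A xi ord0 i).
Hypothesis hA : forall xi, `|A xi| <= CA * `|xi| `^ (p - 1).
Hypothesis weak : forall phi, C1c setT phi ->
  \int[mu]_x (dot (A (Du x)) (grad phi x)) = \int[mu]_x (sgnpow q (u x) * phi x).
Local Notation total_energy := (total_energy p q u Du).
Local Notation energy := (energy Du A).

(** [weighted_young] with [j = 1] and [z = 1], applied only on the annulus, outside which the
    gradient of the cut-off vanishes. *)
Lemma flux_cutoff_error : p < q + 1 -> exists2 C : R, 0 <= C & forall r, 0 < r ->
  `|\int[mu]_x (u x * dot (A (Du x)) (cutoffG r x))| <=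
  C * (\int[mu]_x (total_energy x * \1_(annulus r) x) +
       \int[mu]_x (`|cutoffG r x| `^ (p * (q + 1) / (q + 1 - p)))).
Proof.
move=> pq; set sg := p * (q + 1) / (q + 1 - p).
have p0 : 0 < p by have := p2; lra.
have p1 : 1 <= p by have := p2; lra.
have [C C0 hC] := weighted_young p0 pq ltr01 p1 (lexx sg) ltr01.
have CAn : 0 <= n%:R * CA by rewrite mulr_ge0// ltW.
have sg0 : 0 < sg by rewrite divr_gt0 ?mulr_gt0//; have := q1; lra.
exists (n%:R * CA * (1 + C)); first by apply: (mulr_ge0 CAn); exact: addr_ge0.
move=> r r0; have r2 : 0 <= 2 * r by rewrite mulr_ge0 ?ltW.
have supp x : ~ cube n (2 * r) x -> cutoff r x = 0 /\ cutoffG r x = 0 := cutoff_support r0.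
have [_ _ I3 _] := energy_balance p2 q1 CA0 Su bu mA hA weak r2 (C1_cutoff n r) supp.
have IT := intg_indic_disc r0 (loc_intg_total_energy q1 Su bu) (measurable_annulus (n := n) r)
  (@sub_annulus_disc R n r).
have [IG _] := cutoffG_powR_integral n r0 sg0.
have I4 := intgZ (n%:R * CA) (intgD IT (intgZ C IG)).
have hle x : `|u x * dot (A (Du x)) (cutoffG r x)| <=
    n%:R * CA * (total_energy x * \1_(annulus r) x + C * `|cutoffG r x| `^ sg).
  rewrite [X in X <= _]normrM.
  have e1 := ler_wpM2l (normr_ge0 (u x)) (dot_flux_le Du hA x (cutoffG r x)).
  apply: (le_trans e1).
  have z1 : 0 <= (1 : R) <= 1 by rewrite ler01 lexx.
  case: (asboolP (annulus r x)) => hx; last first.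
    have -> : `|cutoffG r x| = 0.
      apply/eqP; rewrite eq_le normr_ge0 andbT; apply: (le_trans (normr_cutoffG_le x r0)).
      rewrite indicE memNset ?mulr0//.
      by move=> ho; apply: hx; exact: (sub_outer_annulus ho).
    rewrite !mulr0; apply: (mulr_ge0 CAn); apply: addr_ge0.
      exact: (mulr_ge0 (total_energy_ge0 _ _ _ _ _) (indic_real_ge0 _ _)).
    exact: (mulr_ge0 C0 (powR_ge0 _ _)).
  rewrite indicE mem_set// mulr1 mulrCA; apply: (ler_wpM2l CAn).
  have := hC _ _ _ _ (normr_ge0 (Du x)) (normr_ge0 (u x)) (normr_ge0 (cutoffG r x)) z1.
  by rewrite !powR1 !powRr1// mul1r mulr1 mul1r mulrCA mulrA.
have h1 := le_norm_Rint I3 I4 hle; apply: (le_trans h1).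
rewrite (RintZ _ (intgD IT (intgZ C IG))) (RintD IT (intgZ C IG)) (RintZ _ IG) -[leRHS]mulrA.
apply: (ler_wpM2l CAn).
set X := \int[mu]_x (total_energy x * _); set Y := \int[mu]_x (`|cutoffG r x| `^ sg).
have X0 : 0 <= X.
  by apply: Rint_ge0 => x; exact: (mulr_ge0 (total_energy_ge0 _ _ _ _ _) (indic_real_ge0 _ _)).
have Y0 : 0 <= Y by apply: Rint_ge0 => x; exact: powR_ge0.
have := mulr_ge0 C0 X0; lra.
Qed.

Lemma dot_cube_le (s : R) (x : 'rV[R]_n) : 0 <= s -> cube n s x -> dot x x <= (n%:R * s) ^+ 2.
Proof.
move=> s0 hx; apply: (le_trans (dot_le_sqr_norm x)); rewrite exprMn.
have n2 : (n%:R : R) <= n%:R ^+ 2.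
  by rewrite -natrX ler_nat -mulnn; case: (n) => // m; exact: leq_pmulr.
apply: (ler_pM (ler0n _ _) (sqr_ge0 _) n2).
by rewrite ler_sqr ?nnegrE//; exact: cube_norm_le.
Qed.

Lemma annulus_tail (f : 'rV[R]_n -> R) (e : R) : intg mu f -> (forall x, 0 <= f x) -> 0 < e ->
  exists2 r0 : R, 0 < r0 & forall r, r0 <= r -> \int[mu]_x (f x * \1_(annulus r) x) <= e.
Proof.
move=> If f0 e0; have [k hk] := cube_tail If f0 e0.
(* For such [r] the inner Euclidean radius [r / 2] of the annulus exceeds [n k], so the annulus
   misses the cube [k]. *)
exists (2 * n%:R * k%:R + 1); first by rewrite ltr_wpDl ?mulr_ge0.
move=> r hr; have lf : loc_intg f.
  split; first exact: intg_measurable If.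
  move=> s; apply: (intg_le_norm _ _ If).
    exact: measurable_on_cube (intg_measurable If).
  move=> x; rewrite /on_cube [X in X <= _]normrM ler_piMr// indicE.
  by case: (_ \in _); rewrite ?normr1 ?normr0.
have r0 : 0 < r by apply: lt_le_trans hr; rewrite ltr_wpDl ?mulr_ge0.
have Ia := intg_indic_disc r0 lf (measurable_annulus r) (@sub_annulus_disc R n r).
have Ik := lf.2 k%:R.
apply: (le_trans _ hk); rewrite -(RintB If Ik); apply: (le_Rint Ia (intgB If Ik)) => x.
rewrite /on_cube -[X in _ <= X - _]mulr1 -mulrBr; apply: ler_wpM2l => //.
rewrite !indicE; case: (asboolP (cube n k%:R x)) => hx; last first.
  by rewrite (memNset hx) subr0; case: (_ \in _).
rewrite (mem_set hx) subrr memNset//= => /andP[h1 _].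
have h6 := dot_cube_le (ler0n R k) hx.
have h7 : (2 * n%:R * k%:R) ^+ 2 < r ^+ 2.
  by rewrite ltr_sqr ?nnegrE ?(ltW r0) ?mulr_ge0//; apply: lt_le_trans hr; rewrite ltrDl.
have h8 : (2 * n%:R * k%:R) ^+ 2 = 4 * (n%:R * k%:R) ^+ 2 :> R by ring.
rewrite h8 in h7; lra.
Qed.

Variables CB CW k : R.
Hypothesis mW : measurable_fun setT W.
Hypothesis W0 : forall xi, 0 <= W xi.
Hypotheses (CB0 : 0 <= CB) (CW0 : 0 <= CW).
Hypothesis hWB : forall xi, W xi <= CB * `|xi| `^ p.
Hypothesis convex_W : forall xi zeta : 'rV[R]_n, dot (A xi) (zeta - xi) <= W zeta - W xi.
Hypothesis dilation_W : forall t xi, 0 <= t <= 1 / 2 ->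
  W ((1 - t) *: xi) <= W xi - t * dot (A xi) xi + CW * t ^+ 2 * `|xi| `^ p.
Hypothesis W_le_energy : forall xi, p * W xi <= k * dot (A xi) xi.
Let sg : R := p * (q + 1) / (q + 1 - p).

(** The energy balance and the Pohozaev inequality are combined by [decay_step]; everything on the
    right lives where the cut-off varies. *)
Lemma source_decay : p < q + 1 -> n%:R * k / p < 1 + n%:R / (q + 1) ->
  exists2 C : R, 0 <= C & forall r, 0 < r ->
    \int[mu]_x (`|u x| `^ (q + 1) * cutoff r x) <=
    C * (\int[mu]_x (total_energy x * \1_(annulus r) x) + \int[mu]_x (`|cutoffG r x| `^ sg)).
Proof.
move=> pq hk; have [C1 C10 hC1] := flux_cutoff_error pq.
have [C2 C20 hC2] := pohozaev p2 q1 CA0 Su bu mA hA weak mW W0 CB0 CW0 hWB convex_W dilation_W.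
set kap : R := 1 + n%:R / (q + 1) - n%:R * k / p.
have kap0 : 0 < kap by rewrite subr_gt0.
have N0 : 0 <= `|n%:R * k / p| := normr_ge0 _.
have D0 : 0 <= C2 + (1 + `|n%:R * k / p|) * C1.
  by apply: (addr_ge0 C20); apply: (mulr_ge0 _ C10); exact: (addr_ge0 ler01 N0).
exists ((C2 + (1 + `|n%:R * k / p|) * C1) / kap); first exact: (divr_ge0 D0 (ltW kap0)).
move=> r r0; have r2 : 0 <= 2 * r by rewrite mulr_ge0 ?ltW.
have supp x : ~ cube n (2 * r) x -> cutoff r x = 0 /\ cutoffG r x = 0 := cutoff_support r0.
have [IE IB _ E] := energy_balance p2 q1 CA0 Su bu mA hA weak r2 (C1_cutoff n r) supp.
set X := \int[mu]_x (total_energy x * _); set Y := \int[mu]_x (`|cutoffG r x| `^ sg).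
have X0 : 0 <= X.
  by apply: Rint_ge0 => x; exact: (mulr_ge0 (total_energy_ge0 _ _ _ _ _) (indic_real_ge0 _ _)).
have Y0 : 0 <= Y by apply: Rint_ge0 => x; exact: powR_ge0.
have p0 : 0 < p by have := p2; lra.
have qq : 0 < q + 1 by have := q1; lra.
have lW : loc_intg (fun x => W (Du x)).
  have [_ _ mD lD _] := Su.
  apply: (loc_intg_le (measurable_rV_coord_comp mW mD) _ (loc_intgZ CB lD)) => x.
  by rewrite ger0_norm.
have IW := intg_cutoff r0 lW.
have hW : p * \int[mu]_x (W (Du x) * cutoff r x) <= k * \int[mu]_x (energy x * cutoff r x).
  rewrite -(RintZ _ IW) -(RintZ _ IE); apply: (le_Rint (intgZ _ IW) (intgZ _ IE)) => x.
  rewrite [X in X <= _]mulrA [X in _ <= X]mulrA; apply: (ler_wpM2r (cutoff_ge0 r x)).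
  exact: W_le_energy.
have hP := hC2 r r0.
have hF : \int[mu]_x (`|u x| `^ (q + 1) / (q + 1) * cutoff r x) =
    \int[mu]_x (`|u x| `^ (q + 1) * cutoff r x) / (q + 1).
  rewrite mulrC -(RintZ _ IB); apply: eq_Rintegral => x _; ring.
rewrite hF in hP.
have h := decay_step (ler0n _ _) p0 qq C20 X0 E hW hP.
rewrite -/kap in h; rewrite mulrAC ler_pdivlMr// mulrC; apply: (le_trans h).
have N1 : 0 <= 1 + `|n%:R * k / p| by exact: (addr_ge0 ler01 N0).
have h' := ler_wpM2l N1 (hC1 r r0).
have e1 := mulr_ge0 C20 Y0; move: h'; rewrite -/sg -/X -/Y; lra.
Qed.

(** Integrability of the total energy makes the annulus integrals tend to 0, and [n < sg] does the
    same for the gradient of the cut-off. *)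
Lemma vanishing : p < q + 1 -> n%:R < sg -> n%:R * k / p < 1 + n%:R / (q + 1) ->
  intg mu total_energy -> {ae mu, forall x, u x = 0}.
Proof.
move=> pq nsg hk IT; have [C C0 hC] := source_decay pq hk.
have p0 : 0 < p by have := p2; lra.
have qq : 0 < q + 1 by have := q1; lra.
have sg0 : 0 < sg by apply: le_lt_trans nsg.
have mu_ := measurable_u Su.
have mf : measurable_fun setT (fun x => `|u x| `^ (q + 1)) by exact: measurable_powR_norm.
have f0 x : 0 <= `|u x| `^ (q + 1) by exact: powR_ge0.
have If : intg mu (fun x => `|u x| `^ (q + 1)).
  by apply: (intg_le mf _ IT) => x; rewrite ger0_norm// lerDr powR_ge0.
have lf := loc_intg_u_powR q1 Su bu.
have small (j : nat) : \int[mu]_x on_cube j%:R (fun x => `|u x| `^ (q + 1)) x <= 0.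
  apply/ler_addgt0Pr => e e0; rewrite add0r.
  have C1 : 0 < 2 * (C + 1) by lra.
  have e1 : 0 < e / (2 * (C + 1)) by rewrite divr_gt0.
  have [r1 r10 h1] := annulus_tail IT (fun x => total_energy_ge0 p q u Du x) e1.
  have [r2 r20 h2] := powR_large_radius nsg e1.
  (* The three summands make the annulus tail small, the cut-off gradient small, and the cut-off
     equal to 1 on the cube [j]. *)
  pose r : R := r1 + r2 + n%:R * j%:R.
  have nj : 0 <= n%:R * j%:R :> R by rewrite mulr_ge0.
  have r1r : r1 <= r by rewrite /r; lra.
  have r2r : r2 <= r by rewrite /r; lra.
  have r0 : 0 < r by exact: lt_le_trans r1r.
  have Ic := intg_cutoff r0 lf.
  have s1 : \int[mu]_x on_cube j%:R (fun x => `|u x| `^ (q + 1)) x <=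
      \int[mu]_x (`|u x| `^ (q + 1) * cutoff r x).
    apply: (le_Rint (lf.2 _) Ic) => x; apply: ler_wpM2l => //.
    rewrite indicE; case: (asboolP (cube n j%:R x)) => hx; last first.
      by rewrite memNset ?cutoff_ge0.
    rewrite mem_set// cutoff_eq1//; apply: (le_trans (dot_cube_le (ler0n R j) hx)).
    by rewrite ler_sqr ?nnegrE ?(ltW r0)//; rewrite /r; lra.
  apply: (le_trans s1); apply: (le_trans (hC r r0)).
  have [_ s2] := cutoffG_powR_integral n r0 sg0.
  have s3 := lerD (h1 r r1r) (le_trans s2 (h2 r r2r)).
  apply: (le_trans (ler_wpM2l C0 s3)).
  have -> : e / (2 * (C + 1)) + e / (2 * (C + 1)) = e / (C + 1).
    by field; rewrite gt_eqF//; lra.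
  rewrite mulrA ler_pdivrMr; last by lra.
  by rewrite mulrC; apply: ler_wpM2l; [exact: ltW|lra].
have I0 : \int[mu]_x (`|u x| `^ (q + 1)) <= 0.
  apply/ler_addgt0Pr => e e0; rewrite add0r; have [j hj] := cube_tail If f0 e0.
  by have := small j; lra.
have I1 : \int[mu]_x (`|u x| `^ (q + 1)) = 0.
  by apply/eqP; rewrite eq_le I0 Rint_ge0.
have E0 : (\int[mu]_x `|(`|u x| `^ (q + 1))%:E| = 0)%E.
  under eq_integral do rewrite gee0_abs ?lee_fin ?powR_ge0//.
  by rewrite -(EFin_Rint If) I1.
have [/(_ E0) h _] := @ae_eq_integral_abs _ _ R mu setT measurableT
  (fun x => (`|u x| `^ (q + 1))%:E) (proj2 (measurable_EFinP _ _) mf).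
apply: filterS h => x /= /(_ Logic.I) [] /eqP.
by rewrite powR_eq0 normr_eq0 => /andP[/eqP].
Qed.

End vanishing.

(** * Locally bounded representatives *)

Section modification.
Variables (R : realType) (n : nat).
Local Notation mu := (lebesgue_rV R n).
Implicit Types (u v f g phi : 'rV[R]_n -> R).

Lemma Rint_ae f g : measurable_fun setT f -> measurable_fun setT g ->
  {ae mu, forall x, f x = g x} -> \int[mu]_x f x = \int[mu]_x g x.
Proof.
move=> mf mg fg; congr fine; apply: ae_eq_integral => //; try exact/measurable_EFinP.
by apply: filterS fg => x + _ => ->.
Qed.

Lemma C1c_C1 (U : set 'rV[R]_n) phi : C1c U phi -> C1 phi (grad phi).
Proof.
move=> [h _ _]; split=> [x|x]; first exact: (h x Logic.I).2.
exact: is_diff_grad (h x Logic.I).1.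
Qed.

(* Loo_loc bounds u only almost everywhere, whereas the estimates use pointwise bounds on
   cubes; hence the passage to an a.e. equal representative. *)
Lemma locally_bounded_modification u : Loo_loc u -> exists v, [/\ measurable_fun setT v,
  {ae mu, forall x, v x = u x}, (forall x, `|v x| <= `|u x|) &
  forall r : R, 0 <= r -> exists M : R, forall x, cube n r x -> `|v x| <= M].
Proof.
move=> [mu_ hu]; have [M hM] := choice (fun k : nat => hu _ (@compact_cube R n (k%:R : R))).
(* The points where the essential bound on the [k]-th cube holds; the representative vanishes off
   the intersection of these sets. *)
pose S (k : nat) : set 'rV[R]_n := [set x | cube n k%:R x -> `|u x| <= M k].
have mS k : measurable (S k).
  have -> : S k = ~` cube n k%:R `|` [set x | `|u x| <= M k].
    apply/seteqP; split => x; last by case=> [h /h|h _].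
    by move=> h; case: (asboolP (cube n k%:R x)) => hx; [right; exact: h|left].
  apply: measurableU; first by apply: measurableC; exact: measurable_cube.
  have mnu : measurable_fun setT (fun x => `|u x|) by exact: measurableT_comp.
  have := mnu measurableT _ (measurable_itv `]-oo, M k]); rewrite setTI.
  by congr measurable; apply/seteqP; split => x; rewrite /= in_itv.
have mA : measurable (\bigcap_k S k) by apply: bigcapT_measurable.
exists (fun x => u x * \1_(\bigcap_k S k) x); split.
- by apply: measurable_funM => //; exact: measurable_indic.
- apply: filterS (ae_foralln hM) => x hx; rewrite indicE mem_set ?mulr1//.
  by move=> k _; exact: hx.
- by move=> x; rewrite [X in X <= _]normrM ler_piMr// indicE; case: (_ \in _); rewrite ?normr1 ?normr0.
- move=> r r0; have [k hk] : exists k : nat, r <= k%:R.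
    by exists (Num.truncn r).+1; rewrite ltW// truncnS_gt.
  exists `|M k| => x hx; rewrite indicE.
  case: (asboolP ((\bigcap_k S k) x)) => hS; last by rewrite memNset// mulr0 normr0.
  rewrite mem_set// mulr1; apply: le_trans (ler_norm _).
  by apply: (hS k Logic.I); exact: (sub_cube hk).
Qed.

(** Integrability comes from [|v| <= |u|], and the weak gradient is unchanged because it is only
    seen through integrals. *)
Lemma sobolev_loc_modification (p : R) u v Du : 0 <= p -> measurable_fun setT v ->
  {ae mu, forall x, v x = u x} -> (forall x, `|v x| <= `|u x|) -> sobolev_loc p u Du ->
  sobolev_loc p v Du.
Proof.
move=> p0 mv vu le_vu [[mu_ Lu] LD hD]; split => //.
  split=> // K cK; apply: (le_integrable (compact_rV_measurable cK) _ _ (Lu K cK)).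
    apply: measurable_funTS; apply/measurable_EFinP; exact: measurable_powR_norm.
  move=> x _ /=; rewrite lee_fin !(ger0_norm (powR_ge0 _ _)).
  by apply: ge0_ler_powR; rewrite ?nnegrE.
move=> i phi cphi; rewrite -(hD i phi cphi).
have [_ mG] := C1_measurable (C1c_C1 cphi).
apply: Rint_ae; [exact: measurable_funM|exact: measurable_funM|].
by apply: filterS vu => x ->.
Qed.

End modification.

(** * Stability for the Finsler flux *)

Section stability_hypothesis.
Variables (R : realType) (n : nat) (H : 'rV[R]_n -> R) (B : R -> R) (p q gam Gam : R).
Local Notation mu := (lebesgue_rV R n).
Variables (u : 'rV[R]_n -> R) (Du : 'rV[R]_n -> 'rV[R]_n).
Hypotheses (fH : finsler_norm H) (p2 : 2 <= p) (gam0 : 0 < gam) (gB : growth p gam Gam B) (q1 : 1 < q).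
Hypothesis Su : approximable p u Du.
Hypothesis bu : forall r : R, 0 <= r -> exists M : R, forall x, cube n r x -> `|u x| <= M.
Local Notation A := (flux H B).

(** Turns the stability hypothesis into the form required by [caccioppoli], by bounding
    [second_energy] with the energy. *)
Lemma stable_caccioppoli (K : set 'rV[R]_n) : 1 <= Gam / gam -> Gam / gam * (p - 1) < q ->
  (forall phi, C1c (~` K) phi -> 0 <= second_variation H B q u Du phi) ->
  exists q' C2 : R, [/\ 0 <= q', q' < q, 0 <= C2 &
  forall (r : R) S eta Geta, 0 <= r -> closed S -> S `<=` cube n r -> S `<=` ~` K ->
    C1 eta Geta -> (forall x, 0 <= eta x <= 1) -> (forall x, ~ S x -> eta x = 0 /\ Geta x = 0) ->
    intg mu (cutoff_error p u Du eta Geta) /\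
    q * \int[mu]_x (`|u x| `^ (q + 1) * eta x ^+ 2) <=
      q' * \int[mu]_x (energy Du A x * eta x ^+ 2) + C2 * \int[mu]_x cutoff_error p u Du eta Geta x].
Proof.
set k := Gam / gam => k1 kq hst.
have kp : 1 <= k * (p - 1).
  by apply: (@le_trans _ _ (p - 1)); [have := p2; lra|rewrite ler_peMl//; have := p2; lra].
have kp0 : 0 < k * (p - 1) by lra.
(* Chosen so that [(1 + e) k (p - 1)] is the midpoint of [k (p - 1)] and [q]; this midpoint is the
   [q' < q]. *)
pose e : R := (q / (k * (p - 1)) - 1) / 2.
have e0 : 0 < e.
  by rewrite divr_gt0// subr_gt0 ltr_pdivlMr// mul1r.
have eq' : (1 + e) * (k * (p - 1)) = (q + k * (p - 1)) / 2.
  by rewrite /e; field; rewrite -/k; apply/andP; split; rewrite gt_eqF//; have := p2; lra.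
have [C C0 hC] := variation_split fH p2 gam0 gB e0.
have [CV CV0 hCV] := second_variation_terms_le fH p2 gB.
have [CA CA0 hA] := flux_le fH p2 gB.
have mD i : measurable_fun setT (fun x => Du x ord0 i) := measurable_Du Su i.
have he2 := second_energy_le fH p2 gam0 gB.
have me2 := measurable_second_energy fH gB.
exists ((1 + e) * (k * (p - 1))), (2 * C); split.
- by rewrite eq'; lra.
- by rewrite eq'; lra.
- by rewrite mulr_ge0.
move=> r S eta Geta r0 cS Sr SK etaG eta01 eta_supp.
have hE xi : 0 <= second_energy H B xi <= (k * (p - 1) * (n%:R * CA)) * `|xi| `^ p.
  have /andP[h1 h2] := he2 xi; rewrite h1; apply: (le_trans h2).
  rewrite -[leRHS]mulrA; apply: (ler_wpM2l (ltW kp0)); apply: (le_trans (ler_norm _)).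
  exact: (@energy_le _ _ _ _ id _ p2 hA xi).
have [I1 I2 I3 I4] := stability_estimate p2 q1 Su bu (V1 := variation1 H B) (V2 := variation2 H B)
  (ltW CV0) C0 r0 (fun F mF => measurable_variation fH gB mD mF) hCV hC me2 hE hst cS Sr SK etaG
  eta01 eta_supp.
split => //; apply: (le_trans I4); rewrite lerD2r -[leRHS]mulrA.
have IE : intg mu (fun x => energy Du A x * eta x ^+ 2).
  have [me mG] := C1_measurable etaG.
  apply: (@intg_loc_mul _ _ (energy Du A) (fun x => eta x ^+ 2) r 1).
  - exact: (loc_intg_energy p2 Su (measurable_flux fH gB) hA).
  - exact: measurable_funX.
  - by move=> x hx; have [-> _] := eta_supp x (fun s => hx (Sr x s)); rewrite expr0n.
  - move=> x; have /andP[h0 h1] := eta01 x.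
    by rewrite ger0_norm ?exprn_ge0// exprn_ile1.
apply: ler_wpM2l; first by lra.
rewrite -(RintZ _ IE); apply: (le_Rint I2 (intgZ _ IE)) => x.
rewrite [leRHS]mulrA; apply: (ler_wpM2r (sqr_ge0 _)).
by have /andP[_] := he2 (Du x).
Qed.

End stability_hypothesis.

(** The solution is a Lebesgue class, given by a representative [u] and a weak gradient [Du]; hence
    the conclusion almost everywhere. *)
Theorem theorem1p6 (R : realType) (N : nat) (H : 'rV[R]_N -> R) (B : R -> R)
    (p q gamma Gamma : R) (u : 'rV[R]_N -> R) (Du : 'rV[R]_N -> 'rV[R]_N) :
  (2 <= N)%N ->
  finsler_norm H ->
  2 <= p -> 0 < gamma -> 0 < Gamma ->
  growth p gamma Gamma B ->
  weak_solution H B p q u Du ->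
  stable_outside_compact H B q u Du ->
  (N%:R <= p * gamma / Gamma -> Gamma / gamma * (p - 1) < q) ->
  (p * gamma / Gamma < N%:R ->
    Gamma / gamma * (p - 1) < q /\
    q < (N%:R * (p - Gamma / gamma) + p) / (N%:R * (Gamma / gamma) - p)) ->
  {ae lebesgue_rV R N, forall x, u x = 0}.
Proof.
move=> N2 fH p2 g0 G0 gB [Su Lu weak] [K cK hst] hs1 hs2.
have hgG := growth_le_constants gB.
have k1 : 1 <= Gamma / gamma by rewrite ler_pdivlMr// mul1r.
have kq : Gamma / gamma * (p - 1) < q.
  by have [/hs1|/hs2[]] := leP N%:R (p * gamma / Gamma).
(* Both cases are merged by writing the dimensional threshold as [p < N (Gamma / gamma)], the sign
   condition on the denominator. *)
have hs : p < N%:R * (Gamma / gamma) ->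
    q < (N%:R * (p - Gamma / gamma) + p) / (N%:R * (Gamma / gamma) - p).
  move=> h; have /hs2[] // : p * gamma / Gamma < N%:R.
  rewrite ltr_pdivrMr//; move: h; rewrite mulrA ltr_pdivlMr//; exact.
have [q1 pq nsg hk] := subcritical p2 k1 (ltnW N2) kq hs.
have p0 : 0 <= p by lra.
have p1 : 1 <= p by lra.
(* From here on [u] is replaced by the representative [v]; the equation and the stability inequality
   are unaffected, since only integrals of [u] occur in them. *)
have [v [mv vu le_vu bv]] := locally_bounded_modification Lu.
have Sv := sobolev_approximable p1 (sobolev_loc_modification p0 mv vu le_vu Su).
have mu_ := Lu.1.
have [CA CA0 hA] := flux_le fH p2 gB.
have mA := measurable_flux fH gB.
have mpow (s : R) (w : 'rV[R]_N -> R) : measurable_fun setT w ->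
    measurable_fun setT (fun x => `|w x| `^ s) by exact: measurable_powR_norm.
have weak_v phi : C1c setT phi -> \int[lebesgue_rV R N]_x (dot (flux H B (Du x)) (grad phi x)) =
    \int[lebesgue_rV R N]_x (sgnpow q (v x) * phi x).
  move=> cphi; rewrite (weak phi cphi).
  have [mphi _] := C1_measurable (C1c_C1 cphi).
  apply: Rint_ae.
  - by apply: measurable_funM => //; apply: measurable_funM => //; exact: mpow.
  - by apply: measurable_funM => //; apply: measurable_funM => //; exact: mpow.
  - by apply: filterS vu => x ->.
have hst_v phi : C1c (~` K) phi -> 0 <= second_variation H B q v Du phi.
  move=> cphi; have := hst phi cphi; rewrite /second_variation.
  have [mphi _] := C1_measurable (C1c_C1 cphi).
  suff -> : \int[lebesgue_rV R N]_x (q * `|u x| `^ (q - 1) * phi x ^+ 2) =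
    \int[lebesgue_rV R N]_x (q * `|v x| `^ (q - 1) * phi x ^+ 2) by [].
  apply: Rint_ae.
  - apply: measurable_funM; last exact: measurable_funX.
    by apply: measurable_funM => //; exact: mpow.
  - apply: measurable_funM; last exact: measurable_funX.
    by apply: measurable_funM => //; exact: mpow.
  - by apply: filterS vu => x ->.
have [q' [C2 [q'0 q'q C20 hSt]]] := stable_caccioppoli fH p2 g0 gB q1 Sv bv k1 kq hst_v.
have [cc cc0 hcc] := flux_coercive fH p2 g0 gB.
set sg := p * (q + 1) / (q + 1 - p) in nsg.
have sg0 : 0 < sg by apply: le_lt_trans nsg.
(* Any positive integer with [2 m >= sg] would do as the power of the cut-off. *)
pose m := (Num.truncn sg).+1.
have msg : sg <= (2 * m)%:R.
  have h1 : sg < m%:R by rewrite truncnS_gt.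
  by rewrite natrM; lra.
have hcac := caccioppoli p2 q1 CA0 Sv bv mA hA weak_v cc0 hcc q'0 q'q C20 pq (ltn0Sn _) msg hSt.
have IT := total_energy_integrable q1 Sv bv cK (ltW nsg) sg0 (ltn0Sn _) hcac.
have [CW CW0 hCW] := potential_dilation fH p2 gB.
have mW := measurable_growth_H fH gB.
have W0 xi : 0 <= B (H xi) := growth_ge0 gB (finsler_ge0 fH xi).
have hWk xi := flux_potential_le fH p2 g0 gB xi.
have hWB xi : B (H xi) <= (Gamma / gamma * (N%:R * CA)) * `|xi| `^ p.
  have h1 : B (H xi) <= p * B (H xi) by rewrite ler_peMl.
  apply: (le_trans h1); apply: (le_trans (hWk xi)); rewrite -[leRHS]mulrA.
  have k0 : 0 <= Gamma / gamma by lra.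
  apply: (ler_wpM2l k0); apply: (le_trans (ler_norm _)); exact: (@energy_le _ _ _ _ id _ p2 hA xi).
have CB0 : 0 <= Gamma / gamma * (N%:R * CA).
  by rewrite mulr_ge0 ?divr_ge0 ?mulr_ge0// ltW.
have v0 := vanishing p2 q1 CA0 Sv bv mA hA weak_v mW W0 CB0 CW0 hWB (flux_convex fH gB) hCW hWk
  pq nsg hk IT.
by apply: filterS2 vu v0 => x <-.
Qed.
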